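(* For every $n\in\mathbb{N}$, the exact functor ${}^{\mathbf{C}}\!\operatorname{Ind}_n^{n+1}$ is left adjoint to ${}^{\mathbf{C}}\!\operatorname{Res}^{n+1}_n$ and right adjoint to ${}^{\mathbf{C}}\!\operatorname{Res}^{n+1}_n$ up to degree shift.
   Context: $\Bbbk$ is a commutative ring of characteristic not equal to $2$; $\mathbb{N}$ is the set of nonnegative integers. ''Algebra'' means associative unital $\mathbb{Z}$-graded $\Bbbk$-superalgebra, ''module'' means $\mathbb{Z}$-graded left supermodule, module categories consist of finitely generated modules with homomorphisms of degree $0$ and even parity; $|a|$ is the degree and $\bar a$ the parity. ''Degree shift'' is a shift of the $\mathbb{Z}$-grading. Tensor products are over $\Bbbk$ unless indicated, with $(a_1\otimes a_2)(b_1\otimes b_2)=(-1)^{\bar a_2\bar b_1}a_1b_1\otimes a_2b_2$. $F$ is an $\mathbb{N}$-graded Frobenius superalgebra, free of finite rank over $\Bbbk$: there is a parity-preserving linear trace map $\operatorname{tr}\colon F\to\Bbbk$, homogeneous in degree, such that $f\mapsto(g\mapsto(-1)^{\bar f\bar g}\operatorname{tr}(gf))$ is an isomorphism $F\to\operatorname{Hom}_\Bbbk(F,\Bbbk)$. The Nakayama automorphism $\psi$ is defined by $\operatorname{tr}(fg)=(-1)^{\bar f\bar g}\operatorname{tr}(g\psi(f))$. $\delta$ is the maximum degree of elements of $F$. It is assumed that $\psi$ has finite order $\theta$, that the characteristic of $\Bbbk$ does not divide $\theta$, and that $F$ has a basis of eigenvectors of $\psi$. $B$ is a homogeneous basis of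 $F$ and $\{b^\vee\}$ its left dual basis: $\operatorname{tr}(b^\vee c)=\delta_{b,c}$. For $f\in F$: $f_i=1^{\otimes(i-1)}\otimes f\otimes1^{\otimes(n-i)}\in F^{\otimes n}$ and $\psi_i=\operatorname{id}^{\otimes(i-1)}\otimes\psi\otimes\operatorname{id}^{\otimes(n-i)}$. $S_n$ acts on $F^{\otimes n}$ by superpermuting factors, written ${}^\pi\mathbf{f}$: ${}^{s_i}(f_1\otimes\cdots\otimes f_n)=(-1)^{\bar f_i\bar f_{i+1}}f_1\otimes\cdots\otimes f_{i+1}\otimes f_i\otimes\cdots\otimes f_n$, with $s_i$ the transposition of $i,i+1$. The affine wreath product algebra $\mathcal{A}_n(F)$ is the free product $\Bbbk[x_1,\dots,x_n]\star F^{\otimes n}\star\Bbbk S_n$ modulo the relations: $\mathbf{f}x_i=x_i\psi_i(\mathbf{f})$; $s_ix_j=x_js_i$ ($j\ne i,i+1$); $s_ix_i=x_{i+1}s_i-t_{i,i+1}$; $\pi\mathbf{f}={}^\pi\mathbf{f}\,\pi$ ($\pi\in S_n$), where $t_{i,j}=\sum_{b\in B}b_i(b^\vee)_j$ for $i\neq j$. Gradings: $|x_i|=\delta$, $\bar x_i=0$; $f_i$ has the degree and parity of $f$; $\pi\in S_n$ has degree and parity $0$. For $k\in\mathbb{Z}$: $F_\psi=\{f\in F\mid\psi(f)=f\}$, $F^{(k)}=\{f\in F\mid gf=(-1)^{\bar f\bar g}f\psi^k(g)\ \forall g\in F\}$, $F_\psi^{(k)}=F^{(k)}\cap F_\psi$.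 For $1\le k\le\theta$ choose $e_k\in\mathbb{N}$ and even elements $\mathbf{c}^{(k,1)},\dots,\mathbf{c}^{(k,e_k)}\in F_\psi^{(k)}$ of degree $k\delta$, where $F$ is identified with the first tensor factor $F\otimes\Bbbk^{\otimes(n-1)}\subseteq F^{\otimes n}$ for each $n\ge1$; $\mathbf{C}$ is the tuple of all these elements. Let $\chi_{\mathbf{C}}=\prod_{k=1}^\theta\prod_{j=1}^{e_k}(x_1^k-\mathbf{c}^{(k,j)})$. For $n\ge1$, $\mathcal{A}_n^{\mathbf{C}}(F)$ is the quotient of $\mathcal{A}_n(F)$ by the two-sided ideal generated by $\chi_{\mathbf{C}}$; $\mathcal{A}_0^{\mathbf{C}}(F)=\Bbbk$. The level is $d_{\mathbf{C}}=\sum_{k=1}^\theta ke_k$, assumed to be at least $1$. The subalgebra of $\mathcal{A}_{n+1}^{\mathbf{C}}(F)$ generated by $x_1,\dots,x_n$, $F^{\otimes n}\otimes1$ and $S_n$ is isomorphic to $\mathcal{A}_n^{\mathbf{C}}(F)$; via this inclusion, ${}^{\mathbf{C}}\!\operatorname{Ind}_n^{n+1}=\mathcal{A}_{n+1}^{\mathbf{C}}(F)\otimes_{\mathcal{A}_n^{\mathbf{C}}(F)}-$ and ${}^{\mathbf{C}}\!\operatorname{Res}^{n+1}_n$ is restriction. *)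

(* Defs.v *)
From HB Require Import structures.
From mathcomp Require Import all_boot all_order all_algebra.
From mathcomp Require Import generic_quotient perm boolp zify.

Set Implicit Arguments.
Unset Strict Implicit.
Unset Printing Implicit Defensive.

Import GRing.Theory.
Local Open Scope ring_scope.
Local Open Scope quotient_scope.

(* Z-degree paired with parity; [bool] is Z/2 as an additive group. *)
Notation degree := (int * bool)%type.

Record is_grading (V : zmodType) (gr : degree -> V -> Prop) : Prop := IsGrading {
  gr_0 : forall a, gr a 0;
  gr_B : forall a u v, gr a u -> gr a v -> gr a (u - v);
  gr_span : forall v, exists s : seq degree, exists c : degree -> V,
    [/\ uniq s, forall a, gr a (c a) & v = \sum_(a <- s) c a];
  gr_indep : forall (s : seq degree) (c : degree -> V), uniq s ->
    (forall a, gr a (c a)) -> \sum_(a <- s) c a = 0 ->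
    forall a, a \in s -> c a = 0 }.

Section GradingLemmas.
Variables (V : zmodType) (gr : degree -> V -> Prop).

Section Build.
Hypothesis g0 : forall a, gr a 0.
Hypothesis gB : forall a u v, gr a u -> gr a v -> gr a (u - v).
Variable pr : degree -> V -> V.
Hypothesis prD : forall a u v, pr a (u + v) = pr a u + pr a v.
Hypothesis prid : forall a v, gr a v -> pr a v = v.
Hypothesis prne : forall a b v, gr a v -> b != a -> pr b v = 0.
Hypothesis span : forall v, exists s : seq (degree * V),
  (forall x, x \in s -> gr x.1 x.2) /\ v = \sum_(x <- s) x.2.

Lemma build_grading : is_grading gr.
Proof.
have gD a u v : gr a u -> gr a v -> gr a (u + v).
  by move=> hu hv; rewrite -[v]opprK; apply: gB => //; rewrite -sub0r; apply: gB.
have pr0 a : pr a 0 = 0 by apply: (addIr (pr a 0)); rewrite -prD !add0r.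
have pr_sum (I : Type) (s : seq I) (c : I -> V) a :
    pr a (\sum_(i <- s) c i) = \sum_(i <- s) pr a (c i).
  by apply: (big_morph (pr a)) => // u v; rewrite prD.
split => //.
- move=> v; have [s [hs ->]] := span v.
  exists (undup [seq x.1 | x <- s]), (fun a => pr a (\sum_(x <- s) x.2)).
  split; first exact: undup_uniq.
    move=> a; rewrite pr_sum; elim: s hs => [|x s IH] hs; rewrite ?big_nil ?big_cons //.
    apply: gD; last by apply: IH => y hy; apply: hs; rewrite inE hy orbT.
    have hx : gr x.1 x.2 by apply: hs; rewrite inE eqxx.
    have [->|ne] := eqVneq a x.1; first by rewrite prid.
    by rewrite (prne hx).
  have key (t : seq degree) : uniq t -> {subset [seq x.1 | x <- s] <= t} ->
      \sum_(x <- s) x.2 = \sum_(a <- t) pr a (\sum_(x <- s) x.2).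
    move=> ut; elim: s hs => [|x s IH] hs hsub.
      by rewrite big_nil big1 // => a _; rewrite pr0.
    rewrite big_cons; under [RHS]eq_bigr => a _ do rewrite prD.
    rewrite big_split /= -IH; [|by move=> y hy; apply: hs; rewrite inE hy orbT|].
      have hx : gr x.1 x.2 by apply: hs; rewrite inE eqxx.
      congr (_ + _); rewrite (bigD1_seq x.1) //=; last by apply: hsub; rewrite inE eqxx.
      by rewrite prid // big1 ?addr0 // => a ne; rewrite (prne hx).
    by move=> a ha; apply: hsub; rewrite inE ha orbT.
  by apply: key; [exact: undup_uniq | move=> a; rewrite mem_undup].
- move=> s c us hc hsum a ha.
  have := pr_sum _ s c a; rewrite hsum pr0 (bigD1_seq a) //= prid //.
  by rewrite big1 ?addr0 // => b ne; rewrite (prne (hc b)) // eq_sym.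
Qed.
End Build.

Hypothesis hg : is_grading gr.

Lemma gr_N a v : gr a v -> gr a (- v).
Proof. by move=> hv; rewrite -sub0r; apply: (gr_B hg) => //; apply: (gr_0 hg). Qed.

Lemma gr_D a u v : gr a u -> gr a v -> gr a (u + v).
Proof. by move=> hu hv; rewrite -[v]opprK; apply: (gr_B hg) => //; apply: gr_N. Qed.

Lemma gr_sum (I : Type) (s : seq I) (P : pred I) (c : I -> V) a :
  (forall i, P i -> gr a (c i)) -> gr a (\sum_(i <- s | P i) c i).
Proof. by move=> h; apply: (big_ind (gr a)) => //; [apply: (gr_0 hg)|exact: gr_D]. Qed.

Lemma grading_proj : exists pr : degree -> V -> V, [/\ forall a, {morph pr a : u v / u + v},
  forall a v, gr a (pr a v),
  forall a v, gr a v -> pr a v = v,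
  forall a b v, gr a v -> b != a -> pr b v = 0 &
  forall v, exists s : seq degree, forall t : seq degree, uniq t -> {subset s <= t} -> v = \sum_(a <- t) pr a v].
Proof.
pose sup v := sval (cid (gr_span hg v)).
pose cf v := sval (cid (svalP (cid (gr_span hg v)))).
have spec v : [/\ uniq (sup v), forall a, gr a (cf v a) & v = \sum_(a <- sup v) cf v a].
  exact: (svalP (cid (svalP (cid (gr_span hg v))))).
pose pr a v := if a \in sup v then cf v a else 0.
have grpr a v : gr a (pr a v).
  by rewrite /pr; case: ifP => _; [case: (spec v) | apply: (gr_0 hg)].
have ext v (t : seq degree) : uniq t -> {subset sup v <= t} -> v = \sum_(a <- t) pr a v.
  move=> ut sub; case: (spec v) => us hc {1}->.
  rewrite [RHS](bigID (fun a => a \in sup v)) /= [X in _ + X]big1 ?addr0; last first.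
    by move=> a /negbTE na; rewrite /pr na.
  rewrite -[RHS]big_filter; apply: etrans (perm_big _ _); last first.
    apply: uniq_perm; [exact: us | exact: filter_uniq|].
    move=> a; rewrite mem_filter /=; case: (boolP (a \in sup v)) => //= ha.
    by rewrite sub.
  by apply: eq_big_seq => a ha; rewrite /pr ha.
have uniqc v (t : seq degree) (c : degree -> V) : uniq t -> (forall a, gr a (c a)) ->
    v = \sum_(a <- t) c a -> forall a, pr a v = if a \in t then c a else 0.
  move=> ut hc hv a.
  pose w := undup (sup v ++ t).
  pose c' a := if a \in t then c a else 0.
  have hc' b : gr b (c' b) by rewrite /c'; case: ifP => _ //; apply: (gr_0 hg).
  have uw : uniq w by exact: undup_uniq.
  have e1 : v = \sum_(a <- w) pr a v.
    by apply: ext => // b hb; rewrite mem_undup mem_cat hb.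
  have e2 : v = \sum_(a <- w) c' a.
    rewrite hv [RHS](bigID (fun b => b \in t)) /= [X in _ + X]big1 ?addr0; last first.
      by move=> b /negbTE nb; rewrite /c' nb.
    rewrite -[RHS]big_filter; apply: etrans (perm_big _ _); last first.
      apply: uniq_perm; [exact: ut | exact: filter_uniq|].
      by move=> b; rewrite mem_filter mem_undup mem_cat /= ; case: (b \in t); rewrite ?orbT ?andbF.
    by apply: eq_big_seq => b hb; rewrite /c' hb.
  have e3 : \sum_(a <- w) (pr a v - c' a) = 0 by rewrite sumrB -e1 -e2 subrr.
  have h3 b : gr b (pr b v - c' b) by apply: (gr_B hg).
  have [ha|ha] := boolP (a \in w).
    by apply/eqP; rewrite -subr_eq0; apply/eqP; exact: (gr_indep hg uw h3 e3 ha).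
  move: ha; rewrite mem_undup mem_cat negb_or => /andP[/negbTE n1 /negbTE n2].
  by rewrite /pr n1 n2.
exists pr; split=> //.
- move=> a u v.
  pose w := undup (sup u ++ sup v).
  have uw : uniq w by exact: undup_uniq.
  have hu : u = \sum_(a <- w) pr a u.
    by apply: ext => // b hb; rewrite mem_undup mem_cat hb.
  have hv : v = \sum_(a <- w) pr a v.
    by apply: ext => // b hb; rewrite mem_undup mem_cat hb orbT.
  rewrite (uniqc (u + v) w (fun a => pr a u + pr a v)) //; first last.
  + by rewrite big_split /= -hu -hv.
  + by move=> b; apply: gr_D.
  case: ifP => // /negbT; rewrite mem_undup mem_cat negb_or => /andP[/negbTE n1 /negbTE n2].
  by rewrite /pr n1 n2 addr0.
- move=> a v hv; rewrite (uniqc v [:: a] (fun b => if b == a then v else 0)) //.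
  + by rewrite inE eqxx.
  + by move=> b; case: eqP => [->|_] //; apply: (gr_0 hg).
  + by rewrite big_seq1 eqxx.
- move=> a b v hv ne; rewrite (uniqc v [:: a] (fun b => if b == a then v else 0)) //.
  + by rewrite inE (negbTE ne).
  + by move=> d; case: eqP => [->|_] //; apply: (gr_0 hg).
  + by rewrite big_seq1 eqxx.
- by move=> v; exists (sup v) => t; apply: ext.
Qed.

End GradingLemmas.

(* Associative unital graded k-superalgebras; they are [pzRingType]s with a
   central structure map from k since MathComp's [algType] excludes 0 = 1. *)
Record gsalg (k : comNzRingType) := GSAlg {
  ga_ring :> pzRingType;
  ga_in : {rmorphism k -> ga_ring};
  ga_central : forall a x, ga_in a * x = x * ga_in a;
  ga_gr : degree -> ga_ring -> Prop;
  ga_grading : is_grading ga_gr;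
  ga_gr_in : forall a, ga_gr 0 (ga_in a);
  ga_gr_mul : forall d e x y, ga_gr d x -> ga_gr e y -> ga_gr (d + e) (x * y) }.

Record gahom (k : comNzRingType) (A B : gsalg k) := GAHom {
  ah_fun :> {rmorphism A -> B};
  ah_in : forall a, ah_fun (ga_in A a) = ga_in B a;
  ah_gr : forall d x, ga_gr d x -> ga_gr d (ah_fun x) }.

Record gsmod (k : comNzRingType) (A : gsalg k) := GSMod {
  gm_mod :> lmodType A;
  gm_gr : degree -> gm_mod -> Prop;
  gm_grading : is_grading gm_gr;
  gm_gr_act : forall d e (a : A) m,
    ga_gr d a -> gm_gr e m -> gm_gr (d + e) (a *: m) }.

(* Homomorphisms of degree 0 and even parity. *)
Record gshom (k : comNzRingType) (A : gsalg k) (M N : gsmod A) := GSHom {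
  gh_fun :> M -> N;
  gh_lin : linear gh_fun;
  gh_gr : forall d m, gm_gr d m -> gm_gr d (gh_fun m) }.

Definition fin_gen (k : comNzRingType) (A : gsalg k) (M : gsmod A) : Prop :=
  exists r (g : 'I_r -> M), forall m, exists c : 'I_r -> A, m = \sum_i c i *: g i.

Record fgmod (k : comNzRingType) (A : gsalg k) := FGMod {
  fg_mod :> gsmod A;
  fg_fin : fin_gen fg_mod }.

Record category := Category {
  obj :> Type;
  hom : obj -> obj -> Type;
  idc : forall X, hom X X;
  compc : forall X Y Z, hom Y Z -> hom X Y -> hom X Z;
  comp1c : forall X Y (f : hom X Y), compc (idc Y) f = f;
  compc1 : forall X Y (f : hom X Y), compc f (idc X) = f;
  compcA : forall X Y Z T (h : hom Z T) (g : hom Y Z) (f : hom X Y),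
    compc h (compc g f) = compc (compc h g) f }.

Record functor (C D : category) := Functor {
  fobj :> C -> D;
  fmap : forall X Y, hom X Y -> hom (fobj X) (fobj Y);
  fmap1 : forall X, fmap (idc X) = idc (fobj X);
  fmapc : forall X Y Z (g : hom Y Z) (f : hom X Y),
    fmap (compc g f) = compc (fmap g) (fmap f) }.

Definition adjoint (C D : category) (L : functor C D) (R : functor D C) : Prop :=
  exists phi : forall X Y, hom (L X) Y -> hom X (R Y),
    (forall X Y, bijective (phi X Y)) /\
    forall X X' Y Y' (f : hom X' X) (g : hom Y Y') (h : hom (L X) Y),
      phi X' Y' (compc g (compc h (fmap L f))) =
      compc (fmap R g) (compc (phi X Y h) f).

Section CompFunctor.
Variables (C D E : category) (G : functor D E) (F : functor C D).
Lemma cf_id (X : C) : fmap G (fmap F (idc X)) = idc (G (F X)).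
Proof. by rewrite !fmap1. Qed.
Lemma cf_comp (X Y Z : C) (g : hom Y Z) (f : hom X Y) :
  fmap G (fmap F (compc g f)) = compc (fmap G (fmap F g)) (fmap G (fmap F f)).
Proof. by rewrite !fmapc. Qed.
Definition comp_functor : functor C E :=
  @Functor C E (fun X => G (F X)) (fun X Y f => fmap G (fmap F f)) cf_id cf_comp.
End CompFunctor.

Section FGCat.
Variables (k : comNzRingType) (A : gsalg k).

Lemma gshomP (M N : gsmod A) (f g : gshom M N) : f =1 g -> f = g.
Proof.
case: f g => [f fl fg] [g gl gg] /= /funext e; case: _ / e gl gg => gl gg.
by congr GSHom; apply: Prop_irrelevance.
Qed.

Lemma gsid_lin (M : gsmod A) : linear (@id M). Proof. by []. Qed.
Definition gsid (M : gsmod A) : gshom M M :=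
  @GSHom k A M M id (@gsid_lin M) (fun _ _ h => h).

Lemma gscomp_lin (M N P : gsmod A) (g : gshom N P) (f : gshom M N) :
  linear (fun m => g (f m)).
Proof. by move=> a u v /=; rewrite (gh_lin f) (gh_lin g). Qed.
Definition gscomp (M N P : gsmod A) (g : gshom N P) (f : gshom M N) : gshom M P :=
  GSHom (@gscomp_lin M N P g f) (fun d m h => gh_gr g (gh_gr f h)).

Fact gscomp1l (M N : gsmod A) (f : gshom M N) : gscomp (gsid N) f = f.
Proof. exact: gshomP. Qed.
Fact gscomp1r (M N : gsmod A) (f : gshom M N) : gscomp f (gsid M) = f.
Proof. exact: gshomP. Qed.
Fact gscompA (M N P Q : gsmod A) (h : gshom P Q) (g : gshom N P) (f : gshom M N) :
  gscomp h (gscomp g f) = gscomp (gscomp h g) f.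
Proof. exact: gshomP. Qed.

Definition fgcat : category :=
  @Category (fgmod A) (fun M N => gshom M N) (fun M => gsid M)
    (fun M N P => @gscomp M N P) (fun M N => @gscomp1l M N)
    (fun M N => @gscomp1r M N) (fun M N P Q => @gscompA M N P Q).

End FGCat.

(* Preservation of short exact sequences. *)
Definition short_exact (k : comNzRingType) (A : gsalg k) (L M N : fgcat A)
    (f : hom L M) (g : hom M N) : Prop :=
  [/\ injective (f : gshom L M),
      forall n : N, exists m, (g : gshom M N) m = n &
      forall m : M, (g : gshom M N) m = 0 <-> exists l, (f : gshom L M) l = m].

Definition exact_functor (k : comNzRingType) (A B : gsalg k)
    (T : functor (fgcat A) (fgcat B)) : Prop :=
  forall (L M N : fgcat A) (f : hom L M) (g : hom M N),
    short_exact f g -> short_exact (fmap T f) (fmap T g).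

Section Shift.
Variables (k : comNzRingType) (A : gsalg k) (d : int).

Definition shift_gr (M : gsmod A) (a : degree) (m : M) : Prop :=
  gm_gr (a - (d, false)) m.

Lemma shift_grading (M : gsmod A) : is_grading (@shift_gr M).
Proof.
have [pr [prD grpr prid prne span]] := grading_proj (gm_grading M).
apply: (@build_grading _ _ _ _ (fun a => pr (a - (d, false)))).
- by move=> a; apply: (gr_0 (gm_grading M)).
- by move=> a u v; apply: (gr_B (gm_grading M)).
- by move=> a u v; apply: prD.
- by move=> a v; apply: prid.
- move=> a b v h ne; apply: prne h _.
  by apply: contra ne => /eqP /addIr ->.
- move=> v; have [s hs] := span v.
  exists [seq (a + (d, false), pr a v) | a <- undup s]; split.
    by move=> x /mapP[a _ ->] /=; rewrite /shift_gr addrK.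
  rewrite big_map /=; apply: hs; first exact: undup_uniq.
  by move=> a; rewrite mem_undup.
Qed.

Lemma shift_act (M : gsmod A) a b (x : A) (m : M) :
  ga_gr a x -> shift_gr b m -> shift_gr (a + b) (x *: m).
Proof. by move=> hx hm; rewrite /shift_gr -addrA; apply: gm_gr_act. Qed.

Definition shiftm (M : gsmod A) : gsmod A :=
  GSMod (shift_grading M) (@shift_act M).

Definition shift_fg (M : fgmod A) : fgmod A :=
  @FGMod k A (shiftm M) (fg_fin M).

Definition shift_map (M N : gsmod A) (f : gshom M N) : gshom (shiftm M) (shiftm N) :=
  @GSHom k A (shiftm M) (shiftm N) f (gh_lin f) (fun a m h => gh_gr f h).

Fact shift_map1 (M : gsmod A) : shift_map (gsid M) = gsid (shiftm M).
Proof. exact: gshomP. Qed.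
Fact shift_mapc (M N P : gsmod A) (g : gshom N P) (f : gshom M N) :
  shift_map (gscomp g f) = gscomp (shift_map g) (shift_map f).
Proof. exact: gshomP. Qed.

Definition shift_functor : functor (fgcat A) (fgcat A) :=
  @Functor (fgcat A) (fgcat A) shift_fg (fun M N => @shift_map M N)
    (fun M => shift_map1 M) (fun M N P => @shift_mapc M N P).
End Shift.

Section Restriction.
Variables (k : comNzRingType) (A B : gsalg k) (i : gahom A B).

Definition res_car (N : gsmod B) : Type := N.
HB.instance Definition _ (N : gsmod B) := GRing.Zmodule.on (res_car N).

Section Instance.
Variable N : gsmod B.
Definition res_scale (a : A) (m : res_car N) : res_car N := i a *: (m : N).
Fact res_scaleA a b m : res_scale a (res_scale b m) = res_scale (a * b) m.
Proof. by rewrite /res_scale scalerA rmorphM. Qed.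
Fact res_scale1 : left_id 1 res_scale.
Proof. by move=> m; rewrite /res_scale rmorph1 scale1r. Qed.
Fact res_scaleDr : right_distributive res_scale +%R.
Proof. by move=> a u v; rewrite /res_scale scalerDr. Qed.
Fact res_scaleDl m : {morph res_scale^~ m : a b / a + b}.
Proof. by move=> a b; rewrite /res_scale rmorphD scalerDl. Qed.
HB.instance Definition _ := GRing.Zmodule_isLmodule.Build A (res_car N)
  res_scaleA res_scale1 res_scaleDr res_scaleDl.

Definition res_lmod : lmodType A := res_car N.
Definition res_gr (a : degree) (m : res_lmod) : Prop := @gm_gr k B N a m.
Fact res_grading : is_grading res_gr. Proof. exact: (gm_grading N). Qed.
Fact res_act a b (x : A) (m : res_lmod) :
  ga_gr a x -> res_gr b m -> res_gr (a + b) (x *: m).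
Proof. by move=> hx hm; apply: (@gm_gr_act k B N) => //; apply: ah_gr. Qed.
Definition resm : gsmod A := GSMod res_grading res_act.
End Instance.

Fact res_map_lin (M N : gsmod B) (f : gshom M N) :
  linear (f : resm M -> resm N).
Proof. by move=> a u v; apply: (gh_lin f). Qed.
Definition res_map (M N : gsmod B) (f : gshom M N) : gshom (resm M) (resm N) :=
  @GSHom k A (resm M) (resm N) f (res_map_lin f) (fun d m h => gh_gr f h).
Fact res_map1 (M : gsmod B) : res_map (gsid M) = gsid (resm M).
Proof. exact: gshomP. Qed.
Fact res_mapc (M N P : gsmod B) (g : gshom N P) (f : gshom M N) :
  res_map (gscomp g f) = gscomp (res_map g) (res_map f).
Proof. exact: gshomP. Qed.

Definition res_preserves_fg : Prop := forall N : fgmod B, fin_gen (resm N).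

Definition Res_functor (h : res_preserves_fg) : functor (fgcat B) (fgcat A) :=
  @Functor (fgcat B) (fgcat A) (fun N => FGMod (h N)) (fun M N => @res_map M N)
    (fun M => res_map1 M) (fun M N P => @res_mapc M N P).
End Restriction.

Lemma subset_undup (T : eqType) (s : seq T) : {subset s <= undup s}.
Proof. by move=> a; rewrite mem_undup. Qed.

(* B (x)_A M: formal sums of symbols b (x) m modulo the congruence generated by
   the abelian group axioms, biadditivity and A-balancedness. *)
Section Tensor.
Variables (k : comNzRingType) (A B : gsalg k) (i : gahom A B) (M : gsmod A).

Inductive tterm : Type :=
  | TPure of B & M
  | TZero
  | TOpp of tterm
  | TAdd of tterm & tterm.

Inductive tcong : tterm -> tterm -> Prop :=
  | tc_refl x : tcong x x
  | tc_sym x y : tcong x y -> tcong y x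
  | tc_trans x y z : tcong x y -> tcong y z -> tcong x z
  | tc_opp x y : tcong x y -> tcong (TOpp x) (TOpp y)
  | tc_add x x' y y' : tcong x x' -> tcong y y' -> tcong (TAdd x y) (TAdd x' y')
  | tc_addA x y z : tcong (TAdd x (TAdd y z)) (TAdd (TAdd x y) z)
  | tc_addC x y : tcong (TAdd x y) (TAdd y x)
  | tc_add0 x : tcong (TAdd TZero x) x
  | tc_addN x : tcong (TAdd (TOpp x) x) TZero
  | tc_Dl b b' m : tcong (TPure (b + b') m) (TAdd (TPure b m) (TPure b' m))
  | tc_Dr b m m' : tcong (TPure b (m + m')) (TAdd (TPure b m) (TPure b m'))
  | tc_bal b a m : tcong (TPure (b * i a) m) (TPure b (a *: m)).

HB.instance Definition _ := gen_eqMixin tterm.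
HB.instance Definition _ := gen_choiceMixin tterm.

Definition tcongb : rel tterm := fun x y => `[< tcong x y >].
Fact tcongb_equiv : equiv_class_of tcongb.
Proof.
split=> [x|x y|y x z].
- exact/asboolP/tc_refl.
- by apply/asboolP/asboolP; apply: tc_sym.
- by move=> /asboolP h1 /asboolP h2; apply/asboolP; apply: tc_trans h1 h2.
Qed.
Canonical tcong_equiv := EquivRelPack tcongb_equiv.

Definition tens : Type := {eq_quot tcong_equiv}.
HB.instance Definition _ := Choice.on tens.
HB.instance Definition _ := EqQuotient.on tens.

Definition tcls (x : tterm) : tens := \pi_tens x.

Lemma tclsP x y : tcls x = tcls y <-> tcong x y.
Proof.
split=> [/eqP|h]; first by rewrite /tcls eqmodE => /asboolP.
by apply/eqP; rewrite /tcls eqmodE; apply/asboolP.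
Qed.

Lemma tcls_repr (u : tens) : tcls (repr u) = u.
Proof. exact: reprK. Qed.

Definition tens_zero : tens := tcls TZero.
Definition tens_opp (u : tens) : tens := tcls (TOpp (repr u)).
Definition tens_add (u v : tens) : tens := tcls (TAdd (repr u) (repr v)).

Lemma tens_oppE x : tens_opp (tcls x) = tcls (TOpp x).
Proof. by apply/tclsP/tc_opp/tclsP; rewrite tcls_repr. Qed.
Lemma tens_addE x y : tens_add (tcls x) (tcls y) = tcls (TAdd x y).
Proof. by apply/tclsP/tc_add; apply/tclsP; rewrite tcls_repr. Qed.

Fact tens_addA : associative tens_add.
Proof.
move=> u v w; rewrite -[u]tcls_repr -[v]tcls_repr -[w]tcls_repr !tens_addE.
exact/tclsP/tc_addA.
Qed.
Fact tens_addC : commutative tens_add.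
Proof.
by move=> u v; rewrite -[u]tcls_repr -[v]tcls_repr !tens_addE; apply/tclsP/tc_addC.
Qed.
Fact tens_add0 : left_id tens_zero tens_add.
Proof. by move=> u; rewrite -[u]tcls_repr tens_addE; apply/tclsP/tc_add0. Qed.
Fact tens_addN : left_inverse tens_zero tens_opp tens_add.
Proof.
by move=> u; rewrite -[u]tcls_repr tens_oppE tens_addE; apply/tclsP/tc_addN.
Qed.
HB.instance Definition _ :=
  GRing.isZmodule.Build tens tens_addA tens_addC tens_add0 tens_addN.

Definition pure (b : B) (m : M) : tens := tcls (TPure b m).

Lemma pureDl b b' m : pure (b + b') m = pure b m + pure b' m.
Proof. by rewrite /pure [RHS]tens_addE; apply/tclsP/tc_Dl. Qed.
Lemma pureDr b m m' : pure b (m + m') = pure b m + pure b m'.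
Proof. by rewrite /pure [RHS]tens_addE; apply/tclsP/tc_Dr. Qed.
Lemma pure_bal b a m : pure (b * i a) m = pure b (a *: m).
Proof. exact/tclsP/tc_bal. Qed.

Lemma tens_ind (P : tens -> Prop) : (forall b m, P (pure b m)) ->
  P 0 -> (forall u, P u -> P (- u)) -> (forall u v, P u -> P v -> P (u + v)) ->
  forall u, P u.
Proof.
move=> hp h0 hN hD u; rewrite -[u]tcls_repr; elim: (repr u) => [b m||x h|x h y h'].
- exact: hp.
- exact: h0.
- by rewrite -tens_oppE; apply: hN.
- by rewrite -tens_addE; apply: hD.
Qed.

Section Lift.
Variables (Z : zmodType) (f : B -> M -> Z).

Fixpoint tens_eval (x : tterm) : Z :=
  match x with
  | TPure b m => f b m
  | TZero => 0
  | TOpp y => - tens_eval y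
  | TAdd y z => tens_eval y + tens_eval z
  end.
Definition tens_lift (u : tens) : Z := tens_eval (repr u).

Hypothesis fDl : forall b b' m, f (b + b') m = f b m + f b' m.
Hypothesis fDr : forall b m m', f b (m + m') = f b m + f b m'.
Hypothesis fbal : forall b a m, f (b * i a) m = f b (a *: m).

Lemma tens_eval_cong x y : tcong x y -> tens_eval x = tens_eval y.
Proof.
elim=> {x y} //=.
- by move=> x y z _ -> _ ->.
- by move=> x y _ ->.
- by move=> x x' y y' _ -> _ ->.
- by move=> x y z; rewrite addrA.
- by move=> x y; rewrite addrC.
- by move=> x; rewrite add0r.
- by move=> x; rewrite addNr.
Qed.

Lemma tens_liftE b m : tens_lift (pure b m) = f b m.
Proof.
by rewrite /tens_lift (@tens_eval_cong _ (TPure b m)) //; apply/tclsP; rewrite tcls_repr.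
Qed.

Lemma tens_liftD : {morph tens_lift : u v / u + v}.
Proof.
move=> u v; rewrite /tens_lift.
rewrite (@tens_eval_cong _ (TAdd (repr u) (repr v))) //.
by apply/tclsP; rewrite tcls_repr -tens_addE !tcls_repr.
Qed.
End Lift.

Lemma tens_add_eq (Z : zmodType) (f g : tens -> Z) : {morph f : u v / u + v} ->
  {morph g : u v / u + v} -> (forall b m, f (pure b m) = g (pure b m)) -> f =1 g.
Proof.
move=> fD gD h.
have f0 : f 0 = 0 by apply: (addIr (f 0)); rewrite -fD !add0r.
have g0 : g 0 = 0 by apply: (addIr (g 0)); rewrite -gD !add0r.
elim/tens_ind => //; rewrite ?f0 ?g0 // => u.
  by move=> e; apply: (addIr (f u)); rewrite {2}e -fD -gD !addNr f0 g0.
by move=> v e e'; rewrite fD gD e e'.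
Qed.

Definition tens_scale (b : B) : tens -> tens := tens_lift (fun b' m => pure (b * b') m).

Lemma tens_scaleE b b' m : tens_scale b (pure b' m) = pure (b * b') m.
Proof.
apply: tens_liftE => *; rewrite ?mulrDr ?pureDl ?pureDr //.
by rewrite mulrA pure_bal.
Qed.
Lemma tens_scaleD b : {morph tens_scale b : u v / u + v}.
Proof.
apply: tens_liftD => *; rewrite ?mulrDr ?pureDl ?pureDr //.
by rewrite mulrA pure_bal.
Qed.
Fact tens_scaleA a b u : tens_scale a (tens_scale b u) = tens_scale (a * b) u.
Proof.
move: u; apply: tens_add_eq => [u v|u v|b' m]; rewrite ?tens_scaleD //.
by rewrite !tens_scaleE mulrA.
Qed.
Fact tens_scale1 : left_id 1 tens_scale.
Proof.
by apply: tens_add_eq => [u v|u v|b' m]; rewrite ?tens_scaleD // tens_scaleE mul1r.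
Qed.
Fact tens_scaleDr : right_distributive tens_scale +%R.
Proof. by move=> a u v; apply: tens_scaleD. Qed.
Fact tens_scaleDl u : {morph tens_scale^~ u : a b / a + b}.
Proof.
move=> a b; move: u; apply: tens_add_eq => [u v|u v|b' m].
- by rewrite tens_scaleD.
- by rewrite !tens_scaleD addrACA.
- by rewrite !tens_scaleE mulrDl pureDl.
Qed.
HB.instance Definition _ := GRing.Zmodule_isLmodule.Build B tens
  tens_scaleA tens_scale1 tens_scaleDr tens_scaleDl.

Lemma scale_pure (b b' : B) m : b *: pure b' m = pure (b * b') m.
Proof. exact: tens_scaleE. Qed.

(* The degree d piece: sums of b (x) m with |b| + |m| = d. *)
Inductive tens_gr : degree -> tens -> Prop :=
  | tg_pure d e b m : ga_gr d b -> gm_gr e m -> tens_gr (d + e) (pure b m)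
  | tg_0 d : tens_gr d 0
  | tg_opp d u : tens_gr d u -> tens_gr d (- u)
  | tg_add d u v : tens_gr d u -> tens_gr d v -> tens_gr d (u + v).

Lemma pure0r b : pure b 0 = 0.
Proof. by apply: (addIr (pure b 0)); rewrite -pureDr !add0r. Qed.
Lemma pure0l m : pure 0 m = 0.
Proof. by apply: (addIr (pure 0 m)); rewrite -pureDl !add0r. Qed.

Lemma pure_suml (I : Type) (s : seq I) (c : I -> B) m :
  pure (\sum_(j <- s) c j) m = \sum_(j <- s) pure (c j) m.
Proof.
by apply: (big_morph (fun b => pure b m)) => [x y|]; rewrite ?pureDl ?pure0l.
Qed.
Lemma pure_sumr (I : Type) (s : seq I) (c : I -> M) b :
  pure b (\sum_(j <- s) c j) = \sum_(j <- s) pure b (c j).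
Proof. by apply: (big_morph (pure b)) => [x y|]; rewrite ?pureDr ?pure0r. Qed.

Lemma tens_grading : is_grading tens_gr.
Proof.
have [pb [pbD pbg pbid pbne pbs]] := grading_proj (ga_grading B).
have [pa [paD pag paid pane pas]] := grading_proj (ga_grading A).
have [pm [pmD pmg pmid pmne pms]] := grading_proj (gm_grading M).
have pb0 a : pb a 0 = 0 by apply: (addIr (pb a 0)); rewrite -pbD !add0r.
have pm0 a : pm a 0 = 0 by apply: (addIr (pm a 0)); rewrite -pmD !add0r.
pose sb b := undup (sval (cid (pbs b))).
have sbP b (t : seq degree) : uniq t -> {subset sb b <= t} -> b = \sum_(a <- t) pb a b.
  move=> ut sub; apply: (svalP (cid (pbs b))) => // a ha; apply: sub.
  by rewrite mem_undup.
have sb0 b a : a \notin sb b -> pb a b = 0.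
  move=> na; rewrite {1}(sbP b (sb b)) ?undup_uniq //.
  rewrite (big_morph (pb a) (pbD a) (pb0 a)) big_seq big1 // => e he.
  by apply: (pbne e) => //; apply: contraNneq na => ->.
pose f d b m : tens := \sum_(a <- sb b) pure (pb a b) (pm (d - a) m).
have fE d b m t : uniq t -> {subset sb b <= t} ->
    f d b m = \sum_(a <- t) pure (pb a b) (pm (d - a) m).
  move=> ut sub; rewrite [RHS](bigID (fun a => a \in sb b)) /=.
  rewrite [X in _ + X]big1 ?addr0; last by move=> a /sb0 ->; rewrite pure0l.
  rewrite -[RHS]big_filter; apply: perm_big; apply: uniq_perm.
  - exact: undup_uniq.
  - exact: filter_uniq.
  - by move=> a; rewrite mem_filter; case: (boolP (a \in sb b)) => //= /sub ->.
have fDl d b b' m : f d (b + b') m = f d b m + f d b' m.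
  pose t := undup (sb b ++ sb b' ++ sb (b + b')).
  rewrite !(fE _ _ _ t) ?undup_uniq //;
    try by move=> a ha; rewrite mem_undup !mem_cat ha ?orbT.
  by rewrite -big_split; apply: eq_bigr => a _; rewrite pbD pureDl.
have fDr d b m m' : f d b (m + m') = f d b m + f d b m'.
  by rewrite -big_split; apply: eq_bigr => a _; rewrite pmD pureDr.
have f0l d m : f d 0 m = 0 by apply: (addIr (f d 0 m)); rewrite -fDl !add0r.
have f0r d b : f d b 0 = 0 by apply: (addIr (f d b 0)); rewrite -fDr !add0r.
have fhom d e b m : ga_gr e b -> f d b m = pure b (pm (d - e) m).
  move=> hb; rewrite (fE _ _ _ (undup (e :: sb b))) ?undup_uniq //; last first.
    by move=> a ha; rewrite mem_undup inE ha orbT.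
  rewrite (bigD1_seq e) ?undup_uniq ?mem_undup ?inE ?eqxx //=.
  by rewrite pbid // big1 ?addr0 // => a ne; rewrite (pbne e) ?pure0l.
have pm_act d e (a : A) m : ga_gr e a -> pm d (a *: m) = a *: pm (d - e) m.
  move=> ha; have [s hs] := pms m.
  have us := undup_uniq s; have {hs} hm := hs _ us (@subset_undup _ s).
  rewrite {1}hm scaler_sumr (big_morph (pm d) (pmD d) (pm0 d)).
  under eq_bigr => x _.
    have -> : pm d (a *: pm x m) = if x == d - e then a *: pm (d - e) m else 0.
      have hx : gm_gr (e + x) (a *: pm x m) by apply: gm_gr_act.
      case: eqP => [->|ne].
        apply: pmid; have := gm_gr_act ha (pmg (d - e) m).
        by rewrite [e + _]addrC subrK.
      by apply: (pmne (e + x)) => //; apply/eqP=> h; apply: ne; rewrite h addrC addKr.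
    over.
  rewrite -big_mkcond /=; have [h|h] := boolP (d - e \in undup s).
    by rewrite -big_filter filter_pred1_uniq // big_seq1.
  rewrite big_seq_cond big1; last first.
    by move=> x /andP[hx /eqP e']; rewrite -e' hx in h.
  suff -> : pm (d - e) m = 0 by rewrite scaler0.
  rewrite hm (big_morph (pm (d - e)) (pmD _) (pm0 _)) big_seq big1 // => x hx.
  by apply: (pmne x) => //; apply: contraNneq h => ->.
have fbal d b a m : f d (b * i a) m = f d b (a *: m).
  have fhh e e' (b' : B) (a' : A) : ga_gr e b' -> ga_gr e' a' ->
      f d (b' * i a') m = f d b' (a' *: m).
    move=> hb ha; rewrite (fhom d (e + e')); last first.
      by apply: ga_gr_mul => //; apply: ah_gr.
    by rewrite (fhom d e) // (pm_act _ e') // pure_bal opprD addrA.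
  have sumf (s : seq degree) (c : degree -> B) m' :
      f d (\sum_(j <- s) c j) m' = \sum_(j <- s) f d (c j) m'.
    by apply: (big_morph (fun x => f d x m')).
  have [s hs] := pas a; have {hs} ha := hs _ (undup_uniq s) (@subset_undup _ s).
  have hb := sbP b (sb b) (undup_uniq _) (fun _ h => h).
  rewrite {1}hb mulr_suml sumf [in RHS]hb sumf; apply: eq_bigr => e _.
  rewrite {1}ha rmorph_sum mulr_sumr sumf ha scaler_suml.
  rewrite (big_morph (f d (pb e b)) (fDr d _) (f0r d _)) -ha.
  by apply: eq_bigr => e' _; apply: (fhh e e').
pose F d := tens_lift (f d).
have FD d : {morph F d : u v / u + v} by apply: tens_liftD.
have FE d b m : F d (pure b m) = f d b m by apply: tens_liftE.
have F0 d : F d 0 = 0 by apply: (addIr (F d 0)); rewrite -FD !add0r.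
have FN d u : F d (- u) = - F d u.
  by apply: (addIr (F d u)); rewrite -FD !addNr F0.
apply: (@build_grading _ _ _ _ F) => //.
- exact: tg_0.
- by move=> a u v hu hv; apply: tg_add => //; apply: tg_opp.
- move=> a v; elim=> {a v} [d e b m hb hm|d|d u _ e|d u v _ e _ e'].
  + by rewrite FE (fhom _ d) // addrC addKr pmid.
  + by rewrite F0.
  + by rewrite FN e.
  + by rewrite FD e e'.
- move=> a c v h; elim: h c => {a v} [d e b m hb hm|d|d u _ h|d u v _ h _ h'] c ne.
  + rewrite FE (fhom _ d) // (pmne e) ?pure0r //.
    by apply: contraNneq ne => <-; rewrite addrC subrK.
  + by rewrite F0.
  + by rewrite FN h ?oppr0.
  + by rewrite FD h ?h' ?addr0.
- elim/tens_ind => [b m||u [s [hs ->]]|u v [s [hs ->]] [t [ht ->]]].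
  + have hb := sbP b (sb b) (undup_uniq _) (fun _ h => h).
    have [s hs] := pms m; have {hs} hm := hs _ (undup_uniq s) (@subset_undup _ s).
    exists [seq (e + e', pure (pb e b) (pm e' m)) | e <- sb b, e' <- undup s]; split.
      by move=> x /allpairsP[[e e'] [_ _ ->]] /=; apply: tg_pure.
    rewrite big_allpairs_dep /= {1}hb pure_suml; apply: eq_bigr => e _.
    by rewrite {1}hm pure_sumr.
  + by exists [::]; split=> //; rewrite big_nil.
  + exists [seq (x.1, - x.2) | x <- s]; split.
      by move=> x /mapP[y hy ->] /=; apply: tg_opp; apply: hs.
    by rewrite big_map /= sumrN.
  + exists (s ++ t); split; last by rewrite big_cat.
    by move=> x; rewrite mem_cat => /orP[/hs|/ht].
Qed.

Lemma tens_act d e (b : B) (u : tens) :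
  ga_gr d b -> tens_gr e u -> tens_gr (d + e) (b *: u).
Proof.
move=> hb; elim=> {e u} [e e' b' m hb' hm|e|e u _ h|e u v _ h _ h'].
- by rewrite scale_pure addrA; apply: tg_pure => //; apply: ga_gr_mul.
- by rewrite scaler0; apply: tg_0.
- by rewrite scalerN; apply: tg_opp.
- by rewrite scalerDr; apply: tg_add.
Qed.

Definition indm : gsmod B := @GSMod k B tens tens_gr tens_grading tens_act.

Lemma ind_fin_gen : fin_gen M -> fin_gen indm.
Proof.
case=> r [g hg]; exists r, (fun j => pure 1 (g j)).
have dec (u : tens) : exists c : 'I_r -> B, u = \sum_j c j *: pure 1 (g j).
  elim/tens_ind: u => [b m||u [c ->]|u v [c ->] [c' ->]].
  - have [c ->] := hg m; exists (fun j => b * i (c j)).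
    by rewrite pure_sumr; apply: eq_bigr => j _; rewrite scale_pure mulr1 pure_bal.
  - by exists (fun=> 0); rewrite big1 // => j _; rewrite scale0r.
  - by exists (fun j => - c j); rewrite -sumrN; apply: eq_bigr => j _; rewrite scaleNr.
  - exists (fun j => c j + c' j); rewrite -big_split.
    by apply: eq_bigr => j _; rewrite scalerDl.
exact: dec.
Qed.

End Tensor.

Section Induction.
Variables (k : comNzRingType) (A B : gsalg k) (i : gahom A B).

Section Map.
Variables (M N : gsmod A) (f : gshom M N).

Lemma gshomD : {morph f : u v / u + v}.
Proof. by move=> u v; have := gh_lin f 1 u v; rewrite !scale1r. Qed.
Lemma gshomZ a : {morph f : u / a *: u}.
Proof.
have f0 : f 0 = 0 by apply: (addIr (f 0)); rewrite -gshomD !add0r.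
by move=> u; have := gh_lin f a u 0; rewrite !addr0 f0 addr0.
Qed.

Definition ind_fun : indm i M -> indm i N :=
  @tens_lift k A B i M (tens i N) (fun b m => pure i b (f m)).

Lemma ind_funE b m : ind_fun (pure i b m) = pure i b (f m).
Proof.
apply: tens_liftE => *; rewrite ?pureDl ?gshomD ?pureDr //.
by rewrite gshomZ pure_bal.
Qed.
Lemma ind_funD : {morph ind_fun : u v / u + v}.
Proof.
apply: tens_liftD => *; rewrite ?pureDl ?gshomD ?pureDr //.
by rewrite gshomZ pure_bal.
Qed.
Lemma ind_fun_lin : linear ind_fun.
Proof.
move=> b u v; rewrite ind_funD; congr (_ + _); move: u {v}.
apply: (@tens_add_eq k A B i M (tens i N) (fun u => ind_fun (b *: u))
  (fun u => b *: ind_fun u)) => [u v|u v|b' m].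
- by rewrite scalerDr ind_funD.
- by rewrite ind_funD scalerDr.
- by rewrite (scale_pure i) !ind_funE [RHS](scale_pure i).
Qed.
Lemma ind_fun_gr d u : gm_gr d u -> gm_gr d (ind_fun u).
Proof.
have f0 : ind_fun 0 = 0 by apply: (addIr (ind_fun 0)); rewrite -ind_funD !add0r.
elim=> {d u} [d e b m hb hm|d|d u _ h|d u v _ h _ h'].
- by rewrite ind_funE; apply: tg_pure => //; apply: gh_gr.
- by rewrite f0; apply: tg_0.
- suff -> : ind_fun (- u) = - ind_fun u by apply: tg_opp.
  by apply: (addIr (ind_fun u)); rewrite -ind_funD !addNr f0.
- by rewrite ind_funD; apply: tg_add.
Qed.
Definition ind_map : gshom (indm i M) (indm i N) :=
  GSHom ind_fun_lin ind_fun_gr.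
End Map.

Definition ind_obj (M : fgmod A) : fgmod B := @FGMod k B (indm i M) (ind_fin_gen i (fg_fin M)).

Fact ind_map1 (M : gsmod A) : ind_map (gsid M) = gsid (indm i M).
Proof.
apply: gshomP; apply: tens_add_eq => [u v|//|b m] /=.
  exact: ind_funD.
exact: ind_funE.
Qed.
Fact ind_mapc (M N P : gsmod A) (g : gshom N P) (f : gshom M N) :
  ind_map (gscomp g f) = gscomp (ind_map g) (ind_map f).
Proof.
apply: gshomP; apply: tens_add_eq => [u v|u v|b m] /=; rewrite ?ind_funD //.
by rewrite !ind_funE.
Qed.

Definition Ind_functor : functor (fgcat A) (fgcat B) :=
  @Functor (fgcat A) (fgcat B) ind_obj (fun M N => @ind_map M N)
    (fun M => ind_map1 M) (fun M N P => @ind_mapc M N P).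
End Induction.

Inductive term (k G : Type) : Type :=
  | Gen of G
  | Cst of k
  | Add of term k G & term k G
  | Mul of term k G & term k G.
Arguments Gen {k G} g.
Arguments Cst {k G} a.

Notation "t +' u" := (Add t u) (at level 50, left associativity).
Notation "t *' u" := (Mul t u) (at level 40, left associativity).
Notation "t -' u" := (Add t (Mul (Cst (-1)) u)) (at level 50, left associativity).

Fixpoint tpow (k : comNzRingType) (G : Type) (t : term k G) (m : nat) : term k G :=
  if m is m'.+1 then t *' tpow t m' else Cst 1.

(* The k-algebra with generators G and relations R: noncommutative polynomial
   expressions modulo the congruence generated by R and the k-algebra axioms. *)
Section Presented.
Variables (k : comNzRingType) (G : Type).
Local Notation tm := (term k G).
Variable R : tm -> tm -> Prop.

Inductive acong : tm -> tm -> Prop :=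
  | ac_rel x y : R x y -> acong x y
  | ac_refl x : acong x x
  | ac_sym x y : acong x y -> acong y x
  | ac_trans x y z : acong x y -> acong y z -> acong x z
  | ac_add x x' y y' : acong x x' -> acong y y' -> acong (x +' y) (x' +' y')
  | ac_mul x x' y y' : acong x x' -> acong y y' -> acong (x *' y) (x' *' y')
  | ac_addA x y z : acong (x +' (y +' z)) (x +' y +' z)
  | ac_addC x y : acong (x +' y) (y +' x)
  | ac_add0 x : acong (Cst 0 +' x) x
  | ac_mulA x y z : acong (x *' (y *' z)) (x *' y *' z)
  | ac_mul1 x : acong (Cst 1 *' x) x
  | ac_mul0 x : acong (Cst 0 *' x) (Cst 0)
  | ac_mulDl x y z : acong ((x +' y) *' z) (x *' z +' y *' z)
  | ac_mulDr x y z : acong (x *' (y +' z)) (x *' y +' x *' z)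
  | ac_cstD a b : acong (Cst (a + b)) (Cst a +' Cst b)
  | ac_cstM a b : acong (Cst (a * b)) (Cst a *' Cst b)
  | ac_cstC a x : acong (Cst a *' x) (x *' Cst a).

HB.instance Definition _ := gen_eqMixin tm.
HB.instance Definition _ := gen_choiceMixin tm.

Definition acongb : rel tm := fun x y => `[< acong x y >].
Fact acongb_equiv : equiv_class_of acongb.
Proof.
split=> [x|x y|y x z].
- exact/asboolP/ac_refl.
- by apply/asboolP/asboolP; apply: ac_sym.
- by move=> /asboolP h1 /asboolP h2; apply/asboolP; apply: ac_trans h1 h2.
Qed.
Canonical acong_equiv := EquivRelPack acongb_equiv.

Definition pres : Type := {eq_quot acong_equiv}.
HB.instance Definition _ := Choice.on pres.
HB.instance Definition _ := EqQuotient.on pres.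

Definition cls (x : tm) : pres := \pi_pres x.

Lemma clsP x y : cls x = cls y <-> acong x y.
Proof.
split=> [/eqP|h]; first by rewrite /cls eqmodE => /asboolP.
by apply/eqP; rewrite /cls eqmodE; apply/asboolP.
Qed.
Lemma cls_repr (u : pres) : cls (repr u) = u. Proof. exact: reprK. Qed.

Definition pres_opp (u : pres) : pres := cls (Cst (-1) *' repr u).
Definition pres_add (u v : pres) : pres := cls (repr u +' repr v).
Definition pres_mul (u v : pres) : pres := cls (repr u *' repr v).

Lemma pres_oppE x : pres_opp (cls x) = cls (Cst (-1) *' x).
Proof. by apply/clsP/ac_mul; [exact: ac_refl|apply/clsP; rewrite cls_repr]. Qed.
Lemma pres_addE x y : pres_add (cls x) (cls y) = cls (x +' y).
Proof. by apply/clsP/ac_add; apply/clsP; rewrite cls_repr. Qed.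
Lemma pres_mulE x y : pres_mul (cls x) (cls y) = cls (x *' y).
Proof. by apply/clsP/ac_mul; apply/clsP; rewrite cls_repr. Qed.


Fact pres_addA : associative pres_add.
Proof.
move=> u v w; rewrite -[u]cls_repr -[v]cls_repr -[w]cls_repr !pres_addE.
exact/clsP/ac_addA.
Qed.
Fact pres_addC : commutative pres_add.
Proof.
by move=> u v; rewrite -[u]cls_repr -[v]cls_repr !pres_addE; apply/clsP/ac_addC.
Qed.
Fact pres_add0 : left_id (cls (Cst 0)) pres_add.
Proof. by move=> u; rewrite -[u]cls_repr pres_addE; apply/clsP/ac_add0. Qed.
Fact pres_addN : left_inverse (cls (Cst 0)) pres_opp pres_add.
Proof.
move=> u; rewrite -[u]cls_repr pres_oppE pres_addE; apply/clsP.
apply: (ac_trans (y := Cst (-1) *' repr u +' Cst 1 *' repr u)).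
  by apply: ac_add; [exact: ac_refl|apply: ac_sym; exact: ac_mul1].
apply: (ac_trans (y := (Cst (-1) +' Cst 1) *' repr u)).
  by apply: ac_sym; exact: ac_mulDl.
apply: (ac_trans (y := Cst 0 *' repr u)); last exact: ac_mul0.
apply: ac_mul; last exact: ac_refl.
by apply: ac_sym; rewrite -[0](addNr 1); exact: ac_cstD.
Qed.
HB.instance Definition _ :=
  GRing.isZmodule.Build pres pres_addA pres_addC pres_add0 pres_addN.

Fact pres_mulA : associative pres_mul.
Proof.
move=> u v w; rewrite -[u]cls_repr -[v]cls_repr -[w]cls_repr !pres_mulE.
exact/clsP/ac_mulA.
Qed.
Fact pres_mul1 : left_id (cls (Cst 1)) pres_mul.
Proof. by move=> u; rewrite -[u]cls_repr pres_mulE; apply/clsP/ac_mul1. Qed.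
Fact pres_mulr1 : right_id (cls (Cst 1)) pres_mul.
Proof.
move=> u; rewrite -[u]cls_repr pres_mulE; apply/clsP.
by apply: ac_trans (ac_mul1 _); apply: ac_sym; exact: ac_cstC.
Qed.
Fact pres_mulDl : left_distributive pres_mul +%R.
Proof.
move=> u v w; rewrite -[u]cls_repr -[v]cls_repr -[w]cls_repr.
rewrite [cls (repr u) + _]pres_addE !pres_mulE [RHS]pres_addE.
exact/clsP/ac_mulDl.
Qed.
Fact pres_mulDr : right_distributive pres_mul +%R.
Proof.
move=> u v w; rewrite -[u]cls_repr -[v]cls_repr -[w]cls_repr.
rewrite [cls (repr v) + _]pres_addE !pres_mulE [RHS]pres_addE.
exact/clsP/ac_mulDr.
Qed.
HB.instance Definition _ := GRing.Zmodule_isPzRing.Build pres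
  pres_mulA pres_mul1 pres_mulr1 pres_mulDl pres_mulDr.

Lemma clsD x y : cls (x +' y) = cls x + cls y.
Proof. by rewrite [RHS]pres_addE. Qed.
Lemma clsM x y : cls (x *' y) = cls x * cls y.
Proof. by rewrite [RHS]pres_mulE. Qed.
Lemma cls_rel x y : R x y -> cls x = cls y.
Proof. by move=> h; apply/clsP/ac_rel. Qed.

Definition pin (a : k) : pres := cls (Cst a).
Fact pinD : {morph pin : a b / a + b}.
Proof. by move=> a b; rewrite -clsD; apply/clsP/ac_cstD. Qed.
Fact pin_zmod : zmod_morphism pin.
Proof.
have p0 : pin 0 = 0 by [].
by move=> a b; apply: (addIr (pin b)); rewrite -pinD !subrK.
Qed.
Fact pin_monoid : monoid_morphism pin.
Proof. by split=> // a b; rewrite /pin -clsM; apply/clsP/ac_cstM. Qed.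
HB.instance Definition _ := GRing.isZmodMorphism.Build k pres pin pin_zmod.
HB.instance Definition _ := GRing.isMonoidMorphism.Build k pres pin pin_monoid.
Fact pin_central a (u : pres) : pin a * u = u * pin a.
Proof. by rewrite -[u]cls_repr /pin -!clsM; apply/clsP/ac_cstC. Qed.

Section Eval.
Variables (S : gsalg k) (g : G -> S).
Fixpoint ev (t : tm) : S :=
  match t with
  | Gen x => g x
  | Cst a => ga_in S a
  | Add x y => ev x + ev y
  | Mul x y => ev x * ev y
  end.
Hypothesis gR : forall t u, R t u -> ev t = ev u.
Lemma ev_cong t u : acong t u -> ev t = ev u.
Proof.
elim=> {t u} //=.
- by move=> x y z _ -> _ ->.
- by move=> x x' y y' _ -> _ ->.
- by move=> x x' y y' _ -> _ ->.
- by move=> *; rewrite addrA.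
- by move=> *; rewrite addrC.
- by move=> *; rewrite rmorph0 add0r.
- by move=> *; rewrite mulrA.
- by move=> *; rewrite rmorph1 mul1r.
- by move=> *; rewrite rmorph0 mul0r.
- by move=> *; rewrite mulrDl.
- by move=> *; rewrite mulrDr.
- by move=> *; rewrite rmorphD.
- by move=> *; rewrite rmorphM.
- by move=> *; rewrite ga_central.
Qed.
Definition pres_lift (u : pres) : S := ev (repr u).
Lemma pres_liftE t : pres_lift (cls t) = ev t.
Proof. by apply: ev_cong; apply/clsP; rewrite cls_repr. Qed.
Fact pres_lift_zmod : zmod_morphism pres_lift.
Proof.
have hD : {morph pres_lift : x y / x + y}.
  move=> x y; rewrite -[x]cls_repr -[y]cls_repr -clsD.
  by rewrite !pres_liftE.
by move=> a b; apply: (addIr (pres_lift b)); rewrite -hD !subrK.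
Qed.
Fact pres_lift_monoid : monoid_morphism pres_lift.
Proof.
split=> [|x y]; first by rewrite pres_liftE /= rmorph1.
by rewrite -[x]cls_repr -[y]cls_repr -clsM !pres_liftE.
Qed.
End Eval.

Section Graded.
Variable hgen : degree -> G -> Prop.

Inductive thom : degree -> tm -> Prop :=
  | th_gen d g : hgen d g -> thom d (Gen g)
  | th_cst a : thom 0 (Cst a)
  | th_0 d : thom d (Cst 0)
  | th_add d t u : thom d t -> thom d u -> thom d (t +' u)
  | th_mul d e t u : thom d t -> thom e u -> thom (d + e) (t *' u).

Definition pres_gr (d : degree) (u : pres) : Prop := exists2 t, thom d t & u = cls t.

Lemma pres_gr_0 d : pres_gr d 0. Proof. by exists (Cst 0) => //; exact: th_0. Qed.
Lemma pres_gr_D d u v : pres_gr d u -> pres_gr d v -> pres_gr d (u + v).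
Proof.
by move=> [t ht ->] [t' ht' ->]; exists (t +' t'); [exact: th_add|rewrite clsD].
Qed.
Lemma pres_gr_N d u : pres_gr d u -> pres_gr d (- u).
Proof.
move=> [t ht ->]; exists (Cst (-1) *' t); last by rewrite -pres_oppE.
by rewrite -[d]add0r; apply: th_mul => //; exact: th_cst.
Qed.
Lemma pres_gr_B d u v : pres_gr d u -> pres_gr d v -> pres_gr d (u - v).
Proof. by move=> hu hv; apply: pres_gr_D => //; exact: pres_gr_N. Qed.
Lemma pres_gr_in a : pres_gr 0 (pin a).
Proof. by exists (Cst a) => //; exact: th_cst. Qed.
Lemma pres_gr_mul d e u v : pres_gr d u -> pres_gr e v -> pres_gr (d + e) (u * v).
Proof.
by move=> [t ht ->] [t' ht' ->]; exists (t *' t'); [exact: th_mul|rewrite clsM].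
Qed.

Definition hspan (u : pres) : Prop := exists s : seq (degree * pres),
  (forall x, x \in s -> pres_gr x.1 x.2) /\ u = \sum_(x <- s) x.2.

Lemma hspan_gr d u : pres_gr d u -> hspan u.
Proof.
move=> h; exists [:: (d, u)]; split; last by rewrite big_seq1.
by move=> x; rewrite inE => /eqP ->.
Qed.
Lemma hspanD u v : hspan u -> hspan v -> hspan (u + v).
Proof.
move=> [s [hs ->]] [t [ht ->]]; exists (s ++ t); split; last by rewrite big_cat.
by move=> x; rewrite mem_cat => /orP[/hs|/ht].
Qed.
Lemma hspan0 : hspan 0. Proof. exact: hspan_gr (pres_gr_0 0). Qed.
Lemma hspan_sum (I : Type) (s : seq I) (c : I -> pres) :
  (forall j, hspan (c j)) -> hspan (\sum_(j <- s) c j).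
Proof. by move=> h; apply: big_ind => //; [exact: hspan0|exact: hspanD]. Qed.
Lemma hspanM u v : hspan u -> hspan v -> hspan (u * v).
Proof.
move=> [s [hs ->]] [t [ht ->]].
exists [seq (x.1 + y.1, x.2 * y.2) | x <- s, y <- t]; split.
  move=> z /allpairsP[[x y] [/= hx hy ->]] /=; apply: pres_gr_mul.
    exact: hs.
  exact: ht.
rewrite big_allpairs_dep /= mulr_suml; apply: eq_bigr => x _.
by rewrite mulr_sumr.
Qed.

(* The algebra acts on functions degree -> pres by w |-> (c |-> u * w (c - |u|))
   for homogeneous u; the value at the unit impulse gives the components of u. *)
Variables (I : finType) (dgen : G -> I -> degree) (cgen : G -> I -> pres).
Hypothesis hgenE : forall d g, hgen d g -> forall w : degree -> pres, forall c,
  \sum_j cgen g j * w (c - dgen g j) = cls (Gen g) * w (c - d).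
Hypothesis gen_span : forall g, hspan (cls (Gen g)).

Fixpoint rho (t : tm) (w : degree -> pres) (c : degree) : pres :=
  match t with
  | Gen g => \sum_j cgen g j * w (c - dgen g j)
  | Cst a => pin a * w c
  | Add x y => rho x w c + rho y w c
  | Mul x y => rho x (rho y w) c
  end.

Hypothesis rhoR : forall t u, R t u -> forall w c, rho t w c = rho u w c.

Lemma rho_ext t w w' : w =1 w' -> rho t w =1 rho t w'.
Proof.
move=> e; elim: t w w' e => [g|a|x hx y hy|x hx y hy] w w' e c /=.
- by apply: eq_bigr => j _; rewrite e.
- by rewrite e.
- by rewrite (hx _ _ e) (hy _ _ e).
- by apply: hx; apply: hy.
Qed.
Lemma rhoD t w w' c : rho t (fun d => w d + w' d) c = rho t w c + rho t w' c.
Proof.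
elim: t w w' c => [g|a|x hx y hy|x hx y hy] w w' c /=.
- by rewrite -big_split; apply: eq_bigr => j _; rewrite mulrDr.
- by rewrite mulrDr.
- by rewrite hx hy addrACA.
- by rewrite -hx; apply: rho_ext => d; rewrite hy.
Qed.
Lemma rhoZ t a w c : rho t (fun d => pin a * w d) c = pin a * rho t w c.
Proof.
elim: t w c => [g|b|x hx y hy|x hx y hy] w c /=.
- by rewrite mulr_sumr; apply: eq_bigr => j _; rewrite !mulrA pin_central.
- by rewrite !mulrA pin_central.
- by rewrite hx hy mulrDr.
- by rewrite -hx; apply: rho_ext => d; rewrite hy.
Qed.

Lemma rho_cong t u : acong t u -> forall w c, rho t w c = rho u w c.
Proof.
elim=> {t u} //=.
- by move=> x y z _ h1 _ h2 w c; rewrite h1.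
- by move=> x x' y y' _ h1 _ h2 w c; rewrite h1 h2.
- by move=> x x' y y' _ h1 _ h2 w c; rewrite h1; apply: rho_ext => d; rewrite h2.
- by move=> *; rewrite addrA.
- by move=> *; rewrite addrC.
- by move=> *; rewrite rmorph0 mul0r add0r.
- by move=> *; rewrite rmorph1 mul1r.
- by move=> *; rewrite rmorph0 !mul0r.
- by move=> *; rewrite rhoD.
- by move=> *; rewrite rmorphD mulrDl.
- by move=> *; rewrite rmorphM mulrA.
- by move=> *; rewrite rhoZ.
Qed.

Lemma rho_hom d t : thom d t -> forall w c, rho t w c = cls t * w (c - d).
Proof.
elim=> {d t} [d g h|a|d|d t u _ h _ h'|d e t u _ h _ h'] w c /=.
- exact: hgenE.
- by rewrite subr0.
- by rewrite rmorph0 !mul0r.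
- by rewrite h h' clsD mulrDl.
- by rewrite h h' clsM mulrA opprD addrA.
Qed.

Lemma rhoR_hom d t u : thom d t -> thom d u -> R t u ->
  forall w c, rho t w c = rho u w c.
Proof. by move=> ht hu /cls_rel e w c; rewrite !(rho_hom (d := d)) // e. Qed.

Lemma cls_span t : hspan (cls t).
Proof.
elim: t => [g|a|x hx y hy|x hx y hy].
- exact: gen_span.
- by apply: (@hspan_gr 0); exact: pres_gr_in.
- by rewrite clsD; exact: hspanD.
- by rewrite clsM; exact: hspanM.
Qed.

Lemma pres_grading : is_grading pres_gr.
Proof.
pose w0 (c : degree) : pres := if c == 0 then 1 else 0.
pose pr d (u : pres) := rho (repr u) w0 d.
have prE d t : pr d (cls t) = rho t w0 d.
  by apply: rho_cong; apply/clsP; rewrite cls_repr.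
apply: (@build_grading _ _ _ _ pr).
- exact: pres_gr_0.
- exact: pres_gr_B.
- by move=> a u v; rewrite -[u]cls_repr -[v]cls_repr -clsD !prE.
- by move=> a v [t ht ->]; rewrite prE (rho_hom ht) /w0 subrr eqxx mulr1.
- move=> a b v [t ht ->] ne.
  by rewrite prE (rho_hom ht) /w0 subr_eq0 (negbTE ne) mulr0.
- by move=> v; rewrite -[v]cls_repr; exact: cls_span.
Qed.

Definition pres_gsalg (h : is_grading pres_gr) : gsalg k :=
  @GSAlg k pres pin pin_central pres_gr h pres_gr_in pres_gr_mul.
End Graded.
End Presented.

Definition is_char (k : comNzRingType) (c : nat) : Prop :=
  forall m : nat, (m%:R == 0 :> k) = (c %| m)%N.

Definition is_basis (k : comNzRingType) (V : lmodType k) r (b : 'I_r -> V) : Prop :=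
  forall v, exists! c : {ffun 'I_r -> k}, v = \sum_i c i *: b i.

(* [fs_tr_iso]: signs are only defined on homogeneous elements, so the map
   f |-> (g |-> (-1)^(f g) tr (g f)) is the bilinear form Phi with these values. *)
Record frobenius_superalgebra (k : comNzRingType) := FrobeniusSuperalgebra {
  fs_alg :> algType k;
  fs_gr : degree -> fs_alg -> Prop;
  fs_grading : is_grading fs_gr;
  fs_grZ : forall d (a : k) f, fs_gr d f -> fs_gr d (a *: f);
  fs_gr1 : fs_gr 0 1;
  fs_grM : forall d e f g, fs_gr d f -> fs_gr e g -> fs_gr (d + e) (f * g);
  fs_nonneg : forall d p f, fs_gr (d, p) f -> f <> 0 -> (0 <= d)%R;
  fs_free : exists r (b : 'I_r -> fs_alg), is_basis b;
  fs_tr : {scalar fs_alg};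
  fs_tr_even : forall d f, fs_gr (d, true) f -> fs_tr f = 0;
  fs_tr_homog : exists d0 : int, forall d p f, fs_gr (d, p) f -> d <> d0 -> fs_tr f = 0;
  fs_tr_iso : exists Phi : fs_alg -> fs_alg -> k,
    [/\ forall g, scalar (Phi^~ g),
        forall f, scalar (Phi f),
        forall d p f e q g, fs_gr (d, p) f -> fs_gr (e, q) g ->
          Phi f g = (-1) ^+ (p && q) * fs_tr (g * f) &
        forall phi : {scalar fs_alg}, exists! f, forall g, Phi f g = phi g] }.

Section Twisted.
Variables (k : comNzRingType) (F : frobenius_superalgebra k) (psi : F -> F).

Definition has_parity (p : bool) (f : F) : Prop :=
  exists (s : seq int) (c : int -> F),
    (forall d, fs_gr (d, p) (c d)) /\ f = \sum_(d <- s) c d.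

(* F^(m), with the sign rule extended linearly to f = f0 + f1. *)
Definition in_twisted_center (m : nat) (f : F) : Prop :=
  forall f0 f1 q g, has_parity false f0 -> has_parity true f1 -> f = f0 + f1 ->
    has_parity q g -> g * f = f0 * iter m psi g + (-1) ^+ q * (f1 * iter m psi g).

Definition in_psi_twisted_center (m : nat) (f : F) : Prop :=
  in_twisted_center m f /\ psi f = f.
End Twisted.

Record cyclotomic_datum (k : comNzRingType) (F : frobenius_superalgebra k) :=
CyclotomicDatum {
  psi : {linear F -> F};
  psi_nakayama : forall d p f e q g, fs_gr (d, p) f -> fs_gr (e, q) g ->
    fs_tr F (f * g) = (-1) ^+ (p && q) * fs_tr F (g * psi f);
  theta : nat;
  theta_order : [/\ (0 < theta)%N, iter theta psi =1 id &
    forall m, (0 < m < theta)%N -> ~ (iter m psi =1 id)];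
  psi_eigenbasis : exists r (b : 'I_r -> F),
    is_basis b /\ forall i, exists a : k, psi (b i) = a *: b i;
  delta : int;
  delta_attained : exists p (f : F), fs_gr (delta, p) f /\ f <> 0;
  delta_max : forall d p (f : F), fs_gr (d, p) f -> f <> 0 -> (d <= delta)%R;
  rk : nat;
  bas : 'I_rk -> F;
  bas_basis : is_basis bas;
  bas_homog : forall i, exists d, fs_gr d (bas i);
  dual_bas : 'I_rk -> F;
  dualP : forall i j, fs_tr F (dual_bas i * bas j) = (i == j)%:R;
  ce : nat -> nat;
  cc : nat -> nat -> F;
  ccP : forall m j, (1 <= m <= theta)%N -> (j < ce m)%N ->
    in_psi_twisted_center psi m (cc m j) /\ fs_gr (m%:Z * delta, false) (cc m j);
  level_ge1 : (1 <= \sum_(1 <= m < theta.+1) m * ce m)%N }.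
Arguments bas {k F} _ _.
Arguments dual_bas {k F} _ _.

Section FrobFacts.
Variables (k : comNzRingType) (F : frobenius_superalgebra k).
Variable D : cyclotomic_datum F.
Local Notation tr := (fs_tr F).
Local Notation gr := (@fs_gr k F).

Lemma gr_ind (P : F -> Prop) : P 0 -> (forall u v, P u -> P v -> P (u + v)) ->
  (forall a f, gr a f -> P f) -> forall f, P f.
Proof.
move=> h0 hD hg f; have [s [c [_ hc ->]]] := gr_span (fs_grading F) f.
by apply: big_ind => // a _; exact: hg (hc a).
Qed.

Lemma nondeg a f : gr a f -> (forall b g, gr b g -> tr (g * f) = 0) -> f = 0.
Proof.
case: a => d p hf h; have [Phi [lin1 lin2 val bij]] := fs_tr_iso F.
have P0 f' : Phi f' 0 = 0.
  have := lin2 f' 1 0 0; rewrite scale1r addr0 mul1r => e.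
  by apply: (addIr (Phi f' 0)); rewrite add0r -e.
have Pl0 g : Phi 0 g = 0.
  have := lin1 g 1 0 0; rewrite scale1r addr0 mul1r => e.
  by apply: (addIr (Phi 0 g)); rewrite add0r -e.
have [x [hx ux]] := bij (\0 : {scalar F}).
have e0 : x = 0 by apply: ux.
rewrite -e0; apply/esym/ux => g /=; rewrite /=.
elim/gr_ind: g => [|u v hu hv|[e q] g hg]; first by rewrite P0.
  have := lin2 f 1 u v; rewrite scale1r mul1r => ->.
  by rewrite hu hv addr0.
by rewrite (val _ _ _ _ _ _ hf hg) (h _ _ hg) mulr0.
Qed.

Lemma tr_van a f : gr a f -> a <> (delta D, false) -> tr f = 0.
Proof.
case: a => d [|] hf ne; first exact: fs_tr_even hf.
have [d0 hd0] := fs_tr_homog F.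
suff e0 : d0 = delta D by apply: hd0 hf _ => e; apply: ne; rewrite e e0.
have [p [f1 [hf1 nz]]] := delta_attained D.
have [e [g [hg ng]]] : exists e g, gr e g /\ tr (g * f1) <> 0.
  case: (pselect (exists e g, gr e g /\ tr (g * f1) <> 0)) => // h; case: nz.
  apply: nondeg hf1 _ => e g hg; have [->//|/eqP h'] := eqVneq (tr (g * f1)) 0.
  by case: h; exists e, g.
case: e hg => e q hg.
have hm := fs_grM hg hf1.
have e0 : e + delta D = d0.
  by have [//|/eqP h] := eqVneq (e + delta D) d0; case: ng; exact: hd0 hm h.
have gf0 : g * f1 <> 0 by move=> h; apply: ng; rewrite h raddf0.
have g0 : g <> 0 by move=> h; apply: gf0; rewrite h mul0r.
have h1 : (e + delta D <= delta D)%R := delta_max D hm gf0.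
have h2 := fs_nonneg hg g0.
by rewrite -e0; lia.
Qed.

Lemma hom_crit a0 f :
  (forall b g, gr b g -> b + a0 <> (delta D, false) -> tr (g * f) = 0) -> gr a0 f.
Proof.
move=> h; have [pr [prD prg prid prne prs]] := grading_proj (fs_grading F).
have [s hs] := prs f; rewrite (hs (undup s)) ?undup_uniq //; last exact: subset_undup.
have hf := hs _ (undup_uniq _) (@subset_undup _ s).
rewrite big_seq; apply: (gr_sum (fs_grading F)) => a ha.
have [->|ne] := eqVneq a a0; first exact: prg.
suff -> : pr a f = 0 by apply: (gr_0 (fs_grading F)).
apply: (nondeg (prg a f)) => b g hg.
have [e|/eqP ne'] := eqVneq (b + a) (delta D, false); last first.
  by apply: (tr_van (fs_grM hg (prg a f))).
have <- : tr (g * f) = tr (g * pr a f).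
  rewrite {1}hf mulr_sumr raddf_sum (bigD1_seq a) ?undup_uniq //=.
  rewrite big1 ?addr0 // => c nc; apply: (tr_van (fs_grM hg (prg c f))) => e'.
  by case/eqP: nc; apply: (addrI b); rewrite e e'.
apply: (h b g hg) => e'; case/eqP: ne; apply: (addrI b); by rewrite e e'.
Qed.

Lemma psi_gr a f : gr a f -> gr a (psi D f).
Proof.
case: a => d p hf; apply: hom_crit => -[e q] g hg ne.
have := psi_nakayama D hf hg; rewrite (tr_van (fs_grM hf hg)); last first.
  by move=> h; apply: ne; rewrite addrC.
move=> /esym/(congr1 (fun x => (-1) ^+ (p && q) * x)).
by rewrite mulrA -signr_addb addbb mul1r mulr0.
Qed.

Lemma psi_inj f : psi D f = 0 -> f = 0.
Proof.
have [th0 th1 _] := theta_order D => h; rewrite -(th1 f).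
by case: (theta D) th0 => // m _; rewrite iterSr h; elim: m => //= m ->; rewrite raddf0.
Qed.

Lemma nondeg_l a f : gr a f -> (forall g, tr (f * g) = 0) -> f = 0.
Proof.
move=> hf h; apply: psi_inj; apply: (nondeg (psi_gr hf)).
case: a hf => d p hf [e q] g hg.
have := psi_nakayama D hf hg; rewrite h.
move=> /esym/(congr1 (fun x => (-1) ^+ (p && q) * x)).
by rewrite mulrA -signr_addb addbb mul1r mulr0.
Qed.

Lemma dual_gr i a : gr a (bas D i) -> gr ((delta D, false) - a) (dual_bas D i).
Proof.
move=> hi; have [pr [prD prg prid prne prs]] := grading_proj (fs_grading F).
have [s hs] := prs (dual_bas D i).
have hf := hs _ (undup_uniq _) (@subset_undup _ s).
rewrite hf big_seq; apply: (gr_sum (fs_grading F)) => c hc.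
have [->|ne] := eqVneq c ((delta D, false) - a); first exact: prg.
suff -> : pr c (dual_bas D i) = 0 by apply: (gr_0 (fs_grading F)).
apply: (nondeg_l (prg c _)) => g.
have [co [-> _]] := bas_basis D g.
rewrite mulr_sumr raddf_sum big1 // => j _.
have e1 : tr (pr c (dual_bas D i) * (co j *: bas D j)) =
    co j * tr (pr c (dual_bas D i) * bas D j) by rewrite -scalerAr; exact: scalarZ.
suff e0 : tr (pr c (dual_bas D i) * bas D j) = 0 by apply: (etrans e1); rewrite e0 mulr0.
have [b hb] := bas_homog j.
have [e|/eqP ne'] := eqVneq (c + b) (delta D, false); last first.
  exact: (tr_van (fs_grM (prg c _) hb)).
have <- : tr (dual_bas D i * bas D j) = tr (pr c (dual_bas D i) * bas D j).
  rewrite {1}hf mulr_suml raddf_sum (bigD1_seq c) ?undup_uniq //=.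
  rewrite big1 ?addr0 // => x nx; apply: (tr_van (fs_grM (prg x _) hb)) => e'.
  by case/eqP: nx; apply: (addIr b); rewrite e e'.
rewrite dualP; case: eqP => // eij; subst j.
case/eqP: ne; rewrite -e.
have [eab|/eqP nab] := eqVneq a b; first by rewrite eab addrK.
have bi0 : bas D i <> 0.
  move=> h; have := dualP i i; rewrite h mulr0 raddf0 eqxx => /esym/eqP.
  by rewrite oner_eq0.
by case: bi0; rewrite -(prid _ _ hi) (prne _ _ _ hb) //; apply/eqP.
Qed.

Lemma fs_range a f : gr a f -> f <> 0 ->
  exists x : 'I_(`|delta D|).+1 * bool, a = ((x.1 : nat)%:Z, x.2).
Proof.
case: a => d p hf nz; have h1 := fs_nonneg hf nz; have h2 := delta_max D hf nz.
have h : (`|d| < (`|delta D|).+1)%N by lia.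
by exists (Ordinal h, p) => /=; congr (_, _); lia.
Qed.
End FrobFacts.

(* Generators: x_i, elementary tensors f_1 (x) ... (x) f_n, permutations. *)
Inductive agen (F : Type) (n : nat) : Type :=
  | GX of 'I_n
  | GT of {ffun 'I_n -> F}
  | GP of 'S_n.
Arguments GX {F n} i.
Arguments GP {F n} s.

Section CyclotomicAlgebra.
Variables (k : comNzRingType) (F : frobenius_superalgebra k).
Variable D : cyclotomic_datum F.
Local Notation gr := (@fs_gr k F).

Definition upd (n : nat) (f : {ffun 'I_n -> F}) (i : 'I_n) (u : F) : {ffun 'I_n -> F} :=
  [ffun l => if l == i then u else f l].

Definition slot (n : nat) (i : 'I_n) (u : F) : {ffun 'I_n -> F} :=
  upd [ffun=> 1] i u.

(* Sign of (f_1 (x) ... (x) f_n)(g_1 (x) ... (x) g_n) for f, g of degrees d, e. *)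
Definition mul_sign (n : nat) (d e : 'I_n -> degree) : k :=
  (-1) ^+ (\sum_(i < n) \sum_(j < n | j < i) ((d i).2 && (e j).2))%N.

(* Sign of the superpermutation of a tensor with degrees d by s. *)
Definition perm_sign (n : nat) (s : 'S_n) (d : 'I_n -> degree) : k :=
  (-1) ^+ (\sum_(i < n) \sum_(j < n | (i < j) && (s j < s i)) ((d i).2 && (d j).2))%N.

Section Rel.
Variable n : nat.
Local Notation tm := (term k (agen F n)).
Definition tX (i : 'I_n) : tm := Gen (GX i).
Definition tT (f : {ffun 'I_n -> F}) : tm := Gen (GT f).
Definition tP (s : 'S_n) : tm := Gen (GP s).

(* t_(i,j), the sum over the basis of b_i (b^v)_j. *)
Definition teleporter (i j : 'I_n) : tm :=
  \big[@Add _ _/Cst 0]_(b < rk D) (tT (slot i (bas D b)) *' tT (slot j (dual_bas D b))).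

(* The affine wreath product algebra: the free product of k[x_1, ..., x_n]
   (ar_XX), the n-th tensor power of F (ar_Tlin to ar_TM: the universal
   multilinear map, with the super multiplication) and k S_n (ar_P1, ar_PM),
   modulo the four defining relations. In MathComp, (s * t)%g is "s, then t". *)
Inductive aff_rel : tm -> tm -> Prop :=
  | ar_XX i j : aff_rel (tX i *' tX j) (tX j *' tX i)
  | ar_Tlin f i (a : k) u v :
      aff_rel (tT (upd f i (a *: u + v)))
              (Cst a *' tT (upd f i u) +' tT (upd f i v))
  | ar_T1 : aff_rel (tT [ffun=> 1]) (Cst 1)
  | ar_TM (f g : {ffun 'I_n -> F}) (d e : 'I_n -> degree) :
      (forall i, gr (d i) (f i)) -> (forall i, gr (e i) (g i)) ->
      aff_rel (tT f *' tT g) (Cst (mul_sign d e) *' tT [ffun i => f i * g i])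
  | ar_P1 : aff_rel (tP 1%g) (Cst 1)
  | ar_PM s t : aff_rel (tP s *' tP t) (tP (t * s)%g)
  | ar_TX f i : aff_rel (tT f *' tX i) (tX i *' tT (upd f i (psi D (f i))))
  | ar_sX (i i' j : 'I_n) : i' = i.+1 :> nat -> j != i -> j != i' ->
      aff_rel (tP (tperm i i') *' tX j) (tX j *' tP (tperm i i'))
  | ar_sXi (i i' : 'I_n) : i' = i.+1 :> nat ->
      aff_rel (tP (tperm i i') *' tX i) (tX i' *' tP (tperm i i') -' teleporter i i')
  | ar_PT s (f : {ffun 'I_n -> F}) (d : 'I_n -> degree) :
      (forall i, gr (d i) (f i)) ->
      aff_rel (tP s *' tT f)
              (Cst (perm_sign s d) *' tT [ffun i => f ((s^-1)%g i)] *' tP s).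

Definition chi (i : 'I_n) : tm :=
  \big[@Mul _ _/Cst 1]_(1 <= m < (theta D).+1)
    \big[@Mul _ _/Cst 1]_(0 <= j < ce D m) (tpow (tX i) m -' tT (slot i (cc D m j))).

(* Imposing chi = 0 presents the quotient by the two-sided ideal generated by chi,
   a polynomial in the first x. For n = 0 there is no chi, and all generators
   equal 1, so the algebra is k. *)
Inductive cyc_rel : tm -> tm -> Prop :=
  | cr_aff t u : aff_rel t u -> cyc_rel t u
  | cr_chi (i : 'I_n) : i = 0%N :> nat -> cyc_rel (chi i) (Cst 0).

Inductive gen_degree : degree -> agen F n -> Prop :=
  | gd_X i : gen_degree (delta D, false) (GX i)
  | gd_T (f : {ffun 'I_n -> F}) (d : 'I_n -> degree) :
      (forall i, gr (d i) (f i)) -> gen_degree (\sum_i d i) (GT f)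
  | gd_P s : gen_degree 0 (GP s).

Local Notation Q := (pres cyc_rel).
Local Notation cl := (@cls k (agen F n) cyc_rel).
Local Notation th := (thom gen_degree).

Lemma clT_lin f i a u v :
  cl (tT (upd f i (a *: u + v))) = pin _ a * cl (tT (upd f i u)) + cl (tT (upd f i v)).
Proof. by rewrite /pin -clsM -clsD; apply/cls_rel/cr_aff/ar_Tlin. Qed.
Lemma clT_D f i u v :
  cl (tT (upd f i (u + v))) = cl (tT (upd f i u)) + cl (tT (upd f i v)).
Proof. by have := clT_lin f i 1 u v; rewrite scale1r rmorph1 mul1r. Qed.
Lemma clT_0 f i : cl (tT (upd f i 0)) = 0.
Proof. by apply: (addIr (cl (tT (upd f i 0)))); rewrite -clT_D !add0r. Qed.
Lemma clT_sum f i (I : Type) (s : seq I) (c : I -> F) :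
  cl (tT (upd f i (\sum_(j <- s) c j))) = \sum_(j <- s) cl (tT (upd f i (c j))).
Proof.
apply: (big_morph (fun u => cl (tT (upd f i u)))) => [u v|]; last exact: clT_0.
exact: clT_D.
Qed.
Lemma upd_id (f : {ffun 'I_n -> F}) i : upd f i (f i) = f.
Proof. by apply/ffunP=> l; rewrite ffunE; case: eqP => [->|]. Qed.
Lemma clT_z (f : {ffun 'I_n -> F}) i : f i = 0 -> cl (tT f) = 0.
Proof. by move=> h; rewrite -(upd_id f i) h clT_0. Qed.

Lemma th_mul' d e c (t u : tm) : th d t -> th e u -> c = d + e -> th c (t *' u).
Proof. by move=> h h' ->; exact: th_mul. Qed.
Lemma th_cstM d a (t : tm) : th d t -> th d (Cst a *' t).
Proof. by move=> h; apply: (th_mul' (th_cst _ a) h); rewrite add0r. Qed.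
Lemma th_X i : th (delta D, false) (tX i). Proof. exact/th_gen/gd_X. Qed.
Lemma th_P s : th 0 (tP s). Proof. exact/th_gen/gd_P. Qed.
Lemma th_T (f : {ffun 'I_n -> F}) (d : 'I_n -> degree) c :
  (forall i, gr (d i) (f i)) -> c = \sum_i d i -> th c (tT f).
Proof. by move=> h ->; exact/th_gen/gd_T. Qed.
Lemma th_slot i a u : gr a u -> th a (tT (slot i u)).
Proof.
move=> hu; apply: (@th_T _ (fun l => if l == i then a else 0)) => [l|].
  by rewrite !ffunE; case: eqP => // _; exact: fs_gr1.
by rewrite -big_mkcond big_pred1_eq.
Qed.
Lemma th_sum r (t : 'I_r -> tm) d : (forall b, th d (t b)) ->
  th d (\big[@Add _ _/Cst 0]_(b < r) t b).
Proof. by move=> h; apply: big_ind => //; [exact: th_0|exact: th_add]. Qed.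
Lemma th_tele i j : th (delta D, false) (teleporter i j).
Proof.
apply: th_sum => b; have [a ha] := bas_homog b.
by apply: (th_mul' (th_slot i ha) (th_slot j (dual_gr ha))); rewrite addrC subrK.
Qed.
Lemma th_pow i m : th (m%:Z * delta D, false) (tpow (tX i) m).
Proof.
elim: m => [|m IH] /=; first by rewrite mul0r; exact: th_cst.
by apply: (th_mul' (th_X i) IH); rewrite intS mulrDl mul1r.
Qed.
Lemma th_chi i : exists d, th d (chi i).
Proof.
have h1 : exists d, th d (Cst 1) by exists 0; exact: th_cst.
have hM t u : (exists d, th d t) -> (exists d, th d u) -> exists d, th d (t *' u).
  by move=> [d h] [e h']; exists (d + e); exact: th_mul.
rewrite /chi big_nat; apply: (big_ind (fun t => exists d, th d t)); [exact: h1|exact: hM|].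
move=> m hm; rewrite big_nat.
apply: (big_ind (fun t => exists d, th d t)); [exact: h1|exact: hM|move=> j hj].
exists (m%:Z * delta D, false); apply: th_add; first exact: th_pow.
by apply: th_cstM; apply: th_slot; case: (@ccP k F D m j).
Qed.

Section WithProj.
Variable pr : degree -> F -> F.
Hypothesis prD : forall a, {morph pr a : u v / u + v}.
Hypothesis prg : forall a v, gr a (pr a v).
Hypothesis prid : forall a v, gr a v -> pr a v = v.
Hypothesis prne : forall a b v, gr a v -> b != a -> pr b v = 0.
Hypothesis prs : forall v, exists s : seq degree, forall t : seq degree,
  uniq t -> {subset s <= t} -> v = \sum_(a <- t) pr a v.

Lemma pr0 a : pr a 0 = 0.
Proof. by apply: (addIr (pr a 0)); rewrite -prD !add0r. Qed.
Lemma prcomm (h : {linear F -> F}) : (forall a u, gr a u -> gr a (h u)) ->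
  forall a u, pr a (h u) = h (pr a u).
Proof.
move=> hg a u; have [s hs] := prs u.
have e := hs _ (undup_uniq s) (@subset_undup _ s).
rewrite {1}e raddf_sum (big_morph (pr a) (prD a) (pr0 a)).
have [ha|na] := boolP (a \in undup s).
  rewrite (bigD1_seq a) ?undup_uniq //= (prid (hg _ _ (prg _ _))).
  by rewrite big1 ?addr0 // => b ne; rewrite (prne (hg _ _ (prg b u))) // eq_sym.
rewrite big_seq big1; last first.
  move=> b hb; rewrite (prne (hg _ _ (prg b u))) //.
  by apply: contraNneq na => ->.
suff -> : pr a u = 0 by rewrite raddf0.
rewrite e (big_morph (pr a) (prD a) (pr0 a)) big_seq big1 // => b hb.
by rewrite (prne (prg b u)) //; apply: contraNneq na => ->.
Qed.
Lemma prZ a (c : k) u : pr a (c *: u) = c *: pr a u.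
Proof.
have h : linear (fun u : F => c *: u).
  by move=> b x y; rewrite scalerDr !scalerA mulrC.
pose m := GRing.isLinear.Build k F F *:%R (fun u : F => c *: u) h.
pose hl : {linear F -> F} := HB.pack (fun u : F => c *: u) m.
by apply: (@prcomm hl) => b v; exact: fs_grZ.
Qed.

Local Notation fdeg := ('I_(`|delta D|).+1 * bool)%type.
Definition dg (x : fdeg) : degree := ((x.1 : nat)%:Z, x.2).
Definition fdegs := {ffun 'I_n -> fdeg}.
Definition proj_tens (f : {ffun 'I_n -> F}) (e : fdegs) : {ffun 'I_n -> F} :=
  [ffun i => pr (dg (e i)) (f i)].
Definition j0 : fdegs := [ffun=> (ord0, false)].

Definition dgen (g : agen F n) (e : fdegs) : degree :=
  match g with
  | GX _ => (delta D, false)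
  | GT _ => \sum_i dg (e i)
  | GP _ => 0
  end.
Definition cgen (g : agen F n) (e : fdegs) : Q :=
  match g with
  | GT f => cl (tT (proj_tens f e))
  | _ => if e == j0 then cl (Gen g) else 0
  end.

Lemma dg_inj : injective dg.
Proof. by move=> [a p] [b q] [/= /val_inj -> ->]. Qed.

Lemma sum_j0 (u : Q) (w : Q) : \sum_(e : fdegs) (if e == j0 then u else 0) * w = u * w.
Proof.
rewrite (bigD1 j0) //= eqxx big1 ?addr0 // => e /negbTE ->.
by rewrite mul0r.
Qed.

Lemma cgen_hom d g : gen_degree d g -> forall w c,
  \sum_e cgen g e * w (c - dgen g e) = cl (Gen g) * w (c - d).
Proof.
case=> {d g} [i|f d hf|s] w c /=; [exact: sum_j0| |exact: sum_j0].
case: (pselect (forall i, f i <> 0)) => [nz|]; last first.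
  move=> /existsNP[i /contrapT hi]; rewrite (clT_z hi) mul0r big1 // => e _.
  by rewrite (@clT_z _ i) ?mul0r // ffunE hi pr0.
have /choice[e he] : forall i, exists x : fdeg, d i = dg x.
  by move=> i; exact: fs_range (hf i) (nz i).
pose e' : fdegs := [ffun i => e i].
have hce : proj_tens f e' = f.
  by apply/ffunP=> i; rewrite !ffunE -he prid.
rewrite (bigD1 e') //= hce [X in _ + X]big1 ?addr0.
  by congr (_ * w (c - _)); apply: eq_bigr => i _; rewrite ffunE he.
move=> e2 ne; suff [i hi] : exists i, e2 i != e' i.
  rewrite (@clT_z _ i) ?mul0r // ffunE (prne (hf i)) // he.
  by rewrite ffunE in hi; apply: contra hi => /eqP /dg_inj ->.
apply: contrapT => /forallNP h; case/eqP: ne; apply/ffunP => i.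
by have := h i => /negP; rewrite negbK => /eqP.
Qed.

Local Notation rh := (rho dgen cgen).

Lemma proj_tens_upd f i u (e : fdegs) :
  proj_tens (upd f i u) e = upd (proj_tens f e) i (pr (dg (e i)) u).
Proof. by apply/ffunP=> l; rewrite !ffunE; case: eqP => [->|]. Qed.

Lemma rh_hom d t u : th d t -> th d u -> cyc_rel t u -> forall w c, rh t w c = rh u w c.
Proof. by move=> ht hu; apply: rhoR_hom ht hu; exact: cgen_hom. Qed.

Lemma rh_rel t u : cyc_rel t u -> forall w c, rh t w c = rh u w c.
Proof.
move=> htu; case: (htu) => {t u htu} [t u haff|i hi]; last first.
  have [d hd] := th_chi i.
  by apply: (rh_hom hd _ (cr_chi hi)); exact: th_0.
have hr := cr_aff haff; move: hr.
case: haff => {t u}.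
- move=> i j; apply: rh_hom; apply: th_mul; exact: th_X.
- move=> f i a u v _ w c /=.
  rewrite mulr_sumr -big_split /=; apply: eq_bigr => e _.
  by rewrite !proj_tens_upd prD prZ clT_lin mulrDl mulrA.
- apply: (@rh_hom 0); last exact: th_cst.
  by apply: (@th_T _ (fun=> 0)) => [i|]; rewrite ?ffunE ?big1 //; exact: fs_gr1.
- move=> f g d e hf hg; apply: (@rh_hom (\sum_i d i + \sum_i e i)).
    by apply: th_mul; [exact: (th_T hf)|exact: (th_T hg)].
  apply/th_cstM/(@th_T _ (fun i => d i + e i)) => [i|]; last by rewrite big_split.
  by rewrite ffunE; exact: fs_grM.
- by apply: (@rh_hom 0); [exact: th_P|exact: th_cst].
- move=> s t; apply: (@rh_hom 0); last exact: th_P.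
  by apply: (th_mul' (th_P s) (th_P t)); rewrite addr0.
- move=> f i _ w c /=.
  rewrite -[RHS]/(\sum_e cgen (GX i) e * rh (tT (upd f i (psi D (f i)))) w
    (c - (delta D, false))) sum_j0 /= mulr_sumr.
  apply: eq_bigr => e _.
  rewrite -[X in cl (tT (proj_tens f e)) * X]/(\sum_e' cgen (GX i) e' *
    w (c - (\sum_l dg (e l)) - (delta D, false))) sum_j0 !mulrA -!clsM.
  rewrite (cls_rel (cr_aff (ar_TX _ i))) proj_tens_upd ffunE (prcomm (@psi_gr k F D)).
  by congr (_ * w _); rewrite addrAC.
- move=> i i' j _ _ _; apply: (@rh_hom (delta D, false)).
    by apply: (th_mul' (th_P _) (th_X _)); rewrite add0r.
  by apply: (th_mul' (th_X _) (th_P _)); rewrite addr0.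
- move=> i i' _; apply: (@rh_hom (delta D, false)).
    by apply: (th_mul' (th_P _) (th_X _)); rewrite add0r.
  apply: th_add; last exact/th_cstM/th_tele.
  by apply: (th_mul' (th_X _) (th_P _)); rewrite addr0.
- move=> s f d hf; apply: (@rh_hom (\sum_i d i)).
    by apply: (th_mul' (th_P s) (th_T hf erefl)); rewrite add0r.
  apply: (@th_mul' (\sum_i d i) 0); rewrite ?addr0 //; last exact: th_P.
  apply/th_cstM/(@th_T _ (fun i => d ((s^-1)%g i))) => [i|].
    by rewrite ffunE.
  by rewrite [RHS](reindex_inj (@perm_inj _ s)) /=; apply: eq_bigr => i _; rewrite permK.
Qed.

Lemma T_span f : hspan gen_degree (cl (tT f)).
Proof.
have key m : (m <= n)%N -> forall f : {ffun 'I_n -> F},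
    (forall i : 'I_n, (m <= i)%N -> exists d, gr d (f i)) -> hspan gen_degree (cl (tT f)).
  elim: m => [|m IH] hm g hg.
    have /choice[d hd] : forall i, exists d, gr d (g i) by move=> i; exact: hg.
    apply: (@hspan_gr _ _ _ _ (\sum_i d i)); exists (tT g) => //.
    exact: th_T hd erefl.
  pose i := Ordinal hm.
  have [s [c [us hc e]]] := gr_span (fs_grading F) (g i).
  rewrite -(upd_id g i) e clT_sum; apply: hspan_sum => a.
  apply: IH => [|l hl]; first exact: ltnW.
  rewrite ffunE; case: eqP => [_|ne]; first by exists a.
  apply: hg; rewrite ltn_neqAle hl andbT; apply/eqP => e'; apply: ne.
  exact/val_inj.
by apply: (key n) => // i; rewrite leqNgt ltn_ord.
Qed.

Lemma gens_span g : hspan gen_degree (cl (Gen g)).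
Proof.
case: g => [i|f|s]; [|exact: T_span|].
- by apply: (@hspan_gr _ _ _ _ (delta D, false)); exists (tX i) => //; exact: th_X.
- by apply: (@hspan_gr _ _ _ _ 0); exists (tP s) => //; exact: th_P.
Qed.

Lemma cyc_grading_of : is_grading (@pres_gr k _ cyc_rel gen_degree).
Proof. exact: (pres_grading cgen_hom gens_span rh_rel). Qed.
End WithProj.

Lemma cyc_grading : is_grading (@pres_gr k _ cyc_rel gen_degree).
Proof.
have [pr [h1 h2 h3 h4 h5]] := grading_proj (fs_grading F).
exact: cyc_grading_of h1 h2 h3 h4 h5.
Qed.

Definition cyc_alg : gsalg k := pres_gsalg cyc_grading.

End Rel.

Section Inclusion.
Variable n : nat.
Local Notation lft := (lift (@ord_max n)).

Definition ext_tens (f : {ffun 'I_n -> F}) : {ffun 'I_n.+1 -> F} :=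
  [ffun i => if unlift ord_max i is Some j then f j else 1].

(* x_i |-> x_i, f |-> f (x) 1, and the standard inclusion of S_n in S_(n+1). *)
Definition incl_gen (g : agen F n) : agen F n.+1 :=
  match g with
  | GX i => GX (lft i)
  | GT f => GT (ext_tens f)
  | GP s => GP (lift_perm ord_max ord_max s)
  end.

Local Notation B := (cyc_alg n.+1).
Local Notation cl := (@cls k (agen F n.+1) (@cyc_rel n.+1)).
Definition incl_val (g : agen F n) : B := cl (Gen (incl_gen g)).
Local Notation evi := (ev incl_val).

Definition extd (d : 'I_n -> degree) (i : 'I_n.+1) : degree :=
  if unlift ord_max i is Some j then d j else 0.

Lemma ext_lift f i : ext_tens f (lft i) = f i. Proof. by rewrite ffunE liftK. Qed.
Lemma ext_max f : ext_tens f ord_max = 1. Proof. by rewrite ffunE unlift_none. Qed.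
Lemma extd_lift d i : extd d (lft i) = d i. Proof. by rewrite /extd liftK. Qed.
Lemma extd_max d : extd d ord_max = 0. Proof. by rewrite /extd unlift_none. Qed.

Lemma ffun_lift (f g : {ffun 'I_n.+1 -> F}) :
  (forall i, f (lft i) = g (lft i)) -> f ord_max = g ord_max -> f = g.
Proof. by move=> h h'; apply/ffunP=> i; case: (unliftP ord_max i) => [j|] ->. Qed.

Lemma lft_eq (i j : 'I_n) : (lft i == lft j) = (i == j).
Proof. exact: (inj_eq (@lift_inj _ ord_max)). Qed.
Lemma lft_max (i : 'I_n) : (ord_max == lft i) = false.
Proof. by apply/negbTE; exact: neq_lift. Qed.
Lemma lft_val (i : 'I_n) : lft i = i :> nat.
Proof. by rewrite /= /bump leqNgt ltn_ord. Qed.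

Lemma ext_upd f i u : ext_tens (upd f i u) = upd (ext_tens f) (lft i) u.
Proof.
apply: ffun_lift => [j|]; rewrite ?ext_lift ?ext_max !ffunE.
  by rewrite lft_eq liftK.
by rewrite lft_max unlift_none.
Qed.
Lemma ext_1 : ext_tens [ffun=> 1] = [ffun=> 1].
Proof. by apply: ffun_lift => [j|]; rewrite ?ext_lift ?ext_max !ffunE. Qed.
Lemma ext_slot i u : ext_tens (slot i u) = slot (lft i) u.
Proof. by rewrite /slot ext_upd ext_1. Qed.
Lemma ext_gr (f : {ffun 'I_n -> F}) d :
  (forall i, gr (d i) (f i)) -> forall i, gr (extd d i) (ext_tens f i).
Proof.
move=> h i; case: (unliftP ord_max i) => [j|] ->; rewrite ?extd_lift ?ext_lift //.
by rewrite extd_max ext_max; exact: fs_gr1.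
Qed.

Lemma sum_lft (Z : nmodType) (p : pred 'I_n.+1) (h : 'I_n.+1 -> Z) : h ord_max = 0 ->
  \sum_(i < n.+1 | p i) h i = \sum_(i < n | p (lft i)) h (lft i).
Proof.
move=> h0; rewrite big_mkcond big_ord_recr /= h0 if_same addr0 [RHS]big_mkcond.
by apply: eq_bigr => i _; rewrite (_ : widen_ord _ i = lft i) //; apply/val_inj/esym; exact: lft_val.
Qed.

Lemma mul_sign_ext d e : mul_sign (extd d) (extd e) = mul_sign d e.
Proof.
rewrite /mul_sign; congr (_ ^+ _).
have -> : (\sum_(i < n.+1) \sum_(j < n.+1 | (j < i)%N)
    ((extd d i).2 && (extd e j).2 : nat))%N = (\sum_(i < n)
    \sum_(j < n.+1 | (j < lft i)%N) ((extd d (lft i)).2 && (extd e j).2 : nat))%N.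
  by apply: sum_lft; rewrite big1 // => j _; rewrite extd_max.
apply: eq_bigr => i _.
have -> : (\sum_(j < n.+1 | (j < lft i)%N) ((extd d (lft i)).2 && (extd e j).2 : nat))%N
  = (\sum_(j < n | (lft j < lft i)%N) ((extd d (lft i)).2 && (extd e (lft j)).2 : nat))%N.
  by apply: sum_lft; rewrite extd_max andbF.
by apply: eq_big => [j|j _]; rewrite ?extd_lift ?lft_val.
Qed.

Local Notation lp := (lift_perm ord_max ord_max).

Lemma perm_sign_ext s d : perm_sign (lp s) (extd d) = perm_sign s d.
Proof.
rewrite /perm_sign; congr (_ ^+ _).
have -> : (\sum_(i < n.+1) \sum_(j < n.+1 | (i < j) && (lp s j < lp s i))
    ((extd d i).2 && (extd d j).2 : nat))%N = (\sum_(i < n)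
    \sum_(j < n.+1 | (lft i < j) && (lp s j < lp s (lft i)))
      ((extd d (lft i)).2 && (extd d j).2 : nat))%N.
  by apply: sum_lft; rewrite big1 // => j _; rewrite extd_max.
apply: eq_bigr => i _.
have -> : (\sum_(j < n.+1 | (lft i < j) && (lp s j < lp s (lft i)))
      ((extd d (lft i)).2 && (extd d j).2 : nat))%N
  = (\sum_(j < n | (lft i < lft j) && (lp s (lft j) < lp s (lft i)))
      ((extd d (lft i)).2 && (extd d (lft j)).2 : nat))%N.
  by apply: sum_lft; rewrite extd_max andbF.
by apply: eq_big => [j|j _]; rewrite ?extd_lift ?lift_perm_lift ?lft_val.
Qed.

Lemma lp_tperm (i j : 'I_n) : lp (tperm i j) = tperm (lft i) (lft j).
Proof.
apply/permP=> l; case: (unliftP ord_max l) => [l'|] ->.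
  rewrite lift_perm_lift !permE /= !lft_eq.
  by case: eqP => // _; case: eqP.
by rewrite lift_perm_id permE /= !lft_max.
Qed.

Lemma evi_sum r (t : 'I_r -> term k (agen F n)) :
  evi (\big[@Add _ _/Cst 0]_(b < r) t b) = \sum_(b < r) evi (t b).
Proof. by apply: (big_morph evi) => //=; rewrite rmorph0. Qed.
Lemma cl_sum r (t : 'I_r -> term k (agen F n.+1)) :
  cl (\big[@Add _ _/Cst 0]_(b < r) t b) = \sum_(b < r) cl (t b).
Proof. by apply: (big_morph cl) => // x y; rewrite clsD. Qed.

Lemma evi_tele i j : evi (teleporter i j) = cl (teleporter (lft i) (lft j)).
Proof.
rewrite evi_sum cl_sum; apply: eq_bigr => b _ /=.
by rewrite /incl_val /= !ext_slot -clsM.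
Qed.
Lemma evi_pow i m : evi (tpow (tX i) m) = cl (tpow (tX (lft i)) m).
Proof. by elim: m => [|m IH] //=; rewrite IH -clsM. Qed.
Lemma evi_chi i : evi (chi i) = cl (chi (lft i)).
Proof.
have e1 : evi (Cst 1) = 1 by rewrite /= rmorph1.
have c1 : cl (Cst 1) = 1 by [].
rewrite /chi (big_morph evi (fun x y => erefl) e1) (big_morph cl (@clsM _ _ _) c1).
apply: eq_bigr => m _.
rewrite (big_morph evi (fun x y => erefl) e1) (big_morph cl (@clsM _ _ _) c1).
apply: eq_bigr => j _ /=.
by rewrite evi_pow /incl_val /= ext_slot clsD clsM.
Qed.

Lemma incl_rel t u : cyc_rel t u -> evi t = evi u.
Proof.
case=> {t u} [t u|i hi]; last first.
  rewrite evi_chi /=; apply/cls_rel/cr_chi.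
  by rewrite lft_val.
case=> {t u} /=; rewrite /incl_val /=.
- by move=> i j; rewrite -!clsM; apply/cls_rel/cr_aff/ar_XX.
- by move=> f i a u v; rewrite !ext_upd clT_lin.
- by rewrite ext_1; apply/cls_rel/cr_aff/ar_T1.
- move=> f g d e hf hg; rewrite -[LHS]clsM.
  rewrite (cls_rel (cr_aff (ar_TM (ext_gr hf) (ext_gr hg)))) mul_sign_ext.
  rewrite clsM; apply: (congr1 (fun x => cl (Cst (mul_sign d e)) * cl (tT x))).
  by apply: ffun_lift => [i|]; rewrite ?ext_lift ?ext_max !ffunE ?liftK ?unlift_none ?mulr1.
- by rewrite lift_perm1; apply/cls_rel/cr_aff/ar_P1.
- by move=> s t; rewrite -clsM -(lift_permM ord_max ord_max); apply/cls_rel/cr_aff/ar_PM.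
- move=> f i; rewrite -!clsM ext_upd (cls_rel (cr_aff (ar_TX _ _))).
  by rewrite ext_lift.
- move=> i i' j hi h1 h2; rewrite -!clsM lp_tperm.
  by apply/cls_rel/cr_aff/ar_sX; rewrite ?lft_val ?lft_eq.
- move=> i i' hi; rewrite evi_tele -!clsM -clsD lp_tperm.
  by apply/cls_rel/cr_aff/ar_sXi; rewrite !lft_val.
- move=> s f d hf; rewrite -[LHS]clsM.
  rewrite (cls_rel (cr_aff (ar_PT (lp s) (ext_gr hf)))) perm_sign_ext.
  rewrite !clsM.
  apply: (congr1 (fun x => cl (Cst (perm_sign s d)) * cl (tT x) * cl (tP (lp s)))).
  rewrite lift_permV; apply: ffun_lift => [i|].
    by rewrite ext_lift !ffunE lift_perm_lift liftK.
  by rewrite ext_max ffunE lift_perm_id ext_max.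
Qed.

Definition incl_fun : cyc_alg n -> cyc_alg n.+1 := pres_lift incl_val.
HB.instance Definition _ := GRing.isZmodMorphism.Build (cyc_alg n) (cyc_alg n.+1)
  incl_fun (pres_lift_zmod incl_rel).
HB.instance Definition _ := GRing.isMonoidMorphism.Build (cyc_alg n) (cyc_alg n.+1)
  incl_fun (pres_lift_monoid incl_rel).

Lemma incl_in a : incl_fun (ga_in (cyc_alg n) a) = ga_in (cyc_alg n.+1) a.
Proof. exact: (pres_liftE incl_rel (Cst a)). Qed.

Lemma incl_gr d (u : cyc_alg n) : ga_gr d u -> ga_gr d (incl_fun u).
Proof.
case=> t ht ->; rewrite /incl_fun (pres_liftE incl_rel).
elim: ht => {d t u} /= [d g [i|f d' hf|s]|a|d|d t u _ h _ h'|d e t u _ h _ h'].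
- by exists (tX (lft i)) => //; exact: th_X.
- exists (tT (ext_tens f)) => //; apply: th_T (ext_gr hf) _.
  rewrite [RHS](@sum_lft _ xpredT) ?extd_max //.
  by apply: eq_bigr => i _; rewrite extd_lift.
- by exists (tP (lp s)) => //; exact: th_P.
- exact: (@ga_gr_in k (cyc_alg n.+1)).
- by rewrite rmorph0; exact: (gr_0 (ga_grading (cyc_alg n.+1))).
- exact: (gr_D (ga_grading (cyc_alg n.+1))).
- exact: (@ga_gr_mul k (cyc_alg n.+1)).
Qed.

Definition cyc_incl : gahom (cyc_alg n) (cyc_alg n.+1) :=
  @GAHom k (cyc_alg n) (cyc_alg n.+1) incl_fun incl_in incl_gr.

End Inclusion.
End CyclotomicAlgebra.

(* Main.v *)
Require Import Defs.
From HB Require Import structures.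
From mathcomp Require Import all_boot all_order all_algebra.
From mathcomp Require Import fingroup perm generic_quotient boolp zify.

Set Implicit Arguments.
Unset Strict Implicit.
Unset Printing Implicit Defensive.

Import GRing.Theory.
Local Open Scope ring_scope.

(** Write R_n for the cyclotomic algebra of rank n, H_n for the affine one, d for the level,
    x and f for the last variable and the last tensor factor of rank n+1, and s for the
    transposition of the last two indices. The theorem holds because R_(n+1) is a Frobenius
    extension of R_n: there is an R_n-bimodule map tau_n : R_(n+1) -> R_n, homogeneous of
    degree -d delta, with finite homogeneous families u, v such that
        b = sum_j u_j tau(v_j b) = sum_j tau(b u_j) v_j   for all b.
    For a Frobenius extension B of A everything is formal. The maps b (x) m |-> tau(v_j b) m
    are natural coordinates on B (x)_A M, so induction is exact; the v_j generate B over A,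
    so restriction preserves finite generation; induction is left adjoint to restriction, as
    always; and h |-> (y |-> sum_j u_j (x) h(v_j y)) is the other adjunction. It shifts degrees
    by d delta, since u_j (x) v_j has this degree ([extension_Ind_exact],
    [Ind_adjoint_Res], [Res_adjoint_Ind]).

    The relations show that R_(n+1) is spanned by R_n x^a F, for a < d, and by R_n s R_n
    ([cyc_fil]), so that tau_n is determined by
        tau(x^a f) = 0 for a < d-1,   tau(x^(d-1) f) = tr(f),   tau(s) = 0;
    it then satisfies tau_n(s y s) = tau_(n-1)(y) for y in R_n. Given such maps, the dual
    families are found by recursion on n ([dual_families]): u_j s and s v_j, with u, v dual
    for tau_(n-1), reproduce R_n s R_n, because tau_n(s v_j y s) = tau_(n-1)(v_j y); and
    the powers of x times dual bases of F reproduce the rest, by a unitriangular correction.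

    The work lies in the existence of tau_n, and it is done by representations. Let M be the
    module of left R_n-linear maps c : R_n (x) F[x] -> R_n; the subalgebra of H_(n+1) that
    avoids s acts on it. Coinduction, which only needs functions on the symmetric group with
    values in M, makes it a module over H_(n+1) ([coind_affine]). Every c in M extends to a
    vector of the coinduced module on which H_n acts through c ([itw_X]), and the
    corresponding matrix coefficient E_c : H_(n+1) -> R_n is left R_n-linear, with
    E_c(x^a f) = c(x^a f) and E_c(s) = 0. Since s x'^a f' s = x^a f modulo lower terms, where
    x', f' live one index below, the equations E_c(s x'^a f' s) = tau_(n-1)(x'^a f') are
    triangular and have a unique solution c. By uniqueness c commutes with H_n
    ([central_all]): this makes E_c a bimodule map, and it forces E_c to vanish on the ideal
    generated by the cyclotomic polynomial ([cf_chi]). Hence E_c descends to R_(n+1)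
    ([trace_step]). For n = 0 the functional c is given by the linear recursion whose
    characteristic polynomial is the cyclotomic one ([base_trace]). *)

(** * Endomorphism rings and signs of reordered products *)

Lemma morph0 (U V : zmodType) (f : U -> V) : {morph f : x y / x + y} -> f 0 = 0.
Proof. by move=> fD; apply: (addIr (f 0)); rewrite -fD !add0r. Qed.

Lemma morphN (U V : zmodType) (f : U -> V) :
  {morph f : x y / x + y} -> {morph f : x / - x}.
Proof. by move=> fD x; apply: (addIr (f x)); rewrite -fD !addNr morph0. Qed.

Lemma morphB (U V : zmodType) (f : U -> V) :
  {morph f : x y / x + y} -> {morph f : x y / x - y}.
Proof. by move=> fD x y; rewrite fD morphN. Qed.

Lemma morph_sum (U V : zmodType) (f : U -> V) (I : Type) (s : seq I) (P : pred I) c :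
  {morph f : x y / x + y} -> f (\sum_(i <- s | P i) c i) = \sum_(i <- s | P i) f (c i).
Proof. by move=> fD; apply: (big_morph f) => //; exact: morph0. Qed.

Section Endomorphisms.
Variables (k : comNzRingType) (M : lmodType k).

(** The defining relations of the affine algebra will be verified as equations between
    operators, so the operators have to form a ring over k. *)
Record endo := Endo {
  efun :> M -> M;
  efunD : {morph efun : x y / x + y};
  efunZ : forall a, {morph efun : x / a *: x} }.

Lemma endoP (f g : endo) : f =1 g -> f = g.
Proof.
case: f g => [f fD fZ] [g gD gZ] /= /funext e; case: _ / e gD gZ => gD gZ.
by congr Endo; apply: Prop_irrelevance.
Qed.

HB.instance Definition _ := gen_eqMixin endo.
HB.instance Definition _ := gen_choiceMixin endo.

Fact zero_endoD : {morph (fun _ : M => 0 : M) : x y / x + y}.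
Proof. by move=> x y; rewrite addr0. Qed.
Fact zero_endoZ a : {morph (fun _ : M => 0 : M) : x / a *: x}.
Proof. by move=> x; rewrite scaler0. Qed.
Fact add_endoD (f g : endo) : {morph (fun x => f x + g x) : x y / x + y}.
Proof. by move=> x y; rewrite !efunD addrACA. Qed.
Fact add_endoZ (f g : endo) a : {morph (fun x => f x + g x) : x / a *: x}.
Proof. by move=> x; rewrite !efunZ scalerDr. Qed.
Fact opp_endoD (f : endo) : {morph (fun x => - f x) : x y / x + y}.
Proof. by move=> x y; rewrite efunD opprD. Qed.
Fact opp_endoZ (f : endo) a : {morph (fun x => - f x) : x / a *: x}.
Proof. by move=> x; rewrite efunZ scalerN. Qed.
Fact mul_endoD (f g : endo) : {morph (fun x => f (g x)) : x y / x + y}.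
Proof. by move=> x y; rewrite !efunD. Qed.
Fact mul_endoZ (f g : endo) a : {morph (fun x => f (g x)) : x / a *: x}.
Proof. by move=> x; rewrite !efunZ. Qed.

Definition zero_endo := Endo zero_endoD zero_endoZ.
Definition add_endo f g := Endo (add_endoD f g) (add_endoZ f g).
Definition opp_endo f := Endo (opp_endoD f) (opp_endoZ f).
Definition one_endo := @Endo (fun x => x) (fun _ _ => erefl) (fun _ _ => erefl).
Definition mul_endo f g := Endo (mul_endoD f g) (mul_endoZ f g).

Fact add_endoA : associative add_endo.
Proof. by move=> f g h; apply: endoP => x /=; rewrite addrA. Qed.
Fact add_endoC : commutative add_endo.
Proof. by move=> f g; apply: endoP => x /=; rewrite addrC. Qed.
Fact add_endo0 : left_id zero_endo add_endo.
Proof. by move=> f; apply: endoP => x /=; rewrite add0r. Qed.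
Fact add_endoN : left_inverse zero_endo opp_endo add_endo.
Proof. by move=> f; apply: endoP => x /=; rewrite addNr. Qed.
HB.instance Definition _ :=
  GRing.isZmodule.Build endo add_endoA add_endoC add_endo0 add_endoN.

Fact mul_endoA : associative mul_endo. Proof. by move=> *; apply: endoP. Qed.
Fact mul_endo1 : left_id one_endo mul_endo. Proof. by move=> *; apply: endoP. Qed.
Fact mul_endor1 : right_id one_endo mul_endo. Proof. by move=> *; apply: endoP. Qed.
Fact mul_endoDl : left_distributive mul_endo +%R. Proof. by move=> *; apply: endoP. Qed.
Fact mul_endoDr : right_distributive mul_endo +%R.
Proof. by move=> f g h; apply: endoP => x /=; rewrite efunD. Qed.
HB.instance Definition _ := GRing.Zmodule_isPzRing.Build endo
  mul_endoA mul_endo1 mul_endor1 mul_endoDl mul_endoDr.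

Lemma endoM (f g : endo) x : (f * g) x = f (g x). Proof. by []. Qed.
Lemma endoD (f g : endo) x : (f + g) x = f x + g x. Proof. by []. Qed.
Lemma endo_0r (f : endo) : f 0 = 0. Proof. exact: morph0 (efunD f). Qed.
Lemma endo_Br (f : endo) x y : f (x - y) = f x - f y. Proof. exact: morphB (efunD f) x y. Qed.
Lemma endo_sum (I : Type) (s : seq I) (P : pred I) (c : I -> endo) x :
  (\sum_(i <- s | P i) c i) x = \sum_(i <- s | P i) c i x.
Proof. by apply: (big_morph (fun f : endo => f x)). Qed.
Lemma endo_sign (b : bool) x : ((-1) ^+ b : endo) x = (-1) ^+ b *: x.
Proof. by case: b; rewrite ?expr0 ?expr1 ?scale1r ?scaleN1r. Qed.

Lemma endo_signP (b : bool) (f g : endo) :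
  (forall x, f x = (-1) ^+ b *: g x) -> f = (-1) ^+ b * g.
Proof. by move=> h; apply: endoP => x; rewrite h endoM endo_sign. Qed.

Fact scale_endoZ (a b : k) : {morph (fun x : M => a *: x) : x / b *: x}.
Proof. by move=> x; rewrite !scalerA mulrC. Qed.
Definition scale_endo a := Endo (scalerDr a) (scale_endoZ a).
Fact scale_endo_zmod : zmod_morphism scale_endo.
Proof. by move=> a b; apply: endoP => x /=; rewrite scalerBl. Qed.
Fact scale_endo_monoid : monoid_morphism scale_endo.
Proof.
by split=> [|a b]; apply: endoP => x /=; rewrite ?scale1r ?scalerA.
Qed.
HB.instance Definition _ := GRing.isZmodMorphism.Build k endo scale_endo scale_endo_zmod.
HB.instance Definition _ := GRing.isMonoidMorphism.Build k endo scale_endo scale_endo_monoid.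
Lemma scale_endoC a (f : endo) : scale_endo a * f = f * scale_endo a.
Proof. by apply: endoP => x /=; rewrite efunZ. Qed.
End Endomorphisms.

Section TrivialGrading.
Variables (k : comNzRingType) (A : pzRingType) (ka : {rmorphism k -> A}).
Hypothesis kaC : forall a x, ka a * x = x * ka a.

Definition degree0 (d : degree) (x : A) : Prop := d = 0 \/ x = 0.

Fact degree0_grading : is_grading degree0.
Proof.
apply: (@build_grading _ _ _ _ (fun d x => if d == 0 then x else 0)).
- by move=> a; right.
- move=> a u v [->|->]; first by left.
  by case=> [->|->]; [left|right; rewrite subr0].
- by move=> a u v; case: eqP => // _; rewrite addr0.
- by move=> a v [->|->]; rewrite ?eqxx ?if_same.
- move=> a b v [->|->] ne; last by rewrite if_same.
  by rewrite (negbTE ne).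
- move=> v; exists [:: (0, v)]; rewrite big_seq1; split=> // x.
  by rewrite inE => /eqP ->; left.
Qed.
Fact degree0_in a : degree0 0 (ka a). Proof. by left. Qed.
Fact degree0_mul d e x y : degree0 d x -> degree0 e y -> degree0 (d + e) (x * y).
Proof.
move=> [->|->]; last by right; rewrite mul0r.
by case=> [->|->]; [left; rewrite addr0|right; rewrite mulr0].
Qed.
(** Terms are evaluated in graded algebras; a ring without a useful grading takes part with
    all its elements in degree 0. *)
Definition triv_gsalg : gsalg k :=
  @GSAlg k A ka kaC degree0 degree0_grading degree0_in degree0_mul.
End TrivialGrading.

Lemma mul_signC (A : pzRingType) n (x : A) : x * (-1) ^+ n = (-1) ^+ n * x.
Proof. exact: commr_sign. Qed.

Lemma mul_signCA (A : pzRingType) n (x y : A) : x * ((-1) ^+ n * y) = (-1) ^+ n * (x * y).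
Proof. by rewrite mulrA mul_signC mulrA. Qed.

Lemma mul_sign_and (A : pzRingType) n (x y : A) :
  x = (-1) ^+ n * y -> y = (-1) ^+ n * x.
Proof. by move=> ->; rewrite mulrA -expr2 sqrr_sign mul1r. Qed.

Section Reordering.
Variable A : pzRingType.

Lemma prod_pass (I : eqType) (r : seq I) (a : A) (b : I -> A) (c : I -> nat) :
  {in r, forall i, a * b i = (-1) ^+ c i * (b i * a)} ->
  a * \prod_(i <- r) b i = (-1) ^+ (\sum_(i <- r) c i)%N * ((\prod_(i <- r) b i) * a).
Proof.
elim: r => [|x r IH] h; first by rewrite !big_nil expr0 !mul1r mulr1.
rewrite !big_cons mulrA h ?mem_head // -!mulrA IH; last first.
  by move=> i hi; apply: h; rewrite inE hi orbT.
by rewrite mul_signCA exprD -!mulrA.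
Qed.

(** The sign in the product of two elementary tensors: the factor [b j] passes the factors
    [a i] with j < i, and no others. *)
Lemma prod_interleave m (a b : 'I_m -> A) (c : 'I_m -> 'I_m -> nat) :
  (forall i j : 'I_m, (j < i)%N -> a i * b j = (-1) ^+ c i j * (b j * a i)) ->
  (\prod_(i < m) a i) * (\prod_(i < m) b i) =
  (-1) ^+ (\sum_(i < m) \sum_(j < m | (j < i)%N) c i j)%N * \prod_(i < m) (a i * b i).
Proof.
elim: m a b c => [|m IH] a b c h; first by rewrite !big_ord0 mulr1.
pose w := widen_ord (leqnSn m).
rewrite 3!big_ord_recr /=.
set pa := \prod_(i < m) a (w i); set pb := \prod_(i < m) b (w i).
have e : a ord_max * pb = (-1) ^+ (\sum_(j < m) c ord_max (w j))%N * (pb * a ord_max).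
  by apply: prod_pass => j _; apply: h => /=.
have := IH (fun i => a (w i)) (fun i => b (w i)) (fun i j => c (w i) (w j)).
rewrite -/pa -/pb => IH'.
rewrite -mulrA [a ord_max * _]mulrA e -!mulrA mul_signCA [pa * (pb * _)]mulrA.
rewrite IH'; last by move=> i j hij; apply: h.
rewrite !mulrA -exprD -!mulrA [in RHS]big_ord_recr /=; congr ((-1) ^+ _ * (_ * _)).
rewrite addnC; congr (_ + _)%N.
  apply: eq_bigr => i _; rewrite [RHS]big_mkcond big_ord_recr /= ltnNge (ltnW (ltn_ord i)) addn0.
  by rewrite -big_mkcond.
rewrite [RHS]big_mkcond big_ord_recr /= ltnn addn0.
by apply: eq_bigr => j _; rewrite ltn_ord.
Qed.

Section Sorting.
Variables (m : nat) (a : 'I_m -> A) (c : 'I_m -> 'I_m -> nat).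
Hypothesis comm : forall i j : 'I_m, (j < i)%N -> a i * a j = (-1) ^+ c i j * (a j * a i).

Fixpoint inversions (l : seq 'I_m) : nat :=
  if l is x :: l' then (\sum_(y <- l' | (y < x)%N) c x y + inversions l')%N else 0%N.

(** One step of an insertion sort: [a x] passes the smaller elements of [l]. *)
Lemma prod_insert (e : seq 'I_m) (x : 'I_m) (l : pred 'I_m) :
  sorted (fun i j : 'I_m => (i < j)%N) e -> x \in e -> ~~ l x ->
  a x * \prod_(i <- e | l i) a i =
  (-1) ^+ (\sum_(y <- e | l y && (y < x)%N) c x y)%N * \prod_(i <- e | l i || (i == x)) a i.
Proof.
elim: e => [|y e IH] //= se.
have ltr : transitive (fun i j : 'I_m => (i < j)%N) by move=> i j p; apply: ltn_trans.
have hy := order_path_min ltr se; rewrite inE => /orP[/eqP exy|xe] nl.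
  subst y.
  rewrite !big_cons (negbTE nl) eqxx orbT ltnn andbF.
  rewrite [X in (-1) ^+ X]big_seq_cond [X in (-1) ^+ X]big1 ?expr0 ?mul1r; last first.
    by move=> i /andP[hi /andP[_ hix]]; have := allP hy i hi; lia.
  congr (_ * _); rewrite big_seq_cond [RHS]big_seq_cond; apply: eq_bigl => i.
  case hi: (i \in e) => //=; case: eqP => [eix|]; rewrite ?orbF //.
  by have := allP hy i hi; rewrite eix ltnn.
have hyx : (y < x)%N := allP hy x xe.
rewrite !big_cons hyx andbT.
have -> : y == x = false by apply/eqP => eyx; rewrite eyx ltnn in hyx.
rewrite orbF; case ly: (l y); last by apply: IH => //; exact: path_sorted se.
rewrite mulrA comm // -!mulrA IH //; last exact: path_sorted se.
by rewrite mul_signCA exprD -!mulrA.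
Qed.

Lemma prod_sort (l : seq 'I_m) : uniq l ->
  \prod_(i <- l) a i = (-1) ^+ inversions l * \prod_(i < m | i \in l) a i.
Proof.
elim: l => [|x l IH] /=.
  by rewrite big_nil expr0 mul1r big_pred0.
move=> /andP[nx ul]; rewrite big_cons IH // mul_signCA.
rewrite (prod_insert (x := x)) ?mem_index_enum //; last first.
  rewrite /index_enum -enumT; have := iota_ltn_sorted 0 m.
  by rewrite -val_enum_ord sorted_map.
rewrite mulrA -exprD addnC; congr ((-1) ^+ (_ + _) * _); last first.
  by apply: eq_bigl => i; rewrite inE orbC.
rewrite -[RHS]big_filter -[LHS]big_filter; apply: perm_big; apply: uniq_perm.
- by rewrite filter_uniq // /index_enum -enumT enum_uniq.
- by rewrite filter_uniq.
- by move=> i; rewrite !mem_filter mem_index_enum andbT andbC.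
Qed.

(** Sorting the factors exchanges exactly the pairs that s inverts. *)
Lemma prod_perm (s : 'S_m) :
  \prod_(i < m) a (s i) =
  (-1) ^+ (\sum_(i < m) \sum_(j < m | (i < j) && (s j < s i)) c (s i) (s j))%N
  * \prod_(i < m) a i.
Proof.
rewrite -(big_map s xpredT a) prod_sort; last first.
  by rewrite map_inj_uniq; [rewrite /index_enum -enumT enum_uniq|exact: perm_inj].
congr (_ * _); last first.
  apply: eq_bigl => i; rewrite -(permKV s i) mem_map ?mem_index_enum //.
  exact: perm_inj.
congr (_ ^+ _).
have sub (e : seq 'I_m) : sorted (fun i j : 'I_m => (i < j)%N) e ->
  inversions (map s e) =
  (\sum_(i <- e) \sum_(j <- e | (i < j) && (s j < s i)) c (s i) (s j))%N.
  elim: e => [|x e IH] se; first by rewrite big_nil.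
  have ltr : transitive (fun i j : 'I_m => (i < j)%N) by move=> i j p; apply: ltn_trans.
  have hx := order_path_min ltr se.
  rewrite /= big_cons (IH (path_sorted se)) big_map big_cons ltnn /=.
  congr (_ + _)%N; last first.
    apply: eq_big_seq => i hi; rewrite big_cons.
    by have := allP hx i hi => /ltnW; rewrite leqNgt => /negbTE ->.
  rewrite big_seq_cond [RHS]big_seq_cond; apply: eq_bigl => i.
  by case hi: (i \in e) => //=; rewrite (allP hx i hi).
apply: sub; rewrite /index_enum -enumT; have := iota_ltn_sorted 0 m.
by rewrite -val_enum_ord sorted_map.
Qed.
End Sorting.
End Reordering.

(** * Dual bases of the Frobenius algebra, tensor slots and teleporters *)

Section Frobenius.
Variables (k : comNzRingType) (F : frobenius_superalgebra k) (D : cyclotomic_datum F).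
Local Notation tr := (fs_tr F).
Local Notation gr := (@fs_gr k F).

Definition bdeg (b : 'I_(rk D)) : degree := sval (cid (bas_homog b)).
Definition bpar b : bool := (bdeg b).2.

Lemma bas_gr b : gr ((bdeg b).1, bpar b) (bas D b).
Proof. by rewrite -surjective_pairing; exact: (svalP (cid (bas_homog b))). Qed.

Lemma dual_bas_gr b : gr (delta D - (bdeg b).1, bpar b) (dual_bas D b).
Proof. exact: dual_gr (bas_gr b). Qed.

Lemma trZ a f : tr (a *: f) = a * tr f. Proof. exact: scalarZ. Qed.

Lemma tr_neq0 a b f g : gr a f -> gr b g -> a + b <> (delta D, false) -> tr (f * g) = 0.
Proof. by move=> hf hg; apply: tr_van; exact: fs_grM. Qed.


Lemma tr_odd d p e q f g : gr (d, p) f -> gr (e, q) g -> p != q -> tr (f * g) = 0.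
Proof.
move=> hf hg pq; apply: (tr_neq0 hf hg) => -[_ e']; move: pq e'.
by case: p {hf}; case: q {hg}.
Qed.

Lemma expand_bas f : f = \sum_b tr (dual_bas D b * f) *: bas D b.
Proof.
have [c [-> _]] := bas_basis D f; apply: eq_bigr => b _; congr (_ *: _).
rewrite mulr_sumr linear_sum (bigD1 b) //= big1 ?addr0 => [|j ne].
  by rewrite -scalerAr trZ dualP eqxx mulr1.
by rewrite -scalerAr trZ dualP eq_sym (negbTE ne) mulr0.
Qed.

(** Nondegeneracy reduces this to the pairing with the basis vectors, where it is the definition
    of the dual basis. *)
Lemma expand_dual f : f = \sum_b tr (f * bas D b) *: dual_bas D b.
Proof.
elim/gr_ind: f => [|u v hu hv|a f hf].
- by rewrite big1 // => b _; rewrite mul0r linear0 scale0r.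
- rewrite {1}hu {1}hv -big_split; apply: eq_bigr => b _ /=.
  by rewrite mulrDl linearD scalerDl.
apply/eqP; rewrite -subr_eq0; apply/eqP; apply: (@nondeg_l _ _ D a).
  apply: (gr_B (fs_grading F)) => //; apply: (gr_sum (fs_grading F)) => b _.
  case: (pselect (a + ((bdeg b).1, bpar b) = (delta D, false))) => [e|ne]; last first.
    by rewrite (tr_neq0 hf (bas_gr b)) // scale0r; apply: (gr_0 (fs_grading F)).
  apply: fs_grZ; have := dual_gr (bas_gr b); congr (gr _ _).
  by rewrite -e addrK.
move=> g; rewrite mulrBl linearB /= (expand_bas g); apply/eqP; rewrite subr_eq0; apply/eqP.
rewrite !mulr_sumr !linear_sum; apply: eq_bigr => b _ /=; rewrite -!scalerAr !trZ; congr (_ * _).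
rewrite mulr_suml linear_sum (bigD1 b) //= big1 ?addr0 => [|j ne].
  by rewrite -scalerAl trZ dualP eqxx mulr1.
by rewrite -scalerAl trZ dualP (negbTE ne) mulr0.
Qed.

(** The twist [psi] is determined by the trace form, and moving f and then g around the trace is
    the same as moving f g. *)
Lemma psiM f g : psi D (f * g) = psi D f * psi D g.
Proof.
elim/gr_ind: f => [|u v hu hv|[d p] f hf]; first by rewrite mul0r linear0 mul0r.
  by rewrite mulrDl !linearD hu hv mulrDl.
elim/gr_ind: g => [|u v hu hv|[e q] g hg]; first by rewrite mulr0 linear0 mulr0.
  by rewrite mulrDr !linearD hu hv mulrDr.
apply/eqP; rewrite -subr_eq0; apply/eqP.
have hfg := fs_grM hf hg.
apply: (@nondeg _ _ ((d, p) + (e, q))).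
  apply: (gr_B (fs_grading F)); first exact: psi_gr.
  by apply: fs_grM; exact: psi_gr.
move=> [x r] h hh; rewrite mulrBr linearB /=; apply/eqP; rewrite subr_eq0; apply/eqP.
have e1 := psi_nakayama D hfg hh; have e2 := psi_nakayama D hf (fs_grM hg hh).
have e3 := psi_nakayama D hg (fs_grM hh (psi_gr D hf)).
move: e1; rewrite -mulrA e2 -mulrA e3 mulrA -signr_addb -mulrA => /mul_sign_and ->.
rewrite mulrA -signr_addb.
set n := (_ (+) _); have -> : n = false by rewrite /n; case: p {hf hfg e2 e3 n}; case: q {hg}; case: r {hh}.
by rewrite mul1r.
Qed.

Lemma psi1 : psi D 1 = 1.
Proof.
have [th0 th1 _] := theta_order D.
rewrite -[RHS](th1 1) -[LHS]mulr1 -{2}(th1 1).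
have -> : iter (theta D) (psi D) 1 = psi D (iter (theta D).-1 (psi D) 1).
  by rewrite -iterS prednK.
by rewrite -psiM mul1r.
Qed.


Definition psiV (f : F) : F := iter (theta D).-1 (psi D) f.
Lemma psiVK f : psi D (psiV f) = f.
Proof.
have [th0 th1 _] := theta_order D.
by rewrite /psiV -iterS prednK.
Qed.
Lemma psiKV f : psiV (psi D f) = f.
Proof.
have [th0 th1 _] := theta_order D.
by rewrite /psiV -iterSr prednK.
Qed.
Lemma iter_lin (h : {linear F -> F}) m a f g : iter m h (a *: f + g) = a *: iter m h f + iter m h g.
Proof. by elim: m => //= m ->; rewrite linearP. Qed.
Lemma psiV_lin a f g : psiV (a *: f + g) = a *: psiV f + psiV g.
Proof. exact: iter_lin. Qed.
Lemma iter_psi_gr a f m : gr a f -> gr a (iter m (psi D) f).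
Proof. by move=> hf; elim: m => //= m; exact: psi_gr. Qed.
Lemma psiV_gr a f : gr a f -> gr a (psiV f).
Proof. exact: iter_psi_gr. Qed.

(** The component of parity q, read off on a homogeneous basis and therefore visibly linear. *)
Definition ppart (q : bool) (f : F) : F :=
  \sum_(b | bpar b == q) tr (dual_bas D b * f) *: bas D b.

Fact ppart_linear q : linear (ppart q).
Proof.
move=> a f g; rewrite /ppart scaler_sumr -big_split; apply: eq_bigr => b _ /=.
by rewrite mulrDr -scalerAr linearD /= trZ scalerDl scalerA.
Qed.
HB.instance Definition _ q := GRing.isLinear.Build k F F *:%R (ppart q) (ppart_linear q).

Lemma ppartE q d p f : gr (d, p) f -> ppart q f = if p == q then f else 0.
Proof.
move=> hf; case: eqP => [<-|ne].
  rewrite [RHS]expand_bas (bigID (fun b => bpar b == p)) /= -[LHS]addr0; congr (_ + _).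
  rewrite big1 // => b pb.
  by rewrite (tr_odd (dual_bas_gr b) hf pb) scale0r.
rewrite /ppart big1 // => b /eqP pb.
by rewrite (tr_odd (dual_bas_gr b) hf) ?scale0r // pb; apply/eqP => e; apply: ne.
Qed.

(** The sign with which an element of parity q passes f. *)
Definition sgF (q : bool) (f : F) : F := if q then ppart false f - ppart true f else f.
Fact sgF_linear q : linear (sgF q).
Proof.
by rewrite /sgF; case: q => // a f g; rewrite /= !linearP /= scalerDr addrACA.
Qed.
HB.instance Definition _ q := GRing.isLinear.Build k F F *:%R (sgF q) (sgF_linear q).
Lemma sgFE q d p f : gr (d, p) f -> sgF q f = (-1) ^+ (p && q) *: f.
Proof.
move=> hf; rewrite /sgF; case: q; rewrite ?andbF ?scale1r //.
by rewrite !(ppartE _ hf); case: p {hf}; rewrite ?scale1r ?subr0 // sub0r scaleN1r.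
Qed.
Lemma sgFM q f g : sgF q (f * g) = sgF q f * sgF q g.
Proof.
elim/gr_ind: f => [|u v hu hv|[d p] f hf]; first by rewrite mul0r linear0 mul0r.
  by rewrite mulrDl !linearD /= hu hv mulrDl.
elim/gr_ind: g => [|u v hu hv|[e r] g hg]; first by rewrite mulr0 linear0 mulr0.
  by rewrite mulrDr !linearD /= hu hv mulrDr.
have hfg : gr (d + e, p (+) r) (f * g) := fs_grM hf hg.
rewrite (sgFE q hfg) (sgFE q hf) (sgFE q hg) -scalerAl -scalerAr scalerA -signr_addb.
by congr (_ ^+ _ *: _); case: p {hf hfg}; case: q; case: r {hg}.
Qed.
Lemma sgF1 q : sgF q 1 = 1.
Proof. by rewrite (sgFE q (fs_gr1 F)) scale1r. Qed.
Lemma sgF_addb p q f : sgF p (sgF q f) = sgF (p (+) q) f.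
Proof.
elim/gr_ind: f => [|u v hu hv|[d r] f hf]; first by rewrite !linear0.
  by rewrite !linearD /= hu hv.
rewrite (sgFE q hf) (sgFE _ hf) linearZ /= (sgFE p hf) scalerA -signr_addb.
by congr (_ ^+ _ *: _); case: p; case: q; case: r {hf}.
Qed.
End Frobenius.

Section Slots.
Variables (k : comNzRingType) (F : frobenius_superalgebra k) (D : cyclotomic_datum F).
Variables (A : pzRingType) (ka : {rmorphism k -> A}).
Local Notation tr := (fs_tr F).
Local Notation gr := (@fs_gr k F).

(** The tensor power of F never appears as such: it acts through the images S i of its factors,
    and all signs are those of [S_comm]. *)
Record slot_family m (S : 'I_m -> F -> A) : Prop := IsSlotFamily {
  ka_central : forall a x, ka a * x = x * ka a;
  S_lin : forall i a f g, S i (a *: f + g) = ka a * S i f + S i g;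
  S_1 : forall i, S i 1 = 1;
  S_M : forall i f g, S i (f * g) = S i f * S i g;
  S_comm : forall i j, i != j -> forall d p e q f g, gr (d, p) f -> gr (e, q) g ->
    S i f * S j g = (-1) ^+ (p && q) * (S j g * S i f) }.

Record slots m (S : 'I_m -> F -> A) (P : 'S_m -> A) : Prop := IsSlots {
  slots_family :> slot_family S;
  P_1 : P 1%g = 1;
  P_M : forall s t, P s * P t = P (t * s)%g;
  P_S : forall s i f, P s * S i f = S (s i) f * P s }.

(** The image of the teleporter. It is the canonical element of F (x) F, which is what the next
    lemmas use: factors can be moved across it from one slot to the other. *)
Definition tele m (S : 'I_m -> F -> A) i j : A :=
  \sum_(b < rk D) S i (bas D b) * S j (dual_bas D b).

Record affine m X (S : 'I_m -> F -> A) (P : 'S_m -> A) : Prop := IsAffine {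
  aff_slots : slots S P;
  X_X : forall i j, X i * X j = X j * X i;
  S_X : forall i f, S i f * X i = X i * S i (psi D f);
  S_Xne : forall i j f, i != j -> S i f * X j = X j * S i f;
  P_Xne : forall i i' j : 'I_m, i' = i.+1 :> nat -> j != i -> j != i' ->
    P (tperm i i') * X j = X j * P (tperm i i');
  P_X : forall i i' : 'I_m, i' = i.+1 :> nat ->
    P (tperm i i') * X i = X i' * P (tperm i i') - tele S i i' }.

(** In this form of the relations permutations move the variables without correction terms;
    in exchange the variables no longer commute. *)
Record drinfeld m Y (S : 'I_m -> F -> A) (P : 'S_m -> A) : Prop := IsDrinfeld {
  dri_slots : slots S P;
  S_Y : forall i f, S i f * Y i = Y i * S i (psi D f);
  S_Yne : forall i j f, i != j -> S i f * Y j = Y j * S i f;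
  P_Y : forall s i, P s * Y i = Y (s i) * P s;
  Y_Y : forall i j, i != j ->
    Y i * Y j - Y j * Y i = (tele S i j * Y j - Y i * tele S i j) * P (tperm i j) }.

Section SlotTheory.
Variables (m : nat) (S : 'I_m -> F -> A).
Hypothesis hS : slot_family S.

Lemma slotD i : {morph S i : f g / f + g}.
Proof. by move=> f g; have := S_lin hS i 1 f g; rewrite scale1r rmorph1 mul1r. Qed.
Lemma slot0 i : S i 0 = 0. Proof. exact: morph0 (slotD i). Qed.
Lemma slotZ i a f : S i (a *: f) = ka a * S i f.
Proof. by have := S_lin hS i a f 0; rewrite !addr0 slot0 addr0. Qed.
Lemma slot_sum i (I : Type) (s : seq I) (Q : pred I) (c : I -> F) :
  S i (\sum_(j <- s | Q j) c j) = \sum_(j <- s | Q j) S i (c j).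
Proof. exact: morph_sum (slotD i). Qed.
Lemma slot_sign i (b : bool) f : S i ((-1) ^+ b *: f) = (-1) ^+ b * S i f.
Proof. by rewrite slotZ rmorph_sign. Qed.
Lemma kaC a x : ka a * x = x * ka a. Proof. exact: ka_central hS a x. Qed.
Lemma kaCA a x y : x * (ka a * y) = ka a * (x * y).
Proof. by rewrite mulrA -kaC mulrA. Qed.

Lemma slot_even i j f d g : i != j -> gr (d, false) g ->
  S i f * S j g = S j g * S i f.
Proof.
move=> ij hg; elim/gr_ind: f => [|u v hu hv|[e q] f hf].
- by rewrite slot0 mul0r mulr0.
- by rewrite slotD mulrDl mulrDr hu hv.
by rewrite (S_comm hS ij hf hg) andbF expr0 mul1r.
Qed.

Local Notation t := (tele S).

(** Both sides are the same double sum, f b being expanded in the basis on the left and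
    b^v f in the dual basis on the right. *)
Lemma tele_l i j f : S i f * t i j = t i j * S j f.
Proof.
rewrite mulr_sumr mulr_suml.
transitivity (\sum_b \sum_c ka (tr (dual_bas D c * (f * bas D b))) *
    (S i (bas D c) * S j (dual_bas D b))).
  apply: eq_bigr => b _; rewrite mulrA -(S_M hS) {1}(expand_bas D (f * _)) slot_sum mulr_suml.
  by apply: eq_bigr => c _; rewrite slotZ -mulrA.
rewrite exchange_big; apply: eq_bigr => c _ /=.
rewrite -mulrA -(S_M hS) [in RHS](expand_dual D (_ * f)) slot_sum mulr_sumr.
by apply: eq_bigr => b _; rewrite slotZ kaCA -mulrA.
Qed.

Lemma tele_r i j f : i != j -> S j f * t i j = t i j * S i (psi D f).
Proof.
move=> ij; elim/gr_ind: f => [|u v hu hv|[d p] f hf].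
- by rewrite linear0 !slot0 mul0r mulr0.
- by rewrite linearD !slotD mulrDl mulrDr hu hv.
rewrite mulr_sumr mulr_suml; have ji : j != i by rewrite eq_sym.
transitivity (\sum_b \sum_c (-1) ^+ (p && bpar b) * (ka (tr (f * dual_bas D b * bas D c)) *
    (S i (bas D b) * S j (dual_bas D c)))).
  apply: eq_bigr => b _; rewrite mulrA (S_comm hS ji hf (bas_gr b)) -!mulrA -(S_M hS).
  rewrite {1}(expand_dual D (f * _)) slot_sum !mulr_sumr; apply: eq_bigr => c _.
  by rewrite slotZ kaCA mulrA.
rewrite exchange_big; apply: eq_bigr => c _ /=.
rewrite -mulrA (S_comm hS ji (dual_bas_gr c) (psi_gr D hf)) mul_signCA.
rewrite [S i _ * (_ * _)]mulrA -(S_M hS) (expand_bas D (bas D c * _)) slot_sum.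
rewrite mulr_suml mulr_sumr; apply: eq_bigr => b _; rewrite slotZ !mulrA; congr (_ * _ * _).
rewrite -[f * _ * _]mulrA.
have hbc : gr (delta D - (bdeg b).1 + (bdeg c).1, bpar b (+) bpar c)
  (dual_bas D b * bas D c) := fs_grM (dual_bas_gr b) (bas_gr c).
have -> := psi_nakayama D (f := f) hf hbc.
rewrite rmorphM rmorph_sign mulrA -signr_addb.
have [->|ne] := eqVneq p (bpar b (+) bpar c).
  by congr (_ ^+ _ * _); case: (bpar b); case: (bpar c).
by rewrite (tr_odd D hbc (psi_gr D hf)) ?rmorph0 ?mulr0 // eq_sym.
Qed.

Lemma tele_ne i j l f : i != j -> l != i -> l != j -> S l f * t i j = t i j * S l f.
Proof.
move=> ij li lj; elim/gr_ind: f => [|u v hu hv|[d p] f hf].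
- by rewrite !slot0 mul0r mulr0.
- by rewrite !slotD mulrDl mulrDr hu hv.
rewrite mulr_sumr mulr_suml; apply: eq_bigr => b _.
rewrite mulrA (S_comm hS li hf (bas_gr b)) -!mulrA (S_comm hS lj hf (dual_bas_gr b)).
by rewrite mul_signCA [LHS]mulrA -expr2 sqrr_sign mul1r !mulrA.
Qed.

Lemma tele_P (p : A) (s : 'I_m -> 'I_m) i j :
  (forall i f, p * S i f = S (s i) f * p) -> p * t i j = t (s i) (s j) * p.
Proof.
move=> PS; rewrite mulr_sumr mulr_suml; apply: eq_bigr => b _.
by rewrite mulrA PS -!mulrA PS.
Qed.

(** The Nakayama automorphism turns left dual bases into right dual bases. *)
Lemma tele_twist i j : i != j ->
  \sum_b S i (bas D b) * S j (psi D (dual_bas D b)) = t j i.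
Proof.
move=> ij; have ji : j != i by rewrite eq_sym.
transitivity (\sum_b \sum_c ka (tr (dual_bas D c * psi D (dual_bas D b))) *
    (S i (bas D b) * S j (bas D c))).
  apply: eq_bigr => b _; rewrite {1}(expand_bas D (psi D _)) slot_sum mulr_sumr.
  by apply: eq_bigr => c _; rewrite slotZ kaCA.
rewrite exchange_big; apply: eq_bigr => c _ /=.
rewrite (S_comm hS ji (bas_gr c) (dual_bas_gr c)) andbb.
rewrite {2}(expand_bas D (dual_bas D c)) slot_sum mulr_suml mulr_sumr.
apply: eq_bigr => b _; rewrite slotZ !mulrA; congr (_ * _ * _).
have := psi_nakayama D (dual_bas_gr b) (dual_bas_gr c) => ->.
rewrite rmorphM rmorph_sign mulrA -signr_addb.
have [e|ne] := eqVneq (bpar c) (bpar b); first by rewrite e andbb addbb mul1r.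
by rewrite (tr_odd D (dual_bas_gr c) (psi_gr D (dual_bas_gr b)) ne) rmorph0 mulr0.
Qed.

Variable Y : 'I_m -> A.
Hypothesis SY : forall i f, S i f * Y i = Y i * S i (psi D f).
Hypothesis SYne : forall i j f, i != j -> S i f * Y j = Y j * S i f.

Lemma tele_Yr i j : i != j -> t i j * Y j = Y j * t j i.
Proof.
move=> ij; rewrite -(tele_twist ij) mulr_suml mulr_sumr; apply: eq_bigr => b _.
by rewrite -mulrA SY mulrA SYne // mulrA.
Qed.

Lemma tele_Yne i j l : l != i -> l != j -> t i j * Y l = Y l * t i j.
Proof.
move=> li lj; rewrite mulr_suml mulr_sumr; apply: eq_bigr => b _.
by rewrite -mulrA SYne 1?eq_sym // mulrA SYne 1?eq_sym // mulrA.
Qed.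
End SlotTheory.
End Slots.

(** * Evaluating the affine algebra *)

Lemma prod_hole (A : pzRingType) (I : eqType) (e : seq I) (j : I) (c : I -> A) :
  uniq e -> j \in e ->
  exists l r, forall a, \prod_(i <- e) (if i == j then a else c i) = l * a * r.
Proof.
elim: e => [|x e IH] //= /andP[nx ue]; rewrite inE => /orP[/eqP jx|je].
  subst x; exists 1, (\prod_(i <- e) c i) => a.
  rewrite big_cons eqxx mul1r; congr (_ * _); apply: eq_big_seq => i hi.
  by case: eqP => // eij; rewrite -eij hi in nx.
have [l [r h]] := IH ue je; exists (c x * l), r => a; rewrite big_cons h.
case: eqP => [exj|_]; first by rewrite exj je in nx.
by rewrite !mulrA.
Qed.

Section SlotProducts.
Variables (k : comNzRingType) (F : frobenius_superalgebra k) (D : cyclotomic_datum F).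
Variables (A : pzRingType) (ka : {rmorphism k -> A}).
Variables (m : nat) (S : 'I_m -> F -> A) (P : 'S_m -> A).
Hypothesis hS : slots ka S P.
Local Notation gr := (@fs_gr k F).

(** The image of an elementary tensor: the product of the images of its factors, in order. *)
Definition slot_prod (f : {ffun 'I_m -> F}) : A := \prod_(i < m) S i (f i).

(** An elementary tensor is linear in each of its factors, so its image is affected only in
    one place. *)
Lemma slot_prod_upd (f : {ffun 'I_m -> F}) j :
  exists l r, forall u, slot_prod (upd f j u) = l * S j u * r.
Proof.
have uj : uniq (index_enum (fintype_ordinal__canonical__fintype_Finite m)).
  by rewrite /index_enum -enumT enum_uniq.
have [l [r h]] := prod_hole (fun i => S i (f i)) uj (mem_index_enum j).
exists l, r => u; rewrite -h; apply: eq_bigr => i _.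
by rewrite ffunE; case: eqP => // ->.
Qed.

Lemma ev_tele (B : gsalg k) (g : agen F m -> B) i j :
  ev g (teleporter D i j) =
  \sum_(b < rk D) g (GT (slot i (bas D b))) * g (GT (slot j (dual_bas D b))).
Proof. by rewrite (big_morph (ev g) (id1 := 0) (op1 := +%R)) //= rmorph0. Qed.

End SlotProducts.

Section Assemble.
Variables (k : comNzRingType) (F : frobenius_superalgebra k) (D : cyclotomic_datum F).
Variables (A : pzRingType) (ka : {rmorphism k -> A}).
Variables (m : nat) (X : 'I_m -> A) (S : 'I_m -> F -> A) (P : 'S_m -> A).
Hypothesis hA : affine D ka X S P.
Local Notation gr := (@fs_gr k F).
Let hS := aff_slots hA.

Definition aff_gen (g : agen F m) : A :=
  match g with GX i => X i | GT f => slot_prod S f | GP s => P s end.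

Local Notation B := (triv_gsalg (ka_central hS)).
Local Notation evA := (@ev k (agen F m) B aff_gen).

Lemma prod_one_slot (i : 'I_m) a : \prod_(l < m) (if l == i then a else 1) = a :> A.
Proof.
have ui : uniq (index_enum (fintype_ordinal__canonical__fintype_Finite m)).
  by rewrite /index_enum -enumT enum_uniq.
elim: (index_enum _) ui (mem_index_enum i) => [|x e IH] //= /andP[nx ue].
rewrite inE big_cons => /orP[/eqP ix|ie]; last first.
  rewrite IH //; case: eqP => [exi|_]; last by rewrite mul1r.
  by rewrite exi ie in nx.
subst x; rewrite eqxx big_seq big1 ?mulr1 // => l hl; case: eqP => // eli.
by rewrite -eli hl in nx.
Qed.

Lemma slot_prod_slot i f : slot_prod S (slot i f) = S i f.
Proof.
rewrite -[RHS](prod_one_slot i); apply: eq_bigr => l _; rewrite !ffunE.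
by case: eqP => [->|_] //; rewrite (S_1 hS).
Qed.

Lemma aff_gen_tele i j : evA (teleporter D i j) = tele D S i j.
Proof.
by rewrite ev_tele; apply: eq_bigr => b _ /=; rewrite !slot_prod_slot.
Qed.

Lemma slot_prod_X (f : {ffun 'I_m -> F}) i :
  slot_prod S f * X i = X i * slot_prod S (upd f i (psi D (f i))).
Proof.
rewrite /slot_prod; have e l : S l (f l) * X i = X i * S l (upd f i (psi D (f i)) l).
  rewrite ffunE; case: eqP => [->|/eqP ne]; first exact: S_X hA _ _.
  exact: (S_Xne hA).
elim: (index_enum _) => [|l r IH]; first by rewrite !big_nil mul1r mulr1.
by rewrite !big_cons -mulrA IH mulrA e -mulrA.
Qed.

Lemma slot_prod_P s (f : {ffun 'I_m -> F}) :
  P s * slot_prod S f = (\prod_(i < m) S (s i) (f i)) * P s.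
Proof.
rewrite /slot_prod; elim: (index_enum _) => [|l r IH]; first by rewrite !big_nil mul1r mulr1.
by rewrite !big_cons mulrA (P_S hS) -mulrA IH mulrA.
Qed.

(** Relations between elementary tensors become reordering rules for products of slots. *)
Lemma aff_gen_rel t u : aff_rel D t u -> evA t = evA u.
Proof.
case=> {t u} /=.
- exact: X_X hA.
- move=> f i a u v; have [l [r h]] := slot_prod_upd S f i.
  rewrite !h (S_lin hS) mulrDr mulrDl; congr (_ + _).
  by rewrite (kaCA hS) -!mulrA.
- by rewrite rmorph1 /slot_prod big1 // => i _; rewrite ffunE (S_1 hS).
- move=> f g d e hf hg; rewrite /mul_sign rmorph_sign.
  rewrite /slot_prod (prod_interleave (c := fun i j => (d i).2 && (e j).2)).
    by congr (_ * _); apply: eq_bigr => i _; rewrite ffunE (S_M hS).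
  move=> i j hij; have ne : i != j by apply/eqP => eij; rewrite eij ltnn in hij.
  have := hf i; have := hg j; case: (d i) => di p; case: (e j) => ej q hgj hfi.
  exact: (S_comm hS) ne _ _ _ _ _ _ hfi hgj.
- by rewrite (P_1 hS) rmorph1.
- exact: P_M hS.
- exact: slot_prod_X.
- exact: P_Xne hA.
- move=> i i' hi; rewrite aff_gen_tele (P_X hA hi).
  by rewrite rmorphN1 mulN1r.
- move=> s f d hf; rewrite slot_prod_P /perm_sign rmorph_sign; congr (_ * _).
  pose a j := S j (f ((s^-1)%g j)).
  have -> : \prod_(i < m) S (s i) (f i) = \prod_(i < m) a (s i).
    by apply: eq_bigr => i _; rewrite /a permK.
  rewrite (prod_perm (c := fun i j => (d ((s^-1)%g i)).2 && (d ((s^-1)%g j)).2)).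
    congr (_ ^+ _ * _).
      by apply: eq_bigr => i _; apply: eq_bigr => j _; rewrite !permK.
    by apply: eq_bigr => i _; rewrite ffunE.
  move=> i j hij; have ne : i != j by apply/eqP => eij; rewrite eij ltnn in hij.
  have := hf ((s^-1)%g i); have := hf ((s^-1)%g j); rewrite /a.
  case: (d ((s^-1)%g i)) => di p; case: (d ((s^-1)%g j)) => ej q hgj hfi.
  exact: (S_comm hS) ne _ _ _ _ _ _ hfi hgj.
Qed.

(** The affine wreath product algebra. *)
Definition affH := pres (@aff_rel k F D m).
HB.instance Definition _ := GRing.PzRing.on affH.
Definition aff_fun (u : affH) : A := pres_lift (S := B) aff_gen u.
Fact aff_fun_zmod : zmod_morphism aff_fun. Proof. exact: pres_lift_zmod aff_gen_rel. Qed.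
Fact aff_fun_monoid : monoid_morphism aff_fun. Proof. exact: pres_lift_monoid aff_gen_rel. Qed.
HB.instance Definition _ := GRing.isZmodMorphism.Build affH A aff_fun aff_fun_zmod.
HB.instance Definition _ := GRing.isMonoidMorphism.Build affH A aff_fun aff_fun_monoid.

Lemma aff_funE t : aff_fun (cls _ t) = evA t.
Proof. exact: pres_liftE aff_gen_rel t. Qed.
End Assemble.

Section CanonicalSlots.
Variables (k : comNzRingType) (F : frobenius_superalgebra k) (D : cyclotomic_datum F).
Variables (m : nat) (R : term k (agen F m) -> term k (agen F m) -> Prop).
Hypothesis sub : forall t u, aff_rel D t u -> R t u.
Local Notation gr := (@fs_gr k F).
Local Notation Q := (pres R).
Local Notation cl := (@cls k (agen F m) R).

Definition cX (i : 'I_m) : Q := cl (tX F i).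
Definition cT (f : {ffun 'I_m -> F}) : Q := cl (tT f).
Definition cS (i : 'I_m) (f : F) : Q := cT (slot i f).
Definition cP (s : 'S_m) : Q := cl (tP F s).

Lemma cls_aff t u : aff_rel D t u -> cl t = cl u.
Proof. by move=> /sub /cls_rel. Qed.

Lemma cT_lin f i a u v :
  cT (upd f i (a *: u + v)) = pin R a * cT (upd f i u) + cT (upd f i v).
Proof. by rewrite /pin /cT -clsM -clsD; apply/cls_aff/ar_Tlin. Qed.
Lemma cT_D f i u v : cT (upd f i (u + v)) = cT (upd f i u) + cT (upd f i v).
Proof. by have := cT_lin f i 1 u v; rewrite scale1r rmorph1 mul1r. Qed.

Definition slot_deg (i : 'I_m) (a : degree) (l : 'I_m) : degree := if l == i then a else 0.
Lemma slot_degP i a f : gr a f -> forall l, gr (slot_deg i a l) (slot i f l).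
Proof. by move=> hf l; rewrite !ffunE /slot_deg; case: eqP => // _; exact: fs_gr1. Qed.

Lemma cT_M (f g : {ffun 'I_m -> F}) (d e : 'I_m -> degree) : (forall i, gr (d i) (f i)) -> (forall i, gr (e i) (g i)) ->
  cT f * cT g = (-1) ^+ (\sum_(i < m) \sum_(j < m | (j < i)%N) ((d i).2 && (e j).2))%N
     * cT [ffun i => f i * g i].
Proof.
move=> hf hg; rewrite -[LHS]clsM (cls_aff (ar_TM D hf hg)) clsM.
by congr (_ * _); rewrite -(rmorph_sign (pin R)).
Qed.

Lemma sign_slot_deg i j a b :
  (\sum_(l < m) \sum_(l' < m | (l' < l)%N) ((slot_deg i a l).2 && (slot_deg j b l').2) =
  (j < i)%N && (a.2 && b.2) :> nat)%N.
Proof.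
rewrite (bigD1 i) //= [X in (_ + X)%N]big1 ?addn0; last first.
  by move=> l /negbTE ne; apply: big1 => l' _; rewrite /slot_deg ne.
rewrite big_mkcond (bigD1 j) //= [X in (_ + X)%N]big1 ?addn0; last first.
  by move=> l /negbTE ne; rewrite /slot_deg ne andbF if_same.
by rewrite /slot_deg !eqxx; case: (j < i)%N.
Qed.

Lemma slot_mul (i : 'I_m) (f g : F) : [ffun l => slot i f l * slot i g l] = slot i (f * g).
Proof. by apply/ffunP => l; rewrite !ffunE; case: eqP => // _; rewrite mulr1. Qed.

Lemma slot_mulC (i j : 'I_m) (f g : F) : i != j ->
  [ffun l => slot i f l * slot j g l] = [ffun l => slot j g l * slot i f l].
Proof.
move=> ij; apply/ffunP => l; rewrite !ffunE; case: eqP => [->|_].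
  by rewrite (negbTE ij) mulr1 mul1r.
by case: eqP => _; rewrite !(mulr1, mul1r).
Qed.

Lemma cS_slots : slots (pin R) cS cP.
Proof.
have Sl i a f g : cS i (a *: f + g) = pin R a * cS i f + cS i g by exact: cT_lin.
have SD i f g : cS i (f + g) = cS i f + cS i g by exact: cT_D.
have S0 i : cS i 0 = 0 by apply: (addIr (cS i 0)); rewrite -SD !add0r.
split; first split=> //.
- exact: pin_central.
- move=> i; rewrite /cS; have -> : slot i (1 : F) = [ffun=> 1].
    by apply/ffunP => l; rewrite !ffunE if_same.
  exact/cls_aff/ar_T1.
- move=> i f g; elim/gr_ind: f => [|u v hu hv|a f hf].
  + by rewrite mul0r !S0 mul0r.
  + by rewrite mulrDl !SD hu hv mulrDl.
  elim/gr_ind: g => [|u v hu hv|b g hg].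
  + by rewrite mulr0 !S0 mulr0.
  + by rewrite mulrDr !SD hu hv mulrDr.
  rewrite (cT_M (slot_degP i hf) (slot_degP i hg)) sign_slot_deg ltnn expr0 mul1r.
  by rewrite slot_mul.
- move=> i j ij d p e q f g hf hg.
  rewrite (cT_M (slot_degP i hf) (slot_degP j hg)) (cT_M (slot_degP j hg) (slot_degP i hf)).
  rewrite !sign_slot_deg (slot_mulC _ _ ij) mulrA /= -signr_addb [(q && p)]andbC.
  by congr (_ ^+ _ * _); move: ij; rewrite -val_eqE /=; case: ltngtP => //= _ _; case: (p && q).
- exact/cls_aff/ar_P1.
- by move=> s t; rewrite -[LHS]clsM; exact/cls_aff/ar_PM.
- move=> s i f; elim/gr_ind: f => [|u v hu hv|a f hf].
  + by rewrite !S0 mul0r mulr0.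
  + by rewrite !SD mulrDr hu hv mulrDl.
  rewrite -[LHS]clsM (cls_aff (ar_PT D s (slot_degP i hf))) !clsM.
  have -> : [ffun l => slot i f ((s^-1)%g l)] = slot (s i) f.
    by apply/ffunP => l; rewrite !ffunE (can2_eq (permKV s) (permK s)).
  suff -> : perm_sign k s (slot_deg i a) = 1 by rewrite -[cl (Cst 1)]/(1 : Q) mul1r.
  rewrite /perm_sign big1 // => l _; rewrite big1 // => l' /andP[hl _].
  rewrite /slot_deg; case: eqP => [e|]; case: eqP => [e'|] //; last by rewrite andbF.
  by rewrite e e' ltnn in hl.
Qed.

Lemma cS_affine : affine D (pin R) cX cS cP.
Proof.
split.
- exact: cS_slots.
- by move=> i j; rewrite -!clsM; exact/cls_aff/ar_XX.
- move=> i f; rewrite -!clsM (cls_aff (ar_TX _ _ i)); congr cls; congr (_ *' tT _).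
  by apply/ffunP => l; rewrite !ffunE eqxx; case: eqP.
- move=> i j f ij; rewrite -!clsM (cls_aff (ar_TX _ _ j)); congr cls; congr (_ *' tT _).
  apply/ffunP => l; rewrite !ffunE; case: (eqVneq l j) => [->|//].
  by rewrite (eq_sym j i) (negbTE ij) psi1.
- by move=> i i' j hi h1 h2; rewrite -!clsM; exact/cls_aff/ar_sX.
- move=> i i' hi; rewrite -!clsM (cls_aff (ar_sXi _ hi)) clsD clsM; congr (_ + _).
  rewrite clsM [cl (Cst (-1))](rmorphN1 (pin R)) mulN1r; congr (- _).
  rewrite (big_morph cl (id1 := 0) (op1 := +%R)) => [|u v|//]; last exact: clsD.
  by apply: eq_bigr => b _; rewrite clsM.
Qed.

(** By multilinearity one may assume the factors homogeneous; then the multiplication rule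
    appends one factor at a time, in increasing order and hence without signs. *)
Lemma cT_prod (f : {ffun 'I_m -> F}) : cT f = slot_prod cS f.
Proof.
(* Only the first l factors may fail to be homogeneous. *)
have key l : (l <= m)%N -> forall f : {ffun 'I_m -> F},
    (forall i : 'I_m, (l <= i)%N -> exists d, gr d (f i)) -> cT f = slot_prod cS f.
  elim: l => [|l IH] hl g hg; last first.
    pose i := Ordinal hl; have [p [r h]] := slot_prod_upd cS g i.
    rewrite -(upd_id g i); elim/gr_ind: (g i) => [|u v hu hv|a u hu].
    - rewrite h (slot0 cS_slots) mulr0 mul0r.
      by apply: (addIr (cT (upd g i 0))); rewrite -cT_D !add0r.
    - by rewrite cT_D hu hv !h (slotD cS_slots) mulrDr mulrDl.
    apply: IH => [|j hj]; first exact: ltnW.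
    rewrite ffunE; case: eqP => [_|ne]; first by exists a.
    apply: hg; rewrite ltn_neqAle hj andbT; apply/eqP => e; apply: ne.
    exact/val_inj.
  have /choice[d hd] : forall i, exists d, gr d (g i) by move=> i; exact: hg.
  pose gl l := [ffun i : 'I_m => if (i < l)%N then g i else 1].
  have hgl n (i : 'I_m) : gr (if (i < n)%N then d i else 0) (gl n i).
    by rewrite ffunE; case: ifP => // _; exact: fs_gr1.
  pose c (l : nat) : Q := if (insub l : option 'I_m) is Some i then cS i (g i) else 1.
  have step n : (n <= m)%N -> cT (gl n) = \prod_(0 <= l < n) c l.
    elim: n => [|n IHn] hn.
      rewrite big_nil; have -> : gl 0%N = [ffun=> 1] by apply/ffunP => i; rewrite !ffunE.
      exact: cls_aff (ar_T1 _ _).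
    pose i := Ordinal hn.
    have -> : gl n.+1 = [ffun l => gl n l * slot i (g i) l].
      apply/ffunP => l; rewrite !ffunE ltnS leq_eqVlt -val_eqE /=.
      case: eqP => [e|_]; last by rewrite mulr1.
      have -> : l = i by apply/val_inj.
      by rewrite /= ltnn mul1r.
    have := cT_M (hgl n) (slot_degP i (hd i)).
    rewrite big1 ?expr0 ?mul1r => [|l _].
      move=> <-; rewrite IHn 1?ltnW //.
      by rewrite big_nat_recr //= /c (insubT (fun l => (l < m)%N) hn).
    apply: big1 => l' hl'; rewrite /slot_deg; case: eqP => [e|_]; last by rewrite andbF.
    by rewrite e in hl'; rewrite ltnNge (ltnW hl').
  have -> : g = gl m by apply/ffunP => i; rewrite ffunE ltn_ord.
  rewrite step // big_mkord; apply: eq_bigr => i _.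
  by rewrite /c valK ffunE ltn_ord.
by apply: (key m) => // i; rewrite leqNgt ltn_ord.
Qed.
End CanonicalSlots.

Section Generators.
Variables (k : comNzRingType) (F : frobenius_superalgebra k) (D : cyclotomic_datum F).
Variables (m : nat) (R : term k (agen F m) -> term k (agen F m) -> Prop).
Hypothesis sub : forall t u, aff_rel D t u -> R t u.

(** Elementary tensors are products of slots, so the slots of homogeneous elements suffice as
    generators. *)
Lemma gen_ind (Z : pres R -> Prop) :
  (forall a, Z (pin R a)) -> (forall u v, Z u -> Z v -> Z (u + v)) ->
  (forall u v, Z u -> Z v -> Z (u * v)) ->
  (forall i, Z (cX R i)) -> (forall i a f, fs_gr a f -> Z (cS R i f)) -> (forall s, Z (cP R s)) ->
  forall u, Z u.
Proof.
move=> Zk ZD ZM ZX ZS ZP u; rewrite -[u]cls_repr; elim: (repr u) => [g|a|x hx y hy|x hx y hy].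
- case: g => [i|f|s]; [exact: ZX| |exact: ZP].
  rewrite -[cls R _]/(cT R f) (cT_prod sub) /slot_prod.
  apply: (big_ind Z) => [||i _].
  + by have := Zk 1; rewrite rmorph1.
  + exact: ZM.
  elim/gr_ind: (f i) => [|v w hv hw|a v hv]; last exact: ZS hv.
    by rewrite (slot0 (cS_slots sub)) -(rmorph0 (pin R)); exact: Zk.
  by rewrite (slotD (cS_slots sub)); exact: ZD.
- exact: Zk.
- by rewrite clsD; exact: ZD.
- by rewrite clsM; exact: ZM.
Qed.

End Generators.

Section AffFunGenerators.
Variables (k : comNzRingType) (F : frobenius_superalgebra k) (D : cyclotomic_datum F).
Variables (A : pzRingType) (ka : {rmorphism k -> A}).
Variables (m : nat) (X : 'I_m -> A) (S : 'I_m -> F -> A) (P : 'S_m -> A).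
Hypothesis hA : affine D ka X S P.
Lemma aff_fun_k a : aff_fun hA (pin _ a) = ka a. Proof. exact: aff_funE. Qed.
Lemma aff_fun_X i : aff_fun hA (cX _ i) = X i. Proof. exact: aff_funE. Qed.
Lemma aff_fun_P s : aff_fun hA (cP _ s) = P s. Proof. exact: aff_funE. Qed.
Lemma aff_fun_S i f : aff_fun hA (cS _ i f) = S i f.
Proof. by rewrite [LHS]aff_funE /= (slot_prod_slot hA). Qed.
End AffFunGenerators.

(** * Jucys-Murphy elements and the Drinfeld form of the relations *)

Lemma perm_adj_ind m (Z : 'S_m -> Prop) : Z 1%g ->
  (forall s t, Z s -> Z t -> Z (s * t)%g) ->
  (forall i i' : 'I_m, i' = i.+1 :> nat -> Z (tperm i i')) -> forall s, Z s.
Proof.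
move=> Z1 ZM Za s; have [ts -> _] := prod_tpermP s.
apply: (big_ind Z) => // -[x y] _ /=.
have key n (i j : 'I_m) : j = (i + n)%N :> nat -> Z (tperm i j).
  elim: n i j => [|n IH] i j hj.
    by have -> : i = j; [apply/val_inj; rewrite /= hj addn0 | rewrite tperm1].
  have hl : (i + n < m)%N by have := ltn_ord j; rewrite hj; lia.
  pose l := Ordinal hl; have jl : j = l.+1 :> nat by rewrite hj addnS.
  case: n IH hj hl @l jl => [|n] IH hj hl l jl.
    have -> : i = l by apply/val_inj; rewrite /= addn0.
    exact: Za.
  have -> : tperm i j = (tperm i l ^ tperm l j)%g.
    by rewrite tpermJ tpermL tpermD // -val_eqE /=; apply/eqP; lia.
  rewrite conjgE; apply: (ZM); first by rewrite tpermV; exact: Za.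
  by apply: ZM; [exact: (IH i l)|exact: Za].
case: (leqP x y) => hxy; first by apply: (key (y - x)%N); rewrite subnKC.
by rewrite tpermC; apply: (key (x - y)%N); rewrite subnKC // ltnW.
Qed.

Section JucysMurphy.
Variables (k : comNzRingType) (F : frobenius_superalgebra k) (D : cyclotomic_datum F).
Variables (A : pzRingType) (ka : {rmorphism k -> A}).
Variables (m : nat) (S : 'I_m -> F -> A) (P : 'S_m -> A).
Hypothesis hS : slots ka S P.
Local Notation t := (tele D S).

Definition tp (i j : 'I_m) : A := t i j * P (tperm i j).
(** Jucys-Murphy elements. Their behaviour under an adjacent transposition has the same correction
    term as that of the variables, so the differences x_j - J_j are permuted by S_m. *)
Definition JM (j : 'I_m) : A := \sum_(l < m | (l < j)%N) tp l j.

Lemma P_conj s i j : P s * P (tperm i j) = P (tperm (s i) (s j)) * P s.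
Proof. by rewrite !(P_M hS) -tpermJ -conjgC. Qed.
Lemma P_tperm2 i j : P (tperm i j) * P (tperm i j) = 1.
Proof. by rewrite (P_M hS) tperm2 (P_1 hS). Qed.

Lemma tp_P s i j : P s * tp i j = tp (s i) (s j) * P s.
Proof. by rewrite /tp mulrA (tele_P D _ _ (P_S hS s)) -!mulrA P_conj. Qed.

Lemma tp_S i j l f : i != j -> S l f * tp i j = tp i j * S l (if l == j then psi D f else f).
Proof.
move=> ij; rewrite /tp mulrA; case: eqP => [->|/eqP lj].
  by rewrite (tele_r D hS) // -!mulrA (P_S hS) tpermR.
have [->|li] := eqVneq l i; first by rewrite (tele_l D hS) -!mulrA (P_S hS) tpermL.
by rewrite (tele_ne D hS) // -!mulrA (P_S hS) tpermD // eq_sym.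
Qed.

Lemma JM_S j l f : S l f * JM j = JM j * S l (if l == j then psi D f else f).
Proof.
rewrite mulr_sumr mulr_suml; apply: eq_bigr => i hi; apply: tp_S.
by apply/eqP => e; rewrite e ltnn in hi.
Qed.

(** The element J_j only involves the set of indices below j. *)
Lemma JM_P (s : 'S_m) (j : 'I_m) : (forall l : 'I_m, (l < j)%N = (s l < s j)%N) -> P s * JM j = JM (s j) * P s.
Proof.
move=> h; rewrite mulr_sumr [JM (s j)](reindex_inj (@perm_inj _ s)) mulr_suml.
by apply: eq_big => [l|l _]; [exact: h|exact: tp_P].
Qed.

Lemma JM_adj (i i' : 'I_m) : i' = i.+1 :> nat -> P (tperm i i') * JM i = JM i' * P (tperm i i') - t i i'.
Proof.
move=> hi; have ii : (i < i')%N by rewrite hi.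
rewrite [JM i'](bigD1 i) //= mulrDl {1}/tp -mulrA P_tperm2 mulr1.
rewrite [t i i' + _]addrC addrK mulr_sumr mulr_suml.
apply: eq_big => [l|l hl]; first by rewrite hi ltnS -val_eqE; case: ltngtP.
by rewrite tp_P tpermL tpermD // -val_eqE /=; apply/eqP; lia.
Qed.

Lemma JM_adj_ne (i i' j : 'I_m) : i' = i.+1 :> nat -> j != i -> j != i' ->
  P (tperm i i') * JM j = JM j * P (tperm i i').
Proof.
move=> hi ji ji'; have e : tperm i i' j = j by rewrite tpermD // eq_sym.
rewrite -{2}e; apply: JM_P => l; rewrite e.
move: ji ji'; rewrite -!val_eqE /= => /eqP ji /eqP ji'.
by case: tpermP => [->|->|//]; lia.
Qed.

Lemma JM_JM (i j : 'I_m) : (i < j)%N -> JM i * JM j = JM j * JM i.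
Proof.
move=> ij; rewrite [JM i]/JM mulr_suml mulr_sumr; apply: eq_bigr => l li.
have lj : (l < j)%N := ltn_trans li ij.
have nij : i == j = false by apply/eqP => e; rewrite e ltnn in ij.
have nlj : l == j = false by apply/eqP => e; rewrite e ltnn in lj.
have hP : P (tperm l i) * JM j = JM j * P (tperm l i).
  have e : tperm l i j = j by rewrite tpermD // ?nij ?nlj.
  rewrite -{2}e; apply: JM_P => a; rewrite e.
  by case: tpermP => [->|->|//]; rewrite lj ij.
rewrite /tp -mulrA hP !mulrA; congr (_ * _); rewrite /tele mulr_suml mulr_sumr.
by apply: eq_bigr => b _; rewrite -mulrA JM_S nij mulrA JM_S nlj mulrA.
Qed.

Section WithY.
Variable Y : 'I_m -> A.
Hypothesis SY : forall i f, S i f * Y i = Y i * S i (psi D f).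
Hypothesis SYne : forall i j f, i != j -> S i f * Y j = Y j * S i f.
Hypothesis PY : forall s i, P s * Y i = Y (s i) * P s.

Lemma tp_Y i j l : l != i -> l != j -> tp i j * Y l = Y l * tp i j.
Proof.
move=> li lj; rewrite /tp -mulrA PY tpermD 1?eq_sym // !mulrA.
by rewrite (tele_Yne D SYne).
Qed.

Lemma JM_Y (i j : 'I_m) : (i < j)%N -> JM i * Y j = Y j * JM i.
Proof.
move=> ij; rewrite mulr_suml mulr_sumr; apply: eq_bigr => l li.
apply: tp_Y; apply/eqP => e; first by rewrite e ltnNge (ltnW li) in ij.
by rewrite e ltnn in ij.
Qed.

Lemma Y_JM (i j : 'I_m) : (i < j)%N ->
  Y i * JM j - JM j * Y i = (Y i * t i j - t i j * Y j) * P (tperm i j).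
Proof.
move=> ij; rewrite /JM (bigD1 i) //= mulrDl mulrDr opprD addrACA.
set r := \sum_(l < m | (l < j)%N && (l != i)) tp l j.
have -> : r * Y i = Y i * r.
  rewrite mulr_suml mulr_sumr; apply: eq_bigr => l /andP[_ li].
  by apply: tp_Y; [rewrite eq_sym|rewrite -val_eqE neq_ltn ij].
by rewrite subrr addr0 /tp -!mulrA PY tpermL !mulrA mulrBl.
Qed.

(** What the commutation of the variables x_j = y_j + J_j says about the y_j. *)
Definition YY_rel (i j : 'I_m) :=
  Y i * Y j - Y j * Y i = (t i j * Y j - Y i * t i j) * P (tperm i j).

(** The relation is antisymmetric in i and j because [tele i j] and [tele j i] are exchanged
    by passing a variable. *)
Lemma YY_sym (i j : 'I_m) : i != j -> YY_rel i j -> YY_rel j i.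
Proof.
move=> ij h; have ji : j != i by rewrite eq_sym.
rewrite /YY_rel -[LHS]opprB h -[LHS]mulNr opprB (tele_Yr hS SY SYne) //.
by rewrite (tele_Yr hS SY SYne ji) tpermC.
Qed.

(** Used for a, b = y_i, y_j and c, d = J_i, J_j with i < j, where c commutes with b and d. *)
Lemma commutators (a b c d : A) : c * d = d * c -> c * b = b * c ->
  (a + c) * (b + d) - (b + d) * (a + c) = (a * b - b * a) + (a * d - d * a).
Proof.
move=> cd cb; rewrite !mulrDl !mulrDr cd cb.
by rewrite [b * a + _ + _]addrACA opprD addrACA subrr addr0 opprD addrACA.
Qed.

(** The form in which modules are constructed: the relation for the y_j is equivariant under
    S_m, whereas commutation of the x_j is not visibly so. *)
Lemma drinfeld_affine : (forall i j, i != j -> YY_rel i j) ->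
  affine D ka (fun i => Y i + JM i) S P.
Proof.
move=> YY; split=> //.
- move=> i j; wlog ij : i j / (i < j)%N.
    move=> h; case: (ltngtP i j) => hij; [exact: h|by rewrite (h _ _ hij)|].
    by rewrite (val_inj hij).
  apply/eqP; rewrite -subr_eq0; apply/eqP.
  rewrite commutators; [|exact: JM_JM|exact: JM_Y].
  rewrite Y_JM // YY; last by rewrite -val_eqE neq_ltn ij.
  by rewrite -mulrDl addrA subrK subrr mul0r.
- by move=> i f; rewrite mulrDr mulrDl SY JM_S eqxx.
- by move=> i j f ij; rewrite mulrDr mulrDl SYne // JM_S (negbTE ij).
- move=> i i' j hi ji ji'; rewrite mulrDr mulrDl PY JM_adj_ne //.
  by rewrite tpermD // eq_sym.
- by move=> i i' hi; rewrite mulrDr mulrDl PY JM_adj // tpermL addrA.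
Qed.
End WithY.

Section FromAffine.
Variable X : 'I_m -> A.
Hypothesis hA : affine D ka X S P.
Let Y i := X i - JM i.
Let SY i f : S i f * Y i = Y i * S i (psi D f).
Proof. by rewrite mulrBr mulrBl (S_X hA) JM_S eqxx. Qed.
Let SYne i j f : i != j -> S i f * Y j = Y j * S i f.
Proof. by move=> ij; rewrite mulrBr mulrBl (S_Xne hA) // JM_S (negbTE ij). Qed.
Let PY s i : P s * Y i = Y (s i) * P s.
Proof.
move: s i; apply: perm_adj_ind => [i|s u hs hu i|i i' hi j].
- by rewrite perm1 (P_1 hS) mul1r mulr1.
- by rewrite -(P_M hS) -mulrA hs mulrA hu permM mulrA.
have h1 : P (tperm i i') * Y i = Y i' * P (tperm i i').
  by rewrite mulrBr mulrBl (P_X hA hi) JM_adj // opprB addrA subrK.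
case: tpermP => [->|->|/eqP ji /eqP ji'] //.
  by rewrite -[LHS]mulr1 -(P_tperm2 i i') mulrA -[_ * Y i' * _]mulrA -h1 !mulrA P_tperm2 mul1r.
by rewrite mulrBr mulrBl (P_Xne hA hi) // JM_adj_ne.
Qed.

Lemma affine_drinfeld : drinfeld D ka Y S P.
Proof.
have YY (i j : 'I_m) : (i < j)%N -> YY_rel Y i j.
  move=> ij; have := X_X hA i j; rewrite -[X i](subrK (JM i)) -[X j](subrK (JM j)).
  rewrite -/(Y i) -/(Y j) => /eqP; rewrite -subr_eq0.
  rewrite commutators; [|exact: JM_JM|exact: JM_Y].
  by rewrite /YY_rel (Y_JM SYne PY) // addr_eq0 => /eqP ->; rewrite -[LHS]mulNr opprB.
split=> // i j ij; case: (ltngtP i j) => hij.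
- exact: YY.
- by apply: (YY_sym SY SYne); [rewrite eq_sym|exact: YY].
- by rewrite (val_inj hij) eqxx in ij.
Qed.
End FromAffine.
End JucysMurphy.

(** * Coinduction over the symmetric group *)

Section LiftPerm.
Variable n : nat.
Local Notation mx := (@ord_max n).
Local Notation lft := (lift mx).
Local Notation lp := (lift_perm mx mx).

Lemma lpM (s t : 'S_n) : (lp s * lp t)%g = lp (s * t)%g.
Proof. exact: lift_permM. Qed.

Lemma lp_lft (s : 'S_n) i : lp s (lft i) = lft (s i).
Proof. exact: lift_perm_lift. Qed.

Lemma lp_mx (s : 'S_n) : lp s mx = mx.
Proof. exact: lift_perm_id. Qed.

Lemma lp_inj : injective lp.
Proof.
move=> s t /permP e; apply/permP => i; apply: (@lift_inj _ mx).
by rewrite -!lp_lft e.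
Qed.

Lemma stab_lp (p : 'S_n.+1) : p mx = mx -> exists s, p = lp s.
Proof.
move=> hp; have h i : exists j, p (lft i) = lft j.
  case: (unliftP mx (p (lft i))) => [j ->|e]; first by exists j.
  by move: e; rewrite -{2}hp => /perm_inj /eqP; rewrite eq_sym (negbTE (neq_lift _ _)).
have /choice[f hf] := h.
have fi : injective f.
  by move=> i j e; apply: (@lift_inj _ mx); apply: (@perm_inj _ p); rewrite !hf e.
exists (perm fi); apply/permP => i; case: (unliftP mx i) => [j|] ->.
  by rewrite lp_lft permE hf.
by rewrite lp_mx.
Qed.

Lemma tperm_lp (s : 'S_n) (l : 'I_n) :
  (lp s * tperm (lft (s l)) mx)%g = (tperm (lft l) mx * lp s)%g.
Proof. by rewrite [RHS]conjgC tpermJ lp_lft lp_mx. Qed.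

Lemma lp_tp (i j : 'I_n) : lp (tperm i j) = tperm (lft i) (lft j).
Proof.
apply/permP=> l; case: (unliftP mx l) => [l'|] ->.
  rewrite lp_lft !permE /= !(inj_eq (@lift_inj _ _)).
  by case: eqP => // _; case: eqP.
by rewrite lp_mx permE /= !(negbTE (neq_lift _ _)).
Qed.
End LiftPerm.

Section Coinduction.
Variables (k : comNzRingType) (F : frobenius_superalgebra k) (D : cyclotomic_datum F).
Variables (M : lmodType k) (n : nat).
Local Notation ka := (@scale_endo k M).
Local Notation mx := (@ord_max n).
Local Notation lft := (lift mx).
Local Notation lp := (lift_perm mx mx).
Variables (S : 'I_n.+1 -> F -> endo M) (P : 'S_n -> endo M).
Variables (Y : 'I_n -> endo M) (X : endo M).

(** Operators of the subalgebra of the affine algebra of rank n+1 that contains everything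
    except the permutations moving the last index. It is H_n (x) H_1, so the last slot and the last
    variable (super)commute with the rest; H_n is given in Drinfeld form. *)
Record parabolic : Prop := IsParabolic {
  pb_family : slot_family ka S;
  pb_P1 : P 1%g = 1;
  pb_PM : forall s t, P s * P t = P (t * s)%g;
  pb_PS : forall s i f, P s * S i f = S (lp s i) f * P s;
  pb_dri : drinfeld D ka Y (fun i => S (lft i)) P;
  pb_SY : forall j f, S mx f * Y j = Y j * S mx f;
  pb_SX : forall f, S mx f * X = X * S mx (psi D f);
  pb_SXne : forall i f, S (lft i) f * X = X * S (lft i) f;
  pb_PX : forall s, P s * X = X * P s;
  pb_YX : forall j, Y j * X = X * Y j }.
Hypothesis hp : parabolic.
Let hF := pb_family hp.
Local Notation t := (tele D S).

(** The module coinduced from the subalgebra. Only the symmetric group gets larger, so its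
    elements are functions on S_(n+1). *)
Record coind := Coind {
  cofun :> 'S_n.+1 -> M;
  coeq : forall p s, cofun (p * lp s)%g = P s (cofun p) }.

Lemma coindP (u v : coind) : u =1 v -> u = v.
Proof.
case: u v => [u hu] [v hv] /= /funext e; case: _ / e hv => hv.
by congr Coind; apply: Prop_irrelevance.
Qed.

HB.instance Definition _ := gen_eqMixin coind.
HB.instance Definition _ := gen_choiceMixin coind.

Fact coind0_eq p s : (fun=> 0 : M) (p * lp s)%g = P s 0.
Proof. by rewrite endo_0r. Qed.
Fact coindD_eq (u v : coind) p s :
  (fun p => u p + v p) (p * lp s)%g = P s (u p + v p).
Proof. by rewrite efunD !coeq. Qed.
Fact coindN_eq (u : coind) p s : (fun p => - u p) (p * lp s)%g = P s (- u p).
Proof. by rewrite (morphN (efunD _)) !coeq. Qed.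
Definition coind0 := Coind coind0_eq.
Definition coindD u v := Coind (coindD_eq u v).
Definition coindN u := Coind (coindN_eq u).
Fact coindDA : associative coindD.
Proof. by move=> u v w; apply: coindP => p /=; rewrite addrA. Qed.
Fact coindDC : commutative coindD.
Proof. by move=> u v; apply: coindP => p /=; rewrite addrC. Qed.
Fact coind0D : left_id coind0 coindD.
Proof. by move=> u; apply: coindP => p /=; rewrite add0r. Qed.
Fact coindND : left_inverse coind0 coindN coindD.
Proof. by move=> u; apply: coindP => p /=; rewrite addNr. Qed.
HB.instance Definition _ := GRing.isZmodule.Build coind coindDA coindDC coind0D coindND.

Fact coindZ_eq a (u : coind) p s : (fun p => a *: u p) (p * lp s)%g = P s (a *: u p).
Proof. by rewrite /= coeq efunZ. Qed.
Definition coindZ a u := Coind (coindZ_eq a u).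
Fact coindZA a b u : coindZ a (coindZ b u) = coindZ (a * b) u.
Proof. by apply: coindP => p /=; rewrite scalerA. Qed.
Fact coind1Z : left_id 1 coindZ.
Proof. by move=> u; apply: coindP => p /=; rewrite scale1r. Qed.
Fact coindZDr : right_distributive coindZ +%R.
Proof. by move=> a u v; apply: coindP => p /=; rewrite scalerDr. Qed.
Fact coindZDl u : {morph coindZ^~ u : a b / a + b}.
Proof. by move=> a b; apply: coindP => p /=; rewrite scalerDl. Qed.
HB.instance Definition _ := GRing.Zmodule_isLmodule.Build k coind
  coindZA coind1Z coindZDr coindZDl.

Section Operator.
Variable T : ('S_n.+1 -> M) -> 'S_n.+1 -> M.
Hypothesis Teq : forall (u : coind) p s, T u (p * lp s)%g = P s (T u p).
Hypothesis TD : forall (u v : coind) p, T (fun p => u p + v p) p = T u p + T v p.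
Hypothesis TZ : forall a (u : coind) p, T (fun p => a *: u p) p = a *: T u p.
Definition coop_fun (u : coind) : coind := Coind (Teq u).
Fact coop_funD : {morph coop_fun : u v / u + v}.
Proof. by move=> u v; apply: coindP => p /=; rewrite TD. Qed.
Fact coop_funZ a : {morph coop_fun : u / a *: u}.
Proof. by move=> u; apply: coindP => p /=; rewrite TZ. Qed.
Definition coop : endo coind := Endo coop_funD coop_funZ.
End Operator.

Fact coP_eq q (u : coind) p s : u (q * (p * lp s))%g = P s (u (q * p)%g).
Proof. by rewrite mulgA coeq. Qed.
Definition coP (q : 'S_n.+1) : endo coind :=
  @coop (fun u p => u (q * p)%g) (coP_eq q) (fun _ _ _ => erefl) (fun _ _ _ => erefl).

Fact coS_eq i f (u : coind) p s :
  S ((p * lp s)%g i) f (u (p * lp s)%g) = P s (S (p i) f (u p)).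
Proof. by rewrite coeq permM -endoM -(pb_PS hp) endoM. Qed.
Fact coS_D i f (u v : coind) (p : 'S_n.+1) : S (p i) f (u p + v p) = S (p i) f (u p) + S (p i) f (v p).
Proof. exact: efunD. Qed.
Fact coS_Z i f a (u : coind) (p : 'S_n.+1) : S (p i) f (a *: u p) = a *: S (p i) f (u p).
Proof. exact: efunZ. Qed.
Definition coS i f : endo coind := @coop (fun u p => S (p i) f (u p)) (coS_eq i f) (coS_D i f) (coS_Z i f).

(** At p the operator y_i acts as y_(p i). For p i the last index this is the last variable
    minus its Jucys-Murphy element, whose transpositions act on the argument of u. *)
Definition coY_fun i (u : 'S_n.+1 -> M) (p : 'S_n.+1) : M :=
  if unlift mx (p i) is Some j then Y j (u p)
  else X (u p) - \sum_(l < n) t (lft l) mx (u (p * tperm (lft l) mx)%g).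

Lemma coY_lft i u (p : 'S_n.+1) j : p i = lft j -> coY_fun i u p = Y j (u p).
Proof. by move=> e; rewrite /coY_fun e liftK. Qed.
Lemma coY_mx i u (p : 'S_n.+1) : p i = mx ->
  coY_fun i u p = X (u p) - \sum_(l < n) t (lft l) mx (u (p * tperm (lft l) mx)%g).
Proof. by move=> e; rewrite /coY_fun e unlift_none. Qed.

Fact coY_eq i (u : coind) p s : coY_fun i u (p * lp s)%g = P s (coY_fun i u p).
Proof.
have hd := pb_dri hp; case: (unliftP mx (p i)) => [j|] e.
  rewrite (coY_lft _ e) (@coY_lft _ _ _ (s j)) ?permM ?e ?lp_lft // coeq.
  by rewrite -endoM -(P_Y hd).
rewrite (coY_mx _ e) coY_mx ?permM ?e ?lp_mx // (morphB (efunD _)).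
rewrite coeq -!endoM -(pb_PX hp); congr (_ - _).
rewrite (morph_sum _ _ _ (efunD _)) (reindex_inj (@perm_inj _ s)).
apply: eq_bigr => l _; rewrite -mulgA tperm_lp mulgA coeq -!endoM.
by rewrite (tele_P D _ _ (pb_PS hp s)) lp_lft lp_mx.
Qed.
Fact coY_D i (u v : coind) p : coY_fun i (fun p => u p + v p) p = coY_fun i u p + coY_fun i v p.
Proof.
case: (unliftP mx (p i)) => [j|] e; first by rewrite !(coY_lft _ e) efunD.
rewrite !(coY_mx _ e) efunD addrACA -opprD -big_split; congr (_ - _).
by apply: eq_bigr => l _; rewrite efunD.
Qed.
Fact coY_Z i a (u : coind) p : coY_fun i (fun p => a *: u p) p = a *: coY_fun i u p.
Proof.
case: (unliftP mx (p i)) => [j|] e; first by rewrite !(coY_lft _ e) efunZ.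
rewrite !(coY_mx _ e) efunZ scalerBr scaler_sumr; congr (_ - _).
by apply: eq_bigr => l _; rewrite efunZ.
Qed.
Definition coY i : endo coind := @coop (coY_fun i) (coY_eq i) (coY_D i) (coY_Z i).

Lemma coYE i (u : coind) p : coY i u p = coY_fun i u p. Proof. by []. Qed.
Lemma coSE i f (u : coind) p : coS i f u p = S (p i) f (u p). Proof. by []. Qed.
Lemma coPE q (u : coind) p : coP q u p = u (q * p)%g. Proof. by []. Qed.


Lemma co_family : slot_family (@scale_endo k coind) coS.
Proof.
split.
- exact: scale_endoC.
- by move=> i a f g; apply: endoP => u; apply: coindP => p /=; rewrite (S_lin hF).
- by move=> i; apply: endoP => u; apply: coindP => p /=; rewrite (S_1 hF).
- by move=> i f g; apply: endoP => u; apply: coindP => p /=; rewrite (S_M hF).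
- move=> i j ij d p e q f g hf hg; apply: endoP => u; apply: coindP => r.
  have ne : r i != r j by rewrite (inj_eq (@perm_inj _ r)).
  have := congr1 (fun h : endo M => h (u r)) (S_comm hF ne hf hg).
  by case: (p && q); rewrite ?expr0 ?expr1 ?mul1r ?mulN1r.
Qed.

Lemma co_slots : slots (@scale_endo k coind) coS coP.
Proof.
split; first exact: co_family.
- by apply: endoP => u; apply: coindP => p /=; rewrite mul1g.
- by move=> s r; apply: endoP => u; apply: coindP => p /=; rewrite mulgA.
- by move=> s i f; apply: endoP => u; apply: coindP => p /=; rewrite permM.
Qed.

Lemma co_tele i j (u : coind) p : tele D coS i j u p = t (p i) (p j) (u p).
Proof.
rewrite endo_sum (big_morph (fun v : coind => v p) (id1 := 0) (op1 := +%R)) //.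
by rewrite [RHS]endo_sum.
Qed.

Lemma co_S_Y i f : coS i f * coY i = coY i * coS i (psi D f).
Proof.
apply: endoP => u; apply: coindP => p; rewrite !endoM coSE !coYE.
have hd := pb_dri hp; case: (unliftP mx (p i)) => [j|] e.
  by rewrite !(coY_lft _ e) coSE e -!endoM (S_Y hd).
rewrite !(coY_mx _ e) endo_Br coSE e -!endoM (pb_SX hp); congr (_ - _).
rewrite (morph_sum _ _ _ (efunD _)); apply: eq_bigr => l _.
by rewrite coSE permM e tpermR -!endoM (tele_r D hF) // eq_sym neq_lift.
Qed.

Lemma co_S_Yne i j f : i != j -> coS i f * coY j = coY j * coS i f.
Proof.
move=> ij; apply: endoP => u; apply: coindP => p; rewrite !endoM coSE !coYE.
have ne : p i != p j by rewrite (inj_eq (@perm_inj _ p)).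
have hd := pb_dri hp; case: (unliftP mx (p j)) => [b|] e.
  rewrite !(coY_lft _ e) coSE -!endoM.
  case: (unliftP mx (p i)) => [a|] e'; last by rewrite e' (pb_SY hp).
  have ab : a != b by apply: contra ne => /eqP; rewrite e e' => ->.
  by rewrite e' (S_Yne hd _ ab).
rewrite !(coY_mx _ e) endo_Br coSE -!endoM.
case: (unliftP mx (p i)) => [a|] e'; last by rewrite e e' eqxx in ne.
rewrite e' (pb_SXne hp); congr (_ - _).
rewrite (morph_sum _ _ _ (efunD _)); apply: eq_bigr => l _.
rewrite coSE permM e' -!endoM; have [->|al] := eqVneq a l.
  by rewrite tpermL (tele_l D hF).
have al' : lft a != lft l by rewrite (inj_eq (@lift_inj _ _)).
have -> : tperm (lft l) mx (lft a) = lft a by rewrite tpermD ?neq_lift // eq_sym.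
rewrite (tele_ne D hF) //; first by rewrite eq_sym neq_lift.
by rewrite eq_sym neq_lift.
Qed.

Lemma co_P_Y s i : coP s * coY i = coY (s i) * coP s.
Proof.
apply: endoP => u; apply: coindP => p; rewrite !endoM coPE !coYE /coY_fun permM.
case: unlift => [j|]; rewrite coPE //; congr (_ - _); apply: eq_bigr => l _.
by rewrite coPE mulgA.
Qed.

Lemma tperm_p i j (p : 'S_n.+1) : (tperm i j * p)%g = (p * tperm (p i) (p j))%g.
Proof. by rewrite conjgC tpermJ. Qed.

Definition YY_at i j (u : coind) (p : 'S_n.+1) :=
  coY i (coY j u) p - coY j (coY i u) p =
  tele D coS i j (coY j (coP (tperm i j) u)) p - coY i (tele D coS i j (coP (tperm i j) u)) p.

(** If p j is not the last index either, this is the relation in the subalgebra. Otherwise the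
    two sums over l agree termwise, except that the transposition carrying p i to the last
    index turns one y_(p i) into the last variable; that term is the right-hand side. *)
Lemma YY_at_lft i j u (p : 'S_n.+1) : i != j -> p i != mx -> YY_at i j u p.
Proof.
have hd := pb_dri hp; rewrite /YY_at; move=> ij.
have ne : p i != p j by rewrite (inj_eq (@perm_inj _ p)).
case: (unliftP mx (p i)) => [a|] ei; rewrite ei ?eqxx // => _.
case: (unliftP mx (p j)) => [b|] ej.
  have ab : a != b by apply: contra ne => /eqP; rewrite ei ej => ->.
  rewrite co_tele !coYE !(coY_lft _ ei) !(coY_lft _ ej) co_tele.
  rewrite coPE tperm_p ei ej -lp_tp coeq !coYE !(coY_lft _ ei) !(coY_lft _ ej).
  exact: (congr1 (fun f : endo M => f (u p)) (Y_Y hd ab)).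
rewrite co_tele !coYE !(coY_lft _ ei) !(coY_mx _ ej) co_tele !coYE !(coY_lft _ ei) !(coY_mx _ ej) ei ej.
rewrite !coPE !tperm_p ei ej endo_Br (morph_sum _ _ _ (efunD _)).
set tau := tperm (lft a) mx.
have e1 (l : 'I_n) : l != a ->
    t (lft l) mx (coY i u (p * tperm (lft l) mx)%g) =
    Y a (t (lft l) mx (u (p * tperm (lft l) mx)%g)).
  move=> la; rewrite coYE (@coY_lft _ _ _ a) -?endoM; last first.
    by rewrite permM ei tpermD ?neq_lift // (inj_eq (@lift_inj _ _)).
  rewrite mulr_suml mulr_sumr; congr (efun _ _); apply: eq_bigr => c _.
  by rewrite -mulrA (pb_SY hp) mulrA (S_Yne hd) // mulrA.
have e2 : coY i u (p * tau)%g =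
    X (u (p * tau)%g) - \sum_(l < n) t (lft l) mx (u (p * tau * tperm (lft l) mx)%g).
  by rewrite coYE coY_mx // permM ei tpermL.
have e3 : \sum_(l < n) t (lft l) mx (coY i u (p * tperm (lft l) mx)%g) =
    t (lft a) mx (coY i u (p * tau)%g) +
    \sum_(l < n | l != a) Y a (t (lft l) mx (u (p * tperm (lft l) mx)%g)).
  by rewrite (bigD1 a) //=; congr (_ + _); apply: eq_bigr.
(* The terms with l other than a cancel. *)
rewrite e3 e2 (bigD1 a) //=.
have -> : \sum_(l < n) t (lft l) mx (coP (tperm i j) u (p * tperm (lft l) mx)%g) =
    \sum_(l < n) t (lft l) mx (u (p * tau * tperm (lft l) mx)%g).
  by apply: eq_bigr => l _; rewrite coPE mulgA tperm_p ei ej.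
have -> : Y a (X (u p)) = X (Y a (u p)) by rewrite -!endoM (pb_YX hp).
by rewrite opprB [LHS]addrC addrA subrK opprD addrACA subrr addr0.
Qed.

(** At most one of p i and p j is the last index, and the relation is antisymmetric. *)
Lemma co_Y_Y i j : i != j -> YY_rel D coS coP coY i j.
Proof.
move=> ij; have ji : j != i by rewrite eq_sym.
rewrite /YY_rel mulrBl; apply: endoP => u; apply: coindP => p.
suff : YY_at i j u p by [].
have [ei|ne] := eqVneq (p i) mx; last exact: YY_at_lft.
have : YY_at j i u p.
  by apply: YY_at_lft => //; rewrite -ei (inj_eq (@perm_inj _ p)).
rewrite /YY_at => /(congr1 -%R); rewrite opprB => ->.
rewrite opprB tpermC -!endoM.
by rewrite -(tele_Yr co_family co_S_Y co_S_Yne ij) (tele_Yr co_family co_S_Y co_S_Yne ji).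
Qed.

Lemma coind_affine : affine D (@scale_endo k coind) (fun i => coY i + JM D coS coP i) coS coP.
Proof.
apply: (drinfeld_affine co_slots co_S_Y co_S_Yne co_P_Y co_Y_Y).
Qed.
End Coinduction.

(** * Functionals on R (x) F[x] *)

Section Functionals.
Variables (k : comNzRingType) (F : frobenius_superalgebra k) (D : cyclotomic_datum F).
Variables (R : pzRingType) (ka : {rmorphism k -> R}) (n : nat).
Variables (XR : 'I_n -> R) (SR : 'I_n -> F -> R) (PR : 'S_n -> R).
Hypothesis hR : affine D ka XR SR PR.
Let hS := aff_slots hR.
Local Notation mx := (@ord_max n).
Local Notation lft := (lift mx).

(** A left R-linear map R (x) F[x] -> R, by its values u a f at x^a f. The operators below are
    transposed to right multiplication on R (x) F[x], whence the left action on functionals. *)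
Record functional := Functional {
  fn :> nat -> F -> R;
  fn_lin : forall a c f g, fn a (c *: f + g) = ka c * fn a f + fn a g }.

Lemma fnP (u v : functional) : (forall a f, u a f = v a f) -> u = v.
Proof.
move=> e; have {e} : u = v :> (nat -> F -> R) by apply/funext => a; apply/funext.
case: u v => [u hu] [v hv] /= e; case: _ / e hv => hv.
by congr Functional; apply: Prop_irrelevance.
Qed.

HB.instance Definition _ := gen_eqMixin functional.
HB.instance Definition _ := gen_choiceMixin functional.

Fact fn0_lin (a : nat) c (f g : F) : 0 = ka c * 0 + 0.
Proof. by rewrite mulr0 addr0. Qed.
Fact fnD_lin (u v : functional) a c f g :
  u a (c *: f + g) + v a (c *: f + g) = ka c * (u a f + v a f) + (u a g + v a g).
Proof. by rewrite !fn_lin mulrDr addrACA. Qed.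
Fact fnN_lin (u : functional) a c f g : - u a (c *: f + g) = ka c * (- u a f) + (- u a g).
Proof. by rewrite fn_lin mulrN opprD. Qed.
Fact fnZ_lin d (u : functional) a c f g :
  ka d * u a (c *: f + g) = ka c * (ka d * u a f) + ka d * u a g.
Proof. by rewrite fn_lin mulrDr !mulrA -!rmorphM mulrC. Qed.
Definition fn_zero := @Functional (fun _ _ => 0) fn0_lin.
Definition fn_add (u v : functional) := @Functional (fun a f => u a f + v a f) (fnD_lin u v).
Definition fn_opp (u : functional) := @Functional (fun a f => - u a f) (fnN_lin u).
Definition fn_scale d (u : functional) := @Functional (fun a f => ka d * u a f) (fnZ_lin d u).
Fact fn_addA : associative fn_add. Proof. by move=> *; apply: fnP => a f /=; rewrite addrA. Qed.
Fact fn_addC : commutative fn_add. Proof. by move=> *; apply: fnP => a f /=; rewrite addrC. Qed.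
Fact fn_add0 : left_id fn_zero fn_add. Proof. by move=> *; apply: fnP => a f /=; rewrite add0r. Qed.
Fact fn_addN : left_inverse fn_zero fn_opp fn_add.
Proof. by move=> *; apply: fnP => a f /=; rewrite addNr. Qed.
HB.instance Definition _ := GRing.isZmodule.Build functional fn_addA fn_addC fn_add0 fn_addN.
Fact fn_scaleA c d u : fn_scale c (fn_scale d u) = fn_scale (c * d) u.
Proof. by apply: fnP => a f /=; rewrite mulrA -rmorphM. Qed.
Fact fn_scale1 : left_id 1 fn_scale.
Proof. by move=> u; apply: fnP => a f /=; rewrite rmorph1 mul1r. Qed.
Fact fn_scaleDr : right_distributive fn_scale +%R.
Proof. by move=> c u v; apply: fnP => a f /=; rewrite mulrDr. Qed.
Fact fn_scaleDl u : {morph fn_scale^~ u : a b / a + b}.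
Proof. by move=> c d; apply: fnP => a f /=; rewrite rmorphD mulrDl. Qed.
HB.instance Definition _ := GRing.Zmodule_isLmodule.Build k functional
  fn_scaleA fn_scale1 fn_scaleDr fn_scaleDl.

Lemma fnD (u : functional) a f g : u a (f + g) = u a f + u a g.
Proof. by have := fn_lin u a 1 f g; rewrite scale1r rmorph1 mul1r. Qed.
Lemma fn0 (u : functional) a : u a 0 = 0.
Proof. by apply: (addIr (u a 0)); rewrite -fnD !add0r. Qed.
Lemma fnZ (u : functional) a c f : u a (c *: f) = ka c * u a f.
Proof. by have := fn_lin u a c f 0; rewrite !addr0 fn0 addr0. Qed.
Lemma fn_sign (u : functional) a (b : bool) f : u a ((-1) ^+ b *: f) = (-1) ^+ b * u a f.
Proof. by rewrite fnZ rmorph_sign. Qed.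
Lemma fn_signE (u : functional) a (b : bool) f : ((-1) ^+ b *: u) a f = (-1) ^+ b * u a f.
Proof. by rewrite /= rmorph_sign. Qed.

Lemma kaR_C a x : ka a * x = x * ka a. Proof. exact: ka_central hS a x. Qed.

Fact mL_lin r (u : functional) a c f g :
  r * u a (c *: f + g) = ka c * (r * u a f) + r * u a g.
Proof. by rewrite fn_lin mulrDr mulrA -kaR_C mulrA. Qed.
Definition mL_fun r (u : functional) := @Functional (fun a f => r * u a f) (mL_lin r u).
Fact mL_D r : {morph mL_fun r : u v / u + v}.
Proof. by move=> u v; apply: fnP => a f /=; rewrite mulrDr. Qed.
Fact mL_Z r c : {morph mL_fun r : u / c *: u}.
Proof. by move=> u; apply: fnP => a f /=; rewrite mulrA -kaR_C mulrA. Qed.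
Definition mL r : endo functional := Endo (mL_D r) (mL_Z r).
Lemma mLD r s : mL (r + s) = mL r + mL s.
Proof. by apply: endoP => u; apply: fnP => a f /=; rewrite mulrDl. Qed.
Lemma mLB r s : mL (r - s) = mL r - mL s.
Proof. exact: (morphB mLD). Qed.
Lemma mLM r s : mL (r * s) = mL r * mL s.
Proof. by apply: endoP => u; apply: fnP => a f /=; rewrite mulrA. Qed.
Lemma mL1 : mL 1 = 1.
Proof. by apply: endoP => u; apply: fnP => a f /=; rewrite mul1r. Qed.

Fact mR_lin r (u : functional) a c f g :
  u a (c *: f + g) * r = ka c * (u a f * r) + u a g * r.
Proof. by rewrite fn_lin mulrDl mulrA. Qed.
Definition mR_fun r (u : functional) := @Functional (fun a f => u a f * r) (mR_lin r u).
Fact mR_D r : {morph mR_fun r : u v / u + v}.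
Proof. by move=> u v; apply: fnP => a f /=; rewrite mulrDl. Qed.
Fact mR_Z r c : {morph mR_fun r : u / c *: u}.
Proof. by move=> u; apply: fnP => a f /=; rewrite mulrA. Qed.
Definition mR r : endo functional := Endo (mR_D r) (mR_Z r).

Fact mSx_lin g (u : functional) a c f h :
  u a ((c *: f + h) * g) = ka c * u a (f * g) + u a (h * g).
Proof. by rewrite mulrDl -scalerAl fn_lin. Qed.
Definition mSx_fun g (u : functional) := @Functional (fun a f => u a (f * g)) (mSx_lin g u).
Fact mSx_D g : {morph mSx_fun g : u v / u + v}.
Proof. by move=> u v; apply: fnP. Qed.
Fact mSx_Z g c : {morph mSx_fun g : u / c *: u}.
Proof. by move=> u; apply: fnP. Qed.
Definition mSx g : endo functional := Endo (mSx_D g) (mSx_Z g).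

Lemma mSxE g u a f : mSx g u a f = u a (f * g). Proof. by []. Qed.

Fact mXx_lin (u : functional) a c f g :
  u a.+1 (psi D (c *: f + g)) = ka c * u a.+1 (psi D f) + u a.+1 (psi D g).
Proof. by rewrite linearP fn_lin. Qed.
Definition mXx_fun (u : functional) := @Functional (fun a f => u a.+1 (psi D f)) (mXx_lin u).
Fact mXx_D : {morph mXx_fun : u v / u + v}.
Proof. by move=> u v; apply: fnP. Qed.
Fact mXx_Z c : {morph mXx_fun : u / c *: u}.
Proof. by move=> u; apply: fnP. Qed.
Definition mXx : endo functional := Endo mXx_D mXx_Z.
Lemma mXxE u a f : mXx u a f = u a.+1 (psi D f). Proof. by []. Qed.

(** The slots of R stand to the left of the last slot, so that g passes f; the parity of g is
    taken care of by its components. *)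
Definition mSl_val (i : 'I_n) (g : F) (u : nat -> F -> R) a f :=
  SR i (ppart D false g) * u a f + SR i (ppart D true g) * u a (sgF D true f).
Fact mSl_lin i g (u : functional) a c f h :
  mSl_val i g u a (c *: f + h) = ka c * mSl_val i g u a f + mSl_val i g u a h.
Proof.
rewrite /mSl_val linearP /= !fn_lin !mulrDr addrACA; congr (_ + _ + _).
  by rewrite mulrA -kaR_C mulrA.
by rewrite mulrA -kaR_C mulrA.
Qed.
Definition mSl_fun i g (u : functional) := @Functional (mSl_val i g u) (mSl_lin i g u).
Fact mSl_D i g : {morph mSl_fun i g : u v / u + v}.
Proof. by move=> u v; apply: fnP => a f; rewrite /= /mSl_val /= !mulrDr addrACA. Qed.
Fact mSl_Z i g c : {morph mSl_fun i g : u / c *: u}.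
Proof.
move=> u; apply: fnP => a f; rewrite /= /mSl_val /= mulrDr; congr (_ + _).
  by rewrite mulrA -kaR_C mulrA.
by rewrite mulrA -kaR_C mulrA.
Qed.
Definition mSl i g : endo functional := Endo (mSl_D i g) (mSl_Z i g).

Lemma mSlE i d p g u a f : fs_gr (d, p) g -> mSl i g u a f = SR i g * u a (sgF D p f).
Proof.
move=> hg; rewrite /= /mSl_val !(ppartE D _ hg); case: p {hg} => /=.
  by rewrite (slot0 hS) mul0r add0r.
by rewrite (slot0 hS) mul0r addr0.
Qed.

Definition mS (i : 'I_n.+1) (g : F) : endo functional :=
  if unlift mx i is Some j then mSl j g else mSx g.
Lemma mS_lft j g : mS (lft j) g = mSl j g. Proof. by rewrite /mS liftK. Qed.
Lemma mS_mx g : mS mx g = mSx g. Proof. by rewrite /mS unlift_none. Qed.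

Lemma mSl_lin2 i c f g : mSl i (c *: f + g) = scale_endo _ c * mSl i f + mSl i g.
Proof.
apply: endoP => u; apply: fnP => a h; rewrite /= /mSl_val !linearP !(S_lin hS) !mulrDl mulrDr.
by rewrite addrACA !mulrA.
Qed.

Lemma mS_lin i c f g : mS i (c *: f + g) = scale_endo _ c * mS i f + mS i g.
Proof.
case: (unliftP mx i) => [j|] ->; first by rewrite !mS_lft mSl_lin2.
rewrite !mS_mx; apply: endoP => u; apply: fnP => a h /=.
by rewrite mulrDr -scalerAr fn_lin.
Qed.

Lemma mSD i f g : mS i (f + g) = mS i f + mS i g.
Proof. by have := mS_lin i 1 f g; rewrite scale1r rmorph1 mul1r. Qed.
Lemma mS0 i : mS i 0 = 0. Proof. exact: morph0 (mSD i). Qed.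

Lemma mS_family : slot_family (@scale_endo k functional) mS.
Proof.
split.
- exact: scale_endoC.
- exact: mS_lin.
- move=> i; case: (unliftP mx i) => [j|] ->; rewrite ?mS_lft ?mS_mx.
    apply: endoP => u; apply: fnP => a h; rewrite (mSlE _ _ _ _ (fs_gr1 F)).
    by rewrite (S_1 hS) mul1r.
  by apply: endoP => u; apply: fnP => a h /=; rewrite mulr1.
- move=> i f g; case: (unliftP mx i) => [j|] ->; last first.
    by rewrite !mS_mx; apply: endoP => u; apply: fnP => a h /=; rewrite mulrA.
  elim/gr_ind: f => [|u v hu hv|[d p] f hf].
  + by rewrite mul0r mS0 mul0r.
  + by rewrite mulrDl !mSD hu hv mulrDl.
  elim/gr_ind: g => [|u v hu hv|[e q] g hg].
  + by rewrite mulr0 mS0 mulr0.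
  + by rewrite mulrDr !mSD hu hv mulrDr.
  have hfg : fs_gr (d + e, p (+) q) (f * g) := fs_grM hf hg.
  rewrite !mS_lft; apply: endoP => u; apply: fnP => a h; rewrite (mSlE _ _ _ _ hfg).
  by rewrite endoM (mSlE _ _ _ _ hf) (mSlE _ _ _ _ hg) (S_M hS) sgF_addb mulrA addbC.
have key i j d p e q f g : i != j -> fs_gr (d, p) f -> fs_gr (e, q) g -> j != mx ->
    mS i f * mS j g = (-1) ^+ (p && q) * (mS j g * mS i f).
  case: (unliftP mx j) => [j'|] ->; last by rewrite eqxx.
  move=> ij hf hg _; apply: endo_signP => u; apply: fnP => a h; rewrite fn_signE.
  case: (unliftP mx i) ij => [i'|] -> ij; rewrite ?mS_lft ?mS_mx !endoM.
    rewrite (inj_eq (@lift_inj _ _)) in ij.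
    rewrite (mSlE _ _ _ _ hf) (mSlE _ _ _ _ hg) (mSlE _ _ _ _ hg) (mSlE _ _ _ _ hf).
    by rewrite !sgF_addb addbC !mulrA (S_comm hS ij hf hg) !mulrA.
  rewrite mSxE !(mSlE _ _ _ _ hg) mSxE sgFM (sgFE D q hf) -scalerAr fn_sign.
  by rewrite mul_signCA.
move=> i j ij d p e q f g hf hg; have [jm|] := eqVneq j mx; last exact: (key _ _ d _ e).
rewrite andbC; apply: mul_sign_and; apply: (key _ _ e _ d) => //; first by rewrite eq_sym.
by rewrite -jm.
Qed.

Definition mP s := mL (PR s).
Definition mY i := mL (XR i - JM D SR PR i).

Lemma ppart_psi q f : ppart D q (psi D f) = psi D (ppart D q f).
Proof.
elim/gr_ind: f => [|u v hu hv|[d p] f hf]; first by rewrite !linear0.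
  by rewrite !linearD /= hu hv.
rewrite (ppartE D q hf) (ppartE D q (psi_gr D hf)).
by case: ifP => // _; rewrite linear0.
Qed.

(** Teleporters are even, so the signs of the two slots cancel. *)
Lemma tele_mS i j : tele D mS (lft i) (lft j) = mL (tele D SR i j).
Proof.
apply: endoP => u; apply: fnP => a f; rewrite endo_sum.
rewrite (big_morph (fun v : functional => v a f) (id1 := 0) (op1 := +%R)) //=.
rewrite mulr_suml; apply: eq_bigr => b _; rewrite !mS_lft.
have hd := dual_bas_gr b; have hb := bas_gr b.
rewrite -[LHS]/(mSl i (bas D b) (mSl j (dual_bas D b) u) a f).
by rewrite (mSlE _ _ _ _ hb) (mSlE _ _ _ _ hd) sgF_addb addbb mulrA.
Qed.

Lemma mSl_mL i f r g : (forall q, SR i (ppart D q f) * r = r * SR i (ppart D q g)) ->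
  mSl i f * mL r = mL r * mSl i g.
Proof.
by move=> h; apply: endoP => u; apply: fnP => a x; rewrite /= /mSl_val /= !mulrA !h mulrDr !mulrA.
Qed.

Lemma mL_mSx r f : mL r * mSx f = mSx f * mL r.
Proof. by apply: endoP => u; apply: fnP. Qed.
Lemma mL_mXx r : mL r * mXx = mXx * mL r.
Proof. by apply: endoP => u; apply: fnP. Qed.

Lemma mP_mSl s i f : mP s * mSl i f = mSl (s i) f * mP s.
Proof.
apply: endoP => u; apply: fnP => a x; rewrite /= /mSl_val /= mulrDr !mulrA.
by rewrite !(P_S hS).
Qed.

Lemma mR_mL r s : mR r * mL s = mL s * mR r.
Proof. by apply: endoP => u; apply: fnP => a f /=; rewrite mulrA. Qed.
Lemma mR_mS r i f : mR r * mS i f = mS i f * mR r.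
Proof.
case: (unliftP mx i) => [j|] ->; rewrite ?mS_lft ?mS_mx; apply: endoP => u; apply: fnP => a x //.
by rewrite /= /mSl_val /= mulrDl !mulrA.
Qed.
Lemma mR_mXx r : mR r * mXx = mXx * mR r.
Proof. by apply: endoP => u; apply: fnP. Qed.

Lemma mS_parabolic : parabolic D mS mP mY mXx.
Proof.
have hd := affine_drinfeld hS hR.
split.
- exact: mS_family.
- by rewrite /mP (P_1 hS) mL1.
- by move=> s t; rewrite /mP -mLM (P_M hS).
- move=> s i f; case: (unliftP mx i) => [j|] ->; rewrite ?lp_lft ?lp_mx ?mS_lft ?mS_mx.
    exact: mP_mSl.
  exact: mL_mSx.
- split; first split; first split.
  + exact: scale_endoC.
  + by move=> i c f g; rewrite mS_lin.
  + by move=> i; rewrite (S_1 mS_family).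
  + by move=> i f g; rewrite (S_M mS_family).
  + move=> i j ij d p e q f g hf hg.
    by apply: (S_comm mS_family) hf hg; rewrite (inj_eq (@lift_inj _ _)).
  + by rewrite /mP (P_1 hS) mL1.
  + by move=> s t; rewrite /mP -mLM (P_M hS).
  + by move=> s i f; rewrite !mS_lft; exact: mP_mSl.
  + by move=> i f; rewrite !mS_lft; apply: mSl_mL => q; rewrite ppart_psi (S_Y hd).
  + by move=> i j f ij; rewrite !mS_lft; apply: mSl_mL => q; rewrite (S_Yne hd).
  + by move=> s i; rewrite /mP /mY -!mLM (P_Y hd).
  + move=> i j ij; rewrite -[tele D (fun i => mS (lft i)) i j]/(tele D mS (lft i) (lft j)).
    by rewrite tele_mS /mP /mY -!mLM -!mLB -mLM (Y_Y hd ij).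
- by move=> j f; rewrite mS_mx /mY mL_mSx.
- move=> f; rewrite !mS_mx; apply: endoP => u; apply: fnP => a h.
  by rewrite /= psiM.
- move=> i f; rewrite !mS_lft; apply: endoP => u; apply: fnP => a h.
  by rewrite /= /mSl_val /= linearB /= !ppart_psi.
- by move=> s; rewrite mL_mXx.
- by move=> j; rewrite mL_mXx.
Qed.
End Functionals.

(** * The divided difference operator *)

Section Divided.
Variables (k : comNzRingType) (F : frobenius_superalgebra k) (D : cyclotomic_datum F).
Variables (R : pzRingType) (ka : {rmorphism k -> R}) (m : nat).
Variables (XR : 'I_m.+1 -> R) (SR : 'I_m.+1 -> F -> R) (PR : 'S_m.+1 -> R).
Hypothesis hR : affine D ka XR SR PR.
Let hS := aff_slots hR.
Local Notation mx := (@ord_max m.+1).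
Local Notation lft := (lift mx).
Local Notation la := (@ord_max m).
Local Notation func := (functional F ka).
Local Notation mS := (mS hR).
Local Notation mP := (mP hR).
Local Notation mL := (mL hR).
Local Notation mX := (mXx D ka).
Let pb := mS_parabolic hR.
Let mF := mS_family hR.

Definition tele_last : endo func := tele D mS (lft la) mx.

(** Let u be the value at 1 of an equivariant function on which the lower algebra acts through
    u, and v its value at s. The relation x s = s x' + t forces x v = v' + t u, with v' the
    value at s belonging to x' u. This determines v once its value at x^0 is chosen,
    and 0 is chosen because tau(s) = 0 is wanted. *)
Fixpoint ddiff_val (a : nat) (u : func) (f : F) : R :=
  if a is a'.+1 then ddiff_val a' (mL (XR la) u) (psiV D f) + tele_last u a' (psiV D f) else 0.

Lemma ddiff_valS a u f :
  ddiff_val a.+1 u f = ddiff_val a (mL (XR la) u) (psiV D f) + tele_last u a (psiV D f).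
Proof. by []. Qed.

Fact ddiff_val_lin a u c f g : ddiff_val a u (c *: f + g) = ka c * ddiff_val a u f + ddiff_val a u g.
Proof.
elim: a u f g => [|a IH] u f g; first by rewrite /= mulr0 addr0.
by rewrite !ddiff_valS psiV_lin IH fn_lin mulrDr addrACA.
Qed.
Fact ddiff_val_D a u v f : ddiff_val a (u + v) f = ddiff_val a u f + ddiff_val a v f.
Proof.
elim: a u v f => [|a IH] u v f; first by rewrite /= addr0.
by rewrite !ddiff_valS !efunD IH addrACA.
Qed.
Fact ddiff_val_Z a c u f : ddiff_val a (c *: u) f = ka c * ddiff_val a u f.
Proof.
elim: a u f => [|a IH] u f; first by rewrite /= mulr0.
by rewrite !ddiff_valS !efunZ IH mulrDr.
Qed.
Definition ddiff_fun u : func := Functional (fun a => ddiff_val_lin a u).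
Fact ddiff_D : {morph ddiff_fun : u v / u + v}.
Proof. by move=> u v; apply: fnP => a f; exact: ddiff_val_D. Qed.
Fact ddiff_Z c : {morph ddiff_fun : u / c *: u}.
Proof. by move=> u; apply: fnP => a f; exact: ddiff_val_Z. Qed.
Definition ddiff : endo func := Endo ddiff_D ddiff_Z.

Lemma ddiff0 u f : ddiff u 0 f = 0. Proof. by []. Qed.
Lemma mX_ddiff u : mX (ddiff u) = ddiff (mL (XR la) u) + tele_last u.
Proof. by apply: fnP => a f; rewrite mXxE [LHS]/= psiKV. Qed.

(** Operators are compared exponent by exponent: at exponent 0 everything vanishes, and
    x lowers the exponent. *)
Lemma ddiff_ind (G : Type) (T1 T2 : G -> endo func) (s : G -> G) :
  (forall g u f, T1 g (ddiff u) 0 f = 0) ->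
  (forall g u, mX (T1 g (ddiff u)) - mX (ddiff (T2 g u)) =
     T1 (s g) (ddiff (mL (XR la) u)) - ddiff (T2 (s g) (mL (XR la) u))) ->
  forall g, T1 g * ddiff = ddiff * T2 g.
Proof.
move=> h0 hs g; apply: endoP => u; apply: fnP => a f.
elim: a g u f => [|a IH] g u f; first by rewrite endoM h0.
rewrite -(psiVK D f) !endoM -!mXxE; apply/eqP; rewrite -subr_eq0; apply/eqP.
rewrite -[LHS]/((mX (T1 g (ddiff u)) - mX (ddiff (T2 g u))) a (psiV D f)) hs.
by apply/eqP; rewrite subr_eq0; apply/eqP; exact: IH.
Qed.

Lemma laP (i : 'I_m.+1) : i != la -> lft i != lft la.
Proof. by rewrite (inj_eq (@lift_inj _ _)). Qed.

Lemma mSl_XR i f : i != la -> mS (lft i) f * mL (XR la) = mL (XR la) * mS (lft i) f.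
Proof. by move=> ne; rewrite !mS_lft; apply: mSl_mL => q; rewrite (S_Xne hR). Qed.

Lemma ddiff_Smx g : mS mx g * ddiff = ddiff * mS (lft la) g.
Proof.
apply: (@ddiff_ind _ (fun g => mS mx g) (fun g => mS (lft la) g) (@psiV _ _ D)) => {g} [g u f|g u].
  by rewrite mS_mx.
have e1 : mX * mS mx g = mS mx (psiV D g) * mX by rewrite (pb_SX pb) psiVK.
rewrite mX_ddiff -(endoM mX) e1 endoM mX_ddiff efunD -(endoM (mL _) (mS _ _)).
have e : mL (XR la) * mS (lft la) g = mS (lft la) (psiV D g) * mL (XR la).
  rewrite !mS_lft; apply/esym; apply: mSl_mL => q.
  by rewrite (S_X hR) -ppart_psi psiVK.
rewrite e -(endoM (mS mx _) tele_last) -(endoM tele_last (mS _ _)) (tele_r D mF) ?psiVK; last by rewrite eq_sym neq_lift.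
by rewrite opprD addrACA subrr addr0.
Qed.


Lemma ddiff_Sne i g : i != la -> mS (lft i) g * ddiff = ddiff * mS (lft i) g.
Proof.
move=> ne; apply: (@ddiff_ind unit (fun=> mS (lft i) g) (fun=> mS (lft i) g) id) => // [_ u f|_ u].
  by rewrite mS_lft /= /mSl_val /= !mulr0 addr0.
rewrite mX_ddiff -(endoM mX) -(pb_SXne pb) endoM mX_ddiff efunD -(endoM (mL _) (mS _ _)) -mSl_XR //.
rewrite -(endoM (mS _ _) tele_last) -(endoM tele_last (mS _ _)) (tele_ne D mF) ?laP //; last by rewrite eq_sym neq_lift.
  by rewrite opprD addrACA subrr addr0.
by rewrite eq_sym neq_lift.
Qed.

Lemma ddiff_S i g : ddiff * mS (lft i) g = mS (tperm (lft la) mx (lft i)) g * ddiff.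
Proof.
have [->|ne] := eqVneq i la; first by rewrite tpermL ddiff_Smx.
by rewrite tpermD ?ddiff_Sne // ?neq_lift // eq_sym laP.
Qed.

Lemma ddiff_mL r : r * XR la = XR la * r -> mL r * tele_last = tele_last * mL r -> mL r * ddiff = ddiff * mL r.
Proof.
move=> rX rt; apply: (@ddiff_ind unit (fun=> mL r) (fun=> mL r) id) => // [_ u f|_ u].
  by rewrite /= mulr0.
rewrite mX_ddiff -(endoM mX) -(mL_mXx hR) endoM mX_ddiff efunD -(endoM (mL _) (mL _)) -mLM -rX mLM.
by rewrite -(endoM (mL _) tele_last) -(endoM tele_last (mL _)) rt opprD addrACA subrr addr0.
Qed.

Lemma ltn_la (x : 'I_m.+1) : (x < la)%N = (x != la).
Proof. by rewrite -val_eqE ltn_neqAle -ltnS ltn_ord andbT. Qed.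

Lemma ddiff_P (s : 'S_m.+1) : s la = la -> mP s * ddiff = ddiff * mP s.
Proof.
move=> hs; have hd := affine_drinfeld hS hR; apply: ddiff_mL.
  have := P_Y hd s la; rewrite hs mulrBr mulrBl => e.
  have : PR s * JM D SR PR la = JM D SR PR la * PR s.
    rewrite -{2}hs; apply: (JM_P D hS) => l; rewrite hs.
    by rewrite !ltn_la -{2}hs (inj_eq (@perm_inj _ s)).
  by move=> e'; apply: (subIr (JM D SR PR la * PR s)); rewrite -{1}e'.
rewrite /tele_last [mL _ * _](tele_P D _ _ (pb_PS pb s)); congr (tele _ _ _ _ * _).
  by rewrite lp_lft hs.
by rewrite lp_mx.
Qed.
End Divided.

(** * Equivariant extensions of functionals *)

Section Restrict.
Variable n : nat.
Local Notation mx := (@ord_max n).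
Local Notation lp := (lift_perm mx mx).
(** The permutation of the lower indices that induces p, with the default value 1 if p moves the
    last index. *)
Definition lower_perm (p : 'S_n.+1) : 'S_n :=
  if pselect (exists s, p = lp s) is left h then sval (cid h) else 1%g.
Lemma lower_permK (s : 'S_n) : lower_perm (lp s) = s.
Proof.
rewrite /lower_perm; case: pselect => [h|[]]; last by exists s.
by case: (cid h) => s' /= /lp_inj.
Qed.
Lemma lift_lower_perm (p : 'S_n.+1) : p mx = mx -> lp (lower_perm p) = p.
Proof. by move=> /stab_lp[s ->]; rewrite lower_permK. Qed.
End Restrict.

Section Intertwiner.
Variables (k : comNzRingType) (F : frobenius_superalgebra k) (D : cyclotomic_datum F).
Variables (R : pzRingType) (ka : {rmorphism k -> R}) (m : nat).
Variables (XR : 'I_m.+1 -> R) (SR : 'I_m.+1 -> F -> R) (PR : 'S_m.+1 -> R).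
Hypothesis hR : affine D ka XR SR PR.
Local Notation mx := (@ord_max m.+1).
Local Notation lft := (lift mx).
Local Notation lp := (lift_perm mx mx).
Local Notation la := (@ord_max m).
Local Notation func := (functional F ka).
Local Notation mS := (mS hR).
Local Notation mP := (mP hR).
Local Notation mY := (mY hR).
Local Notation mL := (mL hR).
Local Notation ddiff := (ddiff hR).
Let pb := mS_parabolic hR.
Let hd := pb_dri pb.
Local Notation coind := (coind mP).
Local Notation coP := (coP mP).
Local Notation coS := (coS pb).
Local Notation coY := (coY pb).
Local Notation g_ j := (tperm (lft j) mx).

Lemma mPM s t : mP s * mP t = mP (t * s)%g. Proof. exact: pb_PM pb s t. Qed.
Lemma mP1 : mP 1%g = 1. Proof. exact: pb_P1 pb. Qed.

Definition dconj j : endo func := mP (tperm j la) * ddiff * mP (tperm j la).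

(** The coset of p is represented by the transposition that exchanges the last index with its
    preimage. At 1 the value is c, at the last transposition s it is the divided difference of c,
    and the remaining values are dictated by conjugation with S_n. *)
Definition equi_fun (c : func) (p : 'S_m.+2) : func :=
  if unlift mx ((p^-1)%g mx) is Some j then mP (lower_perm (g_ j * p)%g) (dconj j c)
  else mP (lower_perm p) c.

Fact equi_eq c p s : equi_fun c (p * lp s)%g = mP s (equi_fun c p).
Proof.
have e : ((p * lp s)^-1)%g mx = (p^-1)%g mx.
  by rewrite invMg lift_permV permM lp_mx.
rewrite /equi_fun e; case: (unliftP mx ((p^-1)%g mx)) => [j|] ep.
  have hq : (g_ j * p)%g mx = mx by rewrite permM tpermR -ep permKV.
  by rewrite mulgA -{1}(lift_lower_perm hq) lpM lower_permK -mPM.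
have hq : p mx = mx by rewrite -{1}ep permKV.
by rewrite -{1}(lift_lower_perm hq) lpM lower_permK -mPM.
Qed.
Definition equi c : coind := Coind (equi_eq c).

Lemma equi1 c : equi c 1%g = c.
Proof.
rewrite /= /equi_fun invg1 perm1 unlift_none.
by rewrite -(lift_perm1 mx) lower_permK mP1.
Qed.
Lemma equi_g c j : equi c (g_ j) = dconj j c.
Proof.
by rewrite /= /equi_fun tpermV tpermR liftK tperm2 -(lift_perm1 mx) lower_permK mP1.
Qed.
Lemma equiD c d : equi (c + d) = equi c + equi d.
Proof.
apply: coindP => p; rewrite /= /equi_fun.
by case: unlift => [j|]; rewrite ?[dconj j (c + d)]efunD efunD.
Qed.
Lemma equiZ a c : equi (a *: c) = a *: equi c.
Proof.
apply: coindP => p; rewrite /= /equi_fun.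
by case: unlift => [j|]; rewrite ?[dconj j (a *: c)]efunZ efunZ.
Qed.

(** The transpositions with the last index, and 1, represent the cosets of S_n. *)
Lemma coind_ext (u v : coind) : u 1%g = v 1%g -> (forall j, u (g_ j) = v (g_ j)) -> u = v.
Proof.
move=> h1 hg; apply: coindP => p.
case: (unliftP mx ((p^-1)%g mx)) => [j|] ep.
  have hq : (g_ j * p)%g mx = mx by rewrite permM tpermR -ep permKV.
  have -> : p = (g_ j * lp (lower_perm (g_ j * p)))%g by rewrite lift_lower_perm // mulgA tperm2 mul1g.
  by rewrite !coeq hg.
have hq : p mx = mx by rewrite -{1}ep permKV.
by rewrite -(lift_lower_perm hq) -[lp _]mul1g !coeq h1.
Qed.

(** The lower algebra acts on the vector [equi c] through c. *)
Definition intertwines (G : endo coind) (g : endo func) := forall c, G (equi c) = equi (g c).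

Lemma itwD G g G' g' : intertwines G g -> intertwines G' g' -> intertwines (G + G') (g + g').
Proof. by move=> h h' c; rewrite !endoD h h' equiD. Qed.
Lemma itwM G g G' g' : intertwines G g -> intertwines G' g' -> intertwines (G * G') (g * g').
Proof. by move=> h h' c; rewrite !endoM h' h. Qed.
Lemma itw0 : intertwines 0 0.
Proof. by move=> c; apply: (addIr (equi 0)); rewrite -equiD add0r add0r. Qed.
Lemma itw_sum (I : finType) (Q : pred I) G g : (forall i, Q i -> intertwines (G i) (g i)) ->
  intertwines (\sum_(i | Q i) G i) (\sum_(i | Q i) g i).
Proof. by move=> h; apply: (big_rec2 intertwines) => [|i x y hi hxy]; [exact: itw0|apply: itwD (h i hi) hxy]. Qed.

Lemma dconj_P s j : mP s * dconj ((s^-1)%g j) = dconj j * mP s.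
Proof.
set i := (s^-1)%g j; have si : s i = j by rewrite permKV.
pose r := (tperm i la * s * tperm j la)%g.
have hr : r la = la by rewrite /r !permM tpermR si tpermL.
rewrite /dconj !mulrA mPM.
have -> : (tperm i la * s)%g = (r * tperm j la)%g by rewrite /r -mulgA tperm2 mulg1.
rewrite -mPM -[_ * mP r * ddiff]mulrA (ddiff_P hR hr) !mulrA -!mulrA !mPM.
by rewrite /r !mulgA tperm2 mul1g.
Qed.

Lemma itw_P s : intertwines (coP (lp s)) (mP s).
Proof.
move=> c; apply: coind_ext => [|j]; rewrite coPE.
  by rewrite mulg1 -[lp s]mul1g coeq !equi1.
rewrite equi_g -endoM -dconj_P endoM -equi_g.
have e : j = s ((s^-1)%g j) by rewrite permKV.
by rewrite {1}e tperm_lp coeq.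
Qed.

Lemma dconj_S j i f : dconj j * mS (lft i) f = mS (g_ j (lft i)) f * dconj j.
Proof.
rewrite /dconj -mulrA (pb_PS pb) mulrA -[mP _ * ddiff * _]mulrA.
rewrite lp_lft (ddiff_S hR) [mP _ * (_ * _)]mulrA (pb_PS pb) -lp_lft !mulrA.
set q := lp (tperm j la).
congr (mS _ f * _ * _ * _).
have -> : g_ j = (tperm (lft la) mx ^ q)%g by rewrite tpermJ lp_lft lp_mx tpermR.
have {2}-> : lft i = q (q (lft i)) by rewrite -permM /q lpM tperm2 lift_perm1 perm1.
by rewrite permJ.
Qed.

Lemma itw_S i f : intertwines (coS (lft i) f) (mS (lft i) f).
Proof.
move=> c; apply: coind_ext => [|j]; rewrite coSE; first by rewrite !equi1 perm1.
by rewrite !equi_g -!endoM dconj_S.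
Qed.

Lemma ddiff_Y l : l != la -> mY l * ddiff = ddiff * mY l.
Proof.
move=> ll; rewrite /mY mLB mulrBl mulrBr; congr (_ - _).
  apply: ddiff_mL; first exact: X_X hR _ _.
  rewrite mulr_sumr mulr_suml; apply: eq_bigr => b _.
  have e : mS (lft la) (bas D b) * mL (XR l) = mL (XR l) * mS (lft la) (bas D b).
    by rewrite mS_lft; apply: mSl_mL => q; rewrite (S_Xne hR) // eq_sym.
  by rewrite mulrA -e -!mulrA mS_mx mL_mSx.
rewrite (morph_sum _ _ _ (mLD hR)) mulr_suml mulr_sumr; apply: eq_bigr => a al.
rewrite /tp mLM -tele_mS.
have aal : a != la by rewrite -ltn_la (ltn_trans al) // ltn_la.
rewrite -mulrA [mL _ * ddiff](ddiff_P hR); last by rewrite tpermD // eq_sym.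
rewrite !mulrA; congr (_ * _); rewrite mulr_suml mulr_sumr; apply: eq_bigr => b _.
by rewrite -mulrA (ddiff_Sne hR) // mulrA (ddiff_Sne hR) // mulrA.
Qed.

Lemma ddiff_tele l : l != la ->
  tele D mS (lft l) mx * ddiff = ddiff * mL (tele D SR l la).
Proof.
move=> ll; rewrite -tele_mS mulr_suml mulr_sumr; apply: eq_bigr => b _.
by rewrite -mulrA (ddiff_Smx hR) mulrA (ddiff_Sne hR) // mulrA.
Qed.

Lemma mP_mY s i : mP s * mY i = mY (s i) * mP s.
Proof. exact: P_Y hd s i. Qed.

(** At 1, and at transpositions other than s, both sides are conjugates of each other. At s the
    operator is the last variable minus its Jucys-Murphy element, and the formula for x times a
    divided difference has been made for this case. *)
Lemma itw_Yla : intertwines (coY (lft la)) (mY la).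
Proof.
move=> c; apply: coind_ext => [|j]; rewrite coYE.
  have e : (1%g : 'S_m.+2) (lft la) = lft la by rewrite perm1.
  by rewrite (coY_lft _ _ _ _ _ e) !equi1.
have [->|jl] := eqVneq j la; last first.
  have e : g_ j (lft la) = lft la.
    by rewrite tpermD // ?neq_lift // (inj_eq (@lift_inj _ _)).
  rewrite (coY_lft _ _ _ _ _ e) !equi_g -!endoM /dconj -!mulrA mP_mY tpermR.
  by rewrite [ddiff * (_ * _)]mulrA -ddiff_Y // !mulrA mP_mY tpermL.
have e : g_ la (lft la) = mx by rewrite tpermL.
rewrite (coY_mx _ _ _ _ _ e) !equi_g /dconj tperm1 mP1 mul1r mulr1 mX_ddiff.
rewrite (bigD1 la) // tperm2 equi1 -/(tele_last hR) opprD addrA addrK.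
rewrite /mY mLB -[(mL _ - _) c]/(mL (XR la) c - mL (JM D SR PR la) c) endo_Br; congr (_ - _).
rewrite /JM (morph_sum _ _ _ (mLD hR)) endo_sum (morph_sum _ _ _ (efunD ddiff)).
apply: eq_big => [l|l ll]; first by rewrite ltn_la.
have -> : (g_ la * g_ l)%g = (g_ l * lp (tperm la l))%g.
  have e1 : g_ l (lft la) = lft la by rewrite tpermD ?neq_lift // (inj_eq (@lift_inj _ _)).
  by rewrite [LHS]conjgC tpermJ e1 tpermR lp_tp.
have e2 : mP (tperm la l) * dconj l = ddiff * mP (tperm l la).
  by rewrite /dconj !mulrA mPM tpermC tperm2 mP1 mul1r.
rewrite coeq equi_g -[mP _ (dconj l c)]endoM e2 endoM.
by rewrite -(endoM (tele D mS (lft l) mx) ddiff) ddiff_tele // /tp mLM !endoM.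
Qed.

Lemma itw_Y i : intertwines (coY (lft i)) (mY i).
Proof.
pose s := tperm i la.
have -> : coY (lft i) = coP (lp s) * coY (lft la) * coP (lp s).
  by rewrite (co_P_Y pb) lp_lft tpermR -mulrA (P_M (co_slots pb)) lpM tperm2 lift_perm1
    (P_1 (co_slots pb)) mulr1.
have -> : mY i = mP s * mY la * mP s.
  by rewrite mP_mY tpermR -mulrA mPM tperm2 mP1 mulr1.
by do !apply: itwM; [exact: itw_P|exact: itw_Yla|exact: itw_P].
Qed.

Definition coX i := coY i + JM D coS coP i.

(** The variables are y_i + J_i, where J_i belongs to the lower algebra. *)
Lemma itw_X i : intertwines (coX (lft i)) (mL (XR i)).
Proof.
have -> : mL (XR i) = mY i + mL (JM D SR PR i) by rewrite -mLD subrK.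
apply: itwD; first exact: itw_Y.
rewrite /JM (morph_sum _ _ _ (mLD hR)) big_mkcond big_ord_recr /= ltnNge.
have -> : (lft i <= m.+1)%N by rewrite -ltnS ltn_ord.
rewrite addr0 [X in intertwines _ X]big_mkcond; apply: itw_sum => l _.
have -> : widen_ord (leqnSn m.+1) l = lft l.
  by apply/val_inj; rewrite /= /bump leqNgt ltn_ord.
have -> : (l < bump m.+1 i)%N = (l < i)%N.
  by rewrite /bump [(m < i)%N]leqNgt ltn_ord.
case: ifP => _; last exact: itw0.
rewrite /tp mLM -tele_mS; apply: itwM; last by rewrite -lp_tp; exact: itw_P.
by apply: itw_sum => b _; apply: itwM; exact: itw_S.
Qed.

End Intertwiner.

(** * Towers and their filtrations *)

(** The affine algebras and their cyclotomic quotients both form towers. What follows only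
    depends on the data listed here, so it applies to both. *)
Record tower (k : comNzRingType) (F : frobenius_superalgebra k) (D : cyclotomic_datum F) := Tower {
  tw :> nat -> pzRingType;
  twk : forall n, {rmorphism k -> tw n};
  twX : forall n, 'I_n -> tw n;
  twS : forall n, 'I_n -> F -> tw n;
  twP : forall n, 'S_n -> tw n;
  tw_affine : forall n, affine D (twk n) (@twX n) (@twS n) (@twP n);
  up : forall n, {rmorphism tw n -> tw n.+1};
  up_k : forall n a, up n (twk n a) = twk n.+1 a;
  up_X : forall n i, up n (twX i) = twX (lift ord_max i);
  up_S : forall n i f, up n (twS i f) = twS (lift ord_max i) f;
  up_P : forall n (s : 'S_n), up n (twP s) = twP (lift_perm ord_max ord_max s);
  tw_ind : forall n (Z : tw n -> Prop),
    (forall a, Z (twk n a)) -> (forall u v, Z u -> Z v -> Z (u + v)) ->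
    (forall u v, Z u -> Z v -> Z (u * v)) ->
    (forall i, Z (twX i)) -> (forall i a f, fs_gr a f -> Z (twS i f)) ->
    (forall s, Z (twP s)) -> forall u, Z u }.
Arguments up {k F D} t {n}.
Arguments twX {k F D} t {n} i.
Arguments twS {k F D} t {n} i f.
Arguments twP {k F D} t {n} s.
Arguments twk {k F D} t n.

Section Filtration.
Variables (k : comNzRingType) (F : frobenius_superalgebra k) (D : cyclotomic_datum F).
Variable T : tower D.
Local Notation lft := (lift ord_max).
Local Notation lp := (lift_perm ord_max ord_max).
Local Notation up := (@up _ _ _ T _).
Local Notation X := (twX T).
Local Notation S := (twS T).
Local Notation P := (twP T).
Local Notation g_ l := (tperm (lft l) ord_max).
Local Notation x := (X ord_max).
Let hS n := aff_slots (tw_affine T n).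

Lemma S_D n (i : 'I_n) f g : S i (f + g) = S i f + S i g.
Proof. exact: slotD (hS n) i f g. Qed.
Lemma S_sgD n (i : 'I_n) q f g : S i (sgF D q (f + g)) = S i (sgF D q f) + S i (sgF D q g).
Proof. by rewrite -S_D; congr (S i _); exact: linearD. Qed.
Lemma S_0 n (i : 'I_n) : S i 0 = 0 :> T n.
Proof. exact: slot0 (hS n) i. Qed.
Lemma S_sign n (i : 'I_n) (b : bool) f : S i ((-1) ^+ b *: f) = (-1) ^+ b * S i f.
Proof. exact: slot_sign (hS n) i b f. Qed.
Lemma P_mul n (s t : 'S_n) : P s * P t = P (t * s)%g. Proof. exact: P_M (hS n) s t. Qed.
Lemma P_one n : P (1%g : 'S_n) = 1. Proof. exact: P_1 (hS n). Qed.
Lemma P_slot n (s : 'S_n) i f : P s * S i f = S (s i) f * P s. Proof. exact: P_S (hS n) s i f. Qed.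
Lemma S_mul n (i : 'I_n) f g : S i (f * g) = S i f * S i g. Proof. exact: S_M (hS n) i f g. Qed.
Lemma S_one n (i : 'I_n) : S i 1 = 1 :> T n. Proof. exact: S_1 (hS n) i. Qed.
Lemma P_g2 n (l : 'I_n) : P (g_ l) * P (g_ l) = 1 :> T n.+1.
Proof. by rewrite P_mul tperm2 P_one. Qed.

Section Level.
Variable n : nat.
Local Notation mx := (@ord_max n).

Lemma x_up (r : T n) : x * up r = up r * x.
Proof.
elim/tw_ind: r => [a|u v hu hv|u v hu hv|i|i a f _|s].
- by rewrite up_k (kaC (hS n.+1)).
- by rewrite rmorphD mulrDl mulrDr hu hv.
- by rewrite rmorphM mulrA hu -mulrA hv mulrA.
- by rewrite up_X (X_X (tw_affine T n.+1)).
- by rewrite up_S (S_Xne (tw_affine T n.+1)) // eq_sym neq_lift.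
rewrite up_P; elim/perm_adj_ind: s => [|s t hs ht|i i' hi].
- by rewrite lift_perm1 P_one mulr1 mul1r.
- by rewrite -lpM -P_mul mulrA ht -mulrA hs mulrA.
- rewrite lp_tp; apply/esym; apply: (P_Xne (tw_affine T n.+1)); rewrite ?neq_lift //.
  by rewrite !lift_max hi.
Qed.
Lemma xX_up b (r : T n) : x ^+ b * up r = up r * x ^+ b.
Proof. by apply/esym/commrX/esym/x_up. Qed.

(** An element of the lower algebra need not be homogeneous; r0 and r1 are its parity
    components. *)
Lemma slot_past (r : T n) : exists r0 r1, forall f,
  S mx f * up r = up r0 * S mx f + up r1 * S mx (sgF D true f).
Proof.
elim/tw_ind: r => [a|u v [u0 [u1 hu]] [v0 [v1 hv]]|u v [u0 [u1 hu]] [v0 [v1 hv]]|i|i [d p] f hf|s].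
- exists (twk T n a), 0 => f.
  by rewrite rmorph0 mul0r addr0 up_k (kaC (hS n.+1)).
- exists (u0 + v0), (u1 + v1) => f.
  by rewrite !rmorphD mulrDr hu hv !mulrDl addrACA.
- exists (u0 * v0 + u1 * v1), (u0 * v1 + u1 * v0) => f.
  rewrite !rmorphD !rmorphM mulrA hu mulrDl -!mulrA !hv.
  rewrite sgF_addb /= !mulrDr !mulrDl !mulrA -!addrA; congr (_ + _).
  by rewrite [RHS]addrC -!addrA; congr (_ + _); rewrite addrC.
- exists (X i), 0 => f; rewrite rmorph0 mul0r addr0 up_X.
  by rewrite (S_Xne (tw_affine T n.+1)) // neq_lift.
- exists (if p then 0 else S i f), (if p then S i f else 0) => g.
  elim/gr_ind: g => [|u v hu hv|[e q] g hg].
  + by rewrite linear0 !S_0 !mulr0 mul0r addr0.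
  + by rewrite S_sgD (S_D mx u v) mulrDl hu hv !mulrDr addrACA.
  rewrite up_S (S_comm (hS n.+1) (neq_lift _ _) hg hf) (sgFE D true hg) S_sign.
  rewrite andbT -up_S; case: p {hf}; rewrite ?andbT ?andbF rmorph0 mul0r ?add0r ?addr0 ?mul1r //.
  by rewrite mul_signCA.
- exists (P s), 0 => f; rewrite rmorph0 mul0r addr0 up_P P_slot.
  by rewrite lift_perm_id.
Qed.

Lemma past_slot (r : T n) : exists r0 r1, forall f,
  up r * S mx f = S mx f * up r0 + S mx (sgF D true f) * up r1.
Proof.
elim/tw_ind: r => [a|u v [u0 [u1 hu]] [v0 [v1 hv]]|u v [u0 [u1 hu]] [v0 [v1 hv]]|i|i [d p] f hf|s].
- exists (twk T n a), 0 => f.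
  by rewrite rmorph0 mulr0 addr0 up_k (kaC (hS n.+1)).
- exists (u0 + v0), (u1 + v1) => f.
  by rewrite !rmorphD mulrDl hu hv !mulrDr addrACA.
- exists (u0 * v0 + u1 * v1), (u1 * v0 + u0 * v1) => f.
  rewrite !rmorphD !rmorphM -mulrA hv mulrDr !mulrA !hu.
  rewrite sgF_addb /= !mulrDr !mulrDl !mulrA -!addrA; congr (_ + _).
  by rewrite [LHS]addrC -!addrA addrC -!addrA; congr (_ + _); rewrite addrC.
- exists (X i), 0 => f; rewrite rmorph0 mulr0 addr0 up_X.
  by rewrite (S_Xne (tw_affine T n.+1)) // neq_lift.
- exists (if p then 0 else S i f), (if p then S i f else 0) => g.
  elim/gr_ind: g => [|u v hu hv|[e q] g hg].
  + by rewrite linear0 !S_0 !mulr0 !mul0r addr0.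
  + by rewrite S_sgD (S_D mx u v) mulrDr hu hv !mulrDl addrACA.
  have ne : lft i != mx by rewrite eq_sym neq_lift.
  rewrite up_S (S_comm (hS n.+1) ne hf hg) (sgFE D true hg) S_sign.
  rewrite andbT -up_S; case: p {hf}; rewrite ?andbT ?andbF rmorph0 mulr0 ?add0r ?addr0 ?mul1r //.
  by rewrite mulrA.
- exists (P s), 0 => f; rewrite rmorph0 mulr0 addr0 up_P P_slot.
  by rewrite lift_perm_id.
Qed.

(** The filtration by the exponent of the last variable, all terms that involve a transposition
    with the last index being put in degree 0. *)
Inductive fil (a : nat) : T n.+1 -> Prop :=
  | fil_0 : fil a 0
  | fil_D u v : fil a u -> fil a v -> fil a (u + v)
  | fil_pol r b f : (b < a)%N -> fil a (up r * (x ^+ b * S mx f))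
  | fil_s l r r' : fil a (up r * P (g_ l) * up r').

Lemma fil_sum a (I : Type) (s : seq I) (Q : pred I) c :
  (forall i, Q i -> fil a (c i)) -> fil a (\sum_(i <- s | Q i) c i).
Proof. by move=> h; apply: (big_ind (fil a)) => //; [exact: fil_0|exact: fil_D]. Qed.

Lemma fil_xS a b f : (b < a)%N -> fil a (x ^+ b * S mx f).
Proof. by move=> h; rewrite -[_ * _]mul1r -(rmorph1 up); exact: fil_pol. Qed.
Lemma fil_P a l : fil a (P (g_ l)).
Proof. by rewrite -[P _]mul1r -[_ * _]mulr1 -(rmorph1 up); exact: fil_s. Qed.

Lemma fil_upl a r h : fil a h -> fil a (up r * h).
Proof.
elim=> {h} [|u v _ hu _ hv|q b f hb|l q q'].
- by rewrite mulr0; exact: fil_0.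
- by rewrite mulrDr; exact: fil_D.
- by rewrite mulrA -rmorphM; exact: fil_pol.
- by rewrite !mulrA -rmorphM; exact: fil_s.
Qed.

Lemma fil_N a h : fil a h -> fil a (- h).
Proof. by move=> hh; rewrite -mulN1r -(rmorphN1 up); exact: fil_upl. Qed.
Lemma fil_B a u v : fil a u -> fil a v -> fil a (u - v).
Proof. by move=> hu hv; apply: fil_D => //; exact: fil_N. Qed.

Lemma fil_upr a r h : fil a h -> fil a (h * up r).
Proof.
elim=> {h} [|u v _ hu _ hv|q b f hb|l q q'].
- by rewrite mul0r; exact: fil_0.
- by rewrite mulrDl; exact: fil_D.
- have [r0 [r1 h]] := slot_past r.
  rewrite -!mulrA h !mulrDr; apply: fil_D; apply: fil_upl.
    by rewrite mulrA xX_up -mulrA; exact: fil_pol.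
  by rewrite mulrA xX_up -mulrA; exact: fil_pol.
- by rewrite -!mulrA -rmorphM mulrA; exact: fil_s.
Qed.

Lemma fil_mono a b h : (a <= b)%N -> fil a h -> fil b h.
Proof.
move=> ab; elim=> {h} [|u v _ hu _ hv|q c f hc|l q q'].
- exact: fil_0.
- exact: fil_D.
- by apply: fil_pol; exact: leq_trans hc ab.
- exact: fil_s.
Qed.

Lemma fil_tele l b : fil b.+1 (x ^+ b * tele D (@twS _ _ _ T n.+1) (lft l) mx).
Proof.
rewrite mulr_sumr; apply: fil_sum => c _.
by rewrite -up_S mulrA xX_up -mulrA; exact: fil_pol.
Qed.
End Level.

Section Step.
Variable m : nat.
Local Notation mx := (@ord_max m.+1).
Local Notation la := (@ord_max m).
Local Notation s := (P (g_ la) : T m.+2).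
Local Notation x' := (up (x : T m.+1)).
Local Notation te := (tele D (@twS _ _ _ T m.+2)).

Lemma s_x' : s * x' = x * s - te (lft la) mx.
Proof.
by rewrite up_X; apply: (P_X (tw_affine T m.+2)); rewrite lift_max.
Qed.
Lemma s_tele i j : s * te i j = te (g_ la i) (g_ la j) * s.
Proof. exact: (tele_P D _ _ (P_slot (g_ la))). Qed.
Lemma s_x : s * x = x' * s + te mx (lft la).
Proof.
have := congr1 (fun h => s * h * s) s_x'.
rewrite /= mulrA P_g2 mul1r => ->.
rewrite mulrBr mulrBl s_tele tpermL tpermR -!mulrA P_g2 !mulr1.
by rewrite subrK.
Qed.

Lemma P_gE l : P (g_ l) = up (P (tperm l la)) * s * up (P (tperm l la)).
Proof.
rewrite up_P !P_mul; congr twP.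
have e : lp (tperm l la) = (lp (tperm l la))^-1%g by rewrite lift_permV tpermV.
by rewrite mulgA {1}e -mulgA -conjgE tpermJ lp_lft lp_mx tpermR.
Qed.

Lemma fil_x a (h : T m.+2) : fil a h -> fil a.+1 (x * h).
Proof.
elim=> {h} [|u v _ hu _ hv|q b f hb|l q q'].
- by rewrite mulr0; exact: fil_0.
- by rewrite mulrDr; exact: fil_D.
- by rewrite mulrA x_up -mulrA [x * _]mulrA -exprS; exact: fil_pol.
rewrite !mulrA x_up P_gE !mulrA -(mulrA (up q)) x_up mulrA -[_ * x * s]mulrA.
have -> : x * s = s * x' + te (lft la) mx by rewrite s_x' subrK.
rewrite mulrDr !mulrDl; apply: fil_D; apply: fil_upr; apply: fil_upr.
  by rewrite -rmorphM mulrA; exact: fil_s.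
rewrite -rmorphM; apply: fil_upl; rewrite -[te _ _]mul1r -(expr0 x).
exact: fil_mono (fil_tele _ _).
Qed.

(** Each factor x' moves through s by s x' = x s - t. The correction t lies in degree 0 because
    its last slot can be carried across to s, where it becomes a slot of the lower algebra. *)
Lemma fil_conj_x a f : fil a (s * up (x ^+ a * S la f) * s - x ^+ a * S mx f).
Proof.
elim: a => [|a IH].
  rewrite !expr0 !mul1r up_S P_slot tpermL -mulrA P_g2 mulr1 subrr; exact: fil_0.
have -> : s * up (x ^+ a.+1 * S la f) * s - x ^+ a.+1 * S mx f =
    x * (s * up (x ^+ a * S la f) * s - x ^+ a * S mx f)
    - te (lft la) mx * up (x ^+ a * S la f) * s.
  rewrite mulrBr addrAC !mulrA -!mulrBl -s_x' -exprS; congr (_ * _ - _).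
  by rewrite -!mulrA -rmorphM exprS mulrA.
apply: fil_B; first exact: fil_x.
rewrite -!mulrA mulr_suml; apply: fil_sum => b _; rewrite -up_S -mulrA; apply: fil_upl.
have [r0 [r1 h]] := slot_past (x ^+ a * S la f : T m.+1).
have sm g : S mx g * s = s * up (S la g) by rewrite up_S P_slot tpermL.
rewrite mulrA h mulrDl -!mulrA !sm; apply: fil_D; rewrite mulrA; exact: fil_s.
Qed.

(** The transposition of the last two indices commutes with the algebra two levels below. *)
Lemma s_up2 (r : T m) : s * up (up r) = up (up r) * s.
Proof.
elim/tw_ind: r => [a|u v hu hv|u v hu hv|i|i a f _|p].
- by rewrite !up_k (kaC (hS m.+2)).
- by rewrite !rmorphD mulrDl mulrDr hu hv.
- by rewrite !rmorphM mulrA hu -mulrA hv mulrA.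
- rewrite !up_X; apply: (P_Xne (tw_affine T m.+2)); rewrite ?lift_max //.
    by rewrite (inj_eq (@lift_inj _ _)) eq_sym neq_lift.
  by rewrite eq_sym neq_lift.
- rewrite !up_S P_slot tpermD // ?neq_lift // (inj_eq (@lift_inj _ _)).
  exact: neq_lift.
rewrite !up_P !P_mul; congr twP.
by have := tperm_lp (lp p) la; rewrite lp_mx.
Qed.

(** By the previous lemmas conjugation by s carries x'^b f' to x^b f up to lower terms, and
    s P s is again a transposition with the last index. *)
Lemma fil_conj a (h : T m.+1) : fil a h -> fil a (s * up h * s).
Proof.
elim=> {h} [|u v _ hu _ hv|q b f hb|l q q'].
- by rewrite rmorph0 mulr0 mul0r; exact: fil_0.
- by rewrite rmorphD mulrDr mulrDl; exact: fil_D.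
- rewrite rmorphM mulrA s_up2 -!mulrA; apply: fil_upl; rewrite mulrA.
  rewrite -[_ * _](subrK (x ^+ b * S mx f)); apply: fil_D; last exact: fil_xS.
  exact: fil_mono (ltnW hb) (fil_conj_x _ _).
rewrite !rmorphM -!mulrA -s_up2 !mulrA s_up2 -!mulrA.
apply: fil_upl; rewrite !mulrA; apply: fil_upr.
rewrite up_P !P_mul lp_tp.
have -> : (g_ la * (tperm (lft (lft l)) (lft la) * g_ la))%g = g_ (lft l) :> 'S_m.+2.
  rewrite -{1}[g_ la]tpermV -conjgE tpermJ tpermL tpermD // ?neq_lift //.
  by rewrite (inj_eq (@lift_inj _ _)) neq_lift.
exact: fil_P.
Qed.

End Step.

Lemma x_S_x n b f : x ^+ b * S (@ord_max n) f * x = x ^+ b.+1 * S ord_max (psi D f) :> T n.+1.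
Proof. by rewrite -mulrA (S_X (tw_affine T n.+1)) mulrA exprSr. Qed.

Lemma fil_Px n (l : 'I_n) : fil 1 (P (g_ l) * x).
Proof.
case: n l => [[]//|m] l.
rewrite P_gE -!mulrA -x_up [P (g_ ord_max) * _]mulrA s_x.
apply: fil_upl; apply: fil_upr.
apply: fil_D; first by rewrite -[_ * _]mulr1 -(rmorph1 up); exact: fil_s.
apply: fil_sum => b _.
have [r0 [r1 h]] := slot_past (S ord_max (dual_bas D b) : T m.+1).
rewrite -up_S h; apply: fil_D; apply: fil_upl; rewrite -[S _ _]mul1r -(expr0 x); exact: fil_xS.
Qed.

Lemma fil_xP n b (l : 'I_n) : fil b (x ^+ b * P (g_ l)).
Proof.
case: n l => [[]//|m] l.
rewrite P_gE !mulrA xX_up -!mulrA; apply: fil_upl; rewrite mulrA; apply: fil_upr.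
elim: b => [|b IH]; first by rewrite mul1r; exact: fil_P.
have xs : x * P (g_ ord_max) = P (g_ ord_max) * up x + tele D (@twS _ _ _ T m.+2) (lft ord_max) ord_max.
  by rewrite s_x' subrK.
rewrite exprSr -mulrA xs mulrDr mulrA; apply: fil_D; last exact: fil_tele.
apply: fil_upr; exact: fil_mono IH.
Qed.

Section Exhaust.
Variable n : nat.
Local Notation mx := (@ord_max n).
Local Notation cov h := (exists a, @fil n a h).

Lemma cov_D (u v : T n.+1) : cov u -> cov v -> cov (u + v).
Proof.
move=> [a hu] [b hv]; exists (maxn a b); apply: fil_D.
  exact: fil_mono (leq_maxl _ _) hu.
exact: fil_mono (leq_maxr _ _) hv.
Qed.

Hypothesis cov_PrP : forall (l : 'I_n) (r : T n), cov (P (g_ l) * up r * P (g_ l)).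

Lemma Pg_conj (l l' : 'I_n) :
  P (g_ l) = up (P (tperm l l')) * P (g_ l') * up (P (tperm l l')) :> T n.+1.
Proof.
rewrite up_P !P_mul; congr twP.
have e : lp (tperm l l') = (lp (tperm l l'))^-1%g by rewrite lift_permV tpermV.
by rewrite mulgA {1}e -mulgA -conjgE tpermJ lp_lft lp_mx tpermR.
Qed.

Lemma cov_upl r (h : T n.+1) : cov h -> cov (up r * h).
Proof. by case=> a hh; exists a; exact: fil_upl. Qed.
Lemma cov_upr r (h : T n.+1) : cov h -> cov (h * up r).
Proof. by case=> a hh; exists a; exact: fil_upr. Qed.

Lemma cov_right (t : T n.+1) : (forall r b f, cov (up r * (x ^+ b * S mx f) * t)) ->
  (forall l r r', cov (up r * P (g_ l) * up r' * t)) -> forall h, cov h -> cov (h * t).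
Proof.
move=> h1 h2 h [a hh]; elim: hh => {h} [|u v _ hu _ hv|r b f _|l r r'].
- by exists 0%N; rewrite mul0r; exact: fil_0.
- by rewrite mulrDl; exact: cov_D.
- exact: h1.
- exact: h2.
Qed.

Lemma cov_mulx h : cov h -> cov (h * x).
Proof.
apply: cov_right => [r b f|l r r'].
  by rewrite -mulrA x_S_x; exists b.+2; exact: fil_pol.
rewrite -!mulrA -x_up [P _ * _]mulrA; apply: cov_upl; apply: cov_upr; exists 1%N; exact: fil_Px.
Qed.

Lemma cov_mulS g h : cov h -> cov (h * S mx g).
Proof.
apply: cov_right => [r b f|l r r'].
  by rewrite -!mulrA -S_mul; exists b.+1; exact: fil_pol.
have [r0 [r1 e]] := past_slot r'.
have sm f : P (g_ l) * S mx f = up (S l f) * P (g_ l) by rewrite up_S P_slot tpermR.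
rewrite -!mulrA e !mulrDr ![P _ * (_ * _)]mulrA !sm !mulrA -!rmorphM.
by apply: cov_D; exists 0%N; exact: fil_s.
Qed.

Lemma cov_mulP l h : cov h -> cov (h * P (g_ l)).
Proof.
apply: cov_right => [r b f|l' r r'].
  have sm : S mx f * P (g_ l) = P (g_ l) * up (S l f) by rewrite up_S P_slot tpermL.
  rewrite -!mulrA sm [x ^+ b * _]mulrA; apply: cov_upl; apply: cov_upr; exists b; exact: fil_xP.
rewrite (Pg_conj l' l) -!mulrA; do 2!apply: cov_upl.
have -> : P (g_ l) * (up (P (tperm l' l)) * (up r' * P (g_ l))) =
    P (g_ l) * up (P (tperm l' l) * r') * P (g_ l) by rewrite rmorphM !mulrA.
exact: cov_PrP.
Qed.

Lemma cov_all h : cov h.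
Proof.
have key h' : forall h, cov h -> cov (h * h').
  elim/tw_ind: h' => [a|u v hu hv|u v hu hv|i|i a f _|p] h0 hh.
  - by rewrite -up_k; exact: cov_upr.
  - by rewrite mulrDr; apply: cov_D; [exact: hu|exact: hv].
  - by rewrite mulrA; apply: hv; apply: hu.
  - case: (unliftP mx i) => [j|] ->; last exact: cov_mulx.
    by rewrite -up_X; exact: cov_upr.
  - case: (unliftP mx i) => [j|] ->; last exact: cov_mulS.
    by rewrite -up_S; exact: cov_upr.
  - case: (unliftP mx ((p^-1)%g mx)) => [j|] ep.
      have hq : (g_ j * p)%g mx = mx by rewrite permM tpermR -ep permKV.
      have [q eq] := stab_lp hq.
      have -> : p = (g_ j * lp q)%g by rewrite -eq mulgA tperm2 mul1g.
      rewrite -P_mul mulrA; apply: cov_mulP; rewrite -up_P; exact: cov_upr.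
    have hq : p mx = mx by rewrite -{1}ep permKV.
    by have [q ->] := stab_lp hq; rewrite -up_P; exact: cov_upr.
rewrite -[h]mul1r; apply: key; exists 1%N.
by rewrite -[1]mulr1 -{1}(expr0 x) -(S_one mx); exact: fil_xS.
Qed.
End Exhaust.

(** The union of the filtration is stable under right multiplication by the generators. The only case which
    is not immediate, [P r P] with r in the lower algebra, is conjugation by s, and there r
    is known by induction. *)
Lemma fil_exhaust n (h : T n.+1) : exists a, fil a h.
Proof.
elim: n h => [|m IH]; first by apply: cov_all => -[].
apply: cov_all => l r; have [a hr] := IH (P (tperm l ord_max) * r * P (tperm l ord_max)).
exists a; rewrite P_gE -!mulrA; apply: fil_upl.
rewrite !mulrA; apply: fil_upr.
have := fil_conj hr; rewrite !rmorphM !mulrA; apply.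
Qed.

(** If x^d f has lower order on the first level, then so it has on every level: conjugation by s
    transports the statement from one level to the next. *)
Lemma fil_bounded d : (0 < d)%N ->
  (forall f, fil d (x ^+ d * S (@ord_max 0) f)) -> forall n (h : T n.+1), fil d h.
Proof.
move=> d0 h0.
have key n : (forall f, fil d (x ^+ d * S (@ord_max n) f)) -> forall h : T n.+1, fil d h.
  move=> hd.
  (* By [hd] the filtration is stationary from d on. *)
  have dec h : fil d.+1 h -> fil d (h : T n.+1).
    elim=> {h} [|u v _ hu _ hv|r b f hb|l r r'].
    - exact: fil_0.
    - exact: fil_D.
    - apply: fil_upl; move: hb; rewrite ltnS leq_eqVlt => /orP[/eqP ->|hb]; first exact: hd.
      exact: fil_xS.
    - exact: fil_s.
  have hx h : fil d h -> fil d (x * h : T n.+1).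
    case: n hd h dec => [|m] hd h dec hh; last by apply: dec; exact: fil_x.
    apply: dec; elim: hh => {h} [|u v _ hu _ hv|q b f hb|[] //].
    - by rewrite mulr0; exact: fil_0.
    - by rewrite mulrDr; exact: fil_D.
    - by rewrite mulrA x_up -mulrA [x * _]mulrA -exprS; exact: fil_pol.
  have hp b f : fil d (x ^+ b * S ord_max f : T n.+1).
    elim: b => [|b IH]; first exact: fil_xS.
    by rewrite exprS -mulrA; exact: hx.
  move=> h; have [a ha] := fil_exhaust h.
  elim: ha => {h} [|u v _ hu _ hv|q b f hb|l r r'].
  - exact: fil_0.
  - exact: fil_D.
  - by apply: fil_upl.
  - exact: fil_s.
elim=> [|m IH]; first exact: key.
apply: key => f.
have := @fil_conj_x m d f; set u := _ * _ * _ => hu.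
rewrite -[_ * _](subKr u); apply: fil_B => //.
by apply: fil_conj; exact: IH.
Qed.
End Filtration.

(** * The affine and the cyclotomic towers *)

Section Restriction.
Variables (k : comNzRingType) (F : frobenius_superalgebra k) (D : cyclotomic_datum F).
Variables (A : pzRingType) (ka : {rmorphism k -> A}) (n : nat).
Variables (X : 'I_n.+1 -> A) (S : 'I_n.+1 -> F -> A) (P : 'S_n.+1 -> A).
Hypothesis hA : affine D ka X S P.
Let hS := aff_slots hA.
Local Notation lft := (lift (@ord_max n)).
Local Notation lp := (lift_perm (@ord_max n) (@ord_max n)).

Lemma affine_restrict :
  affine D ka (fun i => X (lft i)) (fun i => S (lft i)) (fun s => P (lp s)).
Proof.
split; first split; first split.
- exact: ka_central hS.
- by move=> i; exact: S_lin hS _.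
- by move=> i; exact: S_1 hS _.
- by move=> i; exact: S_M hS _.
- by move=> i j ij; apply: (S_comm hS); rewrite (inj_eq (@lift_inj _ _)).
- by rewrite lift_perm1 (P_1 hS).
- by move=> s t; rewrite (P_M hS) lpM.
- by move=> s i f; rewrite (P_S hS) lp_lft.
- by move=> i j; exact: X_X hA _ _.
- by move=> i f; exact: S_X hA _ _.
- by move=> i j f ij; apply: (S_Xne hA); rewrite (inj_eq (@lift_inj _ _)).
- move=> i i' j hi h1 h2; rewrite lp_tp; apply: (P_Xne hA); rewrite ?lift_max ?(inj_eq (@lift_inj _ _)) //.
- by move=> i i' hi; rewrite lp_tp; apply: (P_X hA); rewrite !lift_max.
Qed.
End Restriction.

Section Towers.
Variables (k : comNzRingType) (F : frobenius_superalgebra k) (D : cyclotomic_datum F).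
Local Notation lft := (lift ord_max).
Local Notation lp := (lift_perm ord_max ord_max).

Definition aff_id n (t u : term k (agen F n)) (h : aff_rel D t u) : aff_rel D t u := h.
Definition aff_up n : {rmorphism affH D n -> affH D n.+1} :=
  aff_fun (affine_restrict (cS_affine (@aff_id n.+1))).

Definition aff_tower : tower D :=
  @Tower k F D (affH D) (fun n => pin _) (fun n => cX _) (fun n => cS _) (fun n => cP _)
    (fun n => cS_affine (@aff_id n)) aff_up
    (fun n => aff_fun_k _) (fun n => aff_fun_X _) (fun n => aff_fun_S _) (fun n => aff_fun_P _)
    (fun n => gen_ind (@aff_id n)).

Lemma cyc_up_k n a : cyc_incl D n (pin (@cyc_rel k F D n) a) = pin _ a.
Proof. exact: (@incl_in k F D n a). Qed.
Lemma cyc_up_X n i : cyc_incl D n (cX (@cyc_rel k F D n) i) = cX _ (lft i).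
Proof. exact: (pres_liftE (@incl_rel k F D n)). Qed.
Lemma cyc_up_S n i f : cyc_incl D n (cS (@cyc_rel k F D n) i f) = cS _ (lft i) f.
Proof. by rewrite [LHS](pres_liftE (@incl_rel k F D n)) /= /incl_val /= ext_slot. Qed.
Lemma cyc_up_P n s : cyc_incl D n (cP (@cyc_rel k F D n) s) = cP _ (lp s).
Proof. exact: (pres_liftE (@incl_rel k F D n)). Qed.

Definition cyc_tower : tower D :=
  @Tower k F D (cyc_alg D) (fun n => pin _) (fun n => cX _) (fun n => cS _) (fun n => cP _)
    (fun n => cS_affine (@cr_aff k F D n)) (fun n => cyc_incl D n)
    cyc_up_k cyc_up_X cyc_up_S cyc_up_P
    (fun n => gen_ind (@cr_aff k F D n)).

(** The projection of the affine algebra onto its cyclotomic quotient. *)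
Definition quo n : {rmorphism aff_tower n -> cyc_tower n} := aff_fun (tw_affine cyc_tower n).

Lemma quo_k n a : quo n (twk _ n a) = twk _ n a. Proof. exact: aff_fun_k. Qed.
Lemma quo_X n i : quo n (twX _ i) = twX _ i. Proof. exact: aff_fun_X. Qed.
Lemma quo_S n i f : quo n (twS _ i f) = twS _ i f. Proof. exact: aff_fun_S. Qed.
Lemma quo_P n s : quo n (twP _ s) = twP _ s. Proof. exact: aff_fun_P. Qed.
Lemma quo_up n (h : aff_tower n) : quo n.+1 (up aff_tower h) = up cyc_tower (quo n h).
Proof.
elim/tw_ind: h => [a|u v hu hv|u v hu hv|i|i a f _|s].
- by rewrite up_k !quo_k up_k.
- by rewrite !rmorphD hu hv.
- by rewrite !rmorphM hu hv.
- by rewrite up_X !quo_X up_X.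
- by rewrite up_S !quo_S up_S.
- by rewrite up_P !quo_P up_P.
Qed.

Lemma quo_surj n (y : cyc_tower n) : exists h, quo n h = y.
Proof.
elim/tw_ind: y => [a|u v [u0 <-] [v0 <-]|u v [u0 <-] [v0 <-]|i|i a f _|s].
- by exists (twk aff_tower n a); exact: quo_k.
- by exists (u0 + v0); rewrite rmorphD.
- by exists (u0 * v0); rewrite rmorphM.
- by exists (twX aff_tower i); exact: quo_X.
- by exists (twS aff_tower i f); exact: quo_S.
- by exists (twP aff_tower s); exact: quo_P.
Qed.
End Towers.

(** * Matrix coefficients of the coinduced modules *)

Lemma sum_below (Z : nmodType) n (i : 'I_n) (G : 'I_n.+1 -> Z) :
  \sum_(l < n.+1 | (l < lift ord_max i)%N) G l = \sum_(l < n | (l < i)%N) G (lift ord_max l).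
Proof.
rewrite big_mkcond sum_lft.
  by rewrite [RHS]big_mkcond; apply: eq_bigr => l _; rewrite !lift_max.
by rewrite lift_max ltnNge ltnW //; exact: ltn_ord.
Qed.

Lemma sum_below_max (Z : nmodType) n (G : 'I_n.+1 -> Z) :
  \sum_(l < n.+1 | (l < @ord_max n)%N) G l = \sum_(l < n) G (lift ord_max l).
Proof.
rewrite big_mkcond sum_lft; last by rewrite ltnn.
by apply: eq_bigr => l _; rewrite lift_max ltn_ord.
Qed.

Section Evaluation.
Variables (k : comNzRingType) (F : frobenius_superalgebra k) (D : cyclotomic_datum F).
Local Notation R := (cyc_tower D).
Local Notation H := (aff_tower D).
Local Notation lft := (lift ord_max).
Local Notation lp := (lift_perm ord_max ord_max).
Local Notation x := (twX H ord_max).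
Local Notation g_ l := (tperm (lft l) ord_max).

Section Level.
Variable n : nat.
Local Notation mx := (@ord_max n).
Let hR := tw_affine R n.
Local Notation func := (functional F (twk R n)).
Local Notation mS := (mS hR).
Local Notation mP := (mP hR).
Local Notation mY := (mY hR).
Local Notation mL := (mL hR).
Local Notation mR y := (@mR k F _ (twk R n) y).
Local Notation mX := (mXx D (twk R n)).
Let pb := mS_parabolic hR.
Local Notation coind := (coind mP).
Local Notation coP := (coP mP).
Local Notation coS := (coS pb).
Local Notation coY := (coY pb).
Local Notation coX := (fun i => coY i + JM D coS coP i).

Lemma alpha_affine :
  affine D (@scale_endo k func) (fun i => mL (twX R i)) (fun i => mS (lft i)) mP.
Proof.
have hd := pb_dri pb.
have e : (fun i => mY i + JM D (fun i => mS (lft i)) mP i) = (fun i => mL (twX R i)).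
  apply/funext => i; rewrite /mY mLB -[RHS](subrK (mL (JM D (@twS _ _ _ R n) (@twP _ _ _ R n) i))).
  congr (_ + _); rewrite /JM (morph_sum _ _ _ (mLD hR)); apply: eq_bigr => l _.
  by rewrite /tp mLM -tele_mS.
rewrite -e; apply: (drinfeld_affine (dri_slots hd) (S_Y hd) (S_Yne hd) (P_Y hd)) => i j ij.
by have h := Y_Y hd ij; rewrite /YY_rel; refine h.
Qed.

(** The action of the lower affine algebra on functionals. Variables and permutations act through
    the coefficient ring; slots do so up to the sign for passing the last slot. *)
Definition alpha : {rmorphism H n -> endo func} := aff_fun alpha_affine.
Definition rho : {rmorphism H n.+1 -> endo coind} := aff_fun (coind_affine pb).

Lemma alpha_k a : alpha (twk H n a) = scale_endo _ a. Proof. exact: aff_fun_k. Qed.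
Lemma alpha_X i : alpha (twX H i) = mL (twX R i). Proof. exact: aff_fun_X. Qed.
Lemma alpha_S i f : alpha (twS H i f) = mS (lft i) f. Proof. exact: aff_fun_S. Qed.
Lemma alpha_P s : alpha (twP H s) = mP s. Proof. exact: aff_fun_P. Qed.
Lemma rho_k a : rho (twk H n.+1 a) = scale_endo _ a. Proof. exact: aff_fun_k. Qed.
Lemma rho_X i : rho (twX H i) = coX i. Proof. exact: aff_fun_X. Qed.
Lemma rho_S i f : rho (twS H i f) = coS i f. Proof. exact: aff_fun_S. Qed.
Lemma rho_P s : rho (twP H s) = coP s. Proof. exact: aff_fun_P. Qed.

Lemma coX_lft1 i (u : coind) : coX (lft i) u 1%g = mL (twX R i) (u 1%g).
Proof.
have e : (1%g : 'S_n.+1) (lft i) = lft i by rewrite perm1.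
rewrite -[LHS]/(coY (lft i) u 1%g + JM D coS coP (lft i) u 1%g) coYE (coY_lft _ _ _ _ _ e).
rewrite -[RHS](subrK (mL (JM D (@twS _ _ _ R n) (@twP _ _ _ R n) i) (u 1%g))).
congr (_ + _); first by rewrite /mY mLB.
rewrite /JM sum_below (morph_sum _ _ _ (mLD hR)) !endo_sum.
rewrite (big_morph (fun v : coind => v 1%g) (id1 := 0) (op1 := +%R)) //.
apply: eq_bigr => l _; rewrite /tp mLM -tele_mS !endoM [LHS](co_tele pb) !perm1.
by congr (efun _ _); rewrite coPE mulg1 -[tperm _ _]mul1g -lp_tp coeq.
Qed.

Lemma rho_up1 r (u : coind) : rho (up H r) u 1%g = alpha r (u 1%g).
Proof.
elim/tw_ind: r u => [a|v w hv hw|v w hv hw|i|i a f _|s] u.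
- by rewrite up_k rho_k alpha_k.
- rewrite !rmorphD; exact: (f_equal2 +%R (hv u) (hw u)).
- by rewrite !rmorphM !endoM hv hw.
- by rewrite up_X rho_X coX_lft1 alpha_X.
- by rewrite up_S rho_S coSE perm1 alpha_S.
- by rewrite up_P rho_P coPE mulg1 -[lp s]mul1g coeq alpha_P.
Qed.

Lemma alpha_val r (c : func) : alpha r c 0%N 1 = quo D n r * c 0%N 1.
Proof.
elim/tw_ind: r c => [a|v w hv hw|v w hv hw|i|i [d p] f hf|s] c.
- by rewrite alpha_k quo_k.
- by rewrite !rmorphD mulrDl -hv -hw.
- by rewrite !rmorphM endoM hv hw mulrA.
- by rewrite alpha_X quo_X.
- by rewrite alpha_S quo_S mS_lft (mSlE hR _ _ _ _ hf) sgF1.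
- by rewrite alpha_P quo_P.
Qed.

(** Evaluation at the identity of S_(n+1), and then at x^0, is linear over the lower algebra;
    hence so is this matrix coefficient, for every u. *)
Definition coef (u : coind) (h : H n.+1) : R n := rho h u 1%g 0%N 1.

Lemma coef_D u h h' : coef u (h + h') = coef u h + coef u h'.
Proof. by rewrite /coef rmorphD. Qed.
Lemma coef_up u r h : coef u (up H r * h) = quo D n r * coef u h.
Proof. by rewrite /coef rmorphM endoM rho_up1 alpha_val. Qed.
Lemma coef_rho u h h' : coef u (h * h') = coef (rho h' u) h.
Proof. by rewrite /coef rmorphM endoM. Qed.

Lemma coX_mx1 (u : coind) : coX mx u 1%g = mX (u 1%g).
Proof.
have e : (1%g : 'S_n.+1) mx = mx by rewrite perm1.
rewrite -[LHS]/(coY mx u 1%g + JM D coS coP mx u 1%g) coYE (coY_mx _ _ _ _ _ e).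
rewrite /JM sum_below_max endo_sum (big_morph (fun v : coind => v 1%g) (id1 := 0) (op1 := +%R)) //.
rewrite -addrA addrC -[RHS]add0r; congr (_ + _); rewrite addrC; apply/eqP; rewrite subr_eq0; apply/eqP.
apply: eq_bigr => l _; rewrite /tp endoM [LHS](co_tele pb) !perm1; congr (efun _ _).
by rewrite coPE mulg1 mul1g.
Qed.

Lemma coef_x u b h : coef u (x ^+ b * h) = rho h u 1%g b 1.
Proof.
rewrite /coef; suff e v : rho (x ^+ b * h) u 1%g v 1 = rho h u 1%g (v + b)%N 1 by rewrite e.
elim: b v => [|b IH] v; first by rewrite mul1r addn0.
rewrite exprS -mulrA rmorphM endoM rho_X.
by rewrite coX_mx1 mXxE psi1 IH addSnnS.
Qed.

Lemma coef_xS u b f : coef u (x ^+ b * twS H mx f) = u 1%g b f.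
Proof. by rewrite coef_x rho_S coSE perm1 mS_mx mSxE mul1r. Qed.

Fact coR_eq y (u : coind) p s : mR y (u (p * lp s)%g) = mP s (mR y (u p)).
Proof. by rewrite coeq -!endoM mR_mL. Qed.
Definition coR_fun y (u : coind) : coind := Coind (coR_eq y u).
Fact coR_D y : {morph coR_fun y : u v / u + v}.
Proof. by move=> u v; apply: coindP => p; exact: efunD. Qed.
Fact coR_Z y a : {morph coR_fun y : u / a *: u}.
Proof. by move=> u; apply: coindP => p; exact: efunZ. Qed.
(** Right multiplication of values by y. It commutes with the whole action, which only
    multiplies values from the left. *)
Definition coR y : endo coind := Endo (@coR_D y) (@coR_Z y).
Lemma coRE y u p : coR y u p = mR y (u p). Proof. by []. Qed.

Lemma coR_S y i f : coR y * coS i f = coS i f * coR y.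
Proof.
apply: endoP => u; apply: coindP => p.
by rewrite !endoM coSE !coRE coSE -!endoM mR_mS.
Qed.
Lemma coR_P y s : coR y * coP s = coP s * coR y.
Proof. by apply: endoP => u; apply: coindP. Qed.
Lemma coR_Y y i : coR y * coY i = coY i * coR y.
Proof.
apply: endoP => u; apply: coindP => p; rewrite !endoM coYE coRE coYE.
case: (unliftP mx (p i)) => [j|] e.
  by rewrite !(coY_lft _ _ _ _ _ e) coRE -!endoM mR_mL.
rewrite !(coY_mx _ _ _ _ _ e) (morphB (@efunD _ _ _)) coRE -!endoM mR_mXx; congr (_ - _).
rewrite (morph_sum _ _ _ (@efunD _ _ _)); apply: eq_bigr => l _.
rewrite coRE -!endoM; congr (efun _ _).
rewrite /tele mulr_suml mulr_sumr; apply: eq_bigr => b _.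
by rewrite mulrA mR_mS -!mulrA mR_mS.
Qed.

Lemma rho_coR h y : coR y * rho h = rho h * coR y.
Proof.
elim/tw_ind: h => [a|v w hv hw|v w hv hw|i|i a f _|s].
- by rewrite rho_k scale_endoC.
- by rewrite rmorphD mulrDl mulrDr hv hw.
- by rewrite rmorphM mulrA hv -!mulrA hw.
- rewrite rho_X mulrDl mulrDr coR_Y; congr (_ + _).
  rewrite /JM mulr_suml mulr_sumr; apply: eq_bigr => l _.
  rewrite /tp mulrA -[RHS]mulrA -coR_P [RHS]mulrA; congr (_ * _).
  rewrite /tele mulr_suml mulr_sumr; apply: eq_bigr => b _.
  by rewrite mulrA coR_S -!mulrA coR_S.
- by rewrite rho_S coR_S.
- by rewrite rho_P coR_P.
Qed.

Lemma coef_coR y u h : coef (coR y u) h = coef u h * y.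
Proof. by rewrite /coef -[rho h _]endoM -rho_coR. Qed.

Lemma alpha_mR r y : alpha r * mR y = mR y * alpha r.
Proof.
elim/tw_ind: r => [a|v w hv hw|v w hv hw|i|i a f _|s].
- by rewrite alpha_k scale_endoC.
- by rewrite rmorphD mulrDl mulrDr hv hw.
- by rewrite rmorphM -mulrA hw !mulrA hv.
- by rewrite alpha_X mR_mL.
- by rewrite alpha_S mR_mS.
- by rewrite alpha_P mR_mL.
Qed.
End Level.

Section Step.
Variable m : nat.
Local Notation n := m.+1.
Local Notation la := (@ord_max m).
Let hR := tw_affine R n.
Let pb := mS_parabolic hR.
Local Notation func := (functional F (twk R n)).
Local Notation mR y := (@mR k F _ (twk R n) y).
Local Notation equi c := (equi hR c).
Local Notation rho := (rho n).
Local Notation alpha := (alpha n).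

Lemma rho_up r : intertwines (hR := hR) (rho (up H r)) (alpha r).
Proof.
elim/tw_ind: r => [a|v w hv hw|v w hv hw|i|i a f _|s].
- by move=> c; rewrite up_k rho_k alpha_k; apply: esym; exact: equiZ.
- by rewrite !rmorphD; exact: itwD.
- by rewrite !rmorphM; exact: itwM.
- by rewrite up_X rho_X alpha_X; exact: itw_X.
- by rewrite up_S rho_S alpha_S; exact: itw_S.
- by rewrite up_P rho_P alpha_P; exact: itw_P.
Qed.

Lemma mR_ddiff y : mR y * ddiff hR = ddiff hR * mR y.
Proof.
apply: endoP => u; apply: fnP => a f; rewrite !endoM.
have key a' (v : func) f' : ddiff_val hR a' (mR y v) f' = ddiff_val hR a' v f' * y.
  elim: a' v f' => [|b IH] v f'; first by rewrite /= mul0r.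
  rewrite !ddiff_valS mulrDl -IH -!endoM mR_mL; congr (_ + _).
  rewrite -[RHS]/(mR y (tele_last hR v) b (psiV D f')) -endoM; congr (fn (efun _ _) _ _).
  rewrite /tele_last /tele mulr_suml mulr_sumr; apply: eq_bigr => c _.
  by rewrite mulrA mR_mS -!mulrA mR_mS.
by rewrite [RHS]key.
Qed.

Lemma equi_mR y c : equi (mR y c) = coR y (equi c).
Proof.
apply: coind_ext => [|j]; rewrite coRE; first by rewrite !equi1.
rewrite !equi_g -!endoM /dconj; congr (efun _ _).
by rewrite -!mulrA -mR_mL [ddiff hR * _]mulrA -mR_ddiff !mulrA mR_mL.
Qed.

(** The matrix coefficient of the extension of c. It restricts to c on R_n (x) F[x] and, by the
    choice of the divided difference, vanishes at s. *)
Definition cf (c : func) (h : H n.+1) : R n := coef (equi c) h.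

Lemma cf_D c h h' : cf c (h + h') = cf c h + cf c h'. Proof. exact: coef_D. Qed.
Lemma cf_Dc c c' h : cf (c + c') h = cf c h + cf c' h.
Proof. by rewrite /cf /coef equiD efunD. Qed.
Lemma cf_upl c r h : cf c (up H r * h) = quo D n r * cf c h. Proof. exact: coef_up. Qed.
(** The extension of c transforms under the lower algebra as c does. *)
Lemma cf_upr c r h : cf c (h * up H r) = cf (alpha r c) h.
Proof. by rewrite /cf coef_rho rho_up. Qed.
Lemma cf_xS c b f : cf c (x ^+ b * twS H ord_max f) = c b f.
Proof. by rewrite /cf coef_xS equi1. Qed.
Lemma cf_mR c y h : cf (mR y c) h = cf c h * y.
Proof. by rewrite /cf equi_mR coef_coR. Qed.
Lemma cf_s c : cf c (twP H (g_ la)) = 0.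
Proof.
rewrite /cf /coef rho_P coPE mulg1 equi_g /dconj tperm1 mP1 mul1r mulr1.
exact: ddiff0.
Qed.
Lemma cf_P c r l r' : cf c (up H r * twP H (g_ l) * up H r') = 0.
Proof. by rewrite cf_upr cf_upl P_gE cf_upr cf_upl cf_s !mulr0. Qed.

(** Consequently the coefficient sees c only through c(x^b f), b < a, on the a-th step of the
    filtration. *)
Lemma cf_fil (c : func) a (h : H n.+1) : (forall b f, (b < a)%N -> c b f = 0) -> fil a h -> cf c h = 0.
Proof.
move=> c0; elim=> {h} [|u v _ hu _ hv|r b f hb|l r r'].
- by apply: (addIr (cf c 0)); rewrite -cf_D !add0r.
- by rewrite cf_D hu hv addr0.
- by rewrite cf_upl cf_xS c0 ?mulr0.
- exact: cf_P.
Qed.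
End Step.
End Evaluation.

(** * The cyclotomic polynomial *)

Section Chi.
Variables (k : comNzRingType) (F : frobenius_superalgebra k) (D : cyclotomic_datum F).
Variable T : tower D.

Definition level : nat := \sum_(1 <= m < (theta D).+1) m * ce D m.

Section Index.
Variables (n : nat) (i : 'I_n).
Local Notation X := (twX T).
Local Notation S := (twS T).
Let hT := tw_affine T n.
Let hS := aff_slots hT.

(** Coefficients are required to be fixed by [psi], so that they commute with the variable. *)
Inductive low (d : nat) : T n -> Prop :=
  | low_0 : low d 0
  | low_D u v : low d u -> low d v -> low d (u + v)
  | low_pol a z : (a < d)%N -> psi D z = z -> low d (X i ^+ a * S i z).

(** The properties of the factors x^m - c of the cyclotomic polynomial that pass to products.
    [tm_S] is the twisted centrality of the coefficients. *)
Record twisted_monic (d : nat) (h : T n) : Prop := TwistedMonic {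
  tm_X : forall j, h * X j = X j * h;
  tm_S : forall f, S i f * h = h * S i (iter d (psi D) f);
  tm_Sne : forall j f, j != i -> S j f * h = h * S j f;
  tm_low : low d (h - X i ^+ d) }.

Lemma low_coef d h : low d h -> exists2 z : nat -> F,
  (forall a, psi D (z a) = z a) & h = \sum_(a < d) X i ^+ a * S i (z a).
Proof.
elim=> {h} [|u v _ [z hz ->] _ [w hw ->]|a z ad hz].
- exists (fun=> 0) => [a|]; first exact: linear0.
  by rewrite big1 // => a _; rewrite (slot0 hS) mulr0.
- exists (fun a => z a + w a) => [a|]; first by rewrite linearD; congr (_ + _).
  by rewrite -big_split; apply: eq_bigr => a _; rewrite (slotD hS) mulrDr.
- exists (fun b => if b == a then z else 0) => [b|].
    by case: ifP => // _; exact: linear0.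
  rewrite (bigD1 (Ordinal ad)) //= eqxx big1 ?addr0 // => b ne.
  case: eqP => [e|_]; last by rewrite (slot0 hS) mulr0.
  by case/eqP: ne; apply/val_inj.
Qed.

Lemma low_mono d e h : (d <= e)%N -> low d h -> low e h.
Proof.
move=> de; elim=> {h} [|u v _ hu _ hv|a z ad hz]; [exact: low_0|exact: low_D|].
by apply: low_pol => //; exact: leq_trans ad de.
Qed.

Lemma psi_iter m z : psi D z = z -> iter m (psi D) z = z.
Proof. by move=> hz; elim: m => //= m ->. Qed.

Lemma S_Xn f m : S i f * X i ^+ m = X i ^+ m * S i (iter m (psi D) f).
Proof.
elim: m f => [|m IH] f; first by rewrite mulr1 mul1r.
by rewrite exprS mulrA (S_X hT) -mulrA IH mulrA iterSr.
Qed.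

Lemma low_mulX d m h : low d h -> low (d + m) (h * X i ^+ m).
Proof.
elim=> {h} [|u v _ hu _ hv|a z ad hz].
- by rewrite mul0r; exact: low_0.
- by rewrite mulrDl; exact: low_D.
rewrite -mulrA S_Xn psi_iter // mulrA -exprD.
by apply: low_pol => //; rewrite ltn_add2r.
Qed.

Lemma low_mulS d h c : psi D c = c -> low d h -> low d (h * S i c).
Proof.
move=> hc; elim=> {h} [|u v _ hu _ hv|a z ad hz].
- by rewrite mul0r; exact: low_0.
- by rewrite mulrDl; exact: low_D.
by rewrite -mulrA -(S_M hS); apply: low_pol => //; rewrite psiM hc hz.
Qed.

Lemma low_mul d h m u : low d h -> low m u -> low (d + m) (h * u).
Proof.
move=> hh; elim=> {u} [|u v _ hu _ hv|a z ad hz].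
- by rewrite mulr0; exact: low_0.
- by rewrite mulrDr; exact: low_D.
rewrite mulrA; apply: low_mono (low_mulS hz (low_mulX a hh)).
by rewrite leq_add2l ltnW.
Qed.

Lemma low_Xmul d m u : low m u -> low (d + m) (X i ^+ d * u).
Proof.
elim=> {u} [|u v _ hu _ hv|a z ad hz].
- by rewrite mulr0; exact: low_0.
- by rewrite mulrDr; exact: low_D.
by rewrite mulrA -exprD; apply: low_pol => //; rewrite ltn_add2l.
Qed.

Lemma tm_mul d e h u : twisted_monic d h -> twisted_monic e u -> twisted_monic (d + e) (h * u).
Proof.
move=> hh hu; split.
- by move=> j; rewrite -mulrA (tm_X hu) mulrA (tm_X hh) mulrA.
- by move=> f; rewrite mulrA (tm_S hh) -mulrA (tm_S hu) mulrA addnC iterD.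
- by move=> j f ji; rewrite mulrA (tm_Sne hh) // -mulrA (tm_Sne hu) // mulrA.
have -> : h * u - X i ^+ (d + e) =
    (h - X i ^+ d) * (u - X i ^+ e) + X i ^+ d * (u - X i ^+ e) + (h - X i ^+ d) * X i ^+ e.
  by rewrite -mulrDl subrK mulrBr mulrBl addrA subrK exprD.
apply: low_D; first apply: low_D.
- exact: low_mul (tm_low hh) (tm_low hu).
- exact: low_Xmul (tm_low hu).
- exact: low_mulX (tm_low hh).
Qed.

Lemma tm_1 : twisted_monic 0 1.
Proof.
split=> [j|f|j f _|]; rewrite ?mulr1 ?mul1r //.
by rewrite expr0 subrr; exact: low_0.
Qed.

Lemma iter_linD m f g : iter m (psi D) (f + g) = iter m (psi D) f + iter m (psi D) g.
Proof. by have := iter_lin (psi D) m 1 f g; rewrite !scale1r. Qed.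
Lemma iter_lin0 m : iter m (psi D) 0 = 0.
Proof. exact: morph0 (iter_linD m). Qed.

Lemma cc_twist m j f : (1 <= m <= theta D)%N -> (j < ce D m)%N ->
  f * cc D m j = cc D m j * iter m (psi D) f.
Proof.
move=> hm hj; have [[tc _] cg] := ccP hm hj.
have hp e p (g : F) : fs_gr (e, p) g -> has_parity p g.
  move=> hg; exists [:: e], (fun d => if d == e then g else 0); split=> [d|].
    by case: eqP => [->|_] //; exact: (gr_0 (fs_grading F)).
  by rewrite big_seq1 eqxx.
elim/gr_ind: f => [|u v hu hv|[e q] f hf].
- by rewrite mul0r iter_lin0 mulr0.
- by rewrite mulrDl hu hv iter_linD mulrDr.
rewrite (tc _ 0 q f (hp _ _ _ cg) _ _ (hp _ _ _ hf)) ?addr0 //.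
  by rewrite mul0r mulr0 addr0.
exact: hp (gr_0 (fs_grading F) (0, true)).
Qed.

Lemma tm_factor m j : (1 <= m <= theta D)%N -> (j < ce D m)%N ->
  twisted_monic m (X i ^+ m - S i (cc D m j)).
Proof.
move=> hm hj; have [[tc pc] cg] := ccP hm hj; split.
- move=> l; rewrite mulrBl mulrBr; congr (_ - _).
    by apply/esym/commrX/(X_X hT).
  by have [->|ne] := eqVneq i l; [rewrite (S_X hT) pc|rewrite (S_Xne hT)].
- move=> f; rewrite mulrBl mulrBr S_Xn -!(S_M hS).
  by rewrite (cc_twist f hm hj).
- move=> l f ne; rewrite mulrBl mulrBr; congr (_ - _).
    by apply/commrX/(S_Xne hT).
  exact: (slot_even hS) _ _ _ _ _ ne cg.
rewrite addrC addKr -[S i _]mul1r -(expr0 (X i)).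
have -> : - (X i ^+ 0 * S i (cc D m j)) = X i ^+ 0 * S i (- cc D m j).
  by rewrite -mulrN (morphN (slotD hS i)).
by apply: low_pol; [case/andP: hm|rewrite linearN pc].
Qed.

(** The cyclotomic polynomial in the i-th variable. *)
Definition Chi : T n := \prod_(1 <= m < (theta D).+1)
  \prod_(0 <= j < ce D m) (X i ^+ m - S i (cc D m j)).

Lemma Chi_tm : twisted_monic level Chi.
Proof.
rewrite /Chi /level [(\sum_(_ <= _ < _) _)%N]big_nat_cond [\prod_(_ <= _ < _) _]big_nat_cond.
apply: (big_rec2 twisted_monic) => [|m h d]; first exact: tm_1.
rewrite andbT ltnS => hm hd; apply: tm_mul => //.
have -> : (m * ce D m = \sum_(0 <= j < ce D m) m)%N by rewrite sum_nat_const_nat subn0 mulnC.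
rewrite [(\sum_(_ <= _ < _) _)%N]big_nat_cond [\prod_(_ <= _ < _) _]big_nat_cond.
apply: (big_rec2 twisted_monic) => [|j v e]; first exact: tm_1.
by rewrite andbT => hj he; apply: tm_mul => //; apply: tm_factor => //; case/andP: hj.
Qed.
End Index.
End Chi.

Section Kernel.
Variables (k : comNzRingType) (F : frobenius_superalgebra k) (D : cyclotomic_datum F).
Local Notation R := (cyc_tower D).
Local Notation H := (aff_tower D).

Lemma cls_chi n (Q : term k (agen F n) -> term k (agen F n) -> Prop) i :
  cls Q (chi D i) = \prod_(1 <= m < (theta D).+1)
    \prod_(0 <= j < ce D m) (cX Q i ^+ m - cS Q i (cc D m j)).
Proof.
have c1 : cls Q (Cst 1) = 1 by [].
rewrite /chi (big_morph (cls Q) (@clsM _ _ Q) c1); apply: eq_bigr => m _.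
rewrite (big_morph (cls Q) (@clsM _ _ Q) c1); apply: eq_bigr => j _.
rewrite clsD clsM [cls Q (Cst (-1))](rmorphN1 (pin Q)) mulN1r; congr (_ - _).
by elim: m => [|m IH] //; rewrite clsM IH exprS.
Qed.

Lemma Chi_cyc n (i : 'I_n) : i = 0%N :> nat -> Chi R i = 0.
Proof.
move=> hi; rewrite -[LHS](@cls_chi n (@cyc_rel k F D n)).
exact: (cls_rel (cr_chi D hi)).
Qed.

Lemma quo_Chi n (i : 'I_n) : quo D n (Chi H i) = Chi R i.
Proof.
rewrite /Chi rmorph_prod; apply: eq_bigr => m _; rewrite rmorph_prod; apply: eq_bigr => j _.
by rewrite rmorphB rmorphXn quo_X quo_S.
Qed.

Lemma up_Chi (T : tower D) n (i : 'I_n) : up T (Chi T i) = Chi T (lift ord_max i).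
Proof.
rewrite /Chi rmorph_prod; apply: eq_bigr => m _; rewrite rmorph_prod; apply: eq_bigr => j _.
by rewrite rmorphB rmorphXn up_X up_S.
Qed.

Inductive chi_ideal n : H n -> Prop :=
  | ci_0 : chi_ideal 0
  | ci_D u v : chi_ideal u -> chi_ideal v -> chi_ideal (u + v)
  | ci_gen u v (i : 'I_n) : i = 0%N :> nat -> chi_ideal (u * Chi H i * v).

Lemma ci_l n (u h : H n) : chi_ideal h -> chi_ideal (u * h).
Proof.
elim=> {h} [|v w _ hv _ hw|v w i hi]; first by rewrite mulr0; exact: ci_0.
  by rewrite mulrDr; exact: ci_D.
by rewrite !mulrA; exact: ci_gen.
Qed.
Lemma ci_r n (u h : H n) : chi_ideal h -> chi_ideal (h * u).
Proof.
elim=> {h} [|v w _ hv _ hw|v w i hi]; first by rewrite mul0r; exact: ci_0.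
  by rewrite mulrDl; exact: ci_D.
by rewrite -mulrA; exact: ci_gen.
Qed.
Lemma ci_N n (h : H n) : chi_ideal h -> chi_ideal (- h).
Proof. by move=> hh; rewrite -mulN1r; exact: ci_l. Qed.

Lemma quo_cls n t : quo D n (cls _ t) = cls (@cyc_rel k F D n) t.
Proof.
rewrite [LHS]aff_funE; elim: t => [g|a|t ht u hu|t ht u hu] //.
- case: g => [i|f|s] //; rewrite [RHS](cT_prod (@cr_aff k F D n)) //.
- by rewrite clsD -ht -hu.
- by rewrite clsM -ht -hu.
Qed.

(** The congruence defining the quotient has one generator besides those of the affine algebra. *)
Lemma quo_ker n (h h' : H n) : quo D n h = quo D n h' -> chi_ideal (h - h').
Proof.
rewrite -[h]cls_repr -[h']cls_repr !quo_cls => /clsP.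
pose c t : H n := cls (@aff_rel k F D n) t; rewrite -!/(c _).
have cong t u : acong (@aff_rel k F D n) t u -> chi_ideal (c t - c u).
  by move=> /clsP e; rewrite /c e subrr; exact: ci_0.
elim=> {h h'} [t u r|t|t u _|t u v _ h1 _ h2|t t' u u' _ h1 _ h2|t t' u u' _ h1 _ h2|||||||||||].
- case: r => {t u} [t u r|i hi]; first by apply: cong; exact: ac_rel.
  rewrite /c [cls _ (chi _ _)]cls_chi subr0 -[X in chi_ideal X]mul1r -[X in chi_ideal X]mulr1.
  exact: (ci_gen 1 1 hi).
- by rewrite subrr; exact: ci_0.
- by move=> /ci_N; rewrite opprB.
- by rewrite -(subrK (c u) (c t)) -addrA; exact: ci_D.
- by rewrite /c !clsD opprD addrACA; exact: ci_D.
- have -> : c (t *' u) - c (t' *' u') = (c t - c t') * c u + c t' * (c u - c u').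
    by rewrite /c !clsM mulrBl mulrBr addrA subrK.
  by apply: ci_D; [exact: ci_r|exact: ci_l].
all: by move=> *; apply: cong; constructor.
Qed.

(** On the first level the cyclotomic polynomial is monic of degree d in the last variable and
    vanishes. *)
Lemma cyc_fil n (h : R n.+1) : (0 < level D)%N -> fil (level D) h.
Proof.
move=> d0; apply: fil_bounded => // f.
have c0 : Chi R (@ord_max 0) = 0 by exact: Chi_cyc.
have := tm_low (Chi_tm R (@ord_max 0)); rewrite c0 sub0r => /low_coef[z _ e].
rewrite -[_ ^+ _]opprK e mulNr; apply: fil_N; rewrite mulr_suml; apply: fil_sum => a _.
by rewrite -mulrA -S_mul; exact: fil_xS.
Qed.
End Kernel.

(** * Traces on the cyclotomic tower *)

Section HomogeneousSums.
Variables (V : zmodType) (gr : degree -> V -> Prop) (Q : degree -> V -> Prop).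

Inductive sums : V -> Prop :=
  | sums_0 : sums 0
  | sums_D u v : sums u -> sums v -> sums (u + v)
  | sums_1 d v : Q d v -> sums v.

Lemma sums_sum (I : Type) (s : seq I) (P : pred I) (c : I -> V) :
  (forall i, P i -> sums (c i)) -> sums (\sum_(i <- s | P i) c i).
Proof. by move=> h; apply: (big_ind sums) => //; [exact: sums_0|exact: sums_D]. Qed.

Hypothesis hg : is_grading gr.
Hypothesis Qgr : forall d v, Q d v -> gr d v.
Hypothesis Q0 : forall d, Q d 0.
Hypothesis QD : forall d u v, Q d u -> Q d v -> Q d (u + v).

(** A sum of terms with a property Q stable under addition has homogeneous components with the
    same property. So Q only has to be checked on spanning sets. *)
Lemma homogeneous_sums d v : sums v -> gr d v -> Q d v.
Proof.
have [pr [prD prg prid prne _]] := grading_proj hg.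
move=> sv hv; rewrite -(prid _ _ hv) {hv}; elim: sv d => {v} [|u v _ hu _ hv|e v hv] d.
- by rewrite prid; [exact: Q0|exact: (gr_0 hg)].
- by rewrite prD; apply: QD.
- have [->|ne] := eqVneq d e; first by rewrite prid //; exact: Qgr.
  by rewrite (prne e) //; exact: Qgr.
Qed.
End HomogeneousSums.

Section Grading.
Variables (k : comNzRingType) (F : frobenius_superalgebra k) (D : cyclotomic_datum F).
Local Notation R := (cyc_tower D).
Local Notation g_ l := (tperm (lift ord_max l) ord_max).
Local Notation up := (@up _ _ _ R _).
Local Notation X := (twX R).
Local Notation S := (twS R).
Local Notation P := (twP R).
Definition rgr n (d : degree) (h : R n) : Prop := @ga_gr k (cyc_alg D n) d h.
Let hS n := aff_slots (tw_affine R n).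

Lemma rgr_grading n : is_grading (@rgr n). Proof. exact: ga_grading. Qed.
Lemma rgr_D n d (u v : R n) : rgr d u -> rgr d v -> rgr d (u + v).
Proof. exact: (gr_D (@rgr_grading n)). Qed.
Lemma rgr_0 n d : rgr d (0 : R n). Proof. exact: (gr_0 (@rgr_grading n)). Qed.
Lemma rgr_M n d e (u v : R n) : rgr d u -> rgr e v -> rgr (d + e) (u * v).
Proof. exact: ga_gr_mul. Qed.
Lemma rgr_k n a : rgr 0 (twk R n a). Proof. exact: (@ga_gr_in k (cyc_alg D n)). Qed.
Lemma rgr_1 n : rgr 0 (1 : R n). Proof. by have := rgr_k n 1; rewrite rmorph1. Qed.
Lemma rgr_X n (i : 'I_n) : rgr (delta D, false) (X i).
Proof. by exists (tX F i) => //; exact: th_X. Qed.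
Lemma rgr_S n (i : 'I_n) d f : fs_gr d f -> rgr d (S i f).
Proof. by move=> hf; exists (tT (slot i f)) => //; exact: th_slot. Qed.
Lemma rgr_P n (s : 'S_n) : rgr 0 (P s).
Proof. by exists (tP F s) => //; exact: th_P. Qed.
Lemma rgr_up n d (u : R n) : rgr d u -> rgr d (up u).
Proof. exact: (@ah_gr _ _ _ (cyc_incl D n)). Qed.
Lemma rgr_Xn n (i : 'I_n) a : rgr (a%:Z * delta D, false) (X i ^+ a).
Proof.
elim: a => [|a IH]; first by rewrite mul0r; exact: rgr_1.
have := rgr_M (rgr_X i) IH; rewrite exprS.
suff -> : (delta D, false) + (a%:Z * delta D, false) = (a.+1%:Z * delta D, false) by [].
by congr pair; rewrite intS mulrDl mul1r.
Qed.

(** The last slot supercommutes with the lower algebra. The sign is multiplicative, so that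
    generators suffice. *)
Lemma super_comm n (z : R n) d f e : rgr d z -> fs_gr e f ->
  up z * S ord_max f = (-1) ^+ (d.2 && e.2) * (S ord_max f * up z).
Proof.
pose Q d (z : R n) := rgr d z /\ forall e f, fs_gr e f ->
  up z * S ord_max f = (-1) ^+ (d.2 && e.2) * (S ord_max f * up z).
have even z0 d0 : rgr d0 z0 -> d0.2 = false ->
    (forall f, up z0 * S ord_max f = S ord_max f * up z0) -> Q d0 z0.
  by move=> h1 h2 h3; split=> // e0 g _; rewrite h3 h2 mul1r.
have QM d1 d2 u v : Q d1 u -> Q d2 v -> Q (d1 + d2) (u * v).
  move=> [hu cu] [hv cv]; split=> [|e0 g hg]; first exact: rgr_M.
  rewrite rmorphM -mulrA (cv _ _ hg) mul_signCA [up u * _]mulrA (cu _ _ hg).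
  rewrite -!mulrA [LHS]mulrA -signr_addb; congr (_ ^+ _ * _).
  by case: d1 d2 e0 {hu cu hv cv hg} => [? [|]] [? [|]] [? [|]].
suff all : sums Q z.
  move=> hz hf; suff [_ h] : Q d z by exact: h.
  apply: (homogeneous_sums (@rgr_grading n) _ _ _ all hz).
  - by move=> ? ? [].
  - by move=> d0; split=> [|e0 g _]; rewrite ?rmorph0 ?mul0r ?mulr0 //; exact: rgr_0.
  - move=> d0 u v [hu cu] [hv cv]; split=> [|e0 g hg]; first exact: rgr_D.
    by rewrite rmorphD mulrDl mulrDr (cu _ _ hg) (cv _ _ hg) mulrDr.
elim/tw_ind: z => [a|u v hu hv|u v hu hv|i|i d0 f0 hf|s].
- apply: (sums_1 (d := 0)); apply: even => //; first exact: rgr_k.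
  by move=> g; rewrite up_k (kaC (hS n.+1)).
- exact: sums_D.
- elim: hu => {u} [|u w _ hu _ hw|d0 u hu]; first by rewrite mul0r; exact: sums_0.
    by rewrite mulrDl; exact: sums_D.
  elim: hv => {v} [|v w _ hv _ hw|d1 v hv]; first by rewrite mulr0; exact: sums_0.
    by rewrite mulrDr; exact: sums_D.
  exact: sums_1 (QM _ _ _ _ hu hv).
- apply: (sums_1 (d := (delta D, false))); apply: even => //; first exact: rgr_X.
  by move=> g; rewrite up_X (S_Xne (tw_affine R n.+1)) // neq_lift.
- apply: (sums_1 (d := d0)); split; first exact: rgr_S.
  move=> e0 g hg; rewrite up_S; case: d0 e0 hf hg => [d0 p] [e0 q] hf hg.
  by apply: (S_comm (hS n.+1) _ hf hg); rewrite eq_sym neq_lift.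
- apply: (sums_1 (d := 0)); apply: even => //; first exact: rgr_P.
  by move=> g; rewrite up_P P_slot lift_perm_id.
Qed.

Local Notation d := (level D).
(** All that the construction of the next trace has to know about the previous one:
    [E (s y s)] belongs to the algebra two levels below. *)
Definition link n : (R n.+1 -> R n) -> Prop :=
  if n is m.+1 return (R n.+1 -> R n) -> Prop then
    fun E => forall y : R m.+1, exists w : R m, E (P (g_ ord_max) * up y * P (g_ ord_max)) = up w
  else fun=> True.

Record trace n (E : R n.+1 -> R n) : Prop := IsTrace {
  tr_D : {morph E : u v / u + v};
  tr_upl : forall r h, E (up r * h) = r * E h;
  tr_upr : forall r h, E (h * up r) = E h * r;
  tr_x : forall a f, (a < d)%N ->
    E (X ord_max ^+ a * S ord_max f) = if a == d.-1 then twk R n (fs_tr F f) else 0;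
  tr_P : forall l, E (P (g_ l)) = 0;
  tr_link : link E }.

Lemma level_gt0 : (0 < d)%N. Proof. exact: level_ge1 D. Qed.

Section TraceGrading.
Variables (n : nat) (E : R n.+1 -> R n).
Hypothesis hE : trace E.

Lemma tr_0 : E 0 = 0. Proof. exact: morph0 (tr_D hE). Qed.

(** A trace is determined by its values on the spanning set of [cyc_fil], where the degree can
    be read off. *)
Lemma tr_gr e h : rgr e h -> rgr (e - (d%:Z * delta D, false)) (E h).
Proof.
pose Q e h := rgr e h /\ rgr (e - (d%:Z * delta D, false)) (E h).
suff all : sums Q h.
  move=> hh; suff [] : Q e h by [].
  apply: (homogeneous_sums (@rgr_grading n.+1) _ _ _ all hh).
  - by move=> ? ? [].
  - by move=> e0; split; rewrite ?tr_0; exact: rgr_0.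
  - by move=> e0 u v [hu cu] [hv cv]; split; rewrite ?(tr_D hE); exact: rgr_D.
have dec m (r : R m) : exists (s : seq degree) (c : degree -> R m),
    (forall a, rgr a (c a)) /\ r = \sum_(a <- s) c a.
  by have [s [c [_ hc ->]]] := gr_span (@rgr_grading m) r; exists s, c.
have decF (f : F) : exists (s : seq degree) (c : degree -> F),
    (forall a, fs_gr a (c a)) /\ f = \sum_(a <- s) c a.
  by have [s [c [_ hc ->]]] := gr_span (fs_grading F) f; exists s, c.
elim: (cyc_fil h level_gt0) => {h} [|u v _ hu _ hv|r a f ad|l r r'].
- exact: sums_0.
- exact: sums_D.
- have [s [c [hc ->]]] := dec _ r; rewrite rmorph_sum mulr_suml; apply: sums_sum => a0 _.
  have [t [g [hg ->]]] := decF f.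
  rewrite (slot_sum (hS n.+1)) !mulr_sumr; apply: sums_sum => a1 _.
  apply: (sums_1 (d := a0 + ((a%:Z * delta D, false) + a1))).
  split; first by apply: rgr_M (rgr_up _) _ => //; apply: rgr_M; [exact: rgr_Xn|exact: rgr_S].
  rewrite (tr_upl hE) (tr_x hE) //; case: eqP => [ea|_]; last by rewrite mulr0; exact: rgr_0.
  (* The trace of F vanishes outside the top degree. *)
  have [e1|/eqP ne] := eqVneq a1 (delta D, false); last first.
    by rewrite (tr_van (hg a1) ne) rmorph0 mulr0; exact: rgr_0.
  have -> : a0 + ((a%:Z * delta D, false) + a1) - (d%:Z * delta D, false) = a0 + 0.
    rewrite -addrA; congr (_ + _); rewrite e1; congr pair.
    rewrite -(prednK level_gt0) -ea /= intS mulrDl mul1r.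
    by rewrite [X in _ - X]addrC subrr.
  by apply: rgr_M => //; exact: rgr_k.
- have [s [c [hc ->]]] := dec _ r; rewrite rmorph_sum !mulr_suml; apply: sums_sum => a0 _.
  have [t [g [hg ->]]] := dec _ r'; rewrite rmorph_sum !mulr_sumr; apply: sums_sum => a1 _.
  apply: (sums_1 (d := a0 + 0 + a1)); split.
    apply: rgr_M (rgr_up _) => //; apply: rgr_M; [exact: rgr_up|exact: rgr_P].
  by rewrite (tr_upr hE) (tr_upl hE) (tr_P hE) mulr0 mul0r; exact: rgr_0.
Qed.
End TraceGrading.
End Grading.

(** * Descent of matrix coefficients and the first trace *)

Section Descent.
Variables (k : comNzRingType) (F : frobenius_superalgebra k) (D : cyclotomic_datum F).
Local Notation R := (cyc_tower D).
Local Notation H := (aff_tower D).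
Local Notation g_ l := (tperm (lift ord_max l) ord_max).
Local Notation d := (level D).
Local Notation pi := (quo D _).

(** A matrix coefficient descends to the cyclotomic quotient once it vanishes on the ideal. *)
Lemma trace_of_coef n (u : coind (mP (tw_affine R n))) :
  (forall h, chi_ideal h -> coef u h = 0) ->
  (forall r h, coef u (h * up H r) = coef u h * pi r) ->
  (forall a f, (a < d)%N -> u 1%g a f = if a == d.-1 then twk R n (fs_tr F f) else 0) ->
  (forall l, coef u (twP H (g_ l)) = 0) ->
  (forall E : R n.+1 -> R n, (forall h, E (pi h) = coef u h) -> link E) ->
  exists2 E : R n.+1 -> R n, trace E & forall h, E (pi h) = coef u h.
Proof.
move=> kills right val hP hl.
pose E (y : R n.+1) := coef u (sval (cid (quo_surj y))).
have EE h : E (pi h) = coef u h.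
  rewrite /E; case: (cid _) => h' /= e.
  have := kills _ (quo_ker e) => e0.
  by rewrite -[h'](subrK h) coef_D e0 add0r.
exists E => //; split; last exact: hl.
- move=> u' v'; have [v <-] := quo_surj u'; have [w <-] := quo_surj v'.
  by rewrite -rmorphD !EE coef_D.
- move=> r' h'; have [r <-] := quo_surj r'; have [h <-] := quo_surj h'.
  by rewrite -quo_up -rmorphM !EE coef_up.
- move=> r' h'; have [r <-] := quo_surj r'; have [h <-] := quo_surj h'.
  by rewrite -quo_up -rmorphM !EE right.
- move=> a f ad; rewrite -quo_X -quo_S -rmorphXn -rmorphM EE coef_xS; exact: val.
- by move=> l; rewrite -quo_P EE.
Qed.

Section Recursion.
Variables (A : pzRingType) (ka : {rmorphism k -> A}).
Hypothesis kaC : forall a x, ka a * x = x * ka a.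
Variables (e : nat) (z : nat -> F).
Hypothesis e0 : (0 < e)%N.

(** The state of a linear recursion of order e: [state a j f] will be the term a + j of the
    sequence, for j < e. *)
Fixpoint state (a j : nat) (f : F) : A :=
  if a is a'.+1 then
    if (j.+1 < e)%N then state a' j.+1 f else - \sum_(i < e) state a' i (z i * f)
  else if j == e.-1 then ka (fs_tr F f) else 0.

Lemma state_lin a j c f g : state a j (c *: f + g) = ka c * state a j f + state a j g.
Proof.
elim: a j f g => [|a IH] j f g /=.
  case: eqP => _; last by rewrite mulr0 addr0.
  by rewrite linearP rmorphD rmorphM.
case: ifP => _; first exact: IH.
rewrite mulrN -opprD mulr_sumr -big_split /=; congr (- _); apply: eq_bigr => i _.
by rewrite mulrDr -scalerAr IH.
Qed.

Lemma state_shift a j f : (j < e)%N -> state a j f = state (a + j) 0 f.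
Proof.
elim: j a => [|j IH] a hj; first by rewrite addn0.
by rewrite -addSnnS -IH 1?ltnW //= hj.
Qed.

(** The functional on F[x] with initial values 0, ..., 0, tr that vanishes on the multiples of
    the monic polynomial with lower coefficients z. *)
Definition monic_functional : functional F ka := Functional (fun a => @state_lin a 0).

Lemma monic_functional_low a f : (a < e)%N ->
  monic_functional a f = if a == e.-1 then ka (fs_tr F f) else 0.
Proof. by move=> ha; rewrite /= -[a]add0n -state_shift. Qed.

Lemma monic_functional_rec a f :
  monic_functional (e + a)%N f + \sum_(i < e) monic_functional (i + a)%N (z i * f) = 0.
Proof.
have -> : (e + a = a.+1 + e.-1)%N by rewrite addSnnS prednK // addnC.
rewrite -[monic_functional _ f]/(state (a.+1 + e.-1) 0 f) -state_shift ?prednK //= prednK // ltnn.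
apply/eqP; rewrite addrC subr_eq0; apply/eqP; apply: eq_bigr => i _.
by rewrite -[LHS]/(state (i + a) 0 (z i * f)) addnC -state_shift.
Qed.
End Recursion.

Lemma S0_1 (s : 'S_0) : s = 1%g. Proof. by apply/permP => -[]. Qed.

Lemma H0_ind (Z : H 0%N -> Prop) : (forall a, Z (twk H 0 a)) ->
  (forall u v, Z u -> Z v -> Z (u + v)) -> (forall u v, Z u -> Z v -> Z (u * v)) ->
  forall u, Z u.
Proof.
move=> Zk ZD ZM u; elim/tw_ind: u => [a|u v hu hv|u v hu hv|[] //|[] //|s].
- exact: Zk.
- exact: ZD.
- exact: ZM.
- by rewrite (S0_1 s) P_one; have := Zk 1; rewrite rmorph1.
Qed.

(** On the first level the cyclotomic polynomial chi satisfies h chi = chi h' for a suitable h',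
    by its twisted centrality. So the ideal is chi H, and a functional that vanishes on all
    chi x^a f vanishes on it. *)
Lemma base_trace : exists E : R 1%N -> R 0%N, trace E.
Proof.
have hC := ka_central (aff_slots (tw_affine R 0)).
have hC1 := ka_central (aff_slots (tw_affine H 1)).
have tm := Chi_tm H (@ord_max 0); have [z zp ze] := low_coef (tm_low tm).
pose c := monic_functional (twk R 0) d z.
have ceq (p : 'S_1) (s : 'S_0) : (fun=> c) (p * lift_perm ord_max ord_max s)%g = mP (tw_affine R 0) s c.
  by rewrite (S0_1 s) /mP P_one mL1.
pose u := Coind ceq.
have upC (r : H 0%N) (h : H 1%N) : h * up H r = up H r * h.
  elim/H0_ind: r h => [a|v w hv hw|v w hv hw] h.
  - by rewrite up_k hC1.
  - by rewrite rmorphD mulrDr mulrDl hv hw.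
  - by rewrite rmorphM mulrA hv -mulrA hw mulrA.
have quoC (r : H 0%N) (y : R 0%N) : y * pi r = pi r * y.
  elim/H0_ind: r y => [a|v w hv hw|v w hv hw] y.
  - by rewrite quo_k hC.
  - by rewrite rmorphD mulrDr mulrDl hv hw.
  - by rewrite rmorphM mulrA hv -mulrA hw mulrA.
have chi0 (h : H 1%N) : coef u (Chi H ord_max * h) = 0.
  have [a ha] := fil_exhaust h; elim: ha => {h} [|v w _ hv _ hw|r b f _|[] //].
  - by rewrite mulr0 -[0](subrr 0) (morphB (coef_D u)) subrr.
  - by rewrite mulrDr coef_D hv hw addr0.
  rewrite mulrA upC -mulrA coef_up -[Chi _ _](subrK (twX H ord_max ^+ d)) ze.
  rewrite mulrDl coef_D mulr_suml (morph_sum _ _ _ (coef_D u)).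
  under eq_bigr => i _.
    rewrite -mulrA [twS _ _ _ * _]mulrA S_Xn psi_iter // -mulrA -S_mul mulrA -exprD coef_xS.
    over.
  rewrite mulrA -exprD coef_xS addrC; apply/eqP; apply/eqP.
  by rewrite (monic_functional_rec (twk R 0) z (level_gt0 D)) mulr0.
have swap (h : H 1%N) : exists h', h * Chi H ord_max = Chi H ord_max * h'.
  elim/tw_ind: h => [a|v w [v' hv] [w' hw]|v w [v' hv] [w' hw]|i|i a f _|s].
  - by exists (twk H 1 a); rewrite hC1.
  - by exists (v' + w'); rewrite mulrDl mulrDr hv hw.
  - by exists (v' * w'); rewrite -mulrA hw mulrA hv mulrA.
  - by exists (twX H i); rewrite (tm_X tm).
  - by rewrite (ord1 i) -(ord1 ord_max); eexists; exact: (tm_S tm).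
  - exists 1; suff -> : s = 1%g by rewrite P_one mul1r mulr1.
    by apply/permP => i; rewrite !ord1.
have [|||||E hE _] := @trace_of_coef 0 u _ _ _ _ _; last by exists E.
- move=> h; elim=> {h} [|v w _ hv _ hw|v w i _].
  + by rewrite -[0](subrr 0) (morphB (coef_D u)) subrr.
  + by rewrite coef_D hv hw addr0.
  rewrite (_ : i = ord_max); last by rewrite !ord1.
  by have [v' ->] := swap v; rewrite -mulrA chi0.
- by move=> r h; rewrite upC coef_up quoC.
- by move=> a f ad; rewrite -[LHS]/(c a f) monic_functional_low.
- by case.
- by [].
Qed.
End Descent.

(** * The central functional of a trace *)

Section TowerBraid.
Variables (k : comNzRingType) (F : frobenius_superalgebra k) (D : cyclotomic_datum F).
Variable T : tower D.
Local Notation lft := (lift ord_max).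
Local Notation g_ l := (tperm (lft l) ord_max).

Lemma s_Pg_s m (l : 'I_m) :
  twP T (g_ (@ord_max m)) * up T (twP T (g_ l)) * twP T (g_ ord_max) = twP T (g_ (lft l)).
Proof.
rewrite up_P !P_mul lp_tp; congr twP.
rewrite -{1}[g_ _]tpermV -conjgE tpermJ tpermL tpermD // ?neq_lift //.
by rewrite (inj_eq (@lift_inj _ _)) neq_lift.
Qed.

Lemma braid m (s := twP T (g_ (@ord_max m.+1))) (s' := up T (twP T (g_ (@ord_max m)))) :
  s' * s * s' = s * s' * s.
Proof.
rewrite /s s_Pg_s /s' up_P !P_mul lp_tp; congr twP.
rewrite -{1}[tperm (lft _) (lft _)]tpermV -conjgE tpermJ tpermR tpermD //; by rewrite eq_sym neq_lift.
Qed.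
End TowerBraid.

Section Step.
Variables (k : comNzRingType) (F : frobenius_superalgebra k) (D : cyclotomic_datum F).
Local Notation R := (cyc_tower D).
Local Notation H := (aff_tower D).
Local Notation lft := (lift ord_max).
Local Notation g_ l := (tperm (lft l) ord_max).
Local Notation pi := (quo D _).
Variable m : nat.
Variable E' : R m.+1 -> R m.
Hypothesis hE : trace E'.
Local Notation n := m.+1.
Local Notation la := (@ord_max m).
Local Notation mx := (@ord_max m.+1).
Local Notation func := (functional F (twk R n)).
Local Notation s := (twP H (g_ la) : H m.+2).
Local Notation x' := (twX H la).
Local Notation S' := (twS H la).
Local Notation x := (twX H mx).
Local Notation S := (twS H mx).
Local Notation hup r := (up H r).
Local Notation mR y := (@mR k F _ (twk R n) y).
Let hSH n := aff_slots (tw_affine H n).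

(** The left-hand sides of the equations for the functional of the next trace. *)
Definition conj_coef (c : func) a f : R n := cf c (s * hup (x' ^+ a * S' f) * s).
(** The right-hand sides: conjugation by s should relate the next trace to the given one. *)
Definition conj_target a f : R n := up R (E' (pi (x' ^+ a * S' f))).

Lemma cf_0 (c : func) : cf c 0 = 0.
Proof. exact: morph0 (cf_D c). Qed.
Lemma cf_B (c : func) h h' : cf c (h - h') = cf c h - cf c h'.
Proof. exact: morphB (cf_D c) h h'. Qed.
Lemma cf_Bc (c c' : func) h : cf (c - c') h = cf c h - cf c' h.
Proof. exact: morphB (fun u v => cf_Dc u v h) c c'. Qed.

Lemma lin_arg a (c : k) f g : s * hup (x' ^+ a * S' (c *: f + g)) * s =
  hup (twk H n c) * (s * hup (x' ^+ a * S' f) * s) + s * hup (x' ^+ a * S' g) * s.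
Proof.
rewrite (S_lin (hSH n)) mulrDr rmorphD mulrDr mulrDl; congr (_ + _).
by rewrite (kaCA (hSH n)) rmorphM up_k !mulrA -(kaC (hSH n.+1)).
Qed.

Lemma conj_coef_lin (c : func) a (b : k) f g : conj_coef c a (b *: f + g) = twk R n b * conj_coef c a f + conj_coef c a g.
Proof. by rewrite /conj_coef lin_arg cf_D cf_upl quo_k. Qed.

Lemma conj_target_lin a (b : k) f g : conj_target a (b *: f + g) = twk R n b * conj_target a f + conj_target a g.
Proof.
rewrite /conj_target (S_lin (hSH n)) mulrDr (kaCA (hSH n)) rmorphD rmorphM quo_k.
by rewrite -up_k (tr_D hE) rmorphD (tr_upl hE) rmorphM.
Qed.

Lemma conj_coef_diff (c : func) a f : conj_coef c a f - c a f = cf c (s * hup (x' ^+ a * S' f) * s - x ^+ a * S f).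
Proof. by rewrite cf_B cf_xS. Qed.

(** The equations are triangular: s x'^a f' s is x^a f modulo lower terms. *)
Lemma conj_coef_ext (c c' : func) a f : (forall b g, (b < a)%N -> c b g = c' b g) ->
  conj_coef c a f - c a f = conj_coef c' a f - c' a f.
Proof.
move=> h; rewrite !conj_coef_diff; apply/eqP; rewrite -subr_eq0 -cf_Bc; apply/eqP.
apply: (cf_fil _ (fil_conj_x H m a f)) => b g /h e.
by rewrite -[LHS]/(c b g - c' b g) e subrr.
Qed.

(** Solves the equation number a for u, supposing that the rows of u below a are final. *)
Definition set_row_val (u : func) a b f := if b == a then conj_target a f - (conj_coef u a f - u a f) else u b f.
Fact set_row_lin u a b c f g : set_row_val u a b (c *: f + g) = twk R n c * set_row_val u a b f + set_row_val u a b g.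
Proof.
rewrite /set_row_val; case: eqP => _; last exact: fn_lin.
rewrite conj_target_lin conj_coef_lin fn_lin !opprB mulrDr mulrBr [RHS]addrACA; congr (_ + _).
by rewrite opprD addrACA.
Qed.
Definition set_row (u : func) a : func := Functional (set_row_lin u a).
Fixpoint approx a : func := if a is b.+1 then set_row (approx b) b else 0.
Fact solution_lin a c f g :
  approx a.+1 a (c *: f + g) = twk R n c * approx a.+1 a f + approx a.+1 a g.
Proof. exact: fn_lin. Qed.
Definition solution : func := Functional solution_lin.

Lemma approx_stable a b f : (b < a)%N -> approx a b f = solution b f.
Proof.
elim: a => // a IH; rewrite ltnS leq_eqVlt => /orP[/eqP -> //|ba].
by rewrite -IH //= /set_row_val (ltn_eqF ba).
Qed.

Lemma conj_coef_solution a f : conj_coef solution a f = conj_target a f.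
Proof.
have e : solution a f = conj_target a f - (conj_coef (approx a) a f - approx a a f).
  by rewrite /= /set_row_val eqxx.
rewrite -[LHS](subrK (solution a f)) (conj_coef_ext (c' := approx a)); last first.
  by move=> b g ba; rewrite approx_stable.
by rewrite e addrC subrK.
Qed.

(** The unknown functional is determined by the equations, for any family of elements with the
    leading terms x^a f. *)
Lemma cf_inj (u : func) (Y : nat -> F -> H m.+2) :
  (forall a f, fil a (Y a f - x ^+ a * S f)) ->
  (forall a e f, fs_gr e f -> cf u (Y a f) = 0) -> u = 0.
Proof.
move=> hY h; apply: fnP => a f.
elim/ltn_ind: a f => a IH f; elim/gr_ind: f => [|v w hv hw|e f hf].
- by rewrite fn0.
- by rewrite fnD hv hw addr0.
have := cf_fil (c := u) _ (hY a f); rewrite cf_B (h _ _ _ hf) cf_xS sub0r => e0.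
by apply/eqP; rewrite -oppr_eq0; apply/eqP/e0 => b g ba; exact: IH.
Qed.

Local Notation c := solution.

(** The equations have been imposed for y = x'^a f', and both sides vanish on the rest of the
    filtration. *)
Lemma cf_conj (y : H n) : cf c (s * hup y * s) = up R (E' (pi y)).
Proof.
have [a ha] := fil_exhaust y; elim: ha => {y} [|u v _ hu _ hv|r b f _|l r r'].
- by rewrite !rmorph0 mulr0 mul0r cf_0 (tr_0 hE) rmorph0.
- by rewrite !rmorphD mulrDr mulrDl cf_D hu hv (tr_D hE) rmorphD.
- rewrite rmorphM mulrA s_up2 -!mulrA cf_upl [in LHS]mulrA -/(conj_coef c b f) conj_coef_solution.
  by rewrite [quo D n (hup r * _)]rmorphM !quo_up (tr_upl hE) rmorphM.
rewrite !rmorphM -!mulrA -s_up2 !mulrA s_up2 -!mulrA cf_upl !mulrA.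
rewrite s_Pg_s -[twP _ _]mul1r -(rmorph1 (up H)) cf_P mulr0.
by rewrite !quo_up quo_P (tr_upr hE) (tr_upl hE) (tr_P hE) mulr0 mul0r rmorph0.
Qed.

Lemma S_s g : S g * s = s * hup (S' g).
Proof. by rewrite up_S P_slot tpermL. Qed.
Lemma s_S g : s * S g = hup (S' g) * s.
Proof. by rewrite up_S P_slot tpermR. Qed.

(** The slot is moved to s, where it becomes a slot of the lower algebra. *)
Lemma cf_Szs (u : func) g z : cf u (S g * hup z * s) = 0.
Proof.
have [r0 [r1 ->]] := slot_past z.
by rewrite mulrDl cf_D -!mulrA !S_s [hup r0 * _]mulrA [hup r1 * _]mulrA !cf_P addr0.
Qed.
Lemma cf_szS (u : func) g z : cf u (s * hup z * S g) = 0.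
Proof.
have [r0 [r1 e]] := past_slot z.
by rewrite -mulrA e mulrDr cf_D !mulrA !s_S !cf_P addr0.
Qed.

(** For all r together, this makes the matrix coefficient of [c] linear on the right. *)
Definition central r := alpha D n r c = mR (pi r) c.

(** Both sides of the equation [central r] are functionals, hence equal if they have the same
    values at the elements s y s. *)
Lemma central_intro r :
  (forall a e f, fs_gr e f -> let y := x' ^+ a * S' f in
    cf c (s * hup y * s * hup r) = up R (E' (pi y)) * pi r) -> central r.
Proof.
move=> h; apply/eqP; rewrite -subr_eq0; apply/eqP; apply: (cf_inj (fil_conj_x H m)) => a e f hf.
rewrite cf_Bc cf_mR -cf_upr (h _ _ _ hf) -/(conj_coef _ _ _) conj_coef_solution.
by rewrite subrr.
Qed.

Lemma central_D r t : central r -> central t -> central (r + t).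
Proof.
rewrite /central => hr ht; rewrite !rmorphD endoD hr ht; apply: fnP => a f.
by rewrite /= mulrDr.
Qed.
Lemma central_M r t : central r -> central t -> central (r * t).
Proof.
rewrite /central => hr ht; rewrite !rmorphM endoM ht -endoM alpha_mR endoM hr.
by apply: fnP => a f; rewrite /= mulrA.
Qed.
Lemma central_k b : central (twk H n b).
Proof.
rewrite /central alpha_k quo_k; apply: fnP => a f /=.
by rewrite (kaC (aff_slots (tw_affine R n))).
Qed.

(** Elements from two levels below commute with s, and the previous trace is a bimodule map. *)
Lemma central_up q : central (hup q).
Proof.
apply: central_intro => a e f _ y.
rewrite -mulrA s_up2 mulrA -[_ * hup y * _]mulrA -rmorphM cf_conj.
by rewrite rmorphM quo_up (tr_upr hE) rmorphM.
Qed.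

(** After s x' = x s - t and x s = s x' + t, the two teleporter terms vanish by [cf_Szs] and
    [cf_szS]. *)
Lemma central_x : central x'.
Proof.
apply: central_intro => a e f _ y.
rewrite -mulrA s_x' mulrBr cf_B [X in _ - X](_ : _ = 0) ?subr0; last first.
  rewrite mulr_sumr (morph_sum _ _ _ (cf_D c)) big1 // => b _.
  by rewrite -up_S mulrA -[_ * hup y * _]mulrA -rmorphM cf_szS.
rewrite mulrA -[_ * hup y * _]mulrA -x_up mulrA s_x !mulrDl cf_D.
rewrite [X in _ + X](_ : _ = 0) ?addr0; last first.
  rewrite !mulr_suml (morph_sum _ _ _ (cf_D c)) big1 // => b _.
  by rewrite -up_S -[_ * _ * hup y]mulrA -rmorphM cf_Szs.
by rewrite -!mulrA cf_upl mulrA cf_conj quo_X x_up.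
Qed.

(** Here the parity of the previous trace enters. *)
Lemma central_S e0 g : fs_gr e0 g -> central (S' g).
Proof.
move=> hg; apply: central_intro => a e f hf y.
have yS : hup y * S g = (-1) ^+ (e.2 && e0.2) * (S g * hup y).
  rewrite /y rmorphM rmorphXn up_S -mulrA; case: e e0 hf hg => [e p] [e0 q] hf hg.
  rewrite (S_comm (hSH n.+1) _ hf hg); last by rewrite eq_sym neq_lift.
  rewrite mul_signCA !mulrA; congr (_ * _); rewrite -!mulrA; congr (_ * _).
  apply/esym/commrX; rewrite up_X /GRing.comm (S_Xne (tw_affine H n.+1)) //.
  exact: neq_lift.
rewrite -[_ * s * _]mulrA -S_s -!mulrA [hup y * _]mulrA yS -!mulrA mul_signCA.
rewrite [s * (S g * _)]mulrA s_S.
have sgn (b : bool) h : cf c ((-1) ^+ b * h) = (-1) ^+ b * cf c h.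
  by rewrite -(rmorph_sign (up H)) cf_upl rmorph_sign.
rewrite sgn -!mulrA cf_upl [s * (hup y * _)]mulrA cf_conj quo_S.
have hy : rgr ((a%:Z * delta D, false) + e) (pi y).
  rewrite /y rmorphM rmorphXn quo_X quo_S.
  by apply: rgr_M; [exact: rgr_Xn|exact: rgr_S].
rewrite (super_comm (tr_gr hE hy) hg); congr ((-1) ^+ (_ && _) * _).
by case: e {hf hy yS} => [? []].
Qed.
End Step.

Section CentralTransposition.
Variables (k : comNzRingType) (F : frobenius_superalgebra k) (D : cyclotomic_datum F).
Local Notation R := (cyc_tower D).
Local Notation H := (aff_tower D).
Local Notation lft := (lift ord_max).
Local Notation g_ l := (tperm (lft l) ord_max).
Local Notation pi := (quo D _).

(** The elements s s' y s' s have the leading terms x^a f as well, with s' one level below s. They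
    commute with s' by the braid relation, and so do their values, since the previous trace
    sends s' y s' two levels down. *)
Lemma central_s m (E' : R m.+2 -> R m.+1) (hE : trace E') :
  central hE (twP H (g_ (@ord_max m))).
Proof.
pose s := twP H (g_ (@ord_max m.+1)); pose s' := twP H (g_ (@ord_max m)).
pose y a f := twX H (@ord_max m) ^+ a * twS H ord_max f.
pose Y a f := s * up H (s' * up H (y a f) * s') * s.
rewrite -/s'; apply/eqP; rewrite -subr_eq0; apply/eqP.
have hY a f : fil a (Y a f - twX H ord_max ^+ a * twS H ord_max f).
  pose z := twX H (@ord_max m.+1) ^+ a * twS H ord_max f.
  rewrite -(subrK (s * up H z * s) (Y a f)) -addrA; apply: fil_D; last exact: fil_conj_x.
  rewrite /Y -mulrBl -mulrBr -rmorphB; apply: fil_conj; exact: fil_conj_x.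
apply: (cf_inj hY) => a e f hf.
rewrite cf_Bc cf_mR -cf_upr.
have comm : Y a f * up H s' = up H s' * Y a f.
  have br : up H s' * s * up H s' = s * up H s' * s := braid _ _.
  have sy : s * up H (up H (y a f)) = up H (up H (y a f)) * s := s_up2 (y a f).
  rewrite /Y [up H (s' * _ * s')]rmorphM [up H (s' * _)]rmorphM.
  have -> : s * (up H s' * up H (up H (y a f)) * up H s') * s * up H s' =
      s * up H s' * up H (up H (y a f)) * (up H s' * s * up H s') by rewrite !mulrA.
  rewrite br.
  have -> : up H s' * (s * (up H s' * up H (up H (y a f)) * up H s') * s) =
      (up H s' * s * up H s') * up H (up H (y a f)) * (up H s' * s) by rewrite !mulrA.
  by rewrite br -!mulrA [s * (up H (up H _) * _)]mulrA sy -!mulrA.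
rewrite comm cf_upl cf_conj.
have [w ew] := tr_link hE (pi (y a f)).
have -> : E' (pi (s' * up H (y a f) * s')) = up R w.
  by rewrite [pi (s' * _ * s')]rmorphM [pi (s' * _)]rmorphM quo_up quo_P -ew.
by rewrite quo_P s_up2 subrr.
Qed.
End CentralTransposition.

(** * From one trace to the next *)

Section Step.
Variables (k : comNzRingType) (F : frobenius_superalgebra k) (D : cyclotomic_datum F).
Local Notation R := (cyc_tower D).
Local Notation H := (aff_tower D).
Local Notation lft := (lift ord_max).
Local Notation g_ l := (tperm (lft l) ord_max).
Local Notation d := (level D).
Local Notation pi := (quo D _).
Local Notation hup r := (up H r).

Lemma central_g m (E' : R m.+1 -> R m) (hE : trace E') l : central hE (twP H (g_ l)).
Proof.
case: m E' hE l => [|m] E' hE l; first by case: l.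
by rewrite P_gE; apply: central_M (central_up _ _); apply: central_M (central_up _ _) (central_s _).
Qed.

Section WithTrace.
Variable m : nat.
Variable E' : R m.+1 -> R m.
Hypothesis hE : trace E'.
Local Notation n := m.+1.
Local Notation la := (@ord_max m).
Local Notation mx := (@ord_max m.+1).
Local Notation s := (twP H (g_ la) : H m.+2).
Local Notation x := (twX H mx).
Local Notation S := (twS H mx).
Local Notation c := (solution hE).

(** Every permutation is a product of one that fixes the last index and of a transposition with
    the last index. *)
Lemma central_all r : central hE r.
Proof.
elim/tw_ind: r => [a|u v hu hv|u v hu hv|i|i a f hf|p].
- exact: central_k.
- exact: central_D.
- exact: central_M.
- case: (unliftP la i) => [j|] ->; last exact: central_x.
  by rewrite -up_X; exact: central_up.
- case: (unliftP la i) => [j|] ->; last exact: central_S hf.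
  by rewrite -up_S; exact: central_up.
case: (unliftP la ((p^-1)%g la)) => [j|] ep.
  have hq : (g_ j * p)%g la = la by rewrite permM tpermR -ep permKV.
  have [q eq] := stab_lp hq.
  have -> : p = (g_ j * lift_perm ord_max ord_max q)%g by rewrite -eq mulgA tperm2 mul1g.
  by rewrite -P_mul -up_P; apply: central_M (central_up _ _) (central_g _ _).
have hq : p la = la by rewrite -{1}ep permKV.
by have [q ->] := stab_lp hq; rewrite -up_P; exact: central_up.
Qed.

Lemma cf_upr_c h r : cf c (h * hup r) = cf c h * pi r.
Proof. by rewrite cf_upr (central_all r) cf_mR. Qed.

(** By [past_slot] the lower algebra can be moved from the left to the right of the last slot. *)
Lemma slot_right (h : H m.+2) : sums (fun _ : degree => fun h =>
  (exists b f q, h = x ^+ b * S f * hup q) \/ (exists q q', h = hup q * s * hup q')) h.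
Proof.
pose Q (_ : degree) h := (exists b f q, h = x ^+ b * S f * hup q)
  \/ (exists q q', h = hup q * s * hup q').
have [a ha] := fil_exhaust h; elim: ha => {h} [|u v _ hu _ hv|q b f _|l q q'].
- exact: sums_0.
- exact: sums_D.
- have [r0 [r1 e]] := past_slot q.
  rewrite mulrA -xX_up -mulrA e mulrDr !mulrA.
  by apply: sums_D; apply: (@sums_1 _ Q 0); left; eexists; eexists; eexists.
apply: (@sums_1 _ Q 0); right; exists (q * twP H (tperm l la)), (twP H (tperm l la) * q').
by rewrite P_gE !rmorphM !mulrA.
Qed.

Section Kill.
Variable i : 'I_n.
Hypothesis hi : i = 0%N :> nat.
Local Notation chi := (Chi H i).

Lemma quo_chi0 : pi chi = 0.
Proof. by rewrite quo_Chi Chi_cyc. Qed.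

(** In positive rank the cyclotomic polynomial belongs to the lower algebra, and it is even, so the
    last variable and slot commute with it. *)
Lemma chi_xS b f : x ^+ b * S f * hup chi = hup chi * (x ^+ b * S f).
Proof.
rewrite up_Chi; have tm := Chi_tm H (lft i).
rewrite -mulrA (tm_Sne tm); last exact: neq_lift.
rewrite !mulrA; congr (_ * _); apply/esym/commrX; exact: tm_X tm _.
Qed.

(** Here chi belongs to the lower algebra, where its image in the cyclotomic quotient is 0. It is
    therefore enough to move chi to the left or to the right end, except if it stands between two
    factors s; in this case the value is that of the previous trace at an element of the ideal. *)
Lemma cf_chi h h' : cf c (h * hup chi * h') = 0.
Proof.
have [a ha] := fil_exhaust h; elim: ha => {h} [|u v _ hu _ hv|r b f _|l r r'].
- by rewrite !mul0r cf_0.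
- by rewrite !mulrDl cf_D hu hv addr0.
- by rewrite -[_ * hup chi]mulrA chi_xS mulrA -rmorphM -mulrA cf_upl rmorphM quo_chi0 mulr0 mul0r.
rewrite P_gE -!mulrA !cf_upl; set z := twP H (tperm l la).
rewrite (_ : cf c _ = 0) ?mulr0 //.
have -> : s * (hup z * (hup r' * (hup chi * h'))) = s * hup (z * r' * chi) * h'.
  by rewrite !rmorphM !mulrA.
(* Now chi stands between s and h'. In h' the lower algebra is put on the right, where linearity
   removes it, so that chi can leave to the right unless h' contains s. *)
elim: (slot_right h') => {h'} [|u v _ hu _ hv|_ v [[b [f [q ->]]]|[q [q' ->]]]].
- by rewrite mulr0 cf_0.
- by rewrite mulrDr cf_D hu hv addr0.
- have -> : s * hup (z * r' * chi) * (x ^+ b * S f * hup q) =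
      s * hup (z * r') * (hup chi * (x ^+ b * S f)) * hup q.
    by rewrite rmorphM !mulrA.
  rewrite -chi_xS cf_upr_c.
  have -> : s * hup (z * r') * (x ^+ b * S f * hup chi) =
     s * hup (z * r') * (x ^+ b * S f) * hup chi by rewrite !mulrA.
  by rewrite cf_upr_c quo_chi0 mulr0 mul0r.
have -> : s * hup (z * r' * chi) * (hup q * s * hup q') =
    s * hup (z * r' * chi * q) * s * hup q' by rewrite [hup (_ * q)]rmorphM !mulrA.
rewrite cf_upr_c cf_conj [pi (_ * q)]rmorphM [pi (_ * chi)]rmorphM quo_chi0 mulr0 mul0r.
by rewrite (tr_0 hE) rmorph0 mul0r.
Qed.
End Kill.

(** The values c(x^a f), a < d, are not imposed directly; they follow from the triangular
    equations, since the previous trace has the same values. *)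
Lemma trace_step : exists2 E : R m.+2 -> R m.+1, trace E &
  forall y, E (twP R (g_ la) * up R y * twP R (g_ la)) = up R (E' y).
Proof.
have sol b f : (b < d)%N -> c b f = if b == d.-1 then twk R n (fs_tr F f) else 0.
  elim/ltn_ind: b f => b IH f bd.
  have -> : c b f = conj_target E' b f.
    rewrite -(conj_coef_solution hE) -[RHS](subrK (c b f)) conj_coef_diff (cf_fil _ (fil_conj_x H m b f)) ?add0r //.
    move=> b' g bb; rewrite IH //; last exact: ltn_trans bb bd.
    by case: eqP => // e; move: bb bd; rewrite e; case: (d) => //= e'; lia.
  rewrite /conj_target rmorphM rmorphXn quo_X quo_S (tr_x hE) //.
  by case: eqP => _; rewrite ?rmorph0 // up_k.
have [|||||E tE EE] := @trace_of_coef k F D n (equi (tw_affine R n) c) _ _ _ _ _.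
- move=> h; elim=> {h} [|u v _ hu _ hv|u v i hi].
  + exact: cf_0.
  + by rewrite coef_D hu hv addr0.
  have [j ej] : exists j : 'I_n, i = lft j.
    case: (unliftP mx i) => [j ->|e]; first by exists j.
    by move: hi; rewrite e.
  rewrite ej -up_Chi; apply: cf_chi.
  by rewrite -hi ej lift_max.
- exact: (fun r h => cf_upr_c h r).
- by move=> a f ad; rewrite equi1 sol.
- by move=> l; have := cf_P c 1 l 1; rewrite !rmorph1 mul1r mulr1.
- move=> E EE y; have [z <-] := quo_surj y; exists (E' (pi z)).
  by rewrite -quo_up -quo_P -!rmorphM EE; exact: cf_conj.
exists E => // y; have [z <-] := quo_surj y.
by rewrite -quo_up -quo_P -!rmorphM EE; exact: cf_conj.
Qed.
End WithTrace.

Definition trace_ex (n : nat) : {E : R n.+1 -> R n | trace E} :=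
  nat_rect (fun n => {E : R n.+1 -> R n | trace E})
    (cid (base_trace D))
    (fun m T => let e := cid2 (trace_step (svalP T)) in exist _ (s2val e) (s2valP e)) n.
Definition tau n : R n.+1 -> R n := sval (trace_ex n).
Lemma tau_trace n : trace (@tau n). Proof. exact: svalP (trace_ex n). Qed.
Lemma tau_conj m (y : R m.+1) :
  tau (twP R (g_ (@ord_max m)) * up R y * twP R (g_ ord_max)) = up R (tau y).
Proof. by rewrite /tau /=; case: cid2 => E tE /= h; exact: h. Qed.
End Step.

(** * Dual families *)

Section DualBases.
Variables (k : comNzRingType) (F : frobenius_superalgebra k) (D : cyclotomic_datum F).
Local Notation R := (cyc_tower D).
Local Notation lft := (lift ord_max).
Local Notation g_ l := (tperm (lft l) ord_max).
Local Notation d := (level D).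
Local Notation up := (@up _ _ _ R _).
Local Notation X := (twX R).
Local Notation S := (twS R).
Local Notation P := (twP R).
Local Notation gr := (@fs_gr k F).
(** The degree of [u] plus the degree of [v], for members of dual families. *)
Definition top_degree : degree := (d%:Z * delta D, false).

(** Each x moves through P by P x = x' P + t. *)
Lemma fil_Px_pow n (l : 'I_n) b : fil b (P (g_ l) * X (@ord_max n) ^+ b).
Proof.
case: n l => [[] //|m] l.
rewrite P_gE -[_ * up _ * X _ ^+ _]mulrA -xX_up mulrA; apply: fil_upr; rewrite -mulrA; apply: fil_upl.
elim: b => [|b IH]; first by rewrite mulr1; exact: fil_P.
rewrite exprS mulrA s_x mulrDl -mulrA; apply: fil_D.
  by apply: fil_upl; exact: fil_mono IH.
rewrite mulr_suml; apply: fil_sum => c _.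
rewrite -up_S -mulrA -xX_up mulrA; apply: fil_upr.
by rewrite S_Xn; exact: fil_xS.
Qed.

Section Families.
Variables (n : nat) (E : R n.+1 -> R n).
Hypothesis hE : trace E.
Local Notation B := (R n.+1).
Local Notation family := (seq (degree * (B * B))).
Local Notation mx := (@ord_max n).
Local Notation x := (X mx).
Let hS := aff_slots (tw_affine R n.+1).
Let d_gt0 : (0 < d)%N := level_gt0 D.

Definition dual_degrees (s : family) := forall t, t \in s -> rgr t.1 t.2.1 /\ rgr (top_degree - t.1) t.2.2.
(** The operators whose equality to the identity defines dual families. *)
Definition opL (s : family) b : B := \sum_(t <- s) t.2.1 * up (E (t.2.2 * b)).
Definition opR (s : family) b : B := \sum_(t <- s) up (E (b * t.2.1)) * t.2.2.

Lemma opL_D s : {morph opL s : b c / b + c}.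
Proof.
move=> b c; rewrite -big_split; apply: eq_bigr => t _ /=.
by rewrite mulrDr (tr_D hE) rmorphD mulrDr.
Qed.
Lemma opR_D s : {morph opR s : b c / b + c}.
Proof.
move=> b c; rewrite -big_split; apply: eq_bigr => t _ /=.
by rewrite mulrDl (tr_D hE) rmorphD mulrDl.
Qed.
Lemma opL_up s b r : opL s (b * up r) = opL s b * up r.
Proof.
rewrite mulr_suml; apply: eq_bigr => t _ /=.
by rewrite mulrA (tr_upr hE) rmorphM mulrA.
Qed.
Lemma opR_up s b r : opR s (up r * b) = up r * opR s b.
Proof.
rewrite mulr_sumr; apply: eq_bigr => t _ /=.
by rewrite -mulrA (tr_upl hE) rmorphM mulrA.
Qed.

Lemma opL_gr s e b : dual_degrees s -> rgr e b -> rgr e (opL s b).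
Proof.
move=> hs hb; rewrite /opL big_seq; apply: (gr_sum (@rgr_grading _ _ _ n.+1)) => t /hs[hu hv].
have := rgr_M hu (rgr_up (tr_gr hE (rgr_M hv hb))).
have -> // : t.1 + (top_degree - t.1 + e - (d%:Z * delta D, false)) = e.
by rewrite [top_degree - _]addrC -!addrA addNKr addrC subrK.
Qed.
Lemma opR_gr s e b : dual_degrees s -> rgr e b -> rgr e (opR s b).
Proof.
move=> hs hb; rewrite /opR big_seq; apply: (gr_sum (@rgr_grading _ _ _ n.+1)) => t /hs[hu hv].
have := rgr_M (rgr_up (tr_gr hE (rgr_M hb hu))) hv.
by rewrite -/top_degree addrA subrK addrK.
Qed.

(** This choice makes 1 - (extL s t) = (1 - s)(1 - t) for the operators of the families. *)
Definition extL (s t : family) : family :=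
  s ++ [seq (x.1, (x.2.1 - opL s x.2.1, x.2.2)) | x <- t].
Definition extR (s t : family) : family :=
  s ++ [seq (x.1, (x.2.1, x.2.2 - opR s x.2.2)) | x <- t].

Lemma extL_deg s t : dual_degrees s -> dual_degrees t -> dual_degrees (extL s t).
Proof.
move=> hs ht y; rewrite mem_cat => /orP[/hs //|/mapP[z /ht[hu hv] ->]] /=; split=> //.
by apply: (gr_B (@rgr_grading _ _ _ n.+1)) => //; exact: opL_gr.
Qed.
Lemma extR_deg s t : dual_degrees s -> dual_degrees t -> dual_degrees (extR s t).
Proof.
move=> hs ht y; rewrite mem_cat => /orP[/hs //|/mapP[z /ht[hu hv] ->]] /=; split=> //.
by apply: (gr_B (@rgr_grading _ _ _ n.+1)) => //; exact: opR_gr.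
Qed.
Lemma opL_opL s t b : opL s (opL t b) = \sum_(y <- t) opL s y.2.1 * up (E (y.2.2 * b)).
Proof.
transitivity (\sum_(y <- t) opL s (y.2.1 * up (E (y.2.2 * b)))).
  exact: (morph_sum _ _ _ (opL_D s)).
by apply: eq_bigr => y _; rewrite opL_up.
Qed.
Lemma opR_opR s t b : opR s (opR t b) = \sum_(y <- t) up (E (b * y.2.1)) * opR s y.2.2.
Proof.
transitivity (\sum_(y <- t) opR s (up (E (b * y.2.1)) * y.2.2)).
  exact: (morph_sum _ _ _ (opR_D s)).
by apply: eq_bigr => y _; rewrite opR_up.
Qed.
Lemma extLE s t b : opL (extL s t) b = opL s b + (opL t b - opL s (opL t b)).
Proof.
rewrite opL_opL {1}/opL big_cat big_map /= -/(opL s b); congr (_ + _).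
by rewrite -sumrB; apply: eq_bigr => y _; rewrite mulrBl.
Qed.
Lemma extRE s t b : opR (extR s t) b = opR s b + (opR t b - opR s (opR t b)).
Proof.
rewrite opR_opR {1}/opR big_cat big_map /= -/(opR s b); congr (_ + _).
by rewrite -sumrB; apply: eq_bigr => y _; rewrite mulrBr.
Qed.

Lemma left_form (Z : B -> Prop) : Z 0 -> (forall u v, Z u -> Z v -> Z (u + v)) ->
  (forall b f q, (b < d)%N -> Z (up q * (x ^+ b * S mx f))) ->
  (forall l q q', Z (up q * P (g_ l) * up q')) -> forall h, Z h.
Proof.
move=> Z0 ZD Zx ZP h; elim: (cyc_fil h d_gt0) => {h} [//|u v _ hu _ hv|r b f bd|//].
  exact: ZD.
exact: Zx.
Qed.
Lemma right_form (Z : B -> Prop) : Z 0 -> (forall u v, Z u -> Z v -> Z (u + v)) ->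
  (forall b f q, (b < d)%N -> Z (x ^+ b * S mx f * up q)) ->
  (forall l q q', Z (up q * P (g_ l) * up q')) -> forall h, Z h.
Proof.
move=> Z0 ZD Zx ZP; apply: left_form => // b f q bd.
have [r0 [r1 e]] := past_slot q.
by rewrite mulrA -xX_up -mulrA e mulrDr !mulrA; apply: ZD; exact: Zx.
Qed.

Lemma fil_S_l a g (h : B) : fil a h -> fil a (S mx g * h).
Proof.
elim=> {h} [|u v _ hu _ hv|r b f ab|l r r'].
- by rewrite mulr0; exact: fil_0.
- by rewrite mulrDr; exact: fil_D.
- have [r0 [r1 e]] := slot_past r.
  have sx g' : S mx g' * (x ^+ b * S mx f) = x ^+ b * S mx (iter b (psi D) g' * f).
    by rewrite mulrA S_Xn -mulrA -S_mul.
  by rewrite mulrA e mulrDl -!mulrA !sx; apply: fil_D; exact: fil_pol.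
have [r0 [r1 e]] := slot_past r.
have sm f w : S mx f * (P (g_ l) * w) = P (g_ l) * (up (S l f) * w).
  by rewrite up_S !mulrA P_slot tpermL.
rewrite -mulrA mulrA e mulrDl -!mulrA !sm -!rmorphM.
by apply: fil_D; rewrite mulrA; exact: fil_s.
Qed.
Lemma fil_S_r a g (h : B) : fil a h -> fil a (h * S mx g).
Proof.
elim=> {h} [|u v _ hu _ hv|r b f ab|l r r'].
- by rewrite mul0r; exact: fil_0.
- by rewrite mulrDl; exact: fil_D.
- by rewrite -!mulrA -S_mul; exact: fil_pol.
have [r0 [r1 e]] := past_slot r'.
have sm f w : P (g_ l) * (S mx f * w) = up (S l f) * (P (g_ l) * w).
  by rewrite up_S !mulrA P_slot tpermR.
rewrite -!mulrA e !mulrDr !sm !mulrA -!rmorphM.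
by apply: fil_D; exact: fil_s.
Qed.

(** A trace only starts to see the exponent d - 1. *)
Lemma E_fil a h : (a < d)%N -> fil a h -> E h = 0.
Proof.
move=> ad; elim=> {h} [|u v _ hu _ hv|r b f ba|l r r'].
- exact: tr_0 hE.
- by rewrite (tr_D hE) hu hv addr0.
- rewrite (tr_upl hE) (tr_x hE); last exact: ltn_trans ba ad.
  by case: eqP => [e|_]; [move: ba ad; rewrite e; lia|rewrite mulr0].
- by rewrite (tr_upr hE) (tr_upl hE) (tr_P hE) mulr0 mul0r.
Qed.

Lemma E_SxP e g l r r' : (e < d)%N -> E (S mx g * x ^+ e * (up r * P (g_ l) * up r')) = 0.
Proof.
move=> ed; apply: (E_fil ed); rewrite -!mulrA [x ^+ e * _]mulrA xX_up -!mulrA.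
by apply: fil_S_l; apply: fil_upl; rewrite mulrA; apply: fil_upr; exact: fil_xP.
Qed.
Lemma E_PxS e g l r r' : (e < d)%N -> E (up r * P (g_ l) * up r' * (x ^+ e * S mx g)) = 0.
Proof.
move=> ed; apply: (E_fil ed); rewrite !mulrA; apply: fil_S_r.
rewrite -[_ * up r' * _]mulrA -xX_up mulrA; apply: fil_upr.
by rewrite -mulrA; apply: fil_upl; exact: fil_Px_pow.
Qed.

Definition psiVn m (f : F) : F := iter m (@psiV _ _ D) f.
Lemma psiVnK m f : iter m (psi D) (psiVn m f) = f.
Proof. by rewrite /psiVn; elim: m => //= m IH; rewrite -iterS iterSr psiVK. Qed.
Lemma psiVKn m f : psiVn m (iter m (psi D) f) = f.
Proof. by rewrite /psiVn; elim: m => //= m IH; rewrite -iterS iterSr psiKV. Qed.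
Lemma psiVn_lin m a f g : psiVn m (a *: f + g) = a *: psiVn m f + psiVn m g.
Proof. by rewrite /psiVn; elim: m => //= m ->; rewrite psiV_lin. Qed.
Lemma psiVn_gr m a f : gr a f -> gr a (psiVn m f).
Proof. by move=> hf; rewrite /psiVn; elim: m => //= m; exact: psiV_gr. Qed.
Lemma psiVnD m : {morph psiVn m : f g / f + g}.
Proof. by move=> f g; have := psiVn_lin m 1 f g; rewrite !scale1r. Qed.
Lemma psiVnZ m a f : psiVn m (a *: f) = a *: psiVn m f.
Proof.
have := psiVn_lin m a f 0; rewrite !addr0 => ->.
by rewrite (morph0 (psiVnD m)) addr0.
Qed.

Lemma xSxS e a f g : S mx g * x ^+ e * (x ^+ a * S mx f) = x ^+ (e + a) * S mx (iter (e + a) (psi D) g * f).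
Proof. by rewrite -!mulrA [x ^+ e * _]mulrA -exprD mulrA S_Xn -mulrA -S_mul. Qed.

(** With these elements, E(v x^a f) picks out the coordinates of f in the basis. Smaller exponents
    of x are annihilated; the larger ones are not, which is what makes the recursion over a
    in [extend_L] necessary. *)
Definition thetaL a : family :=
  [seq ((a%:Z * delta D, false) + ((bdeg b).1, bpar b),
     (x ^+ a * S mx (bas D b), S mx (psiVn d.-1 (dual_bas D b)) * x ^+ (d.-1 - a)))
   | b <- index_enum 'I_(rk D)].
Definition thetaR a : family :=
  [seq (((d.-1 - a)%N%:Z * delta D, false) + ((bdeg b).1, bpar b),
     (x ^+ (d.-1 - a) * S mx (bas D b), x ^+ a * S mx (psiVn (d.-1 - a) (dual_bas D b))))
   | b <- index_enum 'I_(rk D)].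

Lemma theta_deg a (b : 'I_(rk D)) : (a < d)%N -> top_degree - ((a%:Z * delta D, false) + ((bdeg b).1, bpar b)) =
  (delta D - (bdeg b).1, bpar b) + ((d.-1 - a)%N%:Z * delta D, false) :> degree.
Proof.
move=> ad; have e : d%:Z = 1 + a%:Z + (d.-1 - a)%N%:Z :> int by lia.
rewrite /top_degree e; case: (bpar b) (bdeg b) => [] [b1 b2] /=; congr pair.
all: by rewrite /= !mulrDl mul1r; lia.
Qed.

Lemma thetaL_deg a : (a < d)%N -> dual_degrees (thetaL a).
Proof.
move=> ad t /mapP[b _ ->] /=; split.
  by apply: rgr_M; [exact: rgr_Xn|apply: rgr_S; exact: bas_gr].
rewrite (theta_deg b ad); apply: rgr_M; last exact: rgr_Xn.
by apply: rgr_S; apply: psiVn_gr; exact: dual_bas_gr.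
Qed.
Lemma thetaR_deg a : (a < d)%N -> dual_degrees (thetaR a).
Proof.
move=> ad t /mapP[b _ ->] /=; split.
  by apply: rgr_M; [exact: rgr_Xn|apply: rgr_S; exact: bas_gr].
have ad' : (d.-1 - a < d)%N by lia.
rewrite (theta_deg b ad') addrC subKn; last by lia.
by apply: rgr_M; [exact: rgr_Xn|apply: rgr_S; apply: psiVn_gr; exact: dual_bas_gr].
Qed.

Lemma thetaL_x a a' f r : (a' <= a < d)%N ->
  opL (thetaL a) (x ^+ a' * S mx f * up r) = if a' == a then x ^+ a * S mx f * up r else 0.
Proof.
case/andP=> aa ad; rewrite /opL big_map.
transitivity (\sum_b x ^+ a * S mx (bas D b) *
    up ((if a' == a then twk R n (fs_tr F (dual_bas D b * f)) else 0) * r)).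
  apply: eq_bigr => b _; rewrite -[LHS]/(x ^+ a * S mx (bas D b) *
    up (E (S mx (psiVn d.-1 (dual_bas D b)) * x ^+ (d.-1 - a) * (x ^+ a' * S mx f * up r)))).
  rewrite [X in E X]mulrA (tr_upr hE) xSxS (tr_x hE); last by lia.
  congr (_ * up (_ * _)); have -> : (d.-1 - a + a' == d.-1)%N = (a' == a) by lia.
  by case: eqP => // ->; rewrite subnK ?psiVnK //; lia.
case: eqP => _; last by rewrite big1 // => b _; rewrite mul0r rmorph0 mulr0.
rewrite {2}[f](expand_bas D) (slot_sum hS) mulr_sumr mulr_suml; apply: eq_bigr => b _.
by rewrite (slotZ hS) rmorphM up_k !mulrA -!(kaC hS) !mulrA.
Qed.
Lemma thetaR_x a a' f r : (a' <= a < d)%N ->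
  opR (thetaR a) (up r * (x ^+ a' * S mx f)) = if a' == a then up r * (x ^+ a * S mx f) else 0.
Proof.
case/andP=> aa ad; rewrite /opR big_map; set e := (d.-1 - a)%N.
transitivity (\sum_b up (r * (if a' == a then twk R n (fs_tr F (iter e (psi D) f * bas D b)) else 0)) *
   (x ^+ a * S mx (psiVn e (dual_bas D b)))).
  apply: eq_bigr => b _; rewrite -[LHS]/(up (E (up r * (x ^+ a' * S mx f) * (x ^+ e * S mx (bas D b)))) *
    (x ^+ a * S mx (psiVn e (dual_bas D b)))).
  rewrite -[X in E X]mulrA (tr_upl hE).
  have -> : x ^+ a' * S mx f * (x ^+ e * S mx (bas D b)) =
     x ^+ (a' + e) * S mx (iter e (psi D) f * bas D b).
    by rewrite -mulrA [S mx f * _]mulrA S_Xn -!mulrA -S_mul mulrA -exprD.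
  rewrite (tr_x hE); last by rewrite /e; lia.
  by have -> : (a' + e == d.-1)%N = (a' == a) by rewrite /e; lia.
case: eqP => _; last by rewrite big1 // => b _; rewrite mulr0 rmorph0 mul0r.
have ef : f = \sum_b fs_tr F (iter e (psi D) f * bas D b) *: psiVn e (dual_bas D b).
  rewrite -[LHS](psiVKn e) [in LHS](expand_dual D (iter e _ f)) (morph_sum _ _ _ (psiVnD e)).
  by apply: eq_bigr => b _; rewrite psiVnZ.
rewrite {2}ef (slot_sum hS) !mulr_sumr; apply: eq_bigr => b _.
by rewrite (slotZ hS) rmorphM up_k (kaCA hS) !mulrA.
Qed.

Lemma thetaL_P a l r r' : (a < d)%N -> opL (thetaL a) (up r * P (g_ l) * up r') = 0.
Proof.
move=> ad; rewrite /opL big_map big1 // => b _ /=.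
by rewrite E_SxP ?rmorph0 ?mulr0 //; lia.
Qed.
Lemma thetaR_P a l r r' : (a < d)%N -> opR (thetaR a) (up r * P (g_ l) * up r') = 0.
Proof.
move=> ad; rewrite /opR big_map big1 // => b _ /=.
by rewrite E_PxS ?rmorph0 ?mul0r //; lia.
Qed.

Lemma opL_0 s : opL s 0 = 0. Proof. exact: morph0 (opL_D s). Qed.
Lemma opR_0 s : opR s 0 = 0. Proof. exact: morph0 (opR_D s). Qed.

(** If s reproduces the part R_n P R_n, the families [thetaL a] for a = 0, ..., d-1 are
    appended one after the other. They annihilate everything that has been reproduced before. *)
Lemma extend_L (s : family) : dual_degrees s ->
  (forall l r r', opL s (up r * P (g_ l) * up r') = up r * P (g_ l) * up r') ->
  exists2 s', dual_degrees s' & forall b, opL s' b = b.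
Proof.
move=> hs sP.
have [s' [hs' s'P s'x]] : exists s', [/\ dual_degrees s',
    forall l r r', opL s' (up r * P (g_ l) * up r') = up r * P (g_ l) * up r' &
    forall b f r, (b < d)%N -> opL s' (x ^+ b * S mx f * up r) = x ^+ b * S mx f * up r].
  elim: {1 3}d (leqnn d) => [|a IH] ad; first by exists s; split.
  have [|t [ht tP tx]] := IH; first exact: ltnW.
  exists (extL t (thetaL a)); split=> [|l r r'|b f r].
  - by apply: extL_deg => //; exact: thetaL_deg.
  - by rewrite extLE thetaL_P // opL_0 subrr addr0.
  rewrite ltnS => ba; rewrite extLE thetaL_x ?ba //; case: eqP => [->|ne].
    by rewrite addrC subrK.
  by rewrite opL_0 subrr addr0 tx // ltn_neqAle ba andbT; apply/eqP.
exists s' => //; apply: right_form => [|u v hu hv|b f q bd|l q q'].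
- exact: opL_0.
- by rewrite opL_D hu hv.
- exact: s'x.
- exact: s'P.
Qed.
Lemma extend_R (s : family) : dual_degrees s ->
  (forall l r r', opR s (up r * P (g_ l) * up r') = up r * P (g_ l) * up r') ->
  exists2 s', dual_degrees s' & forall b, opR s' b = b.
Proof.
move=> hs sP.
have [s' [hs' s'P s'x]] : exists s', [/\ dual_degrees s',
    forall l r r', opR s' (up r * P (g_ l) * up r') = up r * P (g_ l) * up r' &
    forall b f r, (b < d)%N -> opR s' (up r * (x ^+ b * S mx f)) = up r * (x ^+ b * S mx f)].
  elim: {1 3}d (leqnn d) => [|a IH] ad; first by exists s; split.
  have [|t [ht tP tx]] := IH; first exact: ltnW.
  exists (extR t (thetaR a)); split=> [|l r r'|b f r].
  - by apply: extR_deg => //; exact: thetaR_deg.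
  - by rewrite extRE thetaR_P // opR_0 subrr addr0.
  rewrite ltnS => ba; rewrite extRE thetaR_x ?ba //; case: eqP => [->|ne].
    by rewrite addrC subrK.
  by rewrite opR_0 subrr addr0 tx // ltn_neqAle ba andbT; apply/eqP.
exists s' => //; apply: left_form => [|u v hu hv|b f q bd|l q q'].
- exact: opR_0.
- by rewrite opR_D hu hv.
- exact: s'x.
- exact: s'P.
Qed.

(** The right family shows that E(z b) = 0 for all b implies z = 0; this is then applied to the
    difference of the two sides. *)
Lemma two_sided s s' : (forall b, opL s b = b) -> (forall b, opR s' b = b) ->
  forall b, opR s b = b.
Proof.
move=> hL hR b.
have nd z : (forall b', E (z * b') = 0) -> z = 0.
  move=> hz; rewrite -(hR z) /opR big1 // => t _; by rewrite hz rmorph0 mul0r.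
apply/eqP; rewrite -subr_eq0; apply/eqP; apply: nd => b'.
rewrite mulrBl (morphB (tr_D hE)) mulr_suml (morph_sum _ _ _ (tr_D hE)).
rewrite -{2}(hL b') mulr_sumr (morph_sum _ _ _ (tr_D hE)).
rewrite -sumrB big1 // => t _.
by rewrite -[up _ * _ * b']mulrA (tr_upl hE) mulrA (tr_upr hE) subrr.
Qed.
End Families.

(** The families u s, s v coming from the level below reproduce R_n s R_n because
    tau(s v y s) is the previous trace of v y. *)
Theorem dual_families n : exists s : seq (degree * (R n.+1 * R n.+1)),
  [/\ dual_degrees s, forall b, opL (@tau _ _ D n) s b = b & forall b, opR (@tau _ _ D n) s b = b].
Proof.
have fromLR m : (exists2 s, dual_degrees s & forall b, opL (@tau _ _ D m) s b = b) ->
    (exists2 s, dual_degrees s & forall b, opR (@tau _ _ D m) s b = b) ->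
    exists s : seq (degree * (R m.+1 * R m.+1)),
      [/\ dual_degrees s, forall b, opL (@tau _ _ D m) s b = b & forall b, opR (@tau _ _ D m) s b = b].
  move=> [s hs sL] [s' _ sR]; exists s; split=> //.
  exact: (two_sided (tau_trace D m) sL sR).
elim: n => [|m [s [hs sL sR]]].
  apply: fromLR; [apply: (@extend_L 0 _ (tau_trace D 0) [::])|apply: (@extend_R 0 _ (tau_trace D 0) [::])] => //; by case.
pose p := P (g_ (@ord_max m)) : R m.+2.
pose s1 := [seq (t.1, (up t.2.1 * p, p * up t.2.2)) | t <- s].
have hs1 : dual_degrees s1.
  move=> t /mapP[y /hs[hu hv] ->] /=.
  split; first by have := rgr_M (rgr_up hu) (rgr_P D (g_ (@ord_max m))); rewrite addr0.
  by have := rgr_M (rgr_P D (g_ (@ord_max m))) (rgr_up hv); rewrite add0r.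
have hE := tau_trace D m.+1.
apply: fromLR.
  apply: (extend_L hE hs1) => l r r'.
  rewrite P_gE !mulrA -rmorphM -!mulrA -rmorphM !mulrA -/p.
  move: (r * _) (_ * r') => q q'.
  rewrite /opL big_map -[in RHS](sL q) [in RHS]/opL rmorph_sum !mulr_suml.
  apply: eq_bigr => t _.
  rewrite -[LHS]/(up t.2.1 * p * up (tau (p * up t.2.2 * (up q * p * up q')))).
  have -> : p * up t.2.2 * (up q * p * up q') = p * up (t.2.2 * q) * p * up q'.
    by rewrite rmorphM !mulrA.
  rewrite (tr_upr hE) tau_conj rmorphM mulrA -[_ * p * _]mulrA s_up2 !mulrA.
  by rewrite [in RHS]rmorphM.
apply: (extend_R hE hs1) => l r r'.
rewrite P_gE !mulrA -rmorphM -!mulrA -rmorphM !mulrA -/p.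
move: (r * _) (_ * r') => q q'.
rewrite /opR big_map -[in RHS](sR q') [in RHS]/opR rmorph_sum !mulr_sumr.
apply: eq_bigr => t _.
rewrite -[LHS]/(up (tau (up q * p * up q' * (up t.2.1 * p))) * (p * up t.2.2)).
have -> : up q * p * up q' * (up t.2.1 * p) = up q * (p * up (q' * t.2.1) * p).
  by rewrite rmorphM !mulrA.
rewrite (tr_upl hE) tau_conj rmorphM -!mulrA; congr (_ * _).
by rewrite mulrA -s_up2 -mulrA [in RHS]rmorphM.
Qed.
End DualBases.

(** * Frobenius extensions *)

(** A Frobenius extension whose trace has degree -d and even parity. *)
Record frobenius_extension (k : comNzRingType) (A B : gsalg k) (i : gahom A B) (d : int) :=
  FrobeniusExtension {
    fe_tr : B -> A;
    fe_D : {morph fe_tr : b c / b + c};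
    fe_l : forall a b, fe_tr (i a * b) = a * fe_tr b;
    fe_r : forall b a, fe_tr (b * i a) = fe_tr b * a;
    fe_gr : forall e b, ga_gr e b -> ga_gr (e - (d, false)) (fe_tr b);
    fe_size : nat;
    fe_deg : 'I_fe_size -> degree;
    fe_u : 'I_fe_size -> B;
    fe_v : 'I_fe_size -> B;
    fe_u_gr : forall t, ga_gr (fe_deg t) (fe_u t);
    fe_v_gr : forall t, ga_gr ((d, false) - fe_deg t) (fe_v t);
    fe_L : forall b, \sum_t fe_u t * i (fe_tr (fe_v t * b)) = b;
    fe_R : forall b, \sum_t i (fe_tr (b * fe_u t)) * fe_v t = b }.

Section Extension.
Variables (k : comNzRingType) (A B : gsalg k) (i : gahom A B) (d : int).
Variable X : frobenius_extension i d.
Local Notation E := (fe_tr X).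
Local Notation u := (@fe_u _ _ _ _ _ X).
Local Notation v := (@fe_v _ _ _ _ _ X).

(** The elements v_t generate B as a left A-module. *)
Lemma extension_res_fg : res_preserves_fg i.
Proof.
move=> N; have [r [g hg]] := fg_fin N.
pose J := ('I_r * 'I_(fe_size X))%type.
exists #|{: J}|, (fun j => v (enum_val j).2 *: g (enum_val j).1 : N) => m.
have [c ->] := hg m.
pose c' (p : J) : A := E (c p.1 * u p.2).
exists (fun j => c' (enum_val j)).
transitivity (\sum_(p : J) (i (c' p) *: (v p.2 *: g p.1 : N) : N)); last first.
  exact: (reindex _ (onW_bij _ (enum_val_bij J))).
rewrite -(pair_bigA _ (fun a b => i (E (c a * u b)) *: (v b *: g a : N))); apply: eq_bigr => a _.
rewrite -[in LHS](fe_R X (c a)) scaler_suml; apply: eq_bigr => b _.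
by rewrite scalerA.
Qed.

Section Coordinates.
Variable M : gsmod A.
Local Notation pure := (pure i).
(** The coordinate b (x) m |-> E(b0 b) m. By [pure_ind_coord], the coordinates for b0 = v_t
    determine a tensor. *)
Definition ind_coord (b0 : B) : tens i M -> M := tens_lift (fun b m => E (b0 * b) *: m).

Lemma ind_coordE b0 b m : ind_coord b0 (pure b m) = E (b0 * b) *: m.
Proof.
apply: tens_liftE => [b1 b2 m'|b1 m1 m2|b1 a m'].
- by rewrite mulrDr fe_D scalerDl.
- by rewrite scalerDr.
- by rewrite mulrA fe_r scalerA.
Qed.
Lemma ind_coordD b0 : {morph ind_coord b0 : z w / z + w}.
Proof.
apply: tens_liftD => [b1 b2 m'|b1 m1 m2|b1 a m'].
- by rewrite mulrDr fe_D scalerDl.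
- by rewrite scalerDr.
- by rewrite mulrA fe_r scalerA.
Qed.
Lemma ind_coord0 b0 : ind_coord b0 0 = 0. Proof. exact: morph0 (ind_coordD b0). Qed.
Lemma ind_coord_scale b0 b (z : tens i M) : ind_coord b0 (b *: z) = ind_coord (b0 * b) z.
Proof.
move: z; apply: tens_add_eq => [z w|z w|b' m].
- by rewrite scalerDr ind_coordD.
- by rewrite ind_coordD.
- by rewrite scale_pure !ind_coordE mulrA.
Qed.
Lemma ind_coord_gr b0 e0 e z : ga_gr e0 b0 -> gm_gr e (z : indm i M) ->
  gm_gr (e0 + e - (d, false)) (ind_coord b0 z).
Proof.
move=> h0; elim=> {e z} [e e' b m hb hm|e|e z _ h|e z w _ hz _ hw].
- rewrite ind_coordE (_ : e0 + (e + e') - _ = e0 + e - (d, false) + e'); last by rewrite addrA [LHS]addrAC.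
  by apply: gm_gr_act => //; apply: (fe_gr X); exact: ga_gr_mul.
- by rewrite ind_coord0; exact: (gr_0 (gm_grading M)).
- by rewrite (morphN (ind_coordD b0)); exact: (gr_N (gm_grading M)).
- by rewrite ind_coordD; exact: (gr_D (gm_grading M)).
Qed.

Lemma pure_ind_coord (z : tens i M) : z = \sum_t pure (u t) (ind_coord (v t) z).
Proof.
move: z; apply: tens_add_eq => [z w //|z w|b m].
  by rewrite -big_split; apply: eq_bigr => t _; rewrite ind_coordD pureDr.
under eq_bigr => t _ do rewrite ind_coordE -pure_bal.
by rewrite -pure_suml fe_L.
Qed.
End Coordinates.

Lemma ind_coord_map (M N : gsmod A) (f : gshom M N) b0 (z : tens i M) :
  ind_coord b0 (ind_fun f z) = f (ind_coord b0 z).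
Proof.
move: z; apply: tens_add_eq => [z w|z w|b m].
- by rewrite ind_funD ind_coordD.
- by rewrite ind_coordD gshomD.
- by rewrite ind_funE !ind_coordE gshomZ.
Qed.

(** Exactness can be checked in coordinates, which are natural in the module. *)
Lemma extension_Ind_exact : exact_functor (Ind_functor i).
Proof.
move=> L M N f g [finj gsurj ex]; split.
- move=> z w e; rewrite (pure_ind_coord z) (pure_ind_coord w); apply: eq_bigr => t _; congr pure.
  by apply: finj; rewrite -!(ind_coord_map f) [ind_fun f z]e.
- move=> z; have /choice[c hc] : forall t, exists m, (g : gshom M N) m = ind_coord (v t) z.
    by move=> t; exact: gsurj.
  exists (\sum_t pure i (u t) (c t)); rewrite [RHS](pure_ind_coord z).
  rewrite [LHS](morph_sum _ _ _ (@ind_funD _ _ _ i _ _ g)); apply: eq_bigr => t _.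
  by rewrite (@ind_funE _ _ _ i _ _ g) hc.
- move=> z; split=> [e|[w <-]].
    have /choice[c hc] : forall t, exists l, (f : gshom L M) l = ind_coord (v t) z.
      move=> t; apply/ex; rewrite -(ind_coord_map g).
      by rewrite [ind_fun g z]e ind_coord0.
    exists (\sum_t pure i (u t) (c t)); rewrite [RHS](pure_ind_coord z).
    rewrite [LHS](morph_sum _ _ _ (@ind_funD _ _ _ i _ _ f)); apply: eq_bigr => t _.
    by rewrite (@ind_funE _ _ _ i _ _ f) hc.
  rewrite [LHS](pure_ind_coord (M := N)) big1 // => t _.
  rewrite (ind_coord_map g) (ind_coord_map f).
  have -> : (g : gshom M N) (f (ind_coord (v t) w)) = 0 by apply/ex; eexists.
  exact: pure0r.
Qed.
End Extension.

Lemma gr0_pure (k : comNzRingType) (A B : gsalg k) (i : gahom A B) (M : gsmod A) e (m : M) :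
  gm_gr e m -> gm_gr e (pure i 1 m : indm i M).
Proof.
move=> hm; rewrite -[e]add0r; apply: tg_pure => //.
by rewrite -(rmorph1 (ga_in B)); exact: ga_gr_in.
Qed.

Section InductionAdjunction.
Variables (k : comNzRingType) (A B : gsalg k) (i : gahom A B) (hres : res_preserves_fg i).

Section Hom.
Variables (M : gsmod A) (N : gsmod B).
Lemma adj_lin (h : gshom (indm i M) N) : linear (fun m => h (pure i 1 m) : resm i N).
Proof.
move=> a m m'; rewrite pureDr gshomD -pure_bal mul1r -[i a]mulr1 -(scale_pure i).
by rewrite gshomZ.
Qed.
Definition adj (h : gshom (indm i M) N) : gshom M (resm i N) :=
  GSHom (adj_lin h) (fun e m hm => gh_gr h (gr0_pure i hm)).

Variable f : gshom M (resm i N).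
Definition ext_fun : indm i M -> N := @tens_lift k A B i M N (fun b m => b *: (f m : N)).
Lemma ext_bil : [/\ forall b b' m, (b + b') *: (f m : N) = b *: (f m : N) + b' *: (f m : N),
  forall b m m', b *: (f (m + m') : N) = b *: (f m : N) + b *: (f m' : N) &
  forall b a m, (b * i a) *: (f m : N) = b *: (f (a *: m) : N)].
Proof.
split=> [b b' m|b m m'|b a m]; first exact: scalerDl.
  by rewrite gshomD; exact: scalerDr.
by rewrite gshomZ -scalerA.
Qed.
Lemma ext_funE b m : ext_fun (pure i b m) = b *: (f m : N).
Proof. by have [h1 h2 h3] := ext_bil; exact: tens_liftE. Qed.
Lemma ext_funD : {morph ext_fun : z w / z + w}.
Proof. by have [h1 h2 h3] := ext_bil; exact: tens_liftD. Qed.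
Lemma ext_fun_lin : linear ext_fun.
Proof.
move=> b z w; rewrite ext_funD; congr (_ + _); move: z {w}.
apply: (@tens_add_eq k A B i M N (fun z => ext_fun (b *: z)) (fun z => b *: ext_fun z)) => [z w|z w|b' m].
- by rewrite scalerDr ext_funD.
- by rewrite ext_funD scalerDr.
- by rewrite (scale_pure i) !ext_funE scalerA.
Qed.
Lemma ext_fun_gr e z : gm_gr e z -> gm_gr e (ext_fun z).
Proof.
elim=> {e z} [e e' b m hb hm|e|e z _ h|e z w _ hz _ hw].
- by rewrite ext_funE; apply: gm_gr_act => //; exact: (gh_gr f hm).
- by rewrite (morph0 ext_funD); exact: (gr_0 (gm_grading N)).
- by rewrite (morphN ext_funD); exact: (gr_N (gm_grading N)).
- by rewrite ext_funD; exact: (gr_D (gm_grading N)).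
Qed.
Definition ext_hom : gshom (indm i M) N := GSHom ext_fun_lin ext_fun_gr.
End Hom.

Lemma Ind_adjoint_Res : adjoint (Ind_functor i) (Res_functor hres).
Proof.
exists (fun M N h => adj h); split=> [M N|M M' N N' f g h].
  exists (fun f => ext_hom f) => [h|f]; apply: gshomP.
    apply: (tens_add_eq (i := i)) => [z w|z w|b m].
    - exact: ext_funD.
    - exact: gshomD.
    by rewrite [LHS]ext_funE /= -gshomZ (scale_pure i) mulr1.
  by move=> m; rewrite /= [LHS]ext_funE scale1r.
by apply: gshomP => m /=; rewrite ind_funE.
Qed.
End InductionAdjunction.

Section Coinduction.
Variables (k : comNzRingType) (A B : gsalg k) (i : gahom A B) (d : int).
Variable X : frobenius_extension i d.
Hypothesis hres : res_preserves_fg i.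
Local Notation E := (fe_tr X).
Local Notation u := (@fe_u _ _ _ _ _ X).
Local Notation v := (@fe_v _ _ _ _ _ X).

Section Hom.
Variables (N : gsmod B) (M : gsmod A).
Local Notation SM := (shiftm (- d) (indm i M)).

Definition coadj_fun (h : gshom (resm i N) M) (y : N) : SM := \sum_t pure i (u t) (h (v t *: y : N)).

(** The element sum_t u_t (x) v_t is central: v_t b is expanded in the v_r, and then b u_r in
    the u_t. *)
Lemma coadj_lin (h : gshom (resm i N) M) : linear (coadj_fun h).
Proof.
move=> b y y'; rewrite /coadj_fun scaler_sumr.
transitivity (\sum_t pure i (u t) (h (v t *: (b *: y) : N)) + \sum_t pure i (u t) (h (v t *: y' : N))).
  rewrite -big_split; apply: eq_bigr => t _ /=.
  by rewrite scalerDr -pureDr; congr pure; exact: gshomD.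
congr (_ + _).
transitivity (\sum_t \sum_r pure i (u t * i (E (v t * (b * u r)))) (h (v r *: y : N))).
  apply: eq_bigr => t _; rewrite scalerA -{1}(fe_R X (v t * b)) scaler_suml.
  rewrite (morph_sum (f := h : N -> M)); last exact: (gshomD h).
  rewrite pure_sumr; apply: eq_bigr => r _.
  rewrite pure_bal -mulrA; congr pure; rewrite -scalerA; exact: (gshomZ h).
rewrite exchange_big; apply: eq_bigr => r _ /=.
by rewrite -pure_suml fe_L [RHS](scale_pure i).
Qed.
Lemma coadj_gr (h : gshom (resm i N) M) e y : gm_gr e y -> gm_gr e (coadj_fun h y).
Proof.
move=> hy; apply: (gr_sum (gm_grading SM)) => t _.
have := gh_gr h (gm_gr_act (@fe_v_gr _ _ _ _ _ X t) hy : @gm_gr _ _ (resm i N) _ _) => hv.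
have := tg_pure i (@fe_u_gr _ _ _ _ _ X t) hv.
rewrite (_ : _ + _ = e - (- d, false)) //.
rewrite addrA [fe_deg t + _]addrC subrK addrC; congr (_ + _).
by congr pair; rewrite /= opprK.
Qed.
Definition coadj (h : gshom (resm i N) M) : gshom N SM := GSHom (coadj_lin h) (@coadj_gr h).
End Hom.

Section Inverse.
Variables (N : gsmod B) (M : gsmod A) (g : gshom N (shiftm (- d) (indm i M))).
Definition counit_fun (y : resm i N) : M := ind_coord X 1 (g y).
Lemma counit_lin : linear counit_fun.
Proof.
move=> a y y'; rewrite /counit_fun -[a *: y]/(i a *: (y : N)) (gh_lin g).
rewrite (ind_coordD X (M:=M) 1); congr (_ + _).
move: (g y : tens i M); apply: (tens_add_eq (i := i)) => [z w|z w|b m].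
- by rewrite scalerDr ind_coordD.
- by rewrite ind_coordD scalerDr.
- by rewrite (scale_pure i) !ind_coordE !mul1r fe_l scalerA.
Qed.
Lemma counit_gr e (y : resm i N) : gm_gr e y -> gm_gr e (counit_fun y).
Proof.
move=> hy; have h1 : ga_gr 0 (1 : B) by rewrite -(rmorph1 (ga_in B)); exact: ga_gr_in.
have := ind_coord_gr X h1 (gh_gr g (hy : @gm_gr _ _ N _ _) : @gm_gr _ _ (indm i M) (e - (- d, false)) _).
rewrite add0r (_ : _ - _ - _ = e) //.
by rewrite -addrA (_ : - _ - _ = 0) ?addr0 //; congr pair; rewrite /= opprK subrr.
Qed.
Definition counit : gshom (resm i N) M := GSHom counit_lin counit_gr.
End Inverse.

Lemma coadjK (N : gsmod B) (M : gsmod A) (h : gshom (resm i N) M) : counit (coadj h) = h.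
Proof.
apply: gshomP => y; rewrite /= /counit_fun /= /coadj_fun (morph_sum _ _ _ (ind_coordD X (M:=M) 1)).
transitivity (\sum_t h (i (E (u t)) *: (v t *: (y : N)) : N)).
  by apply: eq_bigr => t _; rewrite ind_coordE mul1r; apply/esym; exact: (gshomZ h).
rewrite -(morph_sum (f := h : N -> M)); last exact: (gshomD h).
congr (gh_fun h _); rewrite -[RHS](scale1r (y : N)) -(fe_R X 1) scaler_suml.
by apply: eq_bigr => t _; rewrite mul1r scalerA.
Qed.

Lemma counitK (N : gsmod B) (M : gsmod A) (g : gshom N (shiftm (- d) (indm i M))) :
  coadj (counit g) = g.
Proof.
apply: gshomP => y; rewrite /= /coadj_fun [RHS](pure_ind_coord X (g y)); apply: eq_bigr => t _; congr pure.
by rewrite /= /counit_fun gshomZ (ind_coord_scale X) mul1r.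
Qed.

Lemma Res_adjoint_Ind :
  adjoint (Res_functor hres) (comp_functor (shift_functor B (- d)) (Ind_functor i)).
Proof.
exists (fun N M h => coadj h); split=> [N M|N N' M M' f g h].
  by exists (fun g => counit g) => [h|g]; [exact: coadjK|exact: counitK].
apply: gshomP => y /=; rewrite /coadj_fun.
rewrite [RHS](morph_sum _ _ _ (@ind_funD _ _ _ i _ _ g)); apply: eq_bigr => t _.
by rewrite [RHS](@ind_funE _ _ _ i _ _ g) /= gshomZ.
Qed.
End Coinduction.

(** * The cyclotomic tower consists of Frobenius extensions *)

Lemma cyc_frobenius (k : comNzRingType) (F : frobenius_superalgebra k) (D : cyclotomic_datum F) n :
  inhabited (frobenius_extension (cyc_incl D n) ((level D)%:Z * delta D)).
Proof.
have [s [hs sL sR]] := dual_families D n.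
pose t0 : degree * (cyc_alg D n.+1 * cyc_alg D n.+1) := (0, (0, 0)).
have hE := tau_trace D n.
have mem (t : 'I_(size s)) : nth t0 s t \in s by exact: mem_nth.
constructor; apply: (@FrobeniusExtension k (cyc_alg D n) (cyc_alg D n.+1) (cyc_incl D n) _ (@tau k F D n)
  (tr_D hE) (tr_upl hE) (fun b a => tr_upr hE a b) (fun e b => @tr_gr k F D n _ hE e b) (size s)
  (fun t => (nth t0 s t).1) (fun t => (nth t0 s t).2.1) (fun t => (nth t0 s t).2.2)).
- by move=> t; have [] := hs _ (mem t).
- by move=> t; have [] := hs _ (mem t).
- by move=> b; rewrite -[RHS]sL /opL (big_nth t0) big_mkord.
- by move=> b; rewrite -[RHS]sR /opR (big_nth t0) big_mkord.
Qed.

Theorem corollary6p20 (k : comNzRingType) (c : nat) (char_k : is_char k c)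
    (char_neq2 : c <> 2%N) (F : frobenius_superalgebra k) (D : cyclotomic_datum F)
    (char_theta : ~~ (c %| theta D)%N) (n : nat) :
  exists res_fg : res_preserves_fg (cyc_incl D n),
    let Ind := Ind_functor (cyc_incl D n) in
    let Res := Res_functor res_fg in
    [/\ exact_functor Ind,
        adjoint Ind Res &
        exists d : int, adjoint Res (comp_functor (shift_functor (cyc_alg D n.+1) d) Ind)].
Proof.
have [X] := cyc_frobenius D n.
exists (extension_res_fg X); split.
- exact: extension_Ind_exact X.
- exact: Ind_adjoint_Res.
- by exists (- ((level D)%:Z * delta D)); exact: Res_adjoint_Ind X _.
Qed.
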